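(* Let $p$ be a prime number, let $f(t)\in\mathbb{Z}_p[t^{\pm1}]$ be an irreducible polynomial, let $s\in\mathbb{Z}_p[t^{\pm1}]$ be an element whose class in the field $X:=\mathbb{Z}_p[t^{\pm1}]/(f(t))$ is invertible, regard $X$ as an Alexander biquandle by means of $s$ and $t$, and let $m=\operatorname{type}X$, so that $X$ is a $\mathbb{Z}_m$-family of Alexander biquandles. Let $g\ge 1$, let $H_1$ and $H_2$ be $S^1$-oriented handlebody-knots of genus $g$, and let $D_i$ be a diagram of $H_i$ ($i=1,2$). Then $$\max_{\phi_1\in\mathrm{Flow}(D_1;\mathbb{Z}_m)}\ \min_{\substack{\phi_2\in\mathrm{Flow}(D_2;\mathbb{Z}_m)\\ \gcd\phi_1=\gcd\phi_2}}\bigl|\dim\mathrm{Col}_X(D_1,\phi_1)-\dim\mathrm{Col}_X(D_2,\phi_2)\bigr|\ \le\ d(H_1,H_2),$$ where $\dim$ denotes dimension over the field $X$ and $d(H_1,H_2)$ is the Gordian distance.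
   Context: Notation: $\mathbb{Z}_m=\mathbb{Z}/m\mathbb{Z}$. Handlebody-links. A handlebody-link is a disjoint union of handlebodies, each of genus at least $1$, embedded in $S^3$; a handlebody-knot is a handlebody-link with one component. An $S^1$-orientation is a choice of orientation of (the core circle of) every genus $1$ component. Two $S^1$-oriented handlebody-links are equivalent if an orientation-preserving self-homeomorphism of $S^3$ takes one to the other preserving the $S^1$-orientation. Diagrams. A spatial trivalent graph is a graph with all vertices of valency 3 embedded in $S^3$ (circle components without vertices are allowed). A Y-orientation of it is a direction of all edges such that every vertex is both the initial vertex of a directed edge and the terminal vertex of a directed edge (so each vertex has either two incoming edges and one outgoing edge, or one incoming and two outgoing). A Y-oriented spatial trivalent graph represents an $S^1$-oriented handlebody-link $H$ if $H$ is a regular neighborhood of it and the $S^1$-orientation agrees with the Y-orientation. A diagram of $H$ is a diagram of a Y-oriented spatial trivalent graph representing $H$. An arc of a diagram is a piece of curve whose endpoints are undercrossings or vertices; a semi-arc is a piece of curve each of whose endpoints is a crossing (over or under) or a vertex (a circle component without crossings counts as one arc and one semi-arc). The normal orientation of a (semi-)arc is obtained by rotating its orientation counterclockwise by $\pi/2$ in the plane; the side to which it points is the front, the other side is behind. Gordian distance. A crossing change of an $S^1$-oriented handlebody-link is a crossing change of a spatial trivalent graph representing it (switching over/under information at a crossing of a diagram). For $S^1$-oriented handlebody-knots $H_1,H_2$ of the same genus, the Gordian distance $d(H_1,H_2)$ is the minimal number of crossing changes needed to deform one into the other (up to equivalence). Local notation. At a crossing let $u$ and $w$ be the under semi-arcs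 lying respectively behind and in front of the over strand, and let $v$ and $v'$ be the over semi-arcs lying respectively behind and in front of the under strand (with respect to normal orientations). At a vertex let $\gamma$ be the edge that is the unique incoming or the unique outgoing one, and let $\alpha$, $\beta$ be the other two, with $\alpha$ on the right and $\beta$ on the left when looking in the direction of the orientation. Flows. A $\mathbb{Z}_m$-flow of $D$ is a map $\phi$ from the set $\mathcal{A}(D)$ of arcs to $\mathbb{Z}_m$ with $\phi(u)=\phi(w)$ at each crossing and $\phi(\gamma)=\phi(\alpha)+\phi(\beta)$ at each vertex; a semi-arc carries the value of the arc containing it. $\mathrm{Flow}(D;\mathbb{Z}_m)$ is the set of all $\mathbb{Z}_m$-flows of $D$. We put $\gcd\phi=\gcd\{\phi(a),m\mid a\in\mathcal{A}(D)\}$ (computed with any integer representatives of the values $\phi(a)$). Alexander biquandles. The $\mathbb{Z}_p[s^{\pm1},t^{\pm1}]$-module $X$ is a biquandle (an Alexander biquandle) with $a\mathbin{\underline{*}}b=ta+(s-t)b$, $a\mathbin{\overline{*}}b=sa$. For $n\in\mathbb{Z}$, $a\mathbin{\underline{*}^{[n]}}b=t^na+(s^n-t^n)b$ and $a\mathbin{\overline{*}^{[n]}}b=s^na$. The type of $X$ is $\operatorname{type}X=\min\{n>0\mid a\mathbin{\underline{*}^{[n]}}b=a=a\mathbin{\overline{*}^{[n]}}b\ \text{for all }a,b\in X\}$. With $m=\operatorname{type}X$ finite, the operations $\underline{*}^{[n]},\overline{*}^{[n]}$ depend only on $n$ mod $m$, and $X$ with these operations ($[n]\in\mathbb{Z}_m$)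 is called a $\mathbb{Z}_m$-family of Alexander biquandles. Colorings. An $X$-coloring of $(D,\phi)$ is a map $C$ from the set of semi-arcs of $D$ to $X$ such that at each crossing $C(w)=C(u)\mathbin{\underline{*}^{[\phi(v)]}}C(v)$ and $C(v')=C(v)\mathbin{\overline{*}^{[\phi(u)]}}C(u)$, and at each vertex $C(\alpha)=C(\gamma)$ and $C(\beta)=C(\gamma)\mathbin{\overline{*}^{[\phi(\alpha)]}}C(\gamma)=s^{\phi(\alpha)}C(\gamma)$. $\mathrm{Col}_X(D,\phi)$ is the set of all $X$-colorings, a vector space over the field $X$. *)

(* Defs.v *)
From HB Require Import structures.
From mathcomp Require Import all_boot all_order all_algebra.
From mathcomp Require Import all_classical all_reals all_analysis.
From mathcomp Require Import ring.

Set Implicit Arguments.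
Unset Strict Implicit.
Unset Printing Implicit Defensive.
Import Order.TTheory GRing.Theory Num.Theory.
Import numFieldNormedType.Exports.
Local Open Scope classical_set_scope.
Local Open Scope ring_scope.

(* F[t, t^-1] is realized as the subring of F(t) of the fractions q / t^k. *)
Definition is_laurent (F : fieldType) : pred {fraction {poly F}} :=
  fun x => `[< exists (q : {poly F}) (k : nat),
                 x = tofrac q / tofrac 'X ^+ k >].
Arguments is_laurent F : clear implicits.

Lemma is_laurent_subring (F : fieldType) : subring_closed (is_laurent F).
Proof.
have X0 (k : nat) : tofrac ('X : {poly F}) ^+ k != 0.
  by rewrite expf_neq0 // tofrac_eq0 polyX_eq0.
split=> [|x y /asboolP[q [k ->]] /asboolP[r [l ->]]
         |x y /asboolP[q [k ->]] /asboolP[r [l ->]]]; apply/asboolP.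
- by exists 1, 0%N; rewrite expr0 divr1 tofrac1.
- exists (q * 'X^l - r * 'X^k), (k + l)%N.
  by rewrite -mulNr addf_div // tofracB !tofracM !tofracXn exprD mulNr.
- exists (q * r), (k + l)%N.
  by rewrite mulf_div tofracM exprD.
Qed.

HB.instance Definition _ (F : fieldType) :=
  GRing.isSubringClosed.Build {fraction {poly F}} (is_laurent F)
    (is_laurent_subring F).

Record laurent (F : fieldType) := Laurent {
  laurent_val :> {fraction {poly F}};
  _ : laurent_val \in is_laurent F }.

HB.instance Definition _ (F : fieldType) := [isSub for @laurent_val F].
HB.instance Definition _ (F : fieldType) := [Choice of laurent F by <:].
HB.instance Definition _ (F : fieldType) :=
  [SubChoice_isSubComNzRing of laurent F by <:].

Lemma laurentX_proof (F : fieldType) :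
  tofrac ('X : {poly F}) \in is_laurent F.
Proof. by apply/asboolP; exists 'X, 0%N; rewrite expr0 divr1. Qed.

Definition laurentX (F : fieldType) : laurent F := Laurent (laurentX_proof F).
Arguments laurentX F : clear implicits.

Definition ring_unit (A : comNzRingType) (a : A) := exists b, a * b = 1.

Definition ring_irreducible (A : comNzRingType) (a : A) :=
  [/\ a <> 0, ~ ring_unit a &
      forall b c, a = b * c -> ring_unit b \/ ring_unit c].

(* [pi] exhibits [X] as the quotient ring A / (a). *)
Definition is_quotient_by (A : comNzRingType) (a : A) (X : fieldType)
    (pi : {rmorphism A -> X}) :=
  (forall x, exists b, pi b = x) /\
  (forall b, pi b = 0 <-> exists c, b = c * a).

Section Biquandle.
Variables (X : fieldType) (s t : X).

Definition under_op (n : int) (a b : X) : X := t ^ n * a + (s ^ n - t ^ n) * b.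
Definition over_op (n : int) (a b : X) : X := s ^ n * a.

Definition is_type (m : nat) :=
  let trivial_at (n : nat) :=
    forall a b, under_op n a b = a /\ over_op n a b = a in
  [/\ (0 < m)%N, trivial_at m &
      forall n, (0 < n)%N -> trivial_at n -> (m <= n)%N].
End Biquandle.

(* A polygonal directed graph in R^3, projected to the plane of the first two
   coordinates; the third one is the height.  Semi-arcs and arcs are
   subdivided into straight edges.  The nodes are the trivalent vertices, the
   bends of the edges, and, for every crossing, a node on the over strand and
   a node on the under strand with the same projection. *)
Record diagram (R : realType) := Diagram {
  node : finType;
  edge : finType;
  src : edge -> node;
  tgt : edge -> node;
  pos : node -> R * R * R }.

Section Diagram.
Variables (R : realType) (D : diagram R).
Implicit Types (e a b c u v w : edge D) (x y : node D).

Definition plane_proj x : R * R := (pos x).1.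
Definition height x : R := (pos x).2.

Definition edge_point e (k : R) : R * R * R :=
  let p := pos (src e) in let q := pos (tgt e) in
  ((p.1.1 + k * (q.1.1 - p.1.1), p.1.2 + k * (q.1.2 - p.1.2)),
   p.2 + k * (q.2 - p.2)).

Definition graph_support : set (R * R * R) :=
  [set z | exists e k, 0 <= k <= 1 /\ z = edge_point e k].

Definition dir e : R * R := plane_proj (tgt e) - plane_proj (src e).

Definition det (d d' : R * R) : R := d.1 * d'.2 - d.2 * d'.1.
Definition dot (d d' : R * R) : R := d.1 * d'.1 + d.2 * d'.2.

Definition indeg x := #|[set e | tgt e == x]|.
Definition outdeg x := #|[set e | src e == x]|.

Definition bivalent x := (indeg x == 1%N) && (outdeg x == 1%N).

Definition crossing (lo hi : node D) : bool :=
  (plane_proj lo == plane_proj hi) && (height lo < height hi).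

(* A regular diagram of a Y-oriented spatial trivalent graph: every vertex has
   an incoming and an outgoing edge, and the only multiple points of the
   projection are transversal double points of two straight strands. *)
Definition is_diagram : Prop :=
  [/\ forall x, [/\ (0 < indeg x)%N, (0 < outdeg x)%N &
                    (indeg x + outdeg x <= 3)%N],
      forall e, plane_proj (src e) <> plane_proj (tgt e),
      forall e e' (k k' : R), e <> e' -> 0 < k < 1 -> 0 <= k' <= 1 ->
        (edge_point e k).1 <> (edge_point e' k').1,
      forall x y z, plane_proj x = plane_proj y -> plane_proj y = plane_proj z ->
        [\/ x = y, y = z | x = z] &
      forall x y, x <> y -> plane_proj x = plane_proj y ->
        [/\ bivalent x, bivalent y, height x <> height y &
            forall a b c, tgt a = x -> src b = x -> tgt c = y ->
              [/\ det (dir a) (dir b) = 0, 0 < dot (dir a) (dir b) &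
                  det (dir a) (dir c) <> 0]]].

Definition consecutive e e' : bool := (tgt e == src e') && bivalent (tgt e).

Definition same_arc e e' : bool :=
  consecutive e e' && ~~ [exists y, crossing (tgt e) y].

Definition same_semiarc e e' : bool :=
  same_arc e e' && ~~ [exists y, crossing y (tgt e)].

(* [u], [w] are the under semi-arcs behind and in front of the over strand, and
   [v], [v'] the over semi-arcs behind and in front of the under strand.  When
   the determinant is positive, the under strand crosses the over strand from
   right to left, and the over strand crosses the under strand from left to
   right.  The directions do not depend on the chosen halves of the strands,
   which are straight at the crossing. *)
Definition crossing_at u w v v' : bool :=
  if 0 < det (dir v) (dir u)
  then [&& tgt u == src w, tgt v' == src v & crossing (tgt u) (tgt v')]
  else [&& tgt w == src u, tgt v == src v' & crossing (tgt w) (tgt v)].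

(* The rays spanned by three vectors, no two of which are positively
   proportional, occur in this cyclic order counterclockwise. *)
Definition ccw (d1 d2 d3 : R * R) : bool :=
  (2 <= (0 < det d1 d2)%R + (0 < det d2 d3)%R + (0 < det d3 d1)%R)%N.

(* [c] is the unique incoming or the unique outgoing edge; [a] is on the right
   and [b] on the left of the other two. *)
Definition vertex_at a b c : bool :=
  (a != b) &&
  ([&& tgt a == src c, tgt b == src c & ccw (dir c) (- dir b) (- dir a)] ||
   [&& tgt c == src a, tgt c == src b & ccw (- dir c) (dir a) (dir b)]).

(* Z_m is encoded by the residues 0, ..., m - 1, i.e. by 'I_m with congruences
   modulo m, because 'Z_1 would be Z/2Z. *)
Definition flow (m : nat) (phi : {ffun edge D -> 'I_m}) : bool :=
  [&& [forall e, forall e', same_arc e e' ==> (phi e == phi e')],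
      [forall u, forall w, forall v, forall v',
         crossing_at u w v v' ==> (phi u == phi w)] &
      [forall a, forall b, forall c,
         vertex_at a b c ==> (phi c == phi a + phi b %[mod m])%N]].

Definition flow_gcd (m : nat) (phi : {ffun edge D -> 'I_m}) : nat :=
  \big[gcdn/m]_e (phi e : nat).

Section Coloring.
Variables (X : fieldType) (s t : X) (m : nat) (phi : {ffun edge D -> 'I_m}).

Definition coloring (C : {ffun edge D -> X^o}) : Prop :=
  [/\ forall e e', same_semiarc e e' -> C e = C e',
      forall u w v v', crossing_at u w v v' ->
        C w = under_op s t (phi v) (C u) (C v) /\
        C v' = over_op s (phi u) (C v) (C u) &
      forall a b c, vertex_at a b c ->
        C a = C c /\ C b = over_op s (phi a) (C c) (C c)].

(* The solution space of [coloring], as a subspace; see [mem_col_space]. *)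
Definition comb_defect e (k : X) a (l : X) b (C : {ffun edge D -> X^o}) : X^o :=
  C e - (k * C a + l * C b).

Lemma comb_defect_linear e k a l b : linear (comb_defect e k a l b).
Proof.
move=> z C C'; rewrite /comb_defect !ffunE /GRing.scale /=.
have aux (x x' y y' w w' : X) :
    (z * x + x') - (k * (z * y + y') + l * (z * w + w')) =
    z * (x - (k * y + l * w)) + (x' - (k * y' + l * w')) by ring.
exact: aux.
Qed.

HB.instance Definition _ e k a l b :=
  GRing.isLinear.Build X {ffun edge D -> X^o} X^o _ (comb_defect e k a l b)
    (comb_defect_linear e k a l b).

Definition comb_space e k a l b : {vspace {ffun edge D -> X^o}} :=
  lker (linfun (comb_defect e k a l b)).

Definition col_space : {vspace {ffun edge D -> X^o}} :=
  ((\bigcap_(q : edge D * edge D | same_semiarc q.1 q.2)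
      comb_space q.1 1 q.2 0 q.2) :&:
   (\bigcap_(q : edge D * edge D * edge D * edge D |
             crossing_at q.1.1.1 q.1.1.2 q.1.2 q.2)
      (comb_space q.1.1.2 (t ^ (phi q.1.2 : int)) q.1.1.1
         (s ^ (phi q.1.2 : int) - t ^ (phi q.1.2 : int)) q.1.2 :&:
       comb_space q.2 (s ^ (phi q.1.1.1 : int)) q.1.2 0 q.1.2)) :&:
   (\bigcap_(q : edge D * edge D * edge D | vertex_at q.1.1 q.1.2 q.2)
      (comb_space q.1.1 1 q.2 0 q.2 :&:
       comb_space q.1.2 (s ^ (phi q.1.1 : int)) q.2 0 q.2)))%VS.

Lemma mem_comb_space e k a l b C :
  (C \in comb_space e k a l b) <-> C e = k * C a + l * C b.
Proof.
rewrite memv_ker lfunE /= /comb_defect subr_eq0.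
by split=> [/eqP|->].
Qed.

Lemma mem_bigcapv (I : finType) (P : pred I)
    (U : I -> {vspace {ffun edge D -> X^o}}) C :
  (C \in (\bigcap_(i | P i) U i)%VS) <-> (forall i, P i -> C \in U i).
Proof.
rewrite memvE; split=> [/subv_bigcapP h i Pi|h].
  by rewrite memvE; apply: h.
by apply/subv_bigcapP => i Pi; rewrite -memvE; apply: h.
Qed.

Lemma mem_col_space C : (C \in col_space) <-> coloring C.
Proof.
rewrite /col_space !memv_cap; split.
  case/andP=> /andP[/mem_bigcapv h1 /mem_bigcapv h2] /mem_bigcapv h3.
  split=> [e e' he|u w v v' h|a b c h].
  - by have /mem_comb_space := h1 (e, e') he; rewrite mul1r mul0r addr0.
  - have := h2 (u, w, v, v') h; rewrite memv_cap => /andP[].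
    by move=> /mem_comb_space /= -> /mem_comb_space /= ->; rewrite mul0r addr0.
  - have := h3 (a, b, c) h; rewrite memv_cap => /andP[].
    by move=> /mem_comb_space /= -> /mem_comb_space /= ->;
       rewrite mul1r !mul0r !addr0.
case=> h1 h2 h3; apply/andP; split; first (apply/andP; split);
  apply/mem_bigcapv => q hq.
- by apply/mem_comb_space; rewrite mul1r mul0r addr0; apply: h1.
- have [e1 e2] := h2 _ _ _ _ hq; rewrite memv_cap; apply/andP; split.
    by apply/mem_comb_space.
  by apply/mem_comb_space; rewrite mul0r addr0.
- have [e1 e2] := h3 _ _ _ hq; rewrite memv_cap; apply/andP; split.
    by apply/mem_comb_space; rewrite mul1r mul0r addr0.
  by apply/mem_comb_space; rewrite mul0r addr0.
Qed.
End Coloring.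

End Diagram.

Arguments flow_gcd {R D m} phi.
Arguments flow {R D m} phi.

(* In a regular diagram the edges meet over the plane only at nodes, so this
   keeps the graph embedded and every other crossing unchanged. *)
Definition switch_crossing (R : realType) (D : diagram R) (lo hi : node D) :
    diagram R :=
  Diagram (@src R D) (@tgt R D)
    (fun x => if x == lo then (plane_proj lo, height hi)
              else if x == hi then (plane_proj hi, height lo) else pos x).

Section Topology.
Variable R : realType.

(* The 3-sphere, as the one-point compactification of R^3. *)
Definition S3 : Type := one_point_compactification (R * R * R)%type.
HB.instance Definition _ := Topological.on S3.

Definition homeomorphism (h : S3 -> S3) : Prop :=
  continuous h /\ exists k : S3 -> S3, [/\ continuous k, cancel h k & cancel k h].

(* A self-homeomorphism of the 3-sphere preserves the orientation when it has
   degree 1, that is, when it lies in the homotopy class of the identity. *)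
Definition orientation_preserving (h : S3 -> S3) : Prop :=
  exists F : R * S3 -> S3,
    [/\ {within `[0, 1] `*` setT, continuous F},
        forall z, F (0, z) = h z & forall z, F (1, z) = z].

(* Free homotopy in [A] of the loops given by the restrictions to [0, 1]. *)
Definition freely_homotopic (A : set S3) (l l' : R -> S3) : Prop :=
  exists F : R * R -> S3,
    [/\ {within `[0, 1] `*` `[0, 1], continuous F},
        F @` (`[0, 1] `*` `[0, 1]) `<=` A,
        forall r, 0 <= r <= 1 -> F (0, r) = l r,
        forall r, 0 <= r <= 1 -> F (1, r) = l' r &
        forall r, 0 <= r <= 1 -> F (r, 0) = F (r, 1)].

Definition std_handlebody (g : nat) : set (R * R * R) :=
  [set z | [/\ 0 <= z.1.1 <= g%:R, 0 <= z.1.2 <= 1, 0 <= z.2 <= 1 &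
     forall i : nat, (i < g)%N ->
       (4^-1) ^+ 2 <= (z.1.1 - i%:R - 2^-1) ^+ 2 + (z.1.2 - 2^-1) ^+ 2]].

Definition std_core (r : R) : R * R * R :=
  ((2^-1 + 3 / 8 * cos (2 * pi * r), 2^-1 + 3 / 8 * sin (2 * pi * r)), 2^-1).

(* An embedding of the standard handlebody determines a handlebody-knot, its
   image, and, if g = 1, an S^1-orientation, the orientation of the image of
   the core.  Composing with a self-homeomorphism of the solid torus that
   reverses the core gives the opposite S^1-orientation.  Other data of the
   embedding are not used. *)
Record handlebody_knot (g : nat) := HandlebodyKnot {
  hk_emb : R * R * R -> S3;
  hk_emb_continuous : {within std_handlebody g, continuous hk_emb};
  hk_emb_inj : {in std_handlebody g &, injective hk_emb} }.

Definition hk_set g (H : handlebody_knot g) : set S3 :=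
  hk_emb H @` std_handlebody g.

Definition hk_core g (H : handlebody_knot g) : R -> S3 :=
  hk_emb H \o std_core.

Definition hk_equiv g (H H' : handlebody_knot g) : Prop :=
  exists h : S3 -> S3,
    [/\ homeomorphism h, orientation_preserving h,
        h @` hk_set H = hk_set H' &
        g = 1%N -> freely_homotopic (hk_set H') (h \o hk_core H) (hk_core H')].

Definition sphere_support (D : diagram R) : set S3 := Some @` graph_support D.

(* For the sup norm. *)
Definition eps_neighborhood (D : diagram R) (eps : R) : set S3 :=
  Some @` [set z | exists2 y, graph_support D y & `|z - y| <= eps].

(* For small eps, [eps_neighborhood D eps] is a regular neighborhood of the
   polygonal graph; by uniqueness, the regular neighborhoods are its images
   under orientation-preserving homeomorphisms fixing the graph. *)
Definition regular_neighborhood (D : diagram R) (A : set S3) : Prop :=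
  \forall eps \near 0^'+, exists h : S3 -> S3,
    [/\ homeomorphism h, orientation_preserving h,
        forall z, sphere_support D z -> h z = z &
        h @` eps_neighborhood D eps = A].

(* For a graph that is a circle: [l] goes once around it along its edges. *)
Definition directed_loop (D : diagram R) (l : R -> S3) : Prop :=
  exists w : 'I_#|edge D| -> edge D,
    [/\ bijective w, forall i, tgt (w i) = src (w (ordS i)) &
        forall (i : 'I_#|edge D|) (k : R), 0 <= k <= 1 ->
          l ((i%:R + k) / #|edge D|%:R) = Some (edge_point (w i) k)].

Definition represents g (D : diagram R) (H : handlebody_knot g) : Prop :=
  regular_neighborhood D (hk_set H) /\
  (g = 1%N ->
     exists2 l, directed_loop D l & freely_homotopic (hk_set H) l (hk_core H)).

Definition diagram_of g (D : diagram R) (H : handlebody_knot g) : Prop :=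
  is_diagram D /\ represents D H.

Definition crossing_change g (H H' : handlebody_knot g) : Prop :=
  exists (D : diagram R) (lo hi : node D),
    [/\ diagram_of D H, crossing lo hi &
        diagram_of (switch_crossing lo hi) H'].

Fixpoint deformable g (n : nat) (H H' : handlebody_knot g) : Prop :=
  match n with
  | 0 => hk_equiv H H'
  | n'.+1 => exists K K' : handlebody_knot g,
      [/\ hk_equiv H K, crossing_change K K' & deformable n' K' H']
  end.

Definition gordian g (H H' : handlebody_knot g) : \bar R :=
  ereal_inf [set (n%:R)%:E | n in [set n : nat | deformable n H H']].

End Topology.

(* Main.v *)
Require Import Defs.
From HB Require Import structures.
From mathcomp Require Import all_boot all_order all_algebra.
From mathcomp Require Import all_classical all_reals all_analysis.
From mathcomp Require Import ring lra zify.
Set Implicit Arguments.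
Unset Strict Implicit.
Unset Printing Implicit Defensive.
Import Order.TTheory GRing.Theory Num.Theory.
Import numFieldNormedType.Exports.
Local Open Scope classical_set_scope.
Local Open Scope ring_scope.

(* A coloring of a flowed diagram is the same as an assignment of elements of X
   to the nodes, subject to one linear equation per edge. The transposed system
   describes the twisted flows: elements nu of X on the edges that satisfy the
   Kirchhoff law at the nodes and are multiplied at each under-crossing by a
   power of t / s determined by phi. Row rank equals column rank, so
     dim Col(D, phi) = #V - #E + dim (twisted flows of (D, phi)),
   and the same identity for phi = 0, where colorings are the functions that
   are constant on the components, determines #V - #E.
   By the Wirtinger presentation, a flow together with a twisted flow is a local
   system on the complement of the graph with structure group Z_m acting on X.
   Local systems are described by germs of cocycles, and the complement of the
   handlebody is a deformation retract of that of the graph, so the space of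
   twisted flows is transported, up to gauge, by every homeomorphism between
   handlebodies; gcd phi is recovered from the torsion of the corresponding
   class. Finally, a crossing change replaces a single equation of the linear
   system, so the dimension changes by at most one. *)

(** A germ cocycle replaces a representation of the fundamental group: it pulls back along
    continuous maps and moves along a homotopy by lifting single paths. Its structure group is the
    semidirect product of Z_m and X, which holds a flow and a twisted flow at once. The points with
    no graph below them and those with no graph above them form two contractible sets, which overlap
    over the regions of the plane. A local system is thus a locally constant function on the
    regions: its first component is the Alexander numbering of phi, and the jumps of its second
    component are the twisted flow. Infinity and the segments inside the crossings lie outside both
    sets. The segments carry the Wirtinger relation, but all of this is too thin to obstruct the
    extension of a gauge. An equivalence of handlebodies says nothing about the graphs inside them,
    whence the retraction. Gauges are normalized at a base point below the graph, which makes the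
    correspondence between twisted flows linear and injective without any quotient by coboundaries.
    In a coloring the Alexander numbering also absorbs the powers of s, which leaves the parameter t
    / s. *)

Lemma loc_const_segment (R : realType) (S : Type) (f : R -> S) (a b : R) :
  a <= b ->
  (forall t, a <= t <= b -> \forall t' \near t, a <= t' <= b -> f t' = f t) ->
  f a = f b.
Proof.
move=> ab fl.
pose B := [set t | a <= t <= b /\ f t = f a].
have Ba : B a by rewrite /B /= lexx ab.
suff -> : f b = f a by [].
suff BE : B = `[a, b]%classic.
  have : `[a, b]%classic b by rewrite /= in_itv /= ab lexx.
  by rewrite -BE => -[].
apply: (@segment_connected _ a b); first by exists a.
- exists (interior [set t | a <= t <= b -> f t = f a]); first exact: open_interior.
  rewrite predeqE => t; split.
    move=> [tab ft]; split; first by rewrite /= in_itv.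
    have := fl t tab; apply: filterS => t' h /h ->; exact: ft.
  by move=> [] /=; rewrite in_itv /= => tab /interior_subset; split => //; auto.
- exists (~` interior [set t | a <= t <= b -> f t <> f a]).
    by apply: open_closedC; exact: open_interior.
  rewrite predeqE => t; split.
    move=> [tab ft]; split; first by rewrite /= in_itv.
    by move=> /interior_subset /(_ tab).
  move=> [] /=; rewrite in_itv /= => tab nft; split => //.
  apply: contrapT => ft; apply: nft.
  by have := fl t tab; apply: filterS => t' h /h ->.
Qed.

(** * Local systems as cocycles of germs *)

Section Cocycles.
Variables (T : topologicalType) (G : groupType).
Implicit Types (U V : set T) (c : T -> T -> G) (f F : T -> G).
Local Open Scope group_scope.

(* A local system with structure group G, given by the parallel transport
   [c x y] between sufficiently close points; only the germ of [c x] at [x]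
   matters. *)
Definition germ_cocycle U c := forall p, U p ->
  \forall x \near p, \forall y \near x, c p x * c x y = c p y.

Definition gauge U c c' f := forall x, U x ->
  \forall y \near x, c' x y = (f x)^-1 * c x y * f y.

Definition trivializes U c f := forall x, U x ->
  \forall y \near x, c x y = (f x)^-1 * f y.

Lemma germ_cocycle_chart U c p : germ_cocycle U c -> U p ->
  \forall x \near p, \forall y \near x, c x y = (c p x)^-1 * c p y.
Proof.
move=> cU Up; have := cU p Up; apply: filterS => x; apply: filterS => y <-.
by rewrite mulKg.
Qed.

(** The middle factors cancel in a product of two transports written in the chart [F]. Together with
    [germ_cocycle_chart] this identifies germ cocycles with locally trivial ones. *)
Lemma germ_cocycle_of_charts U c :
  (forall p, U p -> exists F,
     \forall x \near p, \forall y \near x, c x y = (F x)^-1 * F y) ->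
  germ_cocycle U c.
Proof.
move=> h p /h [F hF]; have hp := nbhs_singleton hF.
have hp2 : \forall x \near p, \forall y \near x, c p y = (F p)^-1 * F y.
  exact: near_join.
near=> x; near=> y.
have -> : c x y = (F x)^-1 * F y by near: y; near: x.
have -> : c p y = (F p)^-1 * F y by near: y; near: x.
have -> : c p x = (F p)^-1 * F x by near: x.
by rewrite mulgA mulgK.
Unshelve. all: by end_near. Qed.

Lemma germ_cocycle_diag U c p : germ_cocycle U c -> U p -> c p p = 1.
Proof.
move=> cU /cU /nbhs_singleton /nbhs_singleton h.
by apply: (mulgI (c p p)); rewrite mulg1.
Qed.

Lemma gauge_germ_cocycle U c c' f : open U -> germ_cocycle U c ->
  gauge U c c' f -> germ_cocycle U c'.
Proof.
move=> oU cU cc'; apply: germ_cocycle_of_charts => p Up.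
exists (fun x => c p x * f x).
have h := germ_cocycle_chart cU Up.
have hU : \forall x \near p, U x by exact: open_nbhs_nbhs.
near=> x; have Ux : U x by near: x.
have := cc' x Ux; have : \forall y \near x, c x y = (c p x)^-1 * c p y by near: x.
by apply: filterS2 => y -> ->; rewrite invgM !mulgA.
Unshelve. all: by end_near. Qed.

End Cocycles.

Section Pullback.
Variables (T T' : topologicalType) (G : groupType).
Local Open Scope group_scope.

Lemma germ_cocycle_pullback (U : set T) (U' : set T') (c : T' -> T' -> G)
    (g : T -> T') :
  open U -> (forall x, U x -> U' (g x)) ->
  (forall x, U x -> {for x, continuous g}) -> germ_cocycle U' c ->
  germ_cocycle U (fun x y => c (g x) (g y)).
Proof.
move=> oU gU gc cU'; apply: germ_cocycle_of_charts => p Up.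
exists (fun x => c (g p) (g x)).
have h := germ_cocycle_chart cU' (gU _ Up).
have hU : \forall x \near p, U x by exact: open_nbhs_nbhs.
have h1 : \forall x \near p, \forall y \near g x,
   c (g x) y = (c (g p) (g x))^-1 * c (g p) y.
  exact: (gc p Up _ h).
near=> x; have Ux : U x by near: x.
have : \forall y \near g x, c (g x) y = (c (g p) (g x))^-1 * c (g p) y.
  by near: x.
by move=> /(gc x Ux _).
Unshelve. all: by end_near. Qed.
End Pullback.

Section Homotopy.
Variables (R : realType) (T : topologicalType) (G : groupType).
Local Open Scope group_scope.

Lemma path_lift (c : R -> R -> G) : germ_cocycle setT c ->
  exists2 l : R -> G, l 0%R = 1 & trivializes [set t : R | (0 <= t <= 1)%R] c l.
Proof.
move=> cc.
pose P b := exists2 l : R -> G, l 0%R = 1 &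
  trivializes [set t : R | (0 <= t <= b)%R] c l.
have P0 : P 0%R.
  exists (c 0%R) => [|t /= /andP[t0 t1]]; first exact: (germ_cocycle_diag cc).
  have -> : t = 0%R by apply/eqP; rewrite eq_le t0 t1.
  exact: nbhs_singleton (germ_cocycle_chart cc (I : setT 0%R)).
(* The existence of a lift over [0, b] is a proposition depending on b. It is treated as a locally
   constant function of b, its values being compared by propositional extensionality. *)
suff E : P 0%R = P 1%R by rewrite E in P0.
apply: loc_const_segment => // b0 b0I.
have h := germ_cocycle_chart cc (I : setT b0).
move: h => /nbhs_ballP[r /= r0 hr]; apply/nbhs_ballP; exists r => //= b2 hb2 b2I.
suff main (b1 b : R) : ball b0 r b -> ball b0 r b1 -> (0 <= b)%R ->
    (0 <= b1)%R -> P b1 -> P b.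
  have b0b0 : ball b0 r b0 by exact: ballxx.
  case/andP: b0I => b00 _; case/andP: b2I => b20 _.
  by apply/propext; split; [exact: (main b2 b0)|exact: (main b0 b2)].
move=> hb hb1 b_0 b1_0 [l l0 hl].
have [bb1|b1b] := leP b b1.
  exists l => // t /= /andP[t0 tb]; apply: hl => /=.
  by rewrite t0 (le_trans tb bb1).
(* Past [b1] the lift follows the chart centred at [b0], translated on the left so that both
   formulas agree at [b1]. *)
exists (fun t => if (t <= b1)%R then l t else l b1 * (c b0 b1)^-1 * c b0 t).
  by rewrite b1_0.
have inb t : (b1 <= t <= b)%R -> ball b0 r t.
  move: hb hb1; rewrite /ball /= !ltr_norml => /andP[? ?] /andP[? ?] /andP[? ?].
  by apply/andP; split; lra.
move=> t /= /andP[t0 tb]; have [tb1|b1t] := ltP t b1.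
  have := hl t; rewrite /= t0 (ltW tb1) => /(_ isT).
  have : \forall y \near t, (y < b1)%R by exact: lt_nbhsl.
  by apply: filterS2 => y /ltW ->.
have ht : \forall y \near t, c t y = (c b0 t)^-1 * c b0 y.
  by apply: hr; apply: inb; rewrite b1t tb.
have [E|nE] := eqVneq t b1; last first.
  have {nE}b1t : (b1 < t)%R by rewrite lt_neqAle eq_sym nE.
  have : \forall y \near t, (b1 < y)%R by exact: lt_nbhsr.
  move: ht; apply: filterS2 => y; rewrite !leNgt b1t => -> -> /=.
  by rewrite !invgM !invgK !mulgA ?(mulgVK, mulgK).
subst t; rewrite lexx.
have := hl b1; rewrite /= t0 lexx => /(_ isT).
move: ht; apply: filterS2 => y h1 h2; case: ifP => // _.
by rewrite h1 !mulgA mulVg mul1g.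
Qed.

(* Homotopy invariance of local systems: [f y] is the parallel transport along
   the path followed by [y]. *)
Lemma homotopy_gauge (U Y : set T) (c : T -> T -> G) (F : R -> T -> T) :
  germ_cocycle U c -> open Y -> (forall t y, Y y -> U (F t y)) ->
  (forall t y, Y y -> {for (t, y), continuous (fun z : R * T => F z.1 z.2)}) ->
  exists2 f : T -> G,
    gauge Y (fun x y => c (F 0%R x) (F 0%R y)) (fun x y => c (F 1%R x) (F 1%R y)) f &
    forall y, Y y -> exists l : R -> G,
      [/\ l 0%R = 1, l 1%R = f y & trivializes [set t : R | (0 <= t <= 1)%R]
         (fun t t' => c (F t y) (F t' y)) l].
Proof.
move=> cU oY FU Fc.
pose C (z z' : R * T) := c (F z.1 z.2) (F z'.1 z'.2).
have CY : germ_cocycle [set z : R * T | Y z.2] C.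
  apply: (germ_cocycle_pullback (U' := U) (g := fun z : R * T => F z.1 z.2)) => //.
  - apply: (@open_comp _ _ (snd : R * T -> T) Y) => // z _; exact: cvg_snd.
  - by move=> z /= Yz; apply: FU.
  - by case=> t y /= Yz; apply: Fc.
have slice1 (t : R) (y : T) : (fun t' : R => (t', y)) @ t --> (t, y).
  by exact: (cvg_pair cvg_id (cvg_cst y)).
have slice2 (t : R) (y : T) : (fun y' : T => (t, y')) @ y --> (t, y).
  by exact: (cvg_pair (cvg_cst t) cvg_id).
have /choice [L HL] (y : T) : exists l : R -> G, Y y -> l 0%R = 1 /\
    trivializes [set t : R | (0 <= t <= 1)%R] (fun t t' => C (t, y) (t', y)) l.
  have [Yy|] := pselect (Y y); last by exists (fun=> 1).
  have [|l l0 hl] := @path_lift (fun t t' => C (t, y) (t', y)); last by exists l.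
  apply: (germ_cocycle_pullback (g := fun t => (t, y)) _ _ _ CY) => //.
  + exact: openT.
  + move=> t _; exact: slice1.
exists (fun y => L y 1%R); last first.
  by move=> y Yy; exists (L y); have [? ?] := HL y Yy.
move=> y0 Yy0.
(* Again a proposition that varies with time: the gauge identity between the times 0 and t, on a
   neighbourhood of [y0] that may depend on t. *)
pose Q t := \forall y \near y0,
   C (t, y0) (t, y) = (L y0 t)^-1 * C (0%R, y0) (0%R, y) * L y t.
have nY : \forall y \near y0, Y y by exact: open_nbhs_nbhs.
have Q0 : Q 0%R.
  move: nY; apply: filterS => y Yy.
  have [-> _] := HL y0 Yy0; have [-> _] := HL y Yy.
  by rewrite invg1 mul1g mulg1.
suff E : Q 0%R = Q 1%R by move: Q0; rewrite E.
apply: loc_const_segment => // t1 t1I.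
have := germ_cocycle_chart CY (Yy0 : [set z : R * T | Y z.2] (t1, y0)).
set Phi := C (t1, y0); move=> [[A B] /= [hA hB] hAB].
move: hA => /nbhs_ballP[r /= r0 hr]; apply/nbhs_ballP; exists r => //= t2 ht2 t2I.
suff main (a b : R) : (0 <= a <= 1)%R -> (0 <= b <= 1)%R -> ball t1 r a -> ball t1 r b ->
    Q a -> Q b.
  have t1b : ball t1 r t1 by exact: ballxx.
  by apply/propext; split; [exact: (main t2 t1)|exact: (main t1 t2)].
move=> aI bI ha hb.
(* Along a path inside the product chart, the lift and [Phi] trivialize the same cocycle, so they
   differ by a left factor that does not depend on time. *)
have key y : B y -> Y y -> (L y a)^-1 * L y b = (Phi (a, y))^-1 * Phi (b, y).
  move=> By Yy.
  have cst t : (0 <= t <= 1)%R -> ball t1 r t -> \forall t' \near t,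
      Phi (t', y) * (L y t')^-1 = Phi (t, y) * (L y t)^-1.
    move=> tI /hr At; have [_ /(_ t tI) h1] := HL y Yy.
    have := slice1 t y _ (hAB (t, y) (conj At By)); move: h1.
    rewrite nbhs_simpl /=; apply: filterS2 => t' h1 h2.
    have -> : L y t' = L y t * ((Phi (t, y))^-1 * Phi (t', y)).
      by rewrite -h2 h1 mulVKg.
    by rewrite !invgM invgK !mulgA mulgV mul1g.
  suff E : Phi (a, y) * (L y a)^-1 = Phi (b, y) * (L y b)^-1.
    have -> : Phi (b, y) = Phi (a, y) * (L y a)^-1 * L y b by rewrite E mulgVK.
    by rewrite -!mulgA mulKg.
  case/andP: aI => a0 a1; case/andP: bI => b0 b1.
  move: ha hb; rewrite /ball /= !ltr_norml => /andP[? ?] /andP[? ?].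
  have [ab|/ltW ba] := leP a b.
  - apply: (@loc_const_segment R _ (fun t => Phi (t, y) * (L y t)^-1)) => //.
    move=> t /andP[? ?].
    have : \forall t' \near t, Phi (t', y) * (L y t')^-1 = Phi (t, y) * (L y t)^-1.
      apply: cst; first by apply/andP; split; lra.
      by rewrite /ball /= ltr_norml; apply/andP; split; lra.
    by apply: filterS.
  - apply: esym; apply: (@loc_const_segment R _ (fun t => Phi (t, y) * (L y t)^-1)) => //.
    move=> t /andP[? ?].
    have : \forall t' \near t, Phi (t', y) * (L y t')^-1 = Phi (t, y) * (L y t)^-1.
      apply: cst; first by apply/andP; split; lra.
      by rewrite /ball /= ltr_norml; apply/andP; split; lra.
    by apply: filterS.
have chart t : ball t1 r t -> \forall y \near y0,
    C (t, y0) (t, y) = (Phi (t, y0))^-1 * Phi (t, y).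
  move=> /hr At; have By0 : B y0 := nbhs_singleton hB.
  by have := slice2 t y0 _ (hAB (t, y0) (conj At By0)).
have By0 : B y0 := nbhs_singleton hB.
move=> Qa; rewrite /Q; near=> y.
have By : B y by near: y.
have Yy : Y y by near: y.
have -> : C (b, y0) (b, y) = (Phi (b, y0))^-1 * Phi (b, y) by near: y; exact: chart.
have Ea : C (a, y0) (a, y) = (Phi (a, y0))^-1 * Phi (a, y) by near: y; exact: chart.
have E0 : C (0%R, y0) (0%R, y) = L y0 a * C (a, y0) (a, y) * (L y a)^-1.
  have -> : C (a, y0) (a, y) = (L y0 a)^-1 * C (0%R, y0) (0%R, y) * L y a by near: y.
  by rewrite !mulgA mulgV mul1g mulgK.
rewrite E0 Ea.
have k1 := key y By Yy; have k0 := key y0 By0 Yy0.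
transitivity ((((L y0 a)^-1 * L y0 b)^-1) * ((Phi (a, y0))^-1 * Phi (a, y)) *
              ((L y a)^-1 * L y b)); last by rewrite invgM invgK !mulgA.
by rewrite k0 k1 !invgM !invgK !mulgA ?(mulgVK, mulgK).
Unshelve. all: by end_near. Qed.

End Homotopy.

Section GaugeExtension.
Variables (T : topologicalType) (G : groupType).
Local Open Scope group_scope.

(** A stand-in for codimension at least two: S has no interior at p, and its complement is connected
    near p. The second clause speaks of locally constant functions with values in G because a gauge
    is extended by means of such a function. *)
Definition thin (S : set T) (p : T) :=
  (forall A, nbhs p A -> exists x, A x /\ ~ S x) /\
  (forall kappa : T -> G,
    (\forall x \near p, ~ S x -> \forall y \near x, kappa y = kappa x) ->
    exists k, \forall x \near p, ~ S x -> kappa x = k).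

(** The value at a point p of S is forced: the quantity [kp p x] is locally constant in x off S,
    hence constant near p by thinness, and this constant is the new value. *)
Lemma gauge_extension (U S : set T) (c c' : T -> T -> G) (f : T -> G) :
  open U -> open (~` S) -> germ_cocycle U c -> germ_cocycle U c' ->
  gauge (U `\` S) c c' f -> (forall p, U p -> S p -> thin S p) ->
  exists2 f', gauge U c c' f' & forall x, ~ S x -> f' x = f x.
Proof.
move=> oU oS cU cU' cc' thS.
pose kp p x := c p x * f x * (c' p x)^-1.
have /choice [f' Hf'] p : exists k, (~ S p -> k = f p) /\
    (U p -> S p -> \forall x \near p, ~ S x -> kp p x = k).
  have [Sp|nSp] := pselect (S p); last by exists (f p).
  have [Up|nUp] := pselect (U p); last by exists (f p).
  have [k hk] : exists k, \forall x \near p, ~ S x -> kp p x = k; last by exists k.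
  apply: (thS p Up Sp).2.
  have h := cU p Up; have h' := cU' p Up.
  have hU : \forall x \near p, U x by exact: open_nbhs_nbhs.
  near=> x => nSx; have Ux : U x by near: x.
  have := cc' x (conj Ux nSx).
  have : \forall y \near x, c p x * c x y = c p y by near: x.
  have : \forall y \near x, c' p x * c' x y = c' p y by near: x.
  apply: filterS3 => y e' e e''; rewrite /kp -e -e' e''.
  by rewrite !invgM !invgK !mulgA ?(mulgVK, mulgK).
exists f'; last by move=> x nSx; have [->] := Hf' x.
move=> p Up.
have nearS (x : T) : ~ S x -> \forall y \near x, ~ S y.
  by move=> nSx; apply: open_nbhs_nbhs.
have [Sp|nSp] := pselect (S p); last first.
  have := cc' p (conj Up nSp); have := nearS p nSp.
  by apply: filterS2 => y nSy; rewrite (Hf' p).1 ?(Hf' y).1.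
have hk := (Hf' p).2 Up Sp.
have hk2 : \forall y \near p, \forall z \near y, ~ S z -> kp p z = f' p.
  exact: near_join.
have h := cU p Up; have h' := cU' p Up.
have hU : \forall x \near p, U x by exact: open_nbhs_nbhs.
near=> y; have Uy : U y by near: y.
suff E : f' p = c p y * f' y * (c' p y)^-1.
  by rewrite E !invgM !invgK !mulgA ?(mulgVK, mulgK).
have [Sy|nSy] := pselect (S y); last first.
  by rewrite (Hf' y).1 //; apply: esym; move: nSy; near: y.
have h1 : \forall z \near y, c p y * c y z = c p z by near: y.
have h2 : \forall z \near y, c' p y * c' y z = c' p z by near: y.
have h3 : \forall z \near y, ~ S z -> kp p z = f' p by near: y.
have h4 := (Hf' y).2 Uy Sy.
(* Two points of S are compared through a point z off S which is close to both. *)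
have [z [[[e1 e2] [e3 e4]] nSz]] :=
  (thS y Uy Sy).1 _ (filterI (filterI h1 h2) (filterI h3 h4)).
rewrite -(e3 nSz) -(e4 nSz) /kp -e1 -e2.
by rewrite !invgM !mulgA.
Unshelve. all: by end_near. Qed.
End GaugeExtension.

(** * Twisted coefficients as a semidirect product *)

Record twisting (A B : zmodType) := Twisting {
  act :> A -> B -> B;
  act0 : forall b, act 0 b = b;
  actD : forall a a' b, act (a + a') b = act a (act a' b);
  actB : forall a b b', act a (b - b') = act a b - act a b' }.

Section Semidirect.
Variables (A B : zmodType) (tw : twisting A B).

Lemma act_0r a : tw a 0 = 0.
Proof. by have := actB tw a 0 0; rewrite !subrr. Qed.

Lemma act_N a b : tw a (- b) = - tw a b.
Proof. by rewrite -[- b]sub0r actB act_0r sub0r. Qed.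

Lemma act_D a b b' : tw a (b + b') = tw a b + tw a b'.
Proof. by rewrite -{1}[b']opprK actB act_N opprK. Qed.

Lemma actK a b : tw (- a) (tw a b) = b.
Proof. by rewrite -actD addNr act0. Qed.

Lemma actVK a b : tw a (tw (- a) b) = b.
Proof. by rewrite -actD subrr act0. Qed.

(** The argument is a phantom that attaches the action to the type, so that the group law can depend
    on it. A local system with this group is a class with values in A together with a 1-cocycle with
    values in B twisted by that class. *)
Definition semidirect (_ : twisting A B) : Type := (A * B)%type.
HB.instance Definition _ := Choice.on (semidirect tw).

Definition sd_mul (x y : semidirect tw) : semidirect tw :=
  (x.1 + y.1, x.2 + tw x.1 y.2).
Definition sd_inv (x : semidirect tw) : semidirect tw :=
  (- x.1, - tw (- x.1) x.2).

Lemma sd_mulA : associative sd_mul.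
Proof. by move=> x y z; rewrite /sd_mul /= addrA act_D actD addrA. Qed.

Lemma sd_mul1 : left_id ((0, 0) : semidirect tw) sd_mul.
Proof. by case=> a b; rewrite /sd_mul /= act0 !add0r. Qed.

Lemma sd_1mul : right_id ((0, 0) : semidirect tw) sd_mul.
Proof. by case=> a b; rewrite /sd_mul /= act_0r !addr0. Qed.

Lemma sd_mulV : left_inverse ((0, 0) : semidirect tw) sd_inv sd_mul.
Proof. by case=> a b; rewrite /sd_mul /= !addNr. Qed.

Lemma sd_Vmul : right_inverse ((0, 0) : semidirect tw) sd_inv sd_mul.
Proof. by case=> a b; rewrite /sd_mul /= act_N actVK !subrr. Qed.

HB.instance Definition _ := isGroup.Build (semidirect tw)
  sd_mulA sd_mul1 sd_1mul sd_mulV sd_Vmul.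

Lemma sd_mulE (x y : semidirect tw) : (x * y)%g = (x.1 + y.1, x.2 + tw x.1 y.2).
Proof. by []. Qed.

Lemma sd_invE (x : semidirect tw) : (x^-1)%g = (- x.1, - tw (- x.1) x.2).
Proof. by []. Qed.
End Semidirect.

(** * Continuity of explicit formulas *)

Definition continuous_at (T T' : topologicalType) (f : T -> T') (p : T) :=
  {for p, continuous f}.

Lemma near_comp (T T' : topologicalType) (f : T -> T') (p : T) (P : T' -> Prop) :
  continuous_at f p -> (\forall y \near f p, P y) -> \forall x \near p, P (f x).
Proof. by move=> fc h; exact: (fc _ h). Qed.

Lemma near_forall (T : topologicalType) (I : finType) (P : I -> T -> Prop) (p : T) :
  (forall i, \forall x \near p, P i x) -> \forall x \near p, forall i, P i x.
Proof. exact: filter_forall. Qed.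

Section Continuity.
Variables (R : realType) (T : topologicalType) (p : T).
Local Notation cont f := (continuous_at f p).

Lemma cont_add (f g : T -> R) : cont f -> cont g -> cont (fun x => f x + g x).
Proof. exact: continuousD. Qed.

Lemma cont_opp (f : T -> R) : cont f -> cont (fun x => - f x).
Proof. exact: continuousN. Qed.

Lemma cont_mul (f g : T -> R) : cont f -> cont g -> cont (fun x => f x * g x).
Proof. exact: continuousM. Qed.

Lemma cont_inv (f : T -> R) : f p != 0 -> cont f -> cont (fun x => (f x)^-1).
Proof. exact: continuousV. Qed.

Lemma cont_max (f g : T -> R) :
  cont f -> cont g -> cont (fun x => Num.max (f x) (g x)).
Proof. exact: continuous_max. Qed.

Lemma cont_min (f g : T -> R) :
  cont f -> cont g -> cont (fun x => Num.min (f x) (g x)).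
Proof. exact: continuous_min. Qed.

Lemma cont_norm (V : normedModType R) (f : T -> V) :
  cont f -> cont (fun x => `|f x|).
Proof. by move=> fc; apply: (continuous_comp fc); exact: norm_continuous. Qed.

Lemma cont_pair (T1 T2 : topologicalType) (f : T -> T1) (g : T -> T2) :
  cont f -> cont g -> cont (fun x => (f x, g x)).
Proof. by move=> fc gc; apply: cvg_pair. Qed.

Lemma cont_fst (T1 T2 : topologicalType) (f : T -> T1 * T2) :
  cont f -> cont (fun x => (f x).1).
Proof. by move=> fc; apply: (continuous_comp fc); exact: cvg_fst. Qed.

Lemma cont_snd (T1 T2 : topologicalType) (f : T -> T1 * T2) :
  cont f -> cont (fun x => (f x).2).
Proof. by move=> fc; apply: (continuous_comp fc); exact: cvg_snd. Qed.

Lemma cont_cst (T1 : topologicalType) (a : T1) : cont (fun=> a).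
Proof. exact: cst_continuous. Qed.

Lemma cont_id : cont (fun x => x).
Proof. exact: cvg_id. Qed.

Lemma cont_sum (I : finType) (f : I -> T -> R) : (forall i, cont (f i)) ->
  cont (fun x => \sum_i f i x).
Proof.
move=> fc; elim: (index_enum I) => [|i r IH].
  under eq_fun do rewrite big_nil; exact: cont_cst.
under eq_fun do rewrite big_cons; exact: cont_add.
Qed.
End Continuity.

Ltac ctn :=
  lazymatch goal with
  | |- continuous_at (fun _ => ?a) _ => exact: cont_cst
  | |- continuous_at (fun x => x) _ => exact: cont_id
  | |- continuous_at (fun x => GRing.add (@?f x) (@?g x)) _ =>
      apply: (@cont_add _ _ _ f g); ctn
  | |- continuous_at (fun x => GRing.opp (@?f x)) _ => apply: (@cont_opp _ _ _ f); ctn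
  | |- continuous_at (fun x => GRing.mul (@?f x) (@?g x)) _ =>
      apply: (@cont_mul _ _ _ f g); ctn
  | |- continuous_at (fun x => Order.max (@?f x) (@?g x)) _ =>
      apply: (@cont_max _ _ _ f g); ctn
  | |- continuous_at (fun x => Order.min (@?f x) (@?g x)) _ =>
      apply: (@cont_min _ _ _ f g); ctn
  | |- continuous_at (fun x => Num.norm (@?f x)) _ => apply: (@cont_norm _ _ _ _ f); ctn
  | |- continuous_at (fun x => (@?f x, @?g x)) _ => apply: (@cont_pair _ _ _ _ f g); ctn
  | |- continuous_at (fun x => fst (@?f x)) _ => apply: (@cont_fst _ _ _ _ f); ctn
  | |- continuous_at (fun x => snd (@?f x)) _ => apply: (@cont_snd _ _ _ _ f); ctn
  | |- _ => idtac
  end.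

(** * The shadow of a diagram *)

Section RealPlane.
Variable R : realType.

Lemma near_gt0 (T : topologicalType) (g : T -> R) (p : T) :
  continuous_at g p -> 0 < g p -> \forall q \near p, 0 < g q.
Proof. by move=> gc g0; apply: (cvgr_gt _ gc). Qed.

Lemma continuous_affine (a b c : R) (p : R * R) :
  continuous_at (fun q : R * R => a * q.1 + b * q.2 + c) p.
Proof. by ctn. Qed.

Lemma near_affine (g : R * R -> R) (a b c : R) (p : R * R) :
  (forall q, g q = a * q.1 + b * q.2 + c) -> 0 < g p -> \forall q \near p, 0 < g q.
Proof.
move=> E; have -> : g = fun q => a * q.1 + b * q.2 + c by apply/funext.
exact: (near_gt0 (@continuous_affine a b c p)).
Qed.

Lemma near2P (p : R * R) (P : R * R -> Prop) :
  (\forall q \near p, P q) <->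
  exists2 r : R, 0 < r & forall q, `|q.1 - p.1| < r -> `|q.2 - p.2| < r -> P q.
Proof.
split=> [/nbhs_ballP[r /= r0 h]|[r r0 h]].
  by exists r => // q h1 h2; apply: h; split; rewrite /ball /= distrC.
apply/nbhs_ballP; exists r => //= q [/= h1 h2].
by apply: h; rewrite distrC.
Qed.

Lemma compact_pos (g : R -> R) : (forall k, continuous_at g k) ->
  (forall k, 0 <= k <= 1 -> 0 < g k) ->
  exists2 r : R, 0 < r & forall k, 0 <= k <= 1 -> r <= g k.
Proof.
move=> gc g0.
have [|c] := @EVT_min R g 0 1 ler01; first exact: continuous_subspaceT.
rewrite in_itv /= => c01 hc; exists (g c); first exact: g0.
by move=> k k01; apply: hc; rewrite in_itv.
Qed.

Lemma finite_pos (I : finType) (r : I -> R) : (forall i, 0 < r i) ->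
  exists2 r0 : R, 0 < r0 & forall i, r0 <= r i.
Proof.
move=> rp; exists (\big[Num.min/1]_i r i).
  by apply: (big_ind (fun x : R => 0 < x)) => // x y x0 y0; rewrite lt_min x0.
by move=> i; exact: bigmin_le.
Qed.

Lemma loc_const_convex (V : normedModType R) (S : Type) (C : set V) (f : V -> S) :
  (forall x y t, C x -> C y -> 0 <= t <= 1 -> C (x + t *: (y - x))) ->
  (forall x, C x -> \forall y \near x, C y -> f y = f x) ->
  forall x y, C x -> C y -> f x = f y.
Proof.
move=> Cc fl x y Cx Cy.
pose g (t : R) := x + t *: (y - x).
have -> : f x = f (g 0) by rewrite /g scale0r addr0.
have -> : f y = f (g 1) by rewrite /g scale1r addrC subrK.
apply: (@loc_const_segment R _ (f \o g)) => // t t01.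
have gc : {for t, continuous g}.
  apply: continuousD; first exact: cst_continuous.
  by apply: continuousZr_tmp; exact: cvg_id.
have h : \forall t' \near t, C (g t') -> f (g t') = f (g t).
  exact: (gc _ (fl (g t) (Cc _ _ _ Cx Cy t01))).
by apply: filterS h => t' h t'01; apply: h; apply: Cc.
Qed.

Lemma cvx_gt0 (a b t : R) : 0 <= t <= 1 -> 0 < a -> 0 < b -> 0 < a + t * (b - a).
Proof.
move=> /andP[t0 t1] a0 b0.
have -> : a + t * (b - a) = (1 - t) * a + t * b by ring.
have [->|tn1] := eqVneq t 1; first by rewrite subrr mul0r add0r mul1r.
apply: ltr_pwDl; first by rewrite mulr_gt0 // subr_gt0 lt_neqAle tn1.
by rewrite mulr_ge0 // ltW.
Qed.

Lemma cvx_dist (a b p t r : R) : 0 <= t <= 1 -> `|a - p| < r -> `|b - p| < r ->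
  `|a + t * (b - a) - p| < r.
Proof.
move=> t01; rewrite !ltr_norml => /andP[a1 a2] /andP[b1 b2].
have h1 : 0 < (a - p + r) + t * ((b - p + r) - (a - p + r)) by apply: cvx_gt0 => //; lra.
have h2 : 0 < (r - (a - p)) + t * ((r - (b - p)) - (r - (a - p))) by apply: cvx_gt0 => //; lra.
by apply/andP; split; lra.
Qed.

Lemma half_itv : 0 < (2^-1 : R) < 1.
Proof. by apply/andP; split; lra. Qed.

Lemma avoid_seq (s : seq R) (a b : R) : a < b -> exists2 c, a < c < b & c \notin s.
Proof.
elim: s a b => [|z s IH] a b ab; first by exists ((a + b) / 2) => //; apply/andP; split; lra.
have [zm|mz] := ltP z ((a + b) / 2).
- have [|c /andP[c1 c2] cs] := IH ((a + b) / 2) b; first lra.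
  exists c; first by apply/andP; split; lra.
  by rewrite inE negb_or cs andbT; apply/eqP => E; lra.
- have [|c /andP[c1 c2] cs] := IH a ((a + b) / 2); first lra.
  exists c; first by apply/andP; split; lra.
  by rewrite inE negb_or cs andbT; apply/eqP => E; lra.
Qed.
End RealPlane.

Section Planar.
Variables (R : realType) (D : diagram R).
Hypothesis dD : is_diagram D.
Implicit Types (e : edge D) (x y : node D) (q : R * R).

Let pp x := plane_proj x.
Let ep e k := (edge_point e k).1.

Definition shadow : set (R * R) :=
  [set q | exists e k, 0 <= k <= 1 /\ q = (edge_point e k).1].

Lemma dir_neq0 e : ((dir e).1 != 0) || ((dir e).2 != 0).
Proof.
have [_ h _ _ _] := dD; have := h e; rewrite /dir.
case: (plane_proj (src e)) (plane_proj (tgt e)) => a b [c d] /= ne.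
rewrite -negb_and; apply/negP => /andP[].
rewrite !subr_eq0 => /eqP h1 /eqP h2.
by apply: ne; rewrite h1 h2.
Qed.

Lemma epE e k : ep e k = ((pp (src e)).1 + k * (dir e).1, (pp (src e)).2 + k * (dir e).2).
Proof. by []. Qed.

Lemma ep0 e : ep e 0 = pp (src e).
Proof. by rewrite epE !mul0r !addr0; case: (pp _). Qed.

Lemma ep1 e : ep e 1 = pp (tgt e).
Proof.
rewrite epE !mul1r /dir /pp; case: (plane_proj (tgt e)) => a b.
by case: (plane_proj (src e)) => c d /=; congr pair; ring.
Qed.

Lemma dir_sqr_gt0 e : 0 < (dir e).1 ^+ 2 + (dir e).2 ^+ 2.
Proof.
have /orP[h|h] := dir_neq0 e.
  by apply: ltr_pwDl; rewrite ?exprn_even_gt0 ?sqr_ge0.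
by apply: ltr_wpDl; rewrite ?exprn_even_gt0 ?sqr_ge0.
Qed.

Lemma ep_inj e k k' : ep e k = ep e k' -> k = k'.
Proof.
rewrite !epE => -[/addrI h1 /addrI h2].
by have /orP[h|h] := dir_neq0 e; [apply: (mulIf h)|apply: (mulIf h)].
Qed.

Lemma ep_interior_unique e e' k k' :
  0 < k < 1 -> 0 <= k' <= 1 -> ep e k = ep e' k' -> e = e'.
Proof.
move=> k01 k'01 E; apply: contrapT => ne; have [_ _ h _ _] := dD.
exact: (h e e' k k' ne k01 k'01 E).
Qed.

Lemma node_dart x : exists e b, x = if b then src e else tgt e.
Proof.
have [h _ _ _ _] := dD; have [/card_gt0P[e]] := h x.
by rewrite inE => /eqP E _ _; exists e, false.
Qed.

Lemma node_not_interior x e k : 0 < k < 1 -> ep e k <> pp x.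
Proof.
move=> k01 E; have [e' [b xE]] := node_dart x.
have E' : ep e k = ep e' (if b then 0 else 1).
  by rewrite E xE; case: b {xE}; rewrite ?ep0 ?ep1.
have k'01 : 0 <= (if b then 0 else 1 : R) <= 1 by case: b {xE E'}; rewrite ?lexx ?ler01.
have ee' := ep_interior_unique k01 k'01 E'; subst e'.
by have := ep_inj E'; move: k01 => /[swap] ->; case: b {xE E' k'01}; rewrite ltxx ?andbF.
Qed.

(** The dart [(e, true)] leaves the source of e along e, and [(e, false)] leaves its target
    backwards. The left of [(e, false)] is thus the right of e, and one notion of left value serves
    both sides of an edge. *)
Definition dart := (edge D * bool)%type.
Implicit Types d : dart.
Definition dart_base d := if d.2 then src d.1 else tgt d.1.
Definition dart_dir d : R * R := if d.2 then dir d.1 else - dir d.1.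
Definition dart_flip d : dart := (d.1, ~~ d.2).

Definition within (r : R) q q' := `|q'.1 - q.1| < r /\ `|q'.2 - q.2| < r.

(** An edge is compact, so one that misses q stays at a positive distance from q, and there are
    finitely many edges. *)
Lemma shadow_near q : exists2 r : R, 0 < r & forall q', within r q q' -> shadow q' ->
  exists e k k', [/\ 0 <= k <= 1, 0 <= k' <= 1, q' = ep e k & q = ep e k'].
Proof.
have /choice [r hr] e : exists r : R, 0 < r /\
    forall q', within r q q' -> forall k, 0 <= k <= 1 -> q' = ep e k ->
    exists2 k', 0 <= k' <= 1 & q = ep e k'.
  have [[k' h1 h2]|ne] := pselect (exists2 k', 0 <= k' <= 1 & q = ep e k').
    by exists 1; split => // q' _ k _ _; exists k'.
  have [|k k01|r r0 hr] := @compact_pos R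
      (fun k => Num.max `|(ep e k).1 - q.1| `|(ep e k).2 - q.2|).
  - by move=> k; rewrite /ep /=; ctn.
  - rewrite lt_max !normr_gt0 !subr_eq0 -negb_and; apply/negP => /andP[/eqP h1 /eqP h2].
    by apply: ne; exists k => //; rewrite [q]surjective_pairing -h1 -h2.
  - exists r; split => // q' [h1 h2] k k01 E; exfalso.
    have := hr k k01; rewrite -E leNgt => /negP; apply.
    by rewrite gt_max h1 h2.
have [r0 r00 hr0] := finite_pos (fun e => (hr e).1).
exists r0 => // q' [h1 h2] [e [k [k01 E]]].
have [|k' k'01 E'] := (hr e).2 q' _ k k01 E.
  by split; [exact: lt_le_trans h1 (hr0 e)|exact: lt_le_trans h2 (hr0 e)].
by exists e, k, k'.
Qed.

Lemma dart_near x : exists2 r : R, 0 < r & forall q, within r (pp x) q -> shadow q ->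
  exists d k, [/\ pp (dart_base d) = pp x, 0 <= k <= 1,
     q.1 = (pp x).1 + k * (dart_dir d).1 & q.2 = (pp x).2 + k * (dart_dir d).2].
Proof.
have [r r0 hr] := shadow_near (pp x); exists r => // q h1 h2.
have [e [k [k' [k01 k'01 E E']]]] := hr q h1 h2.
have : (k' == 0) || (k' == 1).
  apply/negP => /negP; rewrite negb_or => /andP[n0 n1].
  apply: (@node_not_interior x e k') => //.
  by case/andP: k'01 => a b; rewrite lt_neqAle eq_sym n0 a lt_neqAle n1 b.
case/orP => /eqP k'E; rewrite {}k'E ?ep0 ?ep1 in E'.
  by exists (e, true), k; rewrite /dart_base /dart_dir /= E'; split => //; rewrite E.
exists (e, false), (1 - k); rewrite /dart_base /dart_dir /= E'; split => //.
- by case/andP: k01 => a b; apply/andP; split; lra.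
- by rewrite E -ep1 !epE /=; ring.
- by rewrite E -ep1 !epE /=; ring.
Qed.

Lemma interior_near e k : 0 < k < 1 -> exists2 r : R, 0 < r &
  forall q, within r (ep e k) q -> shadow q ->
    det (dir e) (q - pp (src e)) = 0.
Proof.
move=> k01; have [r r0 hr] := shadow_near (ep e k); exists r => // q h1 h2.
have [e' [k1 [k' [k101 k'01 E E']]]] := hr q h1 h2.
rewrite -(ep_interior_unique k01 k'01 E') in E.
by rewrite E /det /= ; ring.
Qed.

Definition loc_const_off_shadow (S : Type) (beta : R * R -> S) :=
  forall q, ~ shadow q -> \forall q' \near q, beta q' = beta q.

Definition left_value (S : Type) (beta : R * R -> S) d (v : S) :=
  forall k, 0 < k < 1 -> \forall q \near ep d.1 k,
    0 < det (dart_dir d) (q - pp (src d.1)) -> beta q = v.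

Lemma left_dense d k (A : set (R * R)) : nbhs (ep d.1 k) A ->
  exists2 q, A q & 0 < det (dart_dir d) (q - pp (src d.1)).
Proof.
move=> /near2P [r r0 hA].
pose M : R := `|(dir d.1).1| + `|(dir d.1).2| + 1.
have M0 : 0 < M by rewrite /M; have := normr_ge0 (dir d.1).1; have := normr_ge0 (dir d.1).2; lra.
pose t := r / M; have t0 : 0 < t by rewrite divr_gt0.
pose s : R := if d.2 then 1 else -1.
have hs (z : R) : `|z| < M -> `|t * (s * z)| < r.
  move=> zM; rewrite normrM (gtr0_norm t0) normrM.
  have -> : `|s| = 1 by rewrite /s; case: ifP; rewrite ?normrN normr1.
  by rewrite mul1r /t mulrAC ltr_pdivrMr // ltr_pM2l.
exists ((ep d.1 k).1 + t * (s * - (dir d.1).2), (ep d.1 k).2 + t * (s * (dir d.1).1)).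
  apply: hA => /=; rewrite addrAC subrr add0r hs // ?normrN /M;
    have := normr_ge0 (dir d.1).1; have := normr_ge0 (dir d.1).2; lra.
have -> : det (dart_dir d) (((ep d.1 k).1 + t * (s * - (dir d.1).2),
     (ep d.1 k).2 + t * (s * (dir d.1).1)) - pp (src d.1)) =
     t * ((dir d.1).1 ^+ 2 + (dir d.1).2 ^+ 2).
  by rewrite /s /dart_dir /det; case: d.2 => /=; ring.
by rewrite mulr_gt0 // dir_sqr_gt0.
Qed.

Lemma left_value_unique (S : Type) (beta : R * R -> S) d v v' :
  left_value beta d v -> left_value beta d v' -> v = v'.
Proof.
move=> /(_ _ (half_itv R)) h /(_ _ (half_itv R)) h'.
have [q [h1 h2] h3] := left_dense (filterI h h').
by rewrite -h1 // h2.
Qed.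

Lemma det_cvx (v a b c : R * R) (t : R) : det v (a + t *: (b - a) - c) =
  det v (a - c) + t * (det v (b - c) - det v (a - c)).
Proof. by rewrite /det /GRing.scale /= /GRing.scale /=; ring. Qed.

Lemma left_not_shadow d k : 0 < k < 1 -> \forall q \near ep d.1 k,
  0 < det (dart_dir d) (q - pp (src d.1)) -> ~ shadow q.
Proof.
move=> k01; have [r r0 hr] := interior_near d.1 k01; apply/near2P; exists r => // q h1 h2 h3 sq.
have := hr q (conj h1 h2) sq; move: h3; rewrite /dart_dir /det.
by case: d.2 => /= h3 h4; lra.
Qed.

(** The point is chosen before the function and before its type of values: half of a small square
    beside the edge misses the shadow, so every function that is locally constant off the shadow is
    constant there. Left values of a function and of its image under a homomorphism are therefore
    read at the same point. *)
Lemma left_point_exists d : exists q, forall (S : Type) (beta : R * R -> S),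
  loc_const_off_shadow beta -> left_value beta d (beta q).
Proof.
have /choice [w hw] (k : R) : exists q, 0 < k < 1 ->
    forall (S : Type) (beta : R * R -> S), loc_const_off_shadow beta ->
    \forall q' \near ep d.1 k, 0 < det (dart_dir d) (q' - pp (src d.1)) -> beta q' = beta q.
  have [k01|] := boolP (0 < k < 1); last by exists (0, 0).
  have /near2P[r r0 hr] := @left_not_shadow d k k01.
  pose C : set (R * R) := [set q | [/\ `|q.1 - (ep d.1 k).1| < r, `|q.2 - (ep d.1 k).2| < r &
     0 < det (dart_dir d) (q - pp (src d.1))]].
  have nC : \forall q \near ep d.1 k, 0 < det (dart_dir d) (q - pp (src d.1)) -> C q.
    by apply/near2P; exists r.
  have [q0 /[swap] dq0 /(_ dq0) Cq0] := left_dense nC.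
  exists q0 => _ S beta lb; move: nC; apply: filterS => q /[apply] Cq.
  apply: (@loc_const_convex R (R * R)%type S C) => //.
    move=> a b t [a1 a2 a3] [b1 b2 b3] t01; split => /=; [exact: cvx_dist|exact: cvx_dist|].
    by rewrite det_cvx; apply: cvx_gt0.
  move=> a [a1 a2 a3]; have := lb a (hr a a1 a2 a3); exact: filterS.
exists (w 2^-1) => S beta lb k k01; have := hw k k01 S beta lb.
suff -> : beta (w k) = beta (w 2^-1) by [].
have h01 := half_itv R.
apply: (@loc_const_convex R R S [set k | 0 < k < 1] (fun k => beta (w k))) => //.
  move=> a b t /= /andP[a1 a2] /andP[b1 b2] t01; apply/andP; split; first exact: cvx_gt0.
  by have := @cvx_gt0 R (1 - a) (1 - b) t t01; rewrite /GRing.scale /=; lra.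
move=> a /= a01.
have ec : continuous_at (fun a : R => ep d.1 a) a.
  by rewrite /ep /=; ctn.
have h0 := near_comp ec (near_join (hw a a01 S beta lb)); apply: filterS h0 => b h /= b01.
have [q [h1 h2] h3] := left_dense (filterI h (hw b b01 S beta lb)).
by rewrite -h1 // h2.
Qed.

Definition left_point d := projT1 (cid (left_point_exists d)).

Lemma left_pointP d (S : Type) (beta : R * R -> S) :
  loc_const_off_shadow beta -> left_value beta d (beta (left_point d)).
Proof. by rewrite /left_point; case: cid => q /= h; apply: h. Qed.
Arguments left_pointP d {S} beta _.

Lemma left_pointE d (S : Type) (beta : R * R -> S) v :
  loc_const_off_shadow beta -> left_value beta d v -> beta (left_point d) = v.
Proof. move=> lb; exact/left_value_unique/left_pointP. Qed.

(** For directions that are not positively proportional, the open sector swept counterclockwise from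
    u to v: the intersection of two half-planes if the angle is less than pi, their union
    otherwise. *)
Definition sector (u v w : R * R) : bool :=
  if 0 < det u v then (0 < det u w) && (0 < det w v)
  else (0 < det u w) || (0 < det w v).

Lemma dart_dir_gt0 d : 0 < (dart_dir d).1 ^+ 2 + (dart_dir d).2 ^+ 2.
Proof.
have := dir_sqr_gt0 d.1; rewrite /dart_dir; case: d.2 => //=.
by rewrite !sqrrN.
Qed.

Lemma near_det_l (u c p : R * R) : 0 < det u (p - c) ->
  \forall q \near p, 0 < det u (q - c).
Proof.
apply: (@near_affine R (fun q => det u (q - c)) (- u.2) u.1 (u.2 * c.1 - u.1 * c.2)) => q.
by rewrite /det /=; ring.
Qed.

Lemma near_det_r (u c p : R * R) : 0 < det (p - c) u ->
  \forall q \near p, 0 < det (q - c) u.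
Proof.
apply: (@near_affine R (fun q => det (q - c) u) u.2 (- u.1) (u.1 * c.2 - u.2 * c.1)) => q.
by rewrite /det /=; ring.
Qed.

(** Left values are defined along the open edge; this brings them to its end. The point found is
    arbitrarily close to the base of d and keeps the position of d relative to an auxiliary
    direction w. *)
Lemma dart_side_point d d' (w : R * R) (S : Type) (beta : R * R -> S) v (A : set (R * R)) :
  d'.1 = d.1 -> nbhs (pp (dart_base d)) A -> left_value beta d' v ->
  exists q, [/\ A q, beta q = v, 0 < det (dart_dir d') (q - pp (dart_base d)),
    (0 < det (dart_dir d) w -> 0 < det (q - pp (dart_base d)) w) &
    (0 < det w (dart_dir d) -> 0 < det w (q - pp (dart_base d)))].
Proof.
move=> dd' nA lv; set c := pp (dart_base d).
pose g (t : R) := (c.1 + t * (dart_dir d).1, c.2 + t * (dart_dir d).2).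
have g0 : g 0 = c by rewrite /g !mul0r !addr0; case: (c).
have gc : continuous_at g 0 by rewrite /g; ctn.
have := near_comp gc; rewrite g0 => /(_ _ (near_join nA)) /nbhs_ballP[r /= r0 hr].
pose t := Num.min (r / 2) 2^-1.
have t01 : 0 < t < 1.
  by rewrite /t lt_min gt_min; apply/andP; split; [apply/andP; split|apply/orP; right]; lra.
have tr : t < r by rewrite /t gt_min; apply/orP; left; lra.
have hA : \forall q \near g t, A q.
  by apply: hr; rewrite /ball /= sub0r normrN gtr0_norm //; case/andP: t01.
have {}t0 : 0 < t by case/andP: t01.
pose k := if d.2 then t else 1 - t.
have k01 : 0 < k < 1.
  by case/andP: t01 => ? ?; rewrite /k; case: ifP => _; apply/andP; split; lra.
have gE : g t = ep d'.1 k.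
  rewrite dd' epE /g /c /k /dart_base /dart_dir; case: d.2 => //=.
  rewrite -[pp (tgt d.1)]ep1 epE /=; congr pair; ring.
have hl := lv k k01; rewrite -gE in hl.
have hw1 : \forall q \near g t, 0 < det (dart_dir d) w -> 0 < det (q - c) w.
  have [dw|/negP ndw] := boolP (0 < det (dart_dir d) w); last by apply/near2P; exists 1 => // q _ _ /ndw.
  suff : 0 < det (g t - c) w by move/near_det_r; apply: filterS.
  have -> : det (g t - c) w = t * det (dart_dir d) w by rewrite /g /det /=; ring.
  exact: mulr_gt0.
have hw2 : \forall q \near g t, 0 < det w (dart_dir d) -> 0 < det w (q - c).
  have [dw|/negP ndw] := boolP (0 < det w (dart_dir d)); last by apply/near2P; exists 1 => // q _ _ /ndw.
  suff : 0 < det w (g t - c) by move/near_det_l; apply: filterS.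
  have -> : det w (g t - c) = t * det w (dart_dir d) by rewrite /g /det /=; ring.
  exact: mulr_gt0.
rewrite gE in hA hl hw1 hw2.
have [q [[q1 q2] [q3 q4]] q5] := left_dense (filterI (filterI hA hl) (filterI hw1 hw2)).
exists q; split => //; first exact: q2.
suff -> : det (dart_dir d') (q - c) = det (dart_dir d') (q - pp (src d'.1)) by [].
rewrite /c /dart_base dd' /dart_dir dd' /det; case: d.2 => //.
by case: d'.2; rewrite /dir /=; ring.
Qed.

Lemma det_scale_sector u v w (k : R) : sector u v (k * w.1, k * w.2) -> 0 <= k -> sector u v w.
Proof.
rewrite /sector; have -> : det u (k * w.1, k * w.2) = k * det u w by rewrite /det /=; ring.
have -> : det (k * w.1, k * w.2) v = k * det w v by rewrite /det /=; ring.
rewrite le_eqVlt => /[swap] /orP[/eqP <-|k0]; first by rewrite !mul0r ltxx /= if_same.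
by rewrite !pmulr_rgt0.
Qed.

Lemma det_opp_swap (u v : R * R) : det v u = det (- u) v.
Proof. by rewrite /det /=; ring. Qed.

Lemma dart_dir_flip d : dart_dir (dart_flip d) = - dart_dir d.
Proof. by rewrite /dart_flip /dart_dir /=; case: d.2; rewrite /= ?opprK. Qed.

(** A small piece of a sector without darts misses the shadow and joins the left of [d1] to the
    right of [d2]. *)
Lemma sector_value d1 d2 (S : Type) (beta : R * R -> S) :
  loc_const_off_shadow beta -> pp (dart_base d2) = pp (dart_base d1) ->
  ~~ ((det (dart_dir d1) (dart_dir d2) == 0) && (0 < dot (dart_dir d1) (dart_dir d2))) ->
  (forall d, pp (dart_base d) = pp (dart_base d1) ->
     ~~ sector (dart_dir d1) (dart_dir d2) (dart_dir d)) ->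
  beta (left_point d1) = beta (left_point (dart_flip d2)).
Proof.
move=> lb b12 npar nsec; set u := dart_dir d1 in npar nsec *; set v := dart_dir d2 in npar nsec *.
have [r r0 hr] := dart_near (dart_base d1); set c := pp (dart_base d1) in hr b12 nsec *.
have lc q : within r c q -> sector u v (q - c) -> \forall q' \near q, beta q' = beta q.
  move=> wq sq; apply: lb => /(hr q wq)[d [k [dc /andP[k0 _] E1 E2]]].
  have /negP := nsec d dc; apply; apply: (det_scale_sector (k := k)) => //.
  move: sq; have -> // : q - c = (k * (dart_dir d).1, k * (dart_dir d).2).
  by rewrite [q]surjective_pairing E1 E2 /=; congr pair => /=; ring.
have nw : nbhs c (within r c) by apply/near2P; exists r.
have nw2 : nbhs (pp (dart_base d2)) (within r c) by rewrite b12.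
have [q1 [q1r q1v q1a q1b _]] := @dart_side_point d1 d1 v S beta _ _ erefl nw (left_pointP d1 _ lb).
have [q2 [q2r q2v q2a _ q2b]] :=
  @dart_side_point d2 (dart_flip d2) u S beta _ _ erefl nw2 (left_pointP (dart_flip d2) _ lb).
rewrite b12 in q2a q2b.
have {}q2a : 0 < det (q2 - c) v by rewrite det_opp_swap -dart_dir_flip.
rewrite -q1v -q2v.
pose C1 : set (R * R) := [set q | within r c q /\ 0 < det u (q - c)].
pose C2 : set (R * R) := [set q | within r c q /\ 0 < det (- v) (q - c)].
have C1c (x y : R * R) (t : R) : C1 x -> C1 y -> 0 <= t <= 1 -> C1 (x + t *: (y - x)).
  move=> [[x1 x2] x3] [[y1 y2] y3] t01; split; first by split; exact: cvx_dist.
  by rewrite det_cvx; apply: cvx_gt0.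
have C2c (x y : R * R) (t : R) : C2 x -> C2 y -> 0 <= t <= 1 -> C2 (x + t *: (y - x)).
  move=> [[x1 x2] x3] [[y1 y2] y3] t01; split; first by split; exact: cvx_dist.
  by rewrite det_cvx; apply: cvx_gt0.
have Cq1 : C1 q1 by [].
have Cq2 : C2 q2 by split => //; rewrite -det_opp_swap.
have [duv|duv] := boolP (0 < det u v).
  apply: (@loc_const_convex R (R * R)%type S (C1 `&` C2)).
  - by move=> x y t [? ?] [? ?] t01; split; [apply: C1c|apply: C2c].
  - move=> q [[wq q3] [_ q4]]; have : sector u v (q - c).
      by rewrite /sector duv q3 det_opp_swap.
    by move/(lc q wq); apply: filterS.
  - by split => //; split => //; rewrite -det_opp_swap; exact: q1b.
  - by split => //; split => //; exact: q2b.
(* For an angle of at least pi, the two half-planes are traversed one after the other, and [v0]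
   points into both: it is minus the sum of u and v, or a quarter turn of u if v is opposite to
   u. *)
have [v0 [v01 v02]] : exists v0, 0 < det u v0 /\ 0 < det v0 v.
  have u0 := dart_dir_gt0 d1; have v0 := dart_dir_gt0 d2; rewrite -/u -/v in u0 v0.
  have [/eqP E|ne] := boolP (det u v == 0); last first.
    exists (- (u + v)); move: ne duv; rewrite -leNgt le_eqVlt => /negPf -> /=.
    by rewrite /det /= => h; split; lra.
  exists (- u.2, u.1); split; first by rewrite /det /=; move: u0; rewrite !expr2; lra.
  have : dot u v != 0.
    apply/negP => /eqP E2; have := mulr_gt0 u0 v0.
    suff -> : (u.1 ^+ 2 + u.2 ^+ 2) * (v.1 ^+ 2 + v.2 ^+ 2) = det u v ^+ 2 + dot u v ^+ 2.
      by rewrite E E2 expr0n /= addr0 ltxx.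
    by rewrite /det /dot; ring.
  move: npar; rewrite E eqxx /= -leNgt le_eqVlt => /orP[/eqP ->|]; first by rewrite eqxx.
  by rewrite /det /dot /=; lra.
pose g (t : R) := (c.1 + t * v0.1, c.2 + t * v0.2).
have gc : continuous_at g 0 by rewrite /g; ctn.
have := near_comp gc; have -> : g 0 = c by rewrite /g !mul0r !addr0; case: (c).
move=> /(_ _ nw) /nbhs_ballP[r' /= r'0 hr'].
have wg : within r c (g (r' / 2)).
  by apply: hr'; rewrite /ball /= sub0r normrN gtr0_norm; lra.
have C1g : C1 (g (r' / 2)).
  split => //; have -> : det u (g (r' / 2) - c) = r' / 2 * det u v0 by rewrite /g /det /=; ring.
  by rewrite mulr_gt0 //; lra.
have C2g : C2 (g (r' / 2)).
  split => //; rewrite -det_opp_swap.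
  have -> : det (g (r' / 2) - c) v = r' / 2 * det v0 v by rewrite /g /det /=; ring.
  by rewrite mulr_gt0 //; lra.
transitivity (beta (g (r' / 2))).
- apply: (@loc_const_convex R (R * R)%type S C1) => // q [wq q3].
  have : sector u v (q - c) by rewrite /sector (negPf duv) q3.
  by move/(lc q wq); apply: filterS.
- apply: (@loc_const_convex R (R * R)%type S C2) => // q [wq q3].
  have : sector u v (q - c) by rewrite /sector (negPf duv) (det_opp_swap v (q - c)) q3 orbT.
  by move/(lc q wq); apply: filterS.
Qed.
End Planar.

(** * The Alexander numbering of a planar flow *)

Section Potential.
Variables (R : realType) (D : diagram R).
Hypothesis dD : is_diagram D.
Implicit Types (e : edge D) (x y : node D) (q p : R * R).

Let pp x := plane_proj x.
Let ep e k := (edge_point e k).1.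

Lemma det_sub (u a b : R * R) : det u (a - b) = u.1 * (a.2 - b.2) - u.2 * (a.1 - b.1).
Proof. by []. Qed.

Lemma near_sign (g : R * R -> R) (a b c : R) p :
  (forall q, g q = a * q.1 + b * q.2 + c) -> g p != 0 ->
  \forall q \near p, (0 < g q) = (0 < g p).
Proof.
move=> E; rewrite neq_lt => /orP[h|h]; last first.
  by have := near_affine E h; apply: filterS => q ->; rewrite h.
have E' q : - g q = - a * q.1 + - b * q.2 + - c by rewrite E; ring.
have h' : 0 < - g p by rewrite oppr_gt0.
by have := near_affine E' h'; apply: filterS => q hq; rewrite !ltNge (ltW h) ltW // -oppr_gt0.
Qed.

Lemma near_det (v c p : R * R) (k : R) : k * det v (p - c) != 0 -> \forall q \near p,
  (0 < k * det v (q - c)) = (0 < k * det v (p - c)).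
Proof.
apply: (@near_sign (fun q => k * det v (q - c)) (- k * v.2) (k * v.1) (k * (v.2 * c.1 - v.1 * c.2))).
by move=> q; rewrite /det /=; ring.
Qed.

Lemma near_coord (a : R) p : a != p.1 -> \forall q \near p, (a <= q.1) = (a <= p.1).
Proof.
move=> ap; have ap' : a - p.1 != 0 by rewrite subr_eq0.
have E q : a - q.1 = -1 * q.1 + 0 * q.2 + a by ring.
have := near_sign E ap'; apply: filterS => q.
by rewrite !subr_gt0 !ltNge => /negb_inj.
Qed.

Definition ind (b : bool) : int := if b then 1 else 0.

(* The signed number of times the downward vertical ray from [q] crosses [e],
   with half-open conventions. *)
Definition ray_weight e q : int :=
  (ind ((pp (src e)).1 <= q.1) - ind ((pp (tgt e)).1 <= q.1)) *
  ind (0 < (dir e).1 * det (dir e) (q - pp (src e))).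

(* The correction at the end points cancels in a sum weighted by a flow. *)
Definition ray_weight' p e q : int := ray_weight e q -
  (ind (((pp (src e)).1 <= q.1) && ((pp (src e)).2 < p.2)) -
   ind (((pp (tgt e)).1 <= q.1) && ((pp (tgt e)).2 < p.2))).

Lemma dirE e : (dir e = ((pp (tgt e)).1 - (pp (src e)).1, (pp (tgt e)).2 - (pp (src e)).2)).
Proof. by []. Qed.

Lemma ep_of_between e p k : 0 <= k <= 1 -> p.1 = (pp (src e)).1 + k * (dir e).1 ->
  p.2 = (pp (src e)).2 + k * (dir e).2 -> exists2 k, 0 <= k <= 1 & p = ep e k.
Proof. by move=> k01 h1 h2; exists k; rewrite // [p]surjective_pairing h1 h2. Qed.

Lemma div_between (a b : R) : b != 0 -> 0 <= a * b -> a * b <= b * b -> 0 <= a / b <= 1.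
Proof.
move=> b0 h1 h2; have b2 : 0 < b ^+ 2 by rewrite exprn_even_gt0.
have -> : a / b = a * b / b ^+ 2 by field.
by rewrite divr_ge0 ?(ltW b2) //= ler_pdivrMr // mul1r expr2.
Qed.

(** Away from e, the ray count jumps only when q crosses the vertical line through an end of e while
    lying above that end, and the correction compensates exactly this. The four cases tell which
    ends have the same abscissa as p. *)
Lemma ray_weight_off e p : ~ (exists2 k, 0 <= k <= 1 & p = ep e k) ->
  exists c, \forall q \near p, ray_weight' p e q = c.
Proof.
move=> np; set s := pp (src e); set t := pp (tgt e).
have d0 := dir_neq0 dD e.
have [Es|ns] := eqVneq s.1 p.1; have [Et|nt] := eqVneq t.1 p.1.
- have dx0 : (dir e).1 = 0 by rewrite dirE /= -/s -/t Es Et subrr.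
  have dy0 : (dir e).2 != 0 by move: d0; rewrite dx0 eqxx.
  have E : (s.2 < p.2) = (t.2 < p.2).
    apply: contrapT => ne; apply: np.
    apply: (@ep_of_between e p ((p.2 - s.2) / (dir e).2)).
    + have dE : (dir e).2 = t.2 - s.2 by [].
      apply: div_between => //; rewrite dE; move: ne.
      * case: ltP => h1; case: ltP => h2 // _; nra.
      * case: ltP => h1; case: ltP => h2 // _; nra.
    + by rewrite dx0 mulr0 addr0.
    + by rewrite mulfVK // -/s; ring.
  exists 0; apply/near2P; exists 1 => // q _ _.
  by rewrite /ray_weight' /ray_weight -/s -/t Es Et E subrr mul0r subrr.
- have dx0 : (dir e).1 != 0 by rewrite dirE /= subr_eq0 -/s -/t Es.
  have dE : (dir e).1 * det (dir e) (p - s) = (dir e).1 ^+ 2 * (p.2 - s.2).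
    by rewrite /det /= Es; ring.
  have ps : p.2 - s.2 != 0.
    apply/eqP => E; apply: np; apply: (@ep_of_between e p 0); first by rewrite lexx ler01.
      by rewrite mul0r addr0 -/s Es.
    by rewrite mul0r addr0 -/s; lra.
  have hd : (dir e).1 * det (dir e) (p - s) != 0 by rewrite dE mulf_neq0 // sqrf_eq0.
  have E : (0 < (dir e).1 * det (dir e) (p - s)) = (s.2 < p.2).
    by rewrite dE pmulr_rgt0 ?subr_gt0 // exprn_even_gt0.
  exists (ind (t.1 <= p.1) * (ind (t.2 < p.2) - ind (s.2 < p.2))).
  move: (near_det hd) (near_coord nt); apply: filterS2 => q E1 E2.
  rewrite /ray_weight' /ray_weight -/s -/t E1 E2 E.
  by case: (s.1 <= q.1); case: (s.2 < p.2); case: (t.1 <= p.1); case: (t.2 < p.2).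
- have dx0 : (dir e).1 != 0 by rewrite dirE /= subr_eq0 -/s -/t Et eq_sym.
  have dE : (dir e).1 * det (dir e) (p - s) = (dir e).1 ^+ 2 * (p.2 - t.2).
    have -> : p.2 - t.2 = p.2 - s.2 - (dir e).2 by rewrite dirE /= -/s -/t; ring.
    by rewrite /det /= -Et -/s; have -> : t.1 - s.1 = (dir e).1 by []; ring.
  have ps : p.2 - t.2 != 0.
    apply/eqP => E; apply: np; apply: (@ep_of_between e p 1); first by rewrite lexx ler01.
      by rewrite mul1r dirE /= -/s -/t Et; ring.
    by rewrite mul1r dirE /= -/s -/t; lra.
  have hd : (dir e).1 * det (dir e) (p - s) != 0 by rewrite dE mulf_neq0 // sqrf_eq0.
  have E : (0 < (dir e).1 * det (dir e) (p - s)) = (t.2 < p.2).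
    by rewrite dE pmulr_rgt0 ?subr_gt0 // exprn_even_gt0.
  exists (ind (s.1 <= p.1) * (ind (t.2 < p.2) - ind (s.2 < p.2))).
  move: (near_det hd) (near_coord ns); apply: filterS2 => q E1 E2.
  rewrite /ray_weight' /ray_weight -/s -/t E1 E2 E.
  by case: (t.1 <= q.1); case: (s.2 < p.2); case: (s.1 <= p.1); case: (t.2 < p.2).
- have [E|ne] := eqVneq (s.1 <= p.1) (t.1 <= p.1).
    exists (ind (t.1 <= p.1) * (ind (t.2 < p.2) - ind (s.2 < p.2))).
    move: (near_coord ns) (near_coord nt); apply: filterS2 => q E1 E2.
    rewrite /ray_weight' /ray_weight -/s -/t E1 E2 E subrr mul0r.
    by case: (t.1 <= p.1); case: (s.2 < p.2); case: (t.2 < p.2).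
  have hd : (dir e).1 * det (dir e) (p - s) != 0.
    have dx0 : (dir e).1 != 0.
      by apply: contraNneq ne; rewrite dirE /= -/s -/t => /eqP; rewrite subr_eq0 => /eqP ->.
    rewrite mulf_neq0 //; apply/eqP => E; apply: np.
    apply: (@ep_of_between e p ((p.1 - s.1) / (dir e).1)).
    + have dE : (dir e).1 = t.1 - s.1 by [].
      apply: div_between => //; rewrite dE; move: ne ns nt.
      * by case: leP => h1; case: leP => h2 // _ ns nt; nra.
      * by case: leP => h1; case: leP => h2 // _ ns nt; nra.
    + by rewrite mulfVK // -/s; ring.
    + have E' : (dir e).1 * (p.2 - s.2) = (dir e).2 * (p.1 - s.1).
        by apply/eqP; rewrite -subr_eq0; apply/eqP.
      suff -> : (p.1 - s.1) / (dir e).1 * (dir e).2 = p.2 - s.2 by rewrite -/s; ring.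
      by apply: (mulfI dx0); rewrite E' mulrA mulrCA divff // mulr1 mulrC.
  exists (ray_weight' p e p); move: (near_det hd) (near_coord ns); have := near_coord nt.
  by apply: filterS3 => q E1 E2 E3; rewrite /ray_weight' /ray_weight -/s -/t E1 E2 E3.
Qed.

Lemma ray_weight_on e k : 0 < k < 1 -> exists c, \forall q \near ep e k,
  det (dir e) (q - pp (src e)) != 0 ->
  ray_weight' (ep e k) e q = c + ind (0 < det (dir e) (q - pp (src e))).
Proof.
move=> k01; set p := ep e k; set s := pp (src e); set t := pp (tgt e).
case/andP: k01 => k0 k1.
have p1 : p.1 = s.1 + k * (dir e).1 by []. have p2 : p.2 = s.2 + k * (dir e).2 by [].
have t1 : t.1 = s.1 + (dir e).1 by rewrite dirE /= -/s -/t; ring.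
have t2 : t.2 = s.2 + (dir e).2 by rewrite dirE /= -/s -/t; ring.
have d0 := dir_neq0 dD e; have [dx0|dx0] := eqVneq (dir e).1 0.
(* A vertical edge is met by no ray in the half-open sense, so its jump comes entirely from the
   corrections at its ends. *)
- have dy0 : (dir e).2 != 0 by move: d0; rewrite dx0 eqxx.
  exists (- ind (0 < (dir e).2)); apply/near2P; exists 1 => // q _ _.
  have -> : det (dir e) (q - s) = (dir e).2 * (s.1 - q.1) by rewrite det_sub dx0; ring.
  rewrite /ray_weight' /ray_weight -/s -/t dx0 mul0r ltxx mulr0 sub0r p2 t1 t2 dx0 addr0.
  rewrite mulf_eq0 (negPf dy0) orFb subr_eq0 => nq.
  have E1 : (s.1 < q.1) = (s.1 <= q.1) by rewrite lt_neqAle nq.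
  move: dy0; rewrite neq_lt => /orP[dy|dy].
    have -> : (s.2 < s.2 + k * (dir e).2) = false by apply/negbTE; rewrite -leNgt; nra.
    have -> : (s.2 + (dir e).2 < s.2 + k * (dir e).2) = true by nra.
    have -> : (0 < (dir e).2) = false by apply/negbTE; rewrite -leNgt ltW.
    by rewrite nmulr_rgt0 // subr_lt0 E1 andbF andbT; case: (s.1 <= q.1).
  have -> : (s.2 < s.2 + k * (dir e).2) = true by nra.
  have -> : (s.2 + (dir e).2 < s.2 + k * (dir e).2) = false by apply/negbTE; rewrite -leNgt; nra.
  have -> : (0 < (dir e).2) = true by exact: dy.
  rewrite (pmulr_rgt0 _ dy) subr_gt0 andbF andbT ltNge.
  by case: (s.1 <= q.1).
- have ns : s.1 != p.1 by rewrite p1 -subr_eq0 opprD addrA subrr sub0r oppr_eq0 mulf_neq0 // gt_eqF.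
  have nt : t.1 != p.1.
    rewrite p1 t1 -subr_eq0 opprD addrACA subrr add0r -{1}[(dir e).1]mul1r -mulrBl mulf_neq0 //.
    by rewrite subr_eq0 gt_eqF.
  move: dx0; rewrite neq_lt => /orP[dx|dx].
  + exists (- 1 - (ind (((pp (src e)).1 <= p.1) && ((pp (src e)).2 < p.2)) -
       ind (((pp (tgt e)).1 <= p.1) && ((pp (tgt e)).2 < p.2)))).
    move: (near_coord ns) (near_coord nt); apply: filterS2 => q E1 E2 nq.
    rewrite /ray_weight' /ray_weight -/s -/t E1 E2.
    have -> : (s.1 <= p.1) = false by apply/negbTE; rewrite -ltNge p1; nra.
    have -> : (t.1 <= p.1) = true by rewrite p1 t1; nra.
    rewrite nmulr_rgt0 //; case: ltgtP nq => //= _ _; ring.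
  + exists (- (ind (((pp (src e)).1 <= p.1) && ((pp (src e)).2 < p.2)) -
       ind (((pp (tgt e)).1 <= p.1) && ((pp (tgt e)).2 < p.2)))).
    move: (near_coord ns) (near_coord nt); apply: filterS2 => q E1 E2 nq.
    rewrite /ray_weight' /ray_weight -/s -/t E1 E2.
    have -> : (s.1 <= p.1) = true by rewrite p1; nra.
    have -> : (t.1 <= p.1) = false by apply/negbTE; rewrite -ltNge p1 t1; nra.
    rewrite pmulr_rgt0 //; case: (0 < _) => /=; ring.
Qed.

Section Pot.
Variable (B : zmodType).
Implicit Type nu : edge D -> B.

Definition potential nu q : B := \sum_e nu e *~ ray_weight e q.

(** The boundary of the planar 1-chain [nu] is zero, tested against all functions of the projection;
    the two nodes of a crossing are not told apart. Indicators of quadrants are the test functions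
    that remove the corrections. *)
Definition planar_conserved nu := forall g : R * R -> int,
  \sum_e nu e *~ (g (pp (src e)) - g (pp (tgt e))) = 0.

Lemma potentialE nu p q : planar_conserved nu ->
  potential nu q = \sum_e nu e *~ ray_weight' p e q.
Proof.
move=> cn; rewrite /ray_weight'; under [RHS]eq_bigr do rewrite mulrzBr.
rewrite sumrB [X in _ - X](_ : _ = 0) ?subr0 //.
exact: (cn (fun z => ind ((z.1 <= q.1) && (z.2 < p.2)))).
Qed.

Lemma potential_loc_const nu : planar_conserved nu ->
  loc_const_off_shadow D (potential nu).
Proof.
move=> cn p np.
have : \forall q \near p, forall e, ray_weight' p e q = ray_weight' p e p.
  apply: near_forall => e.
  have [[k k01 E]|c hc] := ray_weight_off (e := e) (p := p); last first.
    by have -> := nbhs_singleton hc.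
  by apply: np; exists e, k.
by apply: filterS => q h; rewrite !(potentialE p) //; apply: eq_bigr => e _; rewrite h.
Qed.

(** Near the midpoint of e the corrected terms of all other edges are constant, and the term of e
    changes by one across e. *)
Lemma potential_jump nu e : planar_conserved nu ->
  potential nu (left_point dD (e, true)) - potential nu (left_point dD (e, false)) = nu e.
Proof.
move=> cn; have lb := potential_loc_const cn.
have [c hc] := ray_weight_on e (half_itv R); set p := ep e 2^-1 in hc.
have hr : \forall q \near p, forall e', e' != e -> ray_weight' p e' q = ray_weight' p e' p.
  apply: near_forall => e'; have [->|ne] := eqVneq e' e; first by apply/near2P; exists 1.
  have [[k k01 E]|c' hc'] := ray_weight_off (e := e') (p := p).
    by case/eqP: ne; apply/esym/(ep_interior_unique dD (half_itv R) k01 E).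
  by have -> := nbhs_singleton hc'; apply: filterS hc'.
have val (b : bool) : potential nu (left_point dD (e, b)) =
    \sum_(e' | e' != e) nu e' *~ ray_weight' p e' p + nu e *~ (c + ind b).
  have hl := left_pointP dD (e, b) lb (half_itv R).
  have [q [[h1 h2] h3] h4] := left_dense dD (d := (e, b)) (filterI (filterI hr hc) hl).
  rewrite -h3 // (potentialE p) // (bigD1 e) //= addrC; congr (_ + _).
    by apply: eq_bigr => e' ne; rewrite h1.
  have detN v u : det (- v) u = - det v u :> R by rewrite /det /=; ring.
  have [hn hs] : det (dir e) (q - pp (src e)) != 0 /\
      (0 < det (dir e) (q - pp (src e))) = b.
    move: h4; rewrite /dart_dir /=; case: b {hl h3} => /= h4; first by rewrite gt_eqF.
    by rewrite detN oppr_gt0 in h4; rewrite lt_eqF // ltNge ltW.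
  by rewrite h2 // hs.
by rewrite !val opprD addrACA subrr add0r -mulrzBr /= opprD addrACA subrr add0r subr0.
Qed.
End Pot.

Section ZeroJump.
Variables (S : Type) (beta : R * R -> S).
Hypothesis lb : loc_const_off_shadow D beta.
Hypothesis jump0 : forall e, beta (left_point dD (e, true)) = beta (left_point dD (e, false)).

Lemma near_interior_shadow e k : 0 < k < 1 -> \forall q \near ep e k,
  det (dir e) (q - pp (src e)) = 0 -> shadow D q.
Proof.
move=> /andP[k0 k1]; set s := pp (src e); set u := dir e.
pose n2 : R := u.1 ^+ 2 + u.2 ^+ 2; have n20 : 0 < n2 by exact: dir_sqr_gt0.
pose g q := u.1 * (q.1 - s.1) + u.2 * (q.2 - s.2).
have epE' t : ep e t = (s.1 + t * u.1, s.2 + t * u.2) by [].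
have gE : g (ep e k) = k * n2 by rewrite epE' /g /n2; clear; move: u s => [? ?] [? ?] /=; ring.
have h1 : \forall q \near ep e k, 0 < g q.
  apply: (@near_affine R g u.1 u.2 (- (u.1 * s.1 + u.2 * s.2))) => [q|].
    by rewrite /g; ring.
  by rewrite gE mulr_gt0.
have h2 : \forall q \near ep e k, 0 < n2 - g q.
  apply: (@near_affine R (fun q => n2 - g q) (- u.1) (- u.2) (n2 + (u.1 * s.1 + u.2 * s.2))) => [q|].
    by rewrite /g; ring.
  by rewrite gE -{1}[n2]mul1r -mulrBl mulr_gt0 // subr_gt0.
move: h1 h2; apply: filterS2 => q g0 g1; rewrite det_sub => dq.
exists e, (g q / n2); split.
  by rewrite divr_ge0 ?(ltW g0) ?(ltW n20) //= ler_pdivrMr // mul1r; lra.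
have aux (a b c : R) : a * n2 = b * c -> b / n2 * c = a.
  by move=> E; rewrite mulrAC -E mulfK // gt_eqF.
rewrite -/(ep e _) epE' (aux (q.1 - s.1)) ?(aux (q.2 - s.2)).
- by rewrite [LHS]surjective_pairing; congr pair; ring.
- have -> : (q.2 - s.2) * n2 = g q * u.2 + u.1 * (u.1 * (q.2 - s.2) - u.2 * (q.1 - s.1)).
    by rewrite /g /n2; ring.
  by rewrite dq mulr0 addr0.
- have -> : (q.1 - s.1) * n2 = g q * u.1 - u.2 * (u.1 * (q.2 - s.2) - u.2 * (q.1 - s.1)).
    by rewrite /g /n2; ring.
  by rewrite dq mulr0 subr0.
Qed.

Lemma off_shadow_value p : (forall x, pp x != p) ->
  (exists v, \forall q \near p, ~ shadow D q -> beta q = v) /\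
  (forall A, nbhs p A -> exists2 q, A q & ~ shadow D q).
Proof.
move=> np; have [[e [k [k01 E]]]|nsp] := pselect (shadow D p); last first.
  split; last by move=> A /nbhs_singleton Ap; exists p.
  by exists (beta p); apply: filterS (lb nsp).
have {}k01 : 0 < k < 1.
  case/andP: k01 => k0 k1; rewrite !lt_neqAle k0 k1 !andbT.
  apply/andP; split; apply/eqP => E'.
    by have := np (src e); rewrite E -E' ep0 eqxx.
  by have := np (tgt e); rewrite E E' ep1 eqxx.
have {}E : p = ep e k by [].
split; last first.
  move=> A; rewrite E => nA.
  have [q [h1 h2] h3] := left_dense dD (d := (e, true)) (filterI nA (@left_not_shadow R D dD (e, true) k k01)).
  by exists q => //; apply: h2.
exists (beta (left_point dD (e, true))); rewrite E.
have h1 : \forall q \near ep e k, 0 < det (dir e) (q - pp (src e)) ->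
    beta q = beta (left_point dD (e, true)) := left_pointP dD (e, true) lb k01.
have h2 : \forall q \near ep e k, 0 < det (- dir e) (q - pp (src e)) ->
    beta q = beta (left_point dD (e, false)) := left_pointP dD (e, false) lb k01.
apply: filterS3 h1 h2 (near_interior_shadow e k01) => q h1 h2 h3 nsq.
have [h|h|h] := ltgtP 0 (det (dir e) (q - pp (src e))).
- exact: h1.
- rewrite h2 ?jump0 //.
  have -> : det (- dir e) (q - pp (src e)) = - det (dir e) (q - pp (src e)).
    by rewrite /det /=; ring.
  by rewrite oppr_gt0.
- by case: nsq; apply: h3.
Qed.

(** A function without jumps extends over the open edges, which leaves out only the finitely many
    projections of nodes. After a generic shift of both end points, a path made of a vertical and a
    horizontal piece avoids them. *)
Lemma zero_jump_const q q' : ~ shadow D q -> ~ shadow D q' -> beta q = beta q'.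
Proof.
have /choice [w hw] p : exists v, (forall x, pp x != p) ->
    \forall q \near p, ~ shadow D q -> beta q = v.
  have [np|np] := pselect (forall x, pp x != p); last by exists (beta q).
  by have [[v hv] _] := off_shadow_value np; exists v.
have wE p : (forall x, pp x != p) -> ~ shadow D p -> w p = beta p.
  by move=> np nsp; have := nbhs_singleton (hw p np) nsp.
have path a b : (forall t, 0 <= t <= 1 -> forall x, pp x != (a.1 + t * (b.1 - a.1), a.2 + t * (b.2 - a.2))) ->
    w a = w b.
  move=> np; pose g (t : R) := (a.1 + t * (b.1 - a.1), a.2 + t * (b.2 - a.2)).
  have -> : a = g 0 by rewrite /g !mul0r !addr0; case: (a).
  have -> : b = g 1 by rewrite /g !mul1r [LHS]surjective_pairing; congr pair; ring.
  apply: (@loc_const_segment R _ (w \o g)) => // t t01.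
  have gc : continuous_at g t by rewrite /g; ctn.
  have h0 := near_comp gc (near_join (hw (g t) (np t t01))).
  apply: filterS h0 => t' h t'01 /=.
  have [q1 [h1 h2] h3] := (off_shadow_value (np t' t'01)).2 _ (filterI h (hw (g t') (np t' t'01))).
  by rewrite -(h1 h3) -(h2 h3).
have generic p : ~ shadow D p -> exists p' : R * R,
    [/\ beta p = w p', forall x, (pp x).1 != p'.1 & forall x, (pp x).2 != p'.2].
  move=> nsp; have := lb nsp; move=> /near_join /near2P[r r0 hr].
  have [a1 /andP[a1l a1r] a1n] := avoid_seq [seq (pp x).1 | x in node D] (ltr_pwDr r0 (lexx p.1)).
  have [a2 /andP[a2l a2r] a2n] := avoid_seq [seq (pp x).2 | x in node D] (ltr_pwDr r0 (lexx p.2)).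
  have n1 x : (pp x).1 != a1 by apply: contraNneq a1n => <-; apply: map_f; rewrite mem_enum.
  have n2 x : (pp x).2 != a2 by apply: contraNneq a2n => <-; apply: map_f; rewrite mem_enum.
  exists (a1, a2); split => //.
  have np x : pp x != (a1, a2) by apply: contraNneq (n1 x) => ->.
  have := hr (a1, a2); rewrite /= !ltr_norml => h.
  have {}h := h ltac:(apply/andP; split; lra) ltac:(apply/andP; split; lra).
  have [q1 [h1 h2] h3] := (off_shadow_value np).2 _ (filterI h (hw _ np)).
  by rewrite -(h2 h3) h1.
move=> /generic[p [-> p1 p2]] /generic[p' [-> p'1 p'2]].
transitivity (w (p.1, p'.2)).
- apply: path => t _ x; apply: contraNneq (p1 x) => -> /=.
  by rewrite subrr mulr0 addr0.
- apply: path => t _ x; apply: contraNneq (p'2 x) => -> /=.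
  by rewrite subrr mulr0 addr0.
Qed.
End ZeroJump.
End Potential.

(** * Regions around a node *)

Section Nodes.
Variables (R : realType) (D : diagram R).
Hypothesis dD : is_diagram D.
Implicit Types (e a b c : edge D) (x y lo hi : node D) (d : dart D).

Let pp x := plane_proj x.
Let ep e k := (edge_point e k).1.

Definition under x := [exists y, crossing x y].
Definition over x := [exists y, crossing y x].

Lemma lone_node x y : ~~ under x -> ~~ over x -> pp y = pp x -> y = x.
Proof.
move=> nu no E; apply: contrapT => ne; have [_ _ _ _ h] := dD.
have [_ _ hne _] := h y x ne E.
have [lt|gt|eq] := ltgtP (height y) (height x).
- by case/existsP: no; exists y; rewrite /crossing lt andbT; apply/eqP.
- by case/existsP: nu; exists y; rewrite /crossing gt andbT; apply/eqP.
- by case: hne.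
Qed.

Lemma in_edge_exists x : exists e, tgt e = x.
Proof. by have [h _ _ _ _] := dD; have [/card_gt0P[e]] := h x; rewrite inE => /eqP; exists e. Qed.

Lemma out_edge_exists x : exists e, src e = x.
Proof. by have [h _ _ _ _] := dD; have [_ /card_gt0P[e]] := h x; rewrite inE => /eqP; exists e. Qed.

Definition in_edge x := projT1 (cid (in_edge_exists x)).
Definition out_edge x := projT1 (cid (out_edge_exists x)).
Lemma in_edgeP x : tgt (in_edge x) = x. Proof. by rewrite /in_edge; case: cid. Qed.

Lemma out_edgeP x : src (out_edge x) = x. Proof. by rewrite /out_edge; case: cid. Qed.

Lemma indegE x : indeg x = #|[pred e | tgt e == x]|.
Proof. by apply: eq_card => e; rewrite !inE; apply/asboolP/idP. Qed.

Lemma outdegE x : outdeg x = #|[pred e | src e == x]|.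
Proof. by apply: eq_card => e; rewrite !inE; apply/asboolP/idP. Qed.

Lemma bivalent_in x e : bivalent x -> tgt e = x -> e = in_edge x.
Proof.
rewrite /bivalent indegE => /andP[/fintype.card1P[a E] _] te.
have := E e; have := E (in_edge x); rewrite !inE te in_edgeP eqxx.
by move=> /esym/eqP -> /esym/eqP ->.
Qed.

Lemma bivalent_out x e : bivalent x -> src e = x -> e = out_edge x.
Proof.
rewrite /bivalent outdegE => /andP[_ /fintype.card1P[a E]] te.
have := E e; have := E (out_edge x); rewrite !inE te out_edgeP eqxx.
by move=> /esym/eqP -> /esym/eqP ->.
Qed.

Lemma dart_pt d t : ep d.1 (if d.2 then t else 1 - t) =
  ((pp (dart_base d)).1 + t * (dart_dir d).1, (pp (dart_base d)).2 + t * (dart_dir d).2).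
Proof.
rewrite /dart_base /dart_dir /ep; case: d => e [] //=; congr pair; rewrite /pp; ring.
Qed.

Lemma pos_multiple (u v : R * R) : 0 < u.1 ^+ 2 + u.2 ^+ 2 -> det u v = 0 -> 0 < dot u v ->
  exists2 l : R, 0 < l & v = (l * u.1, l * u.2).
Proof.
move=> u0 duv duv0; exists (dot u v / (u.1 ^+ 2 + u.2 ^+ 2)); first exact: divr_gt0.
have aux (p q : R) : p * (u.1 ^+ 2 + u.2 ^+ 2) = dot u v * q ->
    p = dot u v / (u.1 ^+ 2 + u.2 ^+ 2) * q.
  by move=> E; rewrite mulrAC -E mulfK // gt_eqF.
have h1 : v.1 * (u.1 ^+ 2 + u.2 ^+ 2) = dot u v * u.1.
  have -> : v.1 * (u.1 ^+ 2 + u.2 ^+ 2) = dot u v * u.1 - u.2 * det u v by rewrite /dot /det; ring.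
  by rewrite duv mulr0 subr0.
have h2 : v.2 * (u.1 ^+ 2 + u.2 ^+ 2) = dot u v * u.2.
  have -> : v.2 * (u.1 ^+ 2 + u.2 ^+ 2) = dot u v * u.2 + u.1 * det u v by rewrite /dot /det; ring.
  by rewrite duv mulr0 addr0.
by rewrite [LHS]surjective_pairing -(aux _ _ h1) -(aux _ _ h2).
Qed.

(** Two distinct darts with the same base and direction would overlap along an interval, against the
    regularity of the diagram. *)
Lemma not_parallel d d' : d != d' -> pp (dart_base d') = pp (dart_base d) ->
  ~~ ((det (dart_dir d) (dart_dir d') == 0) && (0 < dot (dart_dir d) (dart_dir d'))).
Proof.
move=> ne E; apply/negP => /andP[/eqP h1 h2].
have [l l0 dE] := pos_multiple (dart_dir_gt0 dD d) h1 h2.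
have [E1|ne1] := eqVneq d.1 d'.1.
  have [_ h _ _ _] := dD; apply: (h d.1).
  move: ne E E1; case: d {h1 h2 dE} => e b; case: d' => e' b' /=; rewrite /dart_base /= => ne E E1.
  by subst e'; move: ne E; rewrite /pp; case: b; case: b'; rewrite ?eqxx.
(* With this choice [k] and [k * l] are both less than 1, so the common point is interior to both
   edges. *)
pose k := (2 * (1 + l))^-1.
have k0 : 0 < k by rewrite invr_gt0; lra.
have kE : k * (2 * (1 + l)) = 1 by rewrite mulVf // gt_eqF //; lra.
have kl0 : 0 < k * l by exact: mulr_gt0.
have k01 : 0 < (if d'.2 then k else 1 - k) < 1 by case: ifP => _; apply/andP; split; lra.
have kl01 : 0 <= (if d.2 then k * l else 1 - k * l) <= 1 by case: ifP => _; apply/andP; split; lra.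
have h : ep d'.1 (if d'.2 then k else 1 - k) = ep d.1 (if d.2 then k * l else 1 - k * l).
  by rewrite !dart_pt E dE /=; congr pair; ring.
by have := ep_interior_unique dD k01 kl01 h => E'; rewrite E' eqxx in ne1.
Qed.

Section Values.
Variables (S : Type) (beta : R * R -> S).
Hypothesis lb : loc_const_off_shadow D beta.
Local Notation lv d := (beta (left_point dD d)).

Lemma sector_self (u v : R * R) : (sector u v u = false) * (sector u v v = false).
Proof.
have d0 (z : R * R) : det z z = 0 by rewrite /det; ring.
by rewrite /sector !d0 ltxx andbF andFb orbF /=; split; case: ifP => // ->.
Qed.

Lemma pair_values d1 d2 : d1 != d2 -> pp (dart_base d2) = pp (dart_base d1) ->
  (forall d, pp (dart_base d) = pp (dart_base d1) -> d = d1 \/ d = d2) ->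
  lv d1 = lv (dart_flip d2).
Proof.
move=> ne E h; apply: sector_value => //; first exact: not_parallel.
by move=> d /h[->|->]; rewrite sector_self.
Qed.

Lemma ccw_sector (u v w : R * R) : ccw u v w -> ~~ sector u v w.
Proof.
have dN (y z : R * R) : det y z = - det z y by rewrite /det; ring.
rewrite /ccw /sector (dN u w) (dN w v) !oppr_gt0.
have [h1|h1] := ltP 0 (det u v); have [h2|h2] := ltP 0 (det v w);
  have [h3|h3] := ltP 0 (det w u); rewrite ?(ltNge _ 0) ?(ltW h2) ?(ltW h3) ?andbF //=.
all: rewrite -?leNgt ?h2 ?h3 //=; try lra.
Qed.

Lemma ccw_rot (u v w : R * R) : ccw u v w = ccw v w u.
Proof. by rewrite /ccw -addnA addnC. Qed.

Lemma triple_values d1 d2 d3 :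
  d1 != d2 -> pp (dart_base d2) = pp (dart_base d1) ->
  (forall d, pp (dart_base d) = pp (dart_base d1) -> [\/ d = d1, d = d2 | d = d3]) ->
  ccw (dart_dir d1) (dart_dir d2) (dart_dir d3) -> lv d1 = lv (dart_flip d2).
Proof.
move=> ne E h cc; apply: sector_value => //; first exact: not_parallel.
by move=> d /h[]->; rewrite ?sector_self // ccw_sector.
Qed.

Lemma bivalent_values x (b : bool) : bivalent x -> ~~ under x -> ~~ over x ->
  lv (out_edge x, b) = lv (in_edge x, b).
Proof.
move=> bx nu no; pose d1 : dart D := (out_edge x, true); pose d2 : dart D := (in_edge x, false).
have ne : d1 != d2 by rewrite xpair_eqE andbF.
have E1 : dart_base d1 = x by rewrite /dart_base /= out_edgeP.
have E2 : dart_base d2 = x by rewrite /dart_base /= in_edgeP.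
have h d : pp (dart_base d) = pp x -> d = d1 \/ d = d2.
  move=> /(lone_node nu no); rewrite /dart_base; case: d => e [] /= E.
    by left; rewrite (bivalent_out bx E).
  by right; rewrite (bivalent_in bx E).
case: b.
  have -> := @pair_values d1 d2 ne; rewrite ?E1 ?E2 //.
rewrite eq_sym in ne.
have := @pair_values d2 d1 ne; rewrite E1 E2 => /(_ erefl) -> //.
by move=> d /h[]; [right|left].
Qed.
End Values.

Lemma crossing_bivalent lo hi : crossing lo hi -> bivalent lo /\ bivalent hi.
Proof.
move=> /andP[/eqP E lt]; have [_ _ _ _ h] := dD.
have ne : lo <> hi by move=> E'; rewrite E' ltxx in lt.
by have [] := h lo hi ne E.
Qed.

Lemma nonbivalent_lone x : ~~ bivalent x -> ~~ under x /\ ~~ over x.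
Proof.
move=> nb; split; apply: contra nb => /existsP[y] /crossing_bivalent[] //.
Qed.

Lemma degree_le3 x : (indeg x + outdeg x <= 3)%N.
Proof. by have [h _ _ _ _] := dD; have [] := h x. Qed.

Lemma indeg_gt0 x : (0 < indeg x)%N.
Proof. by have [h _ _ _ _] := dD; have [] := h x. Qed.

Lemma outdeg_gt0 x : (0 < outdeg x)%N.
Proof. by have [h _ _ _ _] := dD; have [] := h x. Qed.

Lemma vertex_in_edges a b c : a != b -> tgt a = src c -> tgt b = src c ->
  [/\ forall e, tgt e = src c -> e = a \/ e = b,
      forall e, src e = src c -> e = c & ~~ bivalent (src c)].
Proof.
move=> ne ta tb; set x := src c.
have i2 : (1 < indeg x)%N.
  rewrite indegE; apply/fintype.card_gt1P; exists a, b.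
  by rewrite !inE ta tb eqxx ne.
have o1 := outdeg_gt0 x; have le := degree_le3 x.
split.
- move=> e te; apply: contrapT => nab.
  have : (2 < indeg x)%N; last by lia.
  rewrite indegE; apply/fintype.card_gt2P; exists a, b, e; rewrite !inE ta tb te eqxx ne.
  by split=> //; split=> //; apply/eqP => E; apply: nab; [right|left].
- move=> e se; apply: contrapT => nc.
  have : (1 < outdeg x)%N; last by lia.
  rewrite outdegE; apply/fintype.card_gt1P; exists c, e; rewrite !inE se eqxx; split=> //.
  by apply/eqP => E; apply: nc.
- by rewrite /bivalent; apply/negP => /andP[/eqP E _]; rewrite E in i2.
Qed.

Lemma vertex_out_edges a b c : a != b -> tgt c = src a -> tgt c = src b ->
  [/\ forall e, src e = tgt c -> e = a \/ e = b,
      forall e, tgt e = tgt c -> e = c & ~~ bivalent (tgt c)].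
Proof.
move=> ne ta tb; set x := tgt c.
have i2 : (1 < outdeg x)%N.
  rewrite outdegE; apply/fintype.card_gt1P; exists a, b.
  by rewrite !inE -ta -tb eqxx ne.
have o1 := indeg_gt0 x; have le := degree_le3 x.
split.
- move=> e te; apply: contrapT => nab.
  have : (2 < outdeg x)%N; last by lia.
  rewrite outdegE; apply/fintype.card_gt2P; exists a, b, e; rewrite !inE -ta -tb te eqxx ne.
  by split=> //; split=> //; apply/eqP => E; apply: nab; [right|left].
- move=> e se; apply: contrapT => nc.
  have : (1 < indeg x)%N; last by lia.
  rewrite indegE; apply/fintype.card_gt1P; exists c, e; rewrite !inE se eqxx; split=> //.
  by apply/eqP => E; apply: nc.
- by rewrite /bivalent; apply/negP => /andP[_ /eqP E]; rewrite E in i2.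
Qed.

Lemma vertex_values a b c (S : Type) (beta : R * R -> S) :
  loc_const_off_shadow D beta -> vertex_at a b c ->
  [/\ beta (left_point dD (a, false)) = beta (left_point dD (c, false)),
      beta (left_point dD (b, false)) = beta (left_point dD (a, true)) &
      beta (left_point dD (c, true)) = beta (left_point dD (b, true))].
Proof.
move=> lb /andP[ne /orP[]] /and3P[/eqP ta /eqP tb cc].
- have cc2 := cc; rewrite ccw_rot in cc2; have cc3 := cc2; rewrite ccw_rot in cc3.
  have [h1 h2 /nonbivalent_lone[nu no]] := vertex_in_edges ne ta tb.
  pose d1 : dart D := (c, true); pose d2 : dart D := (b, false); pose d3 : dart D := (a, false).
  have h d : pp (dart_base d) = pp (src c) -> [\/ d = d1, d = d2 | d = d3].
    move=> /(lone_node nu no); rewrite /dart_base; case: d => e [] /=.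
      by move=> /h2 ->; constructor 1.
    by move=> /h1[] ->; [constructor 3|constructor 2].
  split.
  + apply: (@triple_values S beta lb d3 d1 d2).
    * by rewrite xpair_eqE andbF.
    * by rewrite /dart_base /= ?ta.
    * move=> d; rewrite /dart_base /= ?ta => /h[] ->; by [constructor 1|constructor 2|constructor 3].
    * exact: cc3.
  + apply: (@triple_values S beta lb d2 d3 d1).
    * by rewrite xpair_eqE andbT eq_sym.
    * by rewrite /dart_base /= ta tb.
    * move=> d; rewrite /dart_base /= ?tb => /h[] ->; by [constructor 1|constructor 2|constructor 3].
    * exact: cc2.
  + apply: (@triple_values S beta lb d1 d2 d3).
    * by rewrite xpair_eqE andbF.
    * by rewrite /dart_base /= tb.
    * move=> d; rewrite /dart_base /= ?tb => /h[] ->; by [constructor 1|constructor 2|constructor 3].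
    * exact: cc.
- have cc2 := cc; rewrite ccw_rot in cc2; have cc3 := cc2; rewrite ccw_rot in cc3.
  have [h1 h2 /nonbivalent_lone[nu no]] := vertex_out_edges ne ta tb.
  pose d1 : dart D := (c, false); pose d2 : dart D := (a, true); pose d3 : dart D := (b, true).
  have h d : pp (dart_base d) = pp (tgt c) -> [\/ d = d1, d = d2 | d = d3].
    move=> /(lone_node nu no); rewrite /dart_base; case: d => e [] /=.
      by move=> /h1[] ->; [constructor 2|constructor 3].
    by move=> /h2 ->; constructor 1.
  split.
  + apply/esym; apply: (@triple_values S beta lb d1 d2 d3).
    * by rewrite xpair_eqE andbF.
    * by rewrite /dart_base /= -ta.
    * move=> d; rewrite /dart_base /= => /h[] ->; by [constructor 1|constructor 2|constructor 3].
    * exact: cc.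
  + apply/esym; apply: (@triple_values S beta lb d2 d3 d1).
    * by rewrite xpair_eqE andbT.
    * by rewrite /dart_base /= -ta tb.
    * move=> d; rewrite /dart_base /= -ta => /h[] ->; by [constructor 1|constructor 2|constructor 3].
    * exact: cc2.
  + apply/esym; apply: (@triple_values S beta lb d3 d1 d2).
    * by rewrite xpair_eqE andbF.
    * by rewrite /dart_base /= -tb.
    * move=> d; rewrite /dart_base /= -tb => /h[] ->; by [constructor 1|constructor 2|constructor 3].
    * exact: cc3.
Qed.

(** If no determinant vanishes, this is a count of signs. A vanishing one means that two directions
    are opposite, and then the other two determinants have the same sign. *)
Lemma ccw_total (u v w : R * R) :
  0 < u.1 ^+ 2 + u.2 ^+ 2 -> 0 < v.1 ^+ 2 + v.2 ^+ 2 -> 0 < w.1 ^+ 2 + w.2 ^+ 2 ->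
  ~~ ((det u v == 0) && (0 < dot u v)) -> ~~ ((det v w == 0) && (0 < dot v w)) ->
  ~~ ((det w u == 0) && (0 < dot w u)) -> ccw u v w || ccw u w v.
Proof.
have dN (y z : R * R) : det y z = - det z y by rewrite /det; ring.
have zero (x y z : R * R) : 0 < x.1 ^+ 2 + x.2 ^+ 2 -> 0 < y.1 ^+ 2 + y.2 ^+ 2 ->
  ~~ ((det x y == 0) && (0 < dot x y)) -> ~~ ((det y z == 0) && (0 < dot y z)) ->
  ~~ ((det z x == 0) && (0 < dot z x)) -> 0 < z.1 ^+ 2 + z.2 ^+ 2 -> det x y = 0 ->
  0 < det y z * det z x.
  move=> x0 y0 nxy nyz nzx z0 dxy; move: nxy; rewrite dxy eqxx /= => nxy.
  have [l l0 yE] : exists2 l, 0 < l & y = (- l * x.1, - l * x.2).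
    have [||l l0 E] := @pos_multiple x (- y.1, - y.2) x0.
    - by rewrite /det /=; move: dxy; rewrite /det; lra.
    - have -> : dot x (- y.1, - y.2) = - dot x y by rewrite /dot /=; ring.
      rewrite oppr_gt0 lt_neqAle leNgt nxy andbT; apply/eqP => dt.
      have := mulr_gt0 x0 y0.
      suff -> : (x.1 ^+ 2 + x.2 ^+ 2) * (y.1 ^+ 2 + y.2 ^+ 2) = det x y ^+ 2 + dot x y ^+ 2.
        by rewrite dt dxy expr0n /= addr0 ltxx.
      by rewrite /det /dot; ring.
    exists l => //; case: E => E1 E2; rewrite !mulNr -E1 -E2 !opprK; exact: surjective_pairing.
  have E : det y z = l * det z x by rewrite yE /det /=; ring.
  rewrite E -mulrA pmulr_rgt0 // -expr2 exprn_even_gt0 //=.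
  apply/eqP => dzx; move: nyz nzx; rewrite E dzx mulr0 eqxx /= => nyz nzx.
  have E2 : dot y z = - l * dot z x by rewrite yE /dot /=; ring.
  have dt : dot z x = 0.
    apply/eqP; rewrite eq_le; apply/andP; split; first by rewrite leNgt.
    by move: nyz; rewrite E2 -leNgt; nra.
  have := mulr_gt0 z0 x0.
  suff -> : (z.1 ^+ 2 + z.2 ^+ 2) * (x.1 ^+ 2 + x.2 ^+ 2) = det z x ^+ 2 + dot z x ^+ 2.
    by rewrite dt dzx expr0n /= addr0 ltxx.
  by rewrite /det /dot; ring.
move=> u0 v0 w0 uv vw wu.
have h1 := zero u v w u0 v0 uv vw wu w0.
have h2 := zero v w u v0 w0 vw wu uv u0.
have h3 := zero w u v w0 u0 wu uv vw v0.
rewrite /ccw (dN u w) (dN w v) (dN v u) !oppr_gt0.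
move: h1 h2 h3; move: (det u v) (det v w) (det w u) => x y z.
have [x0|x0|<-] := ltgtP 0 x; have [y0|y0|<-] := ltgtP 0 y; have [z0|z0|<-] := ltgtP 0 z => //=;
  rewrite ?mulr0 ?mul0r ?ltxx; move=> h1 h2 h3;
  try (by have := h1 erefl); try (by have := h2 erefl); try (by have := h3 erefl).
all: exfalso; first [have {}h1 := h1 erefl; nra | have {}h2 := h2 erefl; nra | have {}h3 := h3 erefl; nra].
Qed.
End Nodes.

(** * The four quadrants of a crossing *)

Section Crossings.
Variables (R : realType) (D : diagram R).
Hypothesis dD : is_diagram D.
Implicit Types (e : edge D) (x y lo hi : node D) (d : dart D).

Let pp x := plane_proj x.

Lemma detN (u v : R * R) : det (- u) v = - det u v. Proof. by rewrite /det /=; ring. Qed.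

Lemma detC (u v : R * R) : det v u = - det u v. Proof. by rewrite /det; ring. Qed.

Lemma detZ (k : R) (u v : R * R) : det (k * u.1, k * u.2) v = k * det u v.
Proof. by rewrite /det /=; ring. Qed.

Lemma detZr (k : R) (u v : R * R) : det v (k * u.1, k * u.2) = k * det v u.
Proof. by rewrite /det /=; ring. Qed.

Lemma trivalent_vertex x : ~~ bivalent x -> exists a b c, vertex_at a b c /\
  ([/\ tgt a = x, tgt b = x & src c = x] \/ [/\ src a = x, src b = x & tgt c = x]).
Proof.
move=> nb; have [nu no] := nonbivalent_lone dD nb.
have i1 := indeg_gt0 dD x; have o1 := outdeg_gt0 dD x; have le := degree_le3 dD x.
have [i2|i2] := ltnP 1 (indeg x).
- move: i2; rewrite indegE => /fintype.card_gt1P[a [b []]]; rewrite !inE => /eqP ta /eqP tb ab.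
  set c := out_edge dD x; have sc : src c = x := out_edgeP dD x.
  have np1 : ~~ ((det (dir c) (- dir b) == 0) && (0 < dot (dir c) (- dir b))).
    by apply: (@not_parallel _ _ dD (c, true) (b, false)); rewrite ?xpair_eqE ?andbF // /dart_base /= ?ta ?tb ?sc.
  have np2 : ~~ ((det (- dir b) (- dir a) == 0) && (0 < dot (- dir b) (- dir a))).
    by apply: (@not_parallel _ _ dD (b, false) (a, false)); rewrite ?xpair_eqE ?andbT 1?(eq_sym b) // /dart_base /= ?ta ?tb ?sc.
  have np3 : ~~ ((det (- dir a) (dir c) == 0) && (0 < dot (- dir a) (dir c))).
    by apply: (@not_parallel _ _ dD (a, false) (c, true)); rewrite ?xpair_eqE ?andbF // /dart_base /= ?ta ?tb ?sc.
  have := ccw_total (dart_dir_gt0 dD (c, true)) (dart_dir_gt0 dD (b, false))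
     (dart_dir_gt0 dD (a, false)) np1 np2 np3.
  case/orP => cc.
    by exists a, b, c; split; [rewrite /vertex_at ab ta tb sc !eqxx cc|left].
  by exists b, a, c; split; [rewrite /vertex_at eq_sym ab ta tb sc !eqxx cc|left].
- have o2 : (1 < outdeg x)%N.
    by move: nb; rewrite /bivalent eqn_leq i2 i1 /= eqn_leq o1 andbT -ltnNge.
  move: o2; rewrite outdegE => /fintype.card_gt1P[a [b []]]; rewrite !inE => /eqP sa /eqP sb ab.
  set c := in_edge dD x; have tc : tgt c = x := in_edgeP dD x.
  have np1 : ~~ ((det (- dir c) (dir a) == 0) && (0 < dot (- dir c) (dir a))).
    by apply: (@not_parallel _ _ dD (c, false) (a, true)); rewrite ?xpair_eqE ?andbF // /dart_base /= ?sa ?sb ?tc.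
  have np2 : ~~ ((det (dir a) (dir b) == 0) && (0 < dot (dir a) (dir b))).
    by apply: (@not_parallel _ _ dD (a, true) (b, true)); rewrite ?xpair_eqE ?andbT // /dart_base /= ?sa ?sb ?tc.
  have np3 : ~~ ((det (dir b) (- dir c) == 0) && (0 < dot (dir b) (- dir c))).
    by apply: (@not_parallel _ _ dD (b, true) (c, false)); rewrite ?xpair_eqE ?andbF // /dart_base /= ?sa ?sb ?tc.
  have := ccw_total (dart_dir_gt0 dD (c, false)) (dart_dir_gt0 dD (a, true))
     (dart_dir_gt0 dD (b, true)) np1 np2 np3.
  case/orP => cc.
    by exists a, b, c; split; [rewrite /vertex_at ab sa sb tc !eqxx cc !orbT|right].
  by exists b, a, c; split; [rewrite /vertex_at eq_sym ab sa sb tc !eqxx cc !orbT|right].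
Qed.

Section At.
Variables lo hi : node D.
Hypothesis cr : crossing lo hi.
Let w := out_edge dD lo.
Let u := in_edge dD lo.
Let vo := out_edge dD hi.
Let vi := in_edge dD hi.
Let c := pp lo.
Let s : bool := 0 < det (dir vi) (dir u).

Lemma crossing_pp : pp hi = c.
Proof. by case/andP: cr => /eqP. Qed.

Lemma crossing_neq : lo <> hi.
Proof. by move=> E; case/andP: cr; rewrite E ltxx. Qed.

Lemma crossing_dirs :
  [/\ exists2 l : R, 0 < l & dir vo = (l * (dir vi).1, l * (dir vi).2),
      exists2 l : R, 0 < l & dir w = (l * (dir u).1, l * (dir u).2) &
      det (dir vi) (dir u) != 0].
Proof.
have [_ _ _ _ h] := dD.
have [_ _ _ /(_ u w vi (in_edgeP dD lo) (out_edgeP dD lo) (in_edgeP dD hi))[h1 h2 h3]] :=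
  h lo hi crossing_neq (esym crossing_pp).
have [_ _ _ /(_ vi vo u (in_edgeP dD hi) (out_edgeP dD hi) (in_edgeP dD lo))[h4 h5 h6]] :=
  h hi lo (nesym crossing_neq) crossing_pp.
split; [exact: pos_multiple (dir_sqr_gt0 dD vi) h4 h5|
        exact: pos_multiple (dir_sqr_gt0 dD u) h1 h2|exact/eqP].
Qed.

Lemma crossing_nodes x : pp x = c -> x = lo \/ x = hi.
Proof.
move=> E; have [_ _ _ h _] := dD.
by case: (h x lo hi E (esym crossing_pp)); [left|move/crossing_neq|right].
Qed.

Lemma crossing_darts d : pp (dart_base d) = c ->
  (exists k : R, dart_dir d = (k * (dir vi).1, k * (dir vi).2)) \/
  (exists k : R, dart_dir d = (k * (dir u).1, k * (dir u).2)).
Proof.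
have [blo bhi] := crossing_bivalent dD cr; have [[l _ E1] [l' _ E2] _] := crossing_dirs.
have id1 (z : R * R) : z = (1 * z.1, 1 * z.2) by rewrite !mul1r -surjective_pairing.
have idN (z : R * R) : - z = (-1 * z.1, -1 * z.2) by rewrite !mulN1r [LHS]surjective_pairing.
move=> /crossing_nodes; rewrite /dart_base /dart_dir; case: d => e [] /= [] E.
- by right; rewrite (bivalent_out dD blo E) -/w E2; exists l'.
- by left; rewrite (bivalent_out dD bhi E) -/vo E1; exists l.
- by right; rewrite (bivalent_in dD blo E) -/u; exists (-1).
- by left; rewrite (bivalent_in dD bhi E) -/vi; exists (-1).
Qed.

Lemma crossing_near : exists2 r : R, 0 < r & forall q, within r c q ->
  det (dir vi) (q - c) != 0 -> det (dir u) (q - c) != 0 -> ~ shadow D q.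
Proof.
have [r r0 hr] := dart_near dD lo; exists r => // q wq n1 n2 /(hr q wq)[d [k [dc _ E1 E2]]].
have qc : q - c = (k * (dart_dir d).1, k * (dart_dir d).2).
  by rewrite [q]surjective_pairing E1 E2 /=; congr pair => /=; rewrite /c /pp; ring.
have d0 (z : R * R) : det z z = 0 by rewrite /det; ring.
case: (crossing_darts dc) => -[k' E]; move: n1 n2; rewrite qc !detZr E !detZr !d0 !mulr0 eqxx //.
Qed.

Section Val.
Variables (S : Type) (beta : R * R -> S).
Hypothesis lb : loc_const_off_shadow D beta.
Local Notation lv d := (beta (left_point dD d)).

Lemma crossing_side d (b : bool) (v : R * R) (A : set (R * R)) :
  pp (dart_base d) = c -> nbhs c A -> det v (dart_dir d) != 0 ->
  exists q, [/\ A q, beta q = lv (d.1, b), 0 < det (dart_dir (d.1, b)) (q - c),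
    det v (q - c) != 0 & (0 < det v (q - c)) = (0 < det v (dart_dir d))].
Proof.
move=> dc nA vn; have nA' : nbhs (pp (dart_base d)) A by rewrite dc.
have [q [h1 h2 h3 h4 h5]] := @dart_side_point _ _ dD d (d.1, b) v S beta _ A erefl nA'
   (left_pointP dD (d.1, b) lb).
rewrite -/(pp _) dc in h3 h4 h5.
have h6 : det v (dart_dir d) < 0 -> det v (q - c) < 0.
  by rewrite (detC (dart_dir d) v) (detC (q - c) v) !oppr_lt0.
exists q; split => //; move: vn; rewrite neq_lt => /orP[vn|vn].
- by rewrite lt_eqF ?h6.
- by rewrite gt_eqF ?h5.
- by rewrite !ltNge (ltW vn) (ltW (h6 vn)).
- by rewrite vn h5.
Qed.

(** The first argument of [H] tells whether the quadrant is on the left of the over strand, the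
    second whether it is on the left of the under strand. Both strands are straight at the crossing,
    so near it the quadrants are convex and free of shadow. *)
Lemma crossing_quadrants : exists H : bool -> bool -> S,
  (\forall q \near c, det (dir vi) (q - c) != 0 -> det (dir u) (q - c) != 0 ->
     beta q = H (0 < det (dir vi) (q - c)) (0 < det (dir u) (q - c))) /\
  (forall b, [/\ lv (vo, b) = H b (~~ s), lv (vi, b) = H b s,
                 lv (w, b) = H s b & lv (u, b) = H (~~ s) b]).
Proof.
have [r r0 hr] := crossing_near.
pose P q := det (dir vi) (q - c) != 0 /\ det (dir u) (q - c) != 0.
pose sg b (z : R * R) := if b then z else - z.
have sgP b z q : det z q != 0 -> (0 < det z q) = b -> 0 < det (sg b z) q.
  case: b => /= n0 h; rewrite ?h // detN oppr_gt0 lt_neqAle n0 leNgt h //.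
have sgP' b z q : 0 < det (sg b z) q -> det z q != 0 /\ (0 < det z q) = b.
  case: b => /= h; first by rewrite gt_eqF ?h.
  by move: h; rewrite detN oppr_gt0 => h; rewrite lt_eqF // ltNge (ltW h).
have /choice [H' hH'] (z : bool * bool) : exists v, forall q, within r c q ->
    0 < det (sg z.1 (dir vi)) (q - c) -> 0 < det (sg z.2 (dir u)) (q - c) -> beta q = v.
  pose C : set (R * R) := [set q | within r c q /\
    (0 < det (sg z.1 (dir vi)) (q - c) /\ 0 < det (sg z.2 (dir u)) (q - c))].
  have [[q0 Cq0]|nC] := pselect (exists q, C q); last first.
    by exists (beta c) => q h1 h2 h3; case: nC; exists q.
  exists (beta q0) => q h1 h2 h3.
  apply: (@loc_const_convex R (R * R)%type S C) => //.
  - move=> a b t [[a1 a2] [a3 a4]] [[b1 b2] [b3 b4]] t01.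
    split; first by split; exact: cvx_dist.
    by rewrite !det_cvx; split; apply: cvx_gt0.
  - move=> a [a1 [/sgP'[a2 _] /sgP'[a3 _]]]; have := lb (hr a a1 a2 a3); exact: filterS.
have hH q : within r c q -> P q ->
    beta q = H' (0 < det (dir vi) (q - c), 0 < det (dir u) (q - c)).
  by move=> wq [p1 p2]; apply: hH' => //=; apply: sgP.
have nw : nbhs c (within r c) by apply/near2P; exists r.
exists (fun b b' => H' (b, b')); split.
  by move: nw; apply: filterS => q wq p1 p2; apply: hH.
have [[l l0 E1] [l' l'0 E2] dn] := crossing_dirs.
have dn' : det (dir u) (dir vi) != 0 by rewrite detC oppr_eq0.
have sE : (0 < det (dir u) (dir vi)) = ~~ s.
  by rewrite detC oppr_gt0 /s -leNgt le_eqVlt (negPf dn).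
have sE' : (0 < - det (dir u) (dir vi)) = s.
  by rewrite -detC.
have sE'' : (0 < - det (dir vi) (dir u)) = ~~ s by rewrite -detC.
have dirb (e : edge D) b q : 0 < det (dart_dir (e, b)) q -> det (dir e) q != 0 /\ (0 < det (dir e) q) = b.
  exact: (sgP' b (dir e) q).
have dNr (y z : R * R) : det y (- z) = - det y z by rewrite /det /=; ring.
move=> b; split.
- have [||q [q1 <- /dirb[q3 q3'] q4 q5]] := @crossing_side (vo, true) b (dir u) _ _ nw.
  + by rewrite /dart_base /= out_edgeP crossing_pp.
  + by rewrite /dart_dir /= E1 detZr mulf_neq0 // gt_eqF.
  move: q3 q3' q5; rewrite /dart_dir /= E1 detZ detZr !pmulr_rgt0 // mulf_eq0 negb_or.
  by move=> /andP[_ q3] q3' q5; rewrite (hH q) // q3' q5 sE.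
- have [||q [q1 <- /dirb[q3 q3'] q4 q5]] := @crossing_side (vi, false) b (dir u) _ _ nw.
  + by rewrite /dart_base /= in_edgeP crossing_pp.
  + by rewrite /dart_dir /= dNr oppr_eq0.
  move: q5; rewrite /dart_dir /= dNr sE' => q5.
  by rewrite (hH q) // q3' q5.
- have [||q [q1 <- /dirb[q3 q3'] q4 q5]] := @crossing_side (w, true) b (dir vi) _ _ nw.
  + by rewrite /dart_base /= out_edgeP.
  + by rewrite /dart_dir /= E2 detZr mulf_neq0 // gt_eqF.
  move: q3 q3' q5; rewrite /dart_dir /= E2 detZ detZr !pmulr_rgt0 // mulf_eq0 negb_or.
  by move=> /andP[_ q3] q3' q5; rewrite (hH q) // q3' q5.
- have [||q [q1 <- /dirb[q3 q3'] q4 q5]] := @crossing_side (u, false) b (dir vi) _ _ nw.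
  + by rewrite /dart_base /= in_edgeP.
  + by rewrite /dart_dir /= dNr oppr_eq0.
  move: q5; rewrite /dart_dir /= dNr sE'' => q5.
  by rewrite (hH q) // q3' q5.
Qed.
End Val.
End At.
End Crossings.

(** Ordinary flows are twisted flows for the trivial action. Transfer and rigidity are thus applied
    at two levels: to phi itself, and to the flows twisted by phi. *)
Definition trivial_twisting (A B : zmodType) : twisting A B.
Proof. by exists (fun=> id). Defined.

(** * Flows and local systems on the complement *)

Section TwistedFlows.
Variables (R : realType) (D : diagram R).
Hypothesis dD : is_diagram D.
Implicit Types (e : edge D) (x y lo hi : node D) (d : dart D).
Let pp x := plane_proj x.

Definition over_node x := odflt x [pick y | crossing x y].
Definition under_node y := odflt y [pick x | crossing x y].

Lemma crossing_over_unique lo hi hi' : crossing lo hi -> crossing lo hi' -> hi = hi'.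
Proof.
move=> c1 c2; have [_ _ _ h _] := dD.
case: (h lo hi hi' (esym (crossing_pp c1)) _); first by rewrite (crossing_pp c1) (crossing_pp c2).
- by move/(crossing_neq c1).
- by [].
- by move/(crossing_neq c2).
Qed.

Lemma crossing_under_unique lo lo' hi : crossing lo hi -> crossing lo' hi -> lo = lo'.
Proof.
move=> c1 c2; have [_ _ _ h _] := dD.
case: (h lo hi lo' (esym (crossing_pp c1)) (crossing_pp c2)).
- by move/(crossing_neq c1).
- by move/esym/(crossing_neq c2).
- by [].
Qed.

Lemma over_nodeP x : under x -> crossing x (over_node x).
Proof. by case/existsP => y xy; rewrite /over_node; case: pickP => [//|/(_ y)]; rewrite xy. Qed.

Lemma under_nodeP x : over x -> crossing (under_node x) x.
Proof. by case/existsP => y xy; rewrite /under_node; case: pickP => [//|/(_ y)]; rewrite xy. Qed.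

Lemma over_nodeE lo hi : crossing lo hi -> over_node lo = hi.
Proof. by move=> c; apply: (crossing_over_unique (over_nodeP _) c); apply/existsP; exists hi. Qed.

Lemma under_nodeE lo hi : crossing lo hi -> under_node hi = lo.
Proof. by move=> c; apply: (crossing_under_unique (under_nodeP _) c); apply/existsP; exists lo. Qed.

Lemma not_under_over x : under x -> ~~ over x.
Proof.
case/existsP => z xz; apply/negP => /existsP[y yx]; have [_ _ _ h _] := dD.
case: (h y x z (esym (crossing_pp yx)) (esym (crossing_pp xz))).
- by move/(crossing_neq yx).
- by move/(crossing_neq xz).
- move=> E; subst z; case/andP: yx => _ l1; case/andP: xz => _ l2.
  by have := lt_trans l1 l2; rewrite ltxx.
Qed.

Lemma sum_over (B : zmodType) (F : node D -> B) :
  \sum_(y | over y) F y = \sum_(x | under x) F (over_node x).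
Proof.
rewrite (reindex_onto over_node under_node) => [|y /under_nodeP /over_nodeE //].
apply: eq_bigl => x; apply/idP/idP.
  move=> /andP[ov /eqP E]; have := under_nodeP ov; rewrite E => c.
  by apply/existsP; exists (over_node x).
move=> ux; have c := over_nodeP ux; rewrite (under_nodeE c) eqxx andbT.
by apply/existsP; exists x.
Qed.

Lemma sum_nodes (B : zmodType) (F : node D -> B) :
  (forall x, ~~ under x -> ~~ over x -> F x = 0) ->
  \sum_x F x = \sum_(x | under x) (F x + F (over_node x)).
Proof.
move=> F0; rewrite big_split /= -sum_over (bigID (@under R D)) /=; congr (_ + _).
rewrite (bigID (@over R D)) /= [X in _ + X]big1 ?addr0; last first.
  by move=> x /andP[nu no]; apply: F0.
apply: eq_bigl => x; apply: andb_idl => ov; apply: contraL ov; exact: not_under_over.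
Qed.

Section Twisted.
Variables (A B : zmodType) (tw : twisting A B).
Implicit Types (phi : edge D -> A) (nu : edge D -> B).

(** The change of the Alexander numbering along the under strand as it passes the over strand
    ([over_shiftE]); this explains the sign. *)
Definition over_shift phi lo hi : A :=
  if 0 < det (dir (in_edge dD hi)) (dir (in_edge dD lo))
  then phi (in_edge dD hi) else - phi (in_edge dD hi).

Definition conserved_at nu :=
  (forall x, ~~ under x -> ~~ over x ->
    \sum_(e | src e == x) nu e = \sum_(e | tgt e == x) nu e) /\
  (forall lo hi, crossing lo hi ->
    nu (out_edge dD lo) + nu (out_edge dD hi) = nu (in_edge dD lo) + nu (in_edge dD hi)).

(* The classes of 1-cocycles of the complement with values in the twisted
   coefficients, through the Wirtinger presentation read from below. *)
Definition twisted_flow phi nu := conserved_at nu /\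
  forall lo hi, crossing lo hi ->
    nu (out_edge dD lo) = tw (over_shift phi lo hi) (nu (in_edge dD lo)).

Lemma sum_src_bivalent nu x : bivalent x -> \sum_(e | src e == x) nu e = nu (out_edge dD x).
Proof.
move=> bx; rewrite (big_pred1 (out_edge dD x)) // => e; apply/eqP/eqP => [E|->].
  exact: bivalent_out.
exact: out_edgeP.
Qed.

Lemma sum_tgt_bivalent nu x : bivalent x -> \sum_(e | tgt e == x) nu e = nu (in_edge dD x).
Proof.
move=> bx; rewrite (big_pred1 (in_edge dD x)) // => e; apply/eqP/eqP => [E|->].
  exact: bivalent_in.
exact: in_edgeP.
Qed.

Lemma conserved_planar nu : conserved_at nu -> planar_conserved nu.
Proof.
move=> [c1 c2] g.
have E : \sum_e nu e *~ (g (pp (src e)) - g (pp (tgt e))) =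
    \sum_x (\sum_(e | src e == x) nu e - \sum_(e | tgt e == x) nu e) *~ g (pp x).
  under eq_bigr do rewrite mulrzBr; rewrite sumrB.
  under [RHS]eq_bigr do rewrite mulrzBl; rewrite sumrB.
  congr (_ - _).
    rewrite (partition_big (@src R D) predT) //=; apply: eq_bigr => x _.
    rewrite mulrz_suml; apply: eq_bigr => e /eqP ->; by [].
  rewrite (partition_big (@tgt R D) predT) //=; apply: eq_bigr => x _.
  by rewrite mulrz_suml; apply: eq_bigr => e /eqP ->.
rewrite -/(pp _) E sum_nodes; last by move=> x nu0 no; rewrite c1 // subrr mul0rz.
apply: big1 => x /over_nodeP cr; have [bl bh] := crossing_bivalent dD cr.
rewrite !sum_src_bivalent // !sum_tgt_bivalent // /pp (crossing_pp cr) -mulrzDl.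
by rewrite addrACA (c2 _ _ cr) -opprD subrr mul0rz.
Qed.

Definition jump (beta : R * R -> B) e :=
  beta (left_point dD (e, true)) - beta (left_point dD (e, false)).

Lemma vertex_in_sums nu a b c : a != b -> tgt a = src c -> tgt b = src c ->
  \sum_(e | src e == src c) nu e = nu c /\ \sum_(e | tgt e == src c) nu e = nu a + nu b.
Proof.
move=> ne ta tb; have [h1 h2 h3] := vertex_in_edges dD ne ta tb; split.
  by rewrite (big_pred1 c) // => e; apply/eqP/eqP => [/h2|->].
rewrite (bigD1 a) ?ta //=; congr (_ + _); rewrite (big_pred1 b) // => e /=.
apply/andP/eqP => [[/eqP /h1[->|->]]|->]; rewrite ?eqxx // tb eqxx eq_sym ne //.
Qed.

Lemma vertex_out_sums nu a b c : a != b -> tgt c = src a -> tgt c = src b ->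
  \sum_(e | tgt e == tgt c) nu e = nu c /\ \sum_(e | src e == tgt c) nu e = nu a + nu b.
Proof.
move=> ne ta tb; have [h1 h2 h3] := vertex_out_edges dD ne ta tb; split.
  by rewrite (big_pred1 c) // => e; apply/eqP/eqP => [/h2|->].
rewrite (bigD1 a) -?ta //=; congr (_ + _); rewrite (big_pred1 b) // => e /=.
apply/andP/eqP => [[/eqP /h1[->|->]]|->]; rewrite ?eqxx // -tb eqxx eq_sym ne //.
Qed.

(** The jumps met on a small circle around a planar point add up to zero, because the circle returns
    to the region where it started. *)
Lemma jump_conserved beta : loc_const_off_shadow D beta -> conserved_at (jump beta).
Proof.
move=> lb; split=> [x nu no|lo hi cr].
  have [bx|nb] := boolP (bivalent x).
    rewrite sum_src_bivalent // sum_tgt_bivalent // /jump.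
    by rewrite (@bivalent_values _ _ dD _ _ lb x true) ?(@bivalent_values _ _ dD _ _ lb x false).
  have [a [b [c [vc h]]]] := trivalent_vertex dD nb; have [e1 e2 e3] := vertex_values dD lb vc.
  have E : jump beta c = jump beta a + jump beta b.
    by rewrite /jump e3 e2 -e1 [RHS]addrC [RHS]addrA subrK.
  have ne : a != b by case/andP: vc.
  case: h => -[h1 h2 h3]; rewrite -h3.
    have [|| -> ->] := @vertex_in_sums (jump beta) a b c ne; rewrite ?h1 ?h2 ?h3 //.
  have [|| -> ->] := @vertex_out_sums (jump beta) a b c ne; rewrite ?h1 ?h2 ?h3 //.
have [H [_ hH]] := crossing_quadrants dD cr lb.
have [t1 t2 t3 t4] := hH true; have [f1 f2 f3 f4] := hH false.
rewrite /jump t1 t2 t3 t4 f1 f2 f3 f4.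
case: (0 < det _ _) => /=; move: (H true true) (H true false) (H false true) (H false false) => p q r s.
  by rewrite [RHS]addrC !addrA !subrK.
by rewrite [LHS]addrC !addrA !subrK.
Qed.

(* For a function h with values in a group the relation says that the small
   loop around the segment between the two strands of a crossing is trivial. *)
Definition crossing_relation (G : groupType) (h : R * R -> G) :=
  forall lo hi, crossing lo hi ->
  let lv e b := h (left_point dD (e, b)) in
  ((lv (out_edge dD lo) true)^-1 * lv (out_edge dD lo) false =
   (lv (in_edge dD lo) true)^-1 * lv (in_edge dD lo) false)%g.

Lemma over_shiftE (psi : R * R -> A) phi lo hi : crossing lo hi ->
  loc_const_off_shadow D psi ->
  (forall e, psi (left_point dD (e, true)) - psi (left_point dD (e, false)) = phi e) ->
  phi (out_edge dD lo) = phi (in_edge dD lo) ->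
  psi (left_point dD (out_edge dD lo, true)) - psi (left_point dD (in_edge dD lo, true)) =
  over_shift phi lo hi.
Proof.
move=> cr lb jp Ew; have [H [_ hH]] := crossing_quadrants dD cr lb.
have [t1 t2 t3 t4] := hH true; have [f1 f2 f3 f4] := hH false.
move: Ew; rewrite /over_shift -!jp t2 t3 t4 f2 f3 f4; case: (0 < det _ _) => //= E.
have -> : H false true = H true true - H true false + H false false.
  by rewrite -E subrK.
by rewrite opprB [LHS]addrC !addrA addNr add0r addrC.
Qed.

(** The first component of the relation is the constancy of phi along the under strand. In the
    second component, moving the jump of the incoming under edge to the outgoing one costs the
    action of the difference of the potentials, which is [over_shift]. *)
Lemma crossing_relationE (psi : R * R -> A) (beta : R * R -> B) phi :
  loc_const_off_shadow D psi -> (forall e, psi (left_point dD (e, true)) - psi (left_point dD (e, false)) = phi e) ->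
  (forall lo hi, crossing lo hi -> phi (out_edge dD lo) = phi (in_edge dD lo)) ->
  crossing_relation (fun q => (psi q, beta q) : semidirect tw) <->
  (forall lo hi, crossing lo hi ->
    jump beta (out_edge dD lo) = tw (over_shift phi lo hi) (jump beta (in_edge dD lo))).
Proof.
move=> lb jp Ew.
have key (p q r s : A) (a b c d : B) : p - q = r - s ->
  (((p, a) : semidirect tw)^-1 * ((q, b) : semidirect tw) =
   ((r, c) : semidirect tw)^-1 * ((s, d) : semidirect tw))%g <->
  a - b = tw (p - r) (c - d).
  move=> E; rewrite !sd_mulE !sd_invE /=.
  have -> : - p + q = - r + s by rewrite -[LHS]opprK opprD opprK E opprB addrC.
  have e1 (z : A) (x y : B) : - tw (- z) x + tw (- z) y = - tw (- z) (x - y).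
    by rewrite actB opprB addrC.
  rewrite !e1; split=> [[/oppr_inj E2]|E2].
    by rewrite actD -E2 actVK.
  by rewrite E2 addrC actD actK.
split=> h lo hi cr.
- have /key := h lo hi cr; rewrite !jp => /(_ (Ew _ _ cr)).
  by rewrite (over_shiftE cr lb jp (Ew _ _ cr)).
- apply/key; first by rewrite !jp; exact: Ew cr.
  by rewrite (over_shiftE cr lb jp (Ew _ _ cr)); exact: h.
Qed.

Lemma crossing_over_flow nu lo hi : conserved_at nu -> crossing lo hi ->
  nu (out_edge dD lo) = nu (in_edge dD lo) -> nu (out_edge dD hi) = nu (in_edge dD hi).
Proof. by move=> [_ h] cr E; have := h lo hi cr; rewrite E => /addrI. Qed.
End Twisted.
End TwistedFlows.

(** * Points below and above the graph *)

Section Space.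
Variable R : realType.
Local Notation R3 := (R * R * R)%type.
Implicit Types (x y : R3).

Definition within3 (r : R) x y :=
  [/\ `|y.1.1 - x.1.1| < r, `|y.1.2 - x.1.2| < r & `|y.2 - x.2| < r].

Lemma near3P (x : R3) (P : R3 -> Prop) :
  (\forall y \near x, P y) <-> exists2 r : R, 0 < r & forall y, within3 r x y -> P y.
Proof.
split=> [/nbhs_ballP[r /= r0 h]|[r r0 h]].
  by exists r => // y [h1 h2 h3]; apply: h; split; [split|]; rewrite /ball /= distrC.
apply/nbhs_ballP; exists r => //= y [[/= h1 h2] h3].
by apply: h; split; rewrite distrC.
Qed.

Lemma within3_cvx r x y z (t : R) : 0 <= t <= 1 -> within3 r x y -> within3 r x z ->
  within3 r x (y + t *: (z - y)).
Proof. by move=> t01 [a1 a2 a3] [b1 b2 b3]; split => /=; exact: cvx_dist. Qed.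

Lemma near_fst (p : R3) (P : R * R -> Prop) :
  (\forall q \near p.1, P q) -> \forall y \near p, P y.1.
Proof. by apply: near_comp; apply: cont_fst; exact: cont_id. Qed.

Lemma near_snd (p : R3) (P : R -> Prop) :
  (\forall q \near p.2, P q) -> \forall y \near p, P y.2.
Proof. by apply: near_comp; apply: cont_snd; exact: cont_id. Qed.
End Space.

Section Sides.
Variables (R : realType) (D : diagram R).
Hypothesis dD : is_diagram D.
Local Notation R3 := (R * R * R)%type.
Implicit Types (e : edge D) (x y : R3) (q c : R * R).
Let pp := @plane_proj R D.

Lemma edge_pointE e k : edge_point e k =
  (((pp (src e)).1 + k * (dir e).1, (pp (src e)).2 + k * (dir e).2),
   height (src e) + k * (height (tgt e) - height (src e))).
Proof. by []. Qed.

Lemma edge_cont e k : continuous_at (@edge_point R D e) k.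
Proof. by rewrite /edge_point /=; ctn. Qed.

(* [side 1] and [side (-1)] consist of the points below, resp. above, which
   there is no point of the graph. *)
Definition side (sg : R) : set R3 := [set x | forall e k, 0 <= k <= 1 ->
  (edge_point e k).1 = x.1 -> 0 < sg * ((edge_point e k).2 - x.2)].

Lemma edge_pos (g : edge D -> R -> R) : (forall e k, continuous_at (g e) k) ->
  (forall e k, 0 <= k <= 1 -> 0 < g e k) ->
  exists2 r : R, 0 < r & forall e k, 0 <= k <= 1 -> r <= g e k.
Proof.
move=> gc gp.
have /choice [r hr] e : exists r : R, 0 < r /\ forall k, 0 <= k <= 1 -> r <= g e k.
  by have [r r0 h] := compact_pos (gc e) (gp e); exists r.
have [r0 r00 h] := finite_pos (fun e => (hr e).1).
by exists r0 => // e k k01; apply: le_trans (h e) ((hr e).2 k k01).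
Qed.

Lemma pair_neq_max q c : q <> c -> 0 < Num.max `|q.1 - c.1| `|q.2 - c.2|.
Proof.
move=> ne; rewrite lt_max !normr_gt0 !subr_eq0 -negb_and; apply/negP => /andP[/eqP h1 /eqP h2].
by apply: ne; rewrite [q]surjective_pairing h1 h2 -surjective_pairing.
Qed.

Lemma side_open sg x : sg ^+ 2 = 1 -> side sg x -> \forall y \near x, side sg y.
Proof.
move=> sg1 sx.
have [e k|e k k01|r r0 hr] := @edge_pos (fun e k => Num.max
    (Num.max `|(edge_point e k).1.1 - x.1.1| `|(edge_point e k).1.2 - x.1.2|)
    (sg * ((edge_point e k).2 - x.2))).
- by rewrite /edge_point /=; ctn.
- have [E|/pair_neq_max h] := pselect ((edge_point e k).1 = x.1); rewrite lt_max ?h //.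
  by rewrite sx ?orbT.
apply/near3P; exists (r / 2); first lra.
move=> y [h1 h2 h3] e k k01 E; have := hr e k k01; rewrite E.
have nsg : `|sg| = 1 by apply/eqP; rewrite -sqrp_eq1 // -normrX sg1 normr1.
have : `|sg * (y.2 - x.2)| < r / 2 by rewrite normrM nsg mul1r.
rewrite le_max le_max => /ltr_normlP[h4 h5] /orP[/orP[]|]; [lra|lra|].
have -> : sg * ((edge_point e k).2 - y.2) =
  sg * ((edge_point e k).2 - x.2) - sg * (y.2 - x.2) by ring.
lra.
Qed.

Lemma graph_open x : ~ graph_support D x -> \forall y \near x, ~ graph_support D y.
Proof.
move=> nx.
have [e k|e k k01|r r0 hr] := @edge_pos (fun e k => Num.max
    (Num.max `|(edge_point e k).1.1 - x.1.1| `|(edge_point e k).1.2 - x.1.2|)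
    `|(edge_point e k).2 - x.2|).
- by rewrite /edge_point /=; ctn.
- have [E|/pair_neq_max h] := pselect ((edge_point e k).1 = x.1); rewrite lt_max ?h //.
  apply/orP; right; rewrite normr_gt0 subr_eq0; apply/eqP => E2; apply: nx.
  by exists e, k; split => //; rewrite [x]surjective_pairing -E -E2 -surjective_pairing.
apply/near3P; exists r => // y [h1 h2 h3] [e [k [k01 E]]].
by have := hr e k k01; rewrite -E !le_max => /orP[/orP[]|]; lra.
Qed.

Lemma side_not_graph sg x : side sg x -> ~ graph_support D x.
Proof. by move=> sx [e [k [k01 E]]]; have := sx e k k01; rewrite E subrr mulr0 ltxx => /(_ erefl). Qed.

Lemma sides_not_shadow x : side 1 x -> side (-1) x -> ~ shadow D x.1.
Proof.
move=> s1 s2 [e [k [k01 E]]]; have := s1 e k k01 (esym E); have := s2 e k k01 (esym E).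
lra.
Qed.

Lemma not_shadow_side sg x : ~ shadow D x.1 -> side sg x.
Proof. by move=> ns e k k01 E; case: ns; exists e, k. Qed.

Lemma edge_node_or_interior e k : 0 <= k <= 1 ->
  0 < k < 1 \/ exists n : node D, edge_point e k = pos n.
Proof.
move=> /andP[k0 k1]; have [->|n0] := eqVneq k 0.
  right; exists (src e); rewrite /edge_point !mul0r !addr0.
  by case: (pos (src e)) => -[].
have [->|n1] := eqVneq k 1.
  right; exists (tgt e); rewrite /edge_point !mul1r !(addrC _ (_ - _)) !subrK.
  by case: (pos (tgt e)) => -[].
by left; rewrite lt_neqAle eq_sym n0 k0 lt_neqAle n1 k1.
Qed.

(** A point on neither side has a graph point below it and another one above it. These have the same
    projection, so they are the two nodes of a crossing. *)
Lemma side_cases x : ~ graph_support D x -> [\/ side 1 x, side (-1) x |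
  exists lo hi : node D, [/\ crossing lo hi, pp lo = x.1 & height lo < x.2 < height hi]].
Proof.
move=> nx; have [s1|ns1] := pselect (side 1 x); first by constructor 1.
have [s2|ns2] := pselect (side (-1) x); first by constructor 2.
constructor 3.
have [e [k [k01 E le]]] : exists e k, [/\ 0 <= k <= 1, (edge_point e k).1 = x.1 & (edge_point e k).2 < x.2].
  apply: contrapT => h; apply: ns1 => e k k01 E; rewrite mul1r subr_gt0 ltNge; apply/negP => le.
  have [lt|ge] := ltP (edge_point e k).2 x.2; first by apply: h; exists e, k.
  apply: nx; exists e, k; split => //; rewrite [x]surjective_pairing -E.
  by rewrite (_ : x.2 = (edge_point e k).2) -?surjective_pairing //; apply/eqP; rewrite eq_le le ge.
have [e' [k' [k'01 E' ge]]] : exists e k, [/\ 0 <= k <= 1, (edge_point e k).1 = x.1 & x.2 < (edge_point e k).2].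
  apply: contrapT => h; apply: ns2 => e1 k1 k101 E1; rewrite mulN1r opprB subr_gt0 ltNge; apply/negP => le1.
  have [lt|ge1] := ltP x.2 (edge_point e1 k1).2; first by apply: h; exists e1, k1.
  apply: nx; exists e1, k1; split => //; rewrite [x]surjective_pairing -E1.
  by rewrite (_ : x.2 = (edge_point e1 k1).2) -?surjective_pairing //; apply/eqP; rewrite eq_le le1 ge1.
have EE : (edge_point e k).1 = (edge_point e' k').1 by rewrite E E'.
have ne : ~ (e = e' /\ k = k') by case=> h1 h2; move: le ge; rewrite h1 h2 => l1 /(lt_trans l1); rewrite ltxx.
have [ki|[n nE]] := edge_node_or_interior e k01.
  have ee := ep_interior_unique dD ki k'01 EE; case: ne; split => //.
  by apply: (ep_inj dD (e := e')); rewrite -EE ee.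
have [ki|[n' nE']] := edge_node_or_interior e' k'01.
  have ee := ep_interior_unique dD ki k01 (esym EE); case: ne; split => //.
  by apply: (ep_inj dD (e := e')); rewrite -EE ee.
exists n, n'; rewrite /crossing /pp /plane_proj /height -nE -nE' EE eqxx le ge; split => //.
exact: lt_trans le ge.
Qed.

Lemma graph_bound : exists2 M : R, 0 < M & forall e k, 0 <= k <= 1 ->
  [/\ `|(edge_point e k).1.1| < M, `|(edge_point e k).1.2| < M & `|(edge_point e k).2| < M].
Proof.
have [e k|e k k01|r r0 hr] := @edge_pos (fun e k => (1 + Num.max (Num.max `|(edge_point e k).1.1| `|(edge_point e k).1.2|) `|(edge_point e k).2|)^-1).
- apply: cont_inv; last by rewrite /edge_point /=; ctn.
  by rewrite gt_eqF // ltr_wpDr // !le_max !normr_ge0.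
- by rewrite invr_gt0 ltr_wpDr // !le_max !normr_ge0.
exists (r^-1); first by rewrite invr_gt0.
move=> e k k01; have := hr e k k01; set m := Num.max _ _ => h.
have m0 : 0 <= m by rewrite /m !le_max normr_ge0.
have {}h : 1 + m <= r^-1.
  by rewrite -[X in X <= _]invrK lef_pV2 ?posrE ?invr_gt0 //; lra.
have : `|(edge_point e k).1.1| <= m by rewrite /m !le_max lexx.
have : `|(edge_point e k).1.2| <= m by rewrite /m !le_max lexx orbT.
have : `|(edge_point e k).2| <= m by rewrite /m !le_max lexx !orbT.
by split; lra.
Qed.

Definition gbound := s2val (cid2 graph_bound).
Lemma gbound_gt0 : 0 < gbound. Proof. by rewrite /gbound; case: cid2. Qed.

Lemma gboundP e k : 0 <= k <= 1 -> [/\ `|(edge_point e k).1.1| < gbound,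
  `|(edge_point e k).1.2| < gbound & `|(edge_point e k).2| < gbound].
Proof. by rewrite /gbound; case: cid2 => /= M M0; apply. Qed.

Lemma far_side sg x : sg ^+ 2 = 1 -> sg * x.2 <= - gbound -> side sg x.
Proof.
move=> sg1 h e k k01 E; have [_ _] := gboundP e k01; rewrite mulrBr subr_gt0 => hz.
have nsg : `|sg| = 1 by apply/eqP; rewrite -sqrp_eq1 // -normrX sg1 normr1.
apply: le_lt_trans h _; rewrite ltrNl.
by apply: le_lt_trans hz; rewrite -[X in _ <= X]mul1r -nsg -normrM -normrN ler_norm.
Qed.

Lemma side_push sg x (t : R) : sg ^+ 2 = 1 -> 0 <= t -> side sg x -> side sg (x.1, x.2 - sg * t).
Proof.
move=> sg1 t0 sx e k k01 E; have := sx e k k01 E => /=.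
have -> : sg * ((edge_point e k).2 - (x.2 - sg * t)) =
  sg * ((edge_point e k).2 - x.2) + sg ^+ 2 * t by ring.
by rewrite sg1 mul1r => h; apply: ltr_pwDl.
Qed.

Definition half_space (sg : R) : set R3 := [set x | sg * x.2 < - gbound].

Lemma half_space_cvx sg x y (t : R) : half_space sg x -> half_space sg y -> 0 <= t <= 1 ->
  half_space sg (x + t *: (y - x)).
Proof.
rewrite /half_space /= => hx hy t01.
have := @cvx_gt0 R (- gbound - sg * x.2) (- gbound - sg * y.2) t t01.
by rewrite /GRing.scale /= !subr_gt0 => /(_ hx hy); lra.
Qed.

Definition pushed sg x : R3 := (x.1, x.2 - sg * (`|x.2| + gbound + 1)).

Lemma pushed_half sg x : sg ^+ 2 = 1 -> half_space sg (pushed sg x).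
Proof.
move=> sg1; rewrite /half_space /pushed /=.
have -> : sg * (x.2 - sg * (`|x.2| + gbound + 1)) = sg * x.2 - sg ^+ 2 * (`|x.2| + gbound + 1) by ring.
rewrite sg1 mul1r; have nsg : `|sg| = 1 by apply/eqP; rewrite -sqrp_eq1 // -normrX sg1 normr1.
have : sg * x.2 <= `|x.2| by rewrite -[X in _ <= X]mul1r -nsg -normrM ler_norm.
lra.
Qed.

(** A vertical motion away from the graph keeps a point on its side and ends in a half-space, which
    is convex. *)
Lemma side_connected (S : Type) (f : R3 -> S) sg : sg ^+ 2 = 1 ->
  (forall x, side sg x -> \forall y \near x, f y = f x) ->
  forall x y, side sg x -> side sg y -> f x = f y.
Proof.
move=> sg1 fl x y sx sy.
have down z : side sg z -> f z = f (pushed sg z).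
  move=> sz; pose g (t : R) : R3 := (z.1, z.2 - sg * (t * (`|z.2| + gbound + 1))).
  have -> : f z = f (g 0) by rewrite /g mul0r mulr0 subr0 -surjective_pairing.
  have -> : f (pushed sg z) = f (g 1) by rewrite /g mul1r.
  apply: (@loc_const_segment R _ (f \o g)) => // t /andP[t0 t1].
  have gc : continuous_at g t by rewrite /g; ctn.
  have sg' : side sg (g t).
    apply: side_push => //; apply: mulr_ge0 => //.
    by have := gbound_gt0; have := normr_ge0 z.2; lra.
  by have := near_comp gc (fl _ sg'); apply: filterS => t' /= ->.
rewrite (down x sx) (down y sy).
apply: (@loc_const_convex R R3 S (half_space sg)) => //.
- exact: half_space_cvx.
- move=> z hz; have sz : side sg z by apply: far_side => //; exact: ltW.
  by have := fl z sz; apply: filterS.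
- exact: pushed_half.
- exact: pushed_half.
Qed.
End Sides.

(** * The segment between the strands of a crossing *)

Section Mids.
Variables (R : realType) (D : diagram R).
Hypothesis dD : is_diagram D.
Local Notation R3 := (R * R * R)%type.
Implicit Types (e : edge D) (x : node D) (y : R3) (q c : R * R).
Let pp := @plane_proj R D.
Let ep e k := (@edge_point R D e k).1.

Definition incident e x := src e = x \/ tgt e = x.

(** The maximum of [g] and of the planar distance from c is positive on the compact edges, hence
    bounded below; close to c this bound can only come from [g]. *)
Lemma planar_edge_pos c (g : edge D -> R -> R) : (forall e k, continuous_at (g e) k) ->
  (forall e (k : R), 0 <= k <= 1 -> ep e k = c -> 0 < g e k) ->
  \forall q \near c, forall e (k : R), 0 <= k <= 1 -> ep e k = q -> 0 < g e k.
Proof.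
move=> gc gp.
have [e k|e k k01|r r0 hr] := @edge_pos R D (fun e k => Num.max
    (Num.max `|(ep e k).1 - c.1| `|(ep e k).2 - c.2|) (g e k)).
- have := gc e k => h; rewrite /ep /edge_point /=.
  by apply: cont_max => //; ctn.
- have [E|/pair_neq_max h] := pselect (ep e k = c); rewrite lt_max ?h //.
  by rewrite gp ?orbT.
apply/near2P; exists r => // q h1 h2 e k k01 E; have := hr e k k01; rewrite E.
by rewrite !le_max => /orP[/orP[]|]; lra.
Qed.

Lemma ep_node_end e k x : 0 <= k <= 1 -> ep e k = pp x ->
  exists n, [/\ incident e n, pp n = pp x & edge_point e k = pos n].
Proof.
move=> k01 E; have [ki|[n nE]] := edge_node_or_interior e k01.
  by case: (node_not_interior dD (x := x) ki E).
have [k0|k1|k2] : [\/ k = 0, k = 1 | 0 < k < 1].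
  case/andP: k01 => a b; have [->|n0] := eqVneq k 0; first by constructor 1.
  have [->|n1] := eqVneq k 1; first by constructor 2.
  by constructor 3; rewrite lt_neqAle eq_sym n0 a lt_neqAle n1 b.
- exists (src e); split; [by left|by rewrite -E k0 /ep ep0|].
  by rewrite k0 /edge_point !mul0r !addr0; case: (pos (src e)) => -[].
- exists (tgt e); split; [by right|by rewrite -E k1 /ep ep1|].
  by rewrite k1 /edge_point !mul1r !(addrC _ (_ - _)) !subrK; case: (pos (tgt e)) => -[].
- by case: (node_not_interior dD (x := x) k2 E).
Qed.

Lemma near_incident x : \forall q \near pp x, forall e (k : R), 0 <= k <= 1 -> ep e k = q ->
  exists2 n, incident e n & pp n = pp x.
Proof.
have := @planar_edge_pos (pp x) (fun e _ => if `[< exists2 n, incident e n & pp n = pp x >] then 1 else -1).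
case=> [e k|e k k01 E|r /= r0 h]; first exact: cont_cst.
  have [n [h1 h2 _]] := ep_node_end k01 E.
  by rewrite asboolT //; exists n.
exists r => // q hq e k k01 E; have := h q hq e k k01 E.
by case: asboolP => // _; lra.
Qed.

Lemma near_height x (z : R) : height x != z -> \forall q \near pp x, forall e (k : R),
  0 <= k <= 1 -> ep e k = q -> incident e x ->
  (0 < height x - z -> 0 < (edge_point e k).2 - z) /\
  (0 < z - height x -> 0 < z - (edge_point e k).2).
Proof.
move=> hz.
have := @planar_edge_pos (pp x) (fun e k => if `[< incident e x >] then
   (height x - z) * ((edge_point e k).2 - z) else 1).
case=> [e k|e k k01 E|r /= r0 h].
- by case: asboolP => _; [rewrite /edge_point /=; ctn|exact: cont_cst].
- case: asboolP => // i.
  have -> : (edge_point e k).2 = height x.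
    have {i} : exists2 k', 0 <= k' <= 1 & edge_point e k' = pos x.
      case: i => <-.
        exists 0; first by rewrite lexx ler01.
        by rewrite /edge_point !mul0r !addr0; case: (pos (src e)) => -[].
      exists 1; first by rewrite lexx ler01.
      by rewrite /edge_point !mul1r !(addrC _ (_ - _)) !subrK; case: (pos (tgt e)) => -[].
    case=> k' _ E'; have -> : k = k' by apply: (ep_inj dD (e := e)); rewrite E'.
    by rewrite E'.
  by rewrite -expr2 exprn_even_gt0 ?subr_eq0.
exists r => // q hq e k k01 E i; have := h q hq e k k01 E.
rewrite asboolT // => hp; split=> h1.
  by rewrite pmulr_rgt0 in hp.
have : (height x - z) < 0 by lra.
by move=> h2; rewrite nmulr_rgt0 // in hp; lra.
Qed.

Lemma near_line (v c : R * R) (r : R) : 0 < v.1 ^+ 2 + v.2 ^+ 2 -> 0 < r ->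
  \forall q \near c, det v (q - c) = 0 ->
    exists2 t : R, `|t| < r & q = (c.1 + t * v.1, c.2 + t * v.2).
Proof.
move=> v0 r0; set n := _ + _ in v0.
pose t q := ((q.1 - c.1) * v.1 + (q.2 - c.2) * v.2) / n.
have tc : continuous_at t c by rewrite /t; ctn.
have h : \forall q \near c, `|t q| < r.
  have : \forall s \near t c, `|s| < r.
    rewrite {1}/t !subrr !mul0r addr0 mul0r.
    by apply/nbhs_ballP; exists r => //= s; rewrite /ball /= sub0r normrN.
  exact: near_comp.
apply: filterS h => q hq; rewrite det_sub => dq; exists (t q) => //.
have n0 : n != 0 by rewrite gt_eqF.
have e1 : (q.1 - c.1) * n = ((q.1 - c.1) * v.1 + (q.2 - c.2) * v.2) * v.1.
  by apply/eqP; rewrite -subr_eq0; apply/eqP; rewrite /n -[RHS](mulr0 (- v.2)) -dq; ring.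
have e2 : (q.2 - c.2) * n = ((q.1 - c.1) * v.1 + (q.2 - c.2) * v.2) * v.2.
  by apply/eqP; rewrite -subr_eq0; apply/eqP; rewrite /n -[RHS](mulr0 (v.1)) -dq; ring.
rewrite [q]surjective_pairing; congr pair.
  by rewrite /t mulrAC -e1 mulfK // addrC subrK.
by rewrite /t mulrAC -e2 mulfK // addrC subrK.
Qed.

Lemma strand_shadow x (l : R) : 0 < l ->
  dir (out_edge dD x) = (l * (dir (in_edge dD x)).1, l * (dir (in_edge dD x)).2) ->
  \forall q \near pp x, det (dir (in_edge dD x)) (q - pp x) = 0 ->
    exists e (k : R), [/\ 0 <= k <= 1, ep e k = q & incident e x].
Proof.
move=> l0 dE; set u := in_edge dD x; set w := out_edge dD x.
have d0 : 0 < (dir u).1 ^+ 2 + (dir u).2 ^+ 2 := dir_sqr_gt0 dD u.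
have m0 : 0 < Num.min 1 l by rewrite lt_min ltr01.
have := near_line (pp x) d0 m0; apply: filterS => q h /h[t].
rewrite lt_min => /andP[t1 tl] ->.
have [t0|t0] := leP 0 t.
  exists w, (t / l); split; last by left; rewrite /w out_edgeP.
    rewrite divr_ge0 ?(ltW l0) //= ler_pdivrMr // mul1r.
    by apply: le_trans (ler_norm _) _; exact: ltW.
  rewrite /ep epE /w out_edgeP dE -/u /=; congr pair; rewrite mulrA divfK ?gt_eqF //.
exists u, (1 + t); split; last by right; rewrite /u in_edgeP.
  by move: t1; rewrite ltr0_norm //; lra.
rewrite /ep epE; have := in_edgeP dD x; rewrite -/u => E.
by rewrite /dir -/pp E /pp /=; congr pair; ring.
Qed.

Section Mid.
Variables (lo hi : node D) (p : R3).
Hypotheses (cr : crossing lo hi) (pE : pp lo = p.1) (lt1 : height lo < p.2) (lt2 : p.2 < height hi).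
Let u := in_edge dD lo.
Let vi := in_edge dD hi.

(** Near the segment, the only part of the graph underneath is the under strand and the only part
    overhead is the over strand, so each side is the complement of one vertical plane. *)
Lemma mid_sides : \forall y \near p,
  [/\ side D 1 y <-> det (dir u) (y.1 - p.1) != 0,
      side D (-1) y <-> det (dir vi) (y.1 - p.1) != 0,
      height lo < y.2 & y.2 < height hi].
Proof.
have [[lo1 l10 dvo] [lw lw0 dw] _] := crossing_dirs dD cr.
have hpE := crossing_pp cr.
have [z1 [a1 a2]] : exists z, height lo < z /\ z < p.2.
  by exists ((height lo + p.2) / 2); move: lt1; split; lra.
have [z2 [a3 a4]] : exists z, p.2 < z /\ z < height hi.
  by exists ((p.2 + height hi) / 2); move: lt2; split; lra.
have hiE : pp hi = p.1 by rewrite -pE.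
have H1 := @near_incident lo; rewrite pE in H1; have {}H1 := near_fst H1.
have H2 := @near_height lo z1 (negbT (lt_eqF a1)).
have H3 := @near_height hi z2 (negbT (gt_eqF a4)).
have H4 := strand_shadow lw0 dw.
have H5 := strand_shadow l10 dvo.
rewrite pE in H2 H4; rewrite hiE in H3 H5.
have {}H2 := near_fst H2; have {}H3 := near_fst H3; have {}H4 := near_fst H4; have {}H5 := near_fst H5.
have H6 : \forall y \near p, z1 < y.2.
  by apply: (@near_snd _ p (fun z => z1 < z)); exact: (cvgr_gt p.2 cvg_id).
have H7 : \forall y \near p, y.2 < z2.
  by apply: (@near_snd _ p (fun z => z < z2)); exact: (cvgr_lt p.2 cvg_id).
near=> y.
have K1 : forall e (k : R), 0 <= k <= 1 -> ep e k = y.1 -> exists2 n, incident e n & pp n = p.1 by near: y.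
have K2 : forall e (k : R), 0 <= k <= 1 -> ep e k = y.1 -> incident e lo -> (edge_point e k).2 < z1.
  move=> e k k01 E i; have [_] : (0 < height lo - z1 -> 0 < (edge_point e k).2 - z1) /\
    (0 < z1 - height lo -> 0 < z1 - (edge_point e k).2) by move: e k k01 E i; near: y.
  by rewrite !subr_gt0; apply.
have K3 : forall e (k : R), 0 <= k <= 1 -> ep e k = y.1 -> incident e hi -> z2 < (edge_point e k).2.
  move=> e k k01 E i; have [+ _] : (0 < height hi - z2 -> 0 < (edge_point e k).2 - z2) /\
    (0 < z2 - height hi -> 0 < z2 - (edge_point e k).2) by move: e k k01 E i; near: y.
  by rewrite !subr_gt0; apply.
have K4 : det (dir u) (y.1 - p.1) = 0 -> exists e (k : R), [/\ 0 <= k <= 1, ep e k = y.1 & incident e lo] by near: y.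
have K5 : det (dir vi) (y.1 - p.1) = 0 -> exists e (k : R), [/\ 0 <= k <= 1, ep e k = y.1 & incident e hi] by near: y.
have K6 : z1 < y.2 by near: y.
have K7 : y.2 < z2 by near: y.
have line n e k (l : R) : pp n = p.1 -> incident e n -> ep e k = y.1 -> bivalent n ->
    dir (out_edge dD n) = (l * (dir (in_edge dD n)).1, l * (dir (in_edge dD n)).2) ->
    det (dir (in_edge dD n)) (y.1 - p.1) = 0.
  move=> np i E bn dE; rewrite -E /ep epE -np det_sub; case: i => h.
    rewrite (bivalent_out dD bn h) out_edgeP dE.
    by rewrite /pp; case: (dir _) (plane_proj n) => [d1 d2] [n1 n2] /=; ring.
  have -> : pp n = ((plane_proj (src e)).1 + (dir e).1, (plane_proj (src e)).2 + (dir e).2).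
    by rewrite /dir h /pp /=; case: (plane_proj n) => n1 n2 /=; congr pair; ring.
  rewrite -(bivalent_in dD bn h).
  by case: (dir e) (plane_proj (src e)) => [d1 d2] [n1 n2] /=; ring.
have [bl bh] := crossing_bivalent dD cr.
have cases e k : 0 <= k <= 1 -> ep e k = y.1 ->
    (incident e lo /\ det (dir u) (y.1 - p.1) = 0) \/ (incident e hi /\ det (dir vi) (y.1 - p.1) = 0).
  move=> k01 E; have [n i np] := K1 e k k01 E.
  have [nE|nE] := crossing_nodes dD cr (etrans np (esym pE)); rewrite nE in i; [left|right]; split => //.
    exact: line i E bl dw.
  exact: line i E bh dvo.
split; [split|split|exact: lt_trans a1 K6|exact: lt_trans K7 a4].
- move=> s1; apply/eqP => /K4[e [k [k01 E i]]]; have := s1 e k k01 E; have := K2 e k k01 E i; lra.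
- move=> /eqP n0 e k k01 E; have [[_ //]|[i _]] := cases e k k01 E.
  have := K3 e k k01 E i; lra.
- move=> s1; apply/eqP => /K5[e [k [k01 E i]]]; have := s1 e k k01 E; have := K3 e k k01 E i; lra.
- move=> /eqP n0 e k k01 E; have [[i _]|[_ //]] := cases e k k01 E.
  have := K2 e k k01 E i; lra.
Unshelve. all: by end_near. Qed.

End Mid.

Section MidFormula.
Variables (lo hi : node D).
Let u := in_edge dD lo.
Let w := out_edge dD lo.
Let vi := in_edge dD hi.

(* [corner b b'] is the value of [h] in the quadrant of the crossing on the
   side [b] of the over strand and the side [b'] of the under strand. *)
Definition corner (G : Type) (h : R * R -> G) (b b' : bool) : G :=
  h (left_point dD (if b == (0 < det (dir vi) (dir u)) then w else u, b')).

(** The chart of the cocycle around the segment. It must be locally constant off the line of the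
    under strand and a left translate of [h] on each side of the over strand. It takes two constants
    off the under line; on that line it follows [h], translated so as to be 1 on the left of the
    under strand. *)
Definition mid_formula (G : groupType) (h : R * R -> G) (q : R * R) : G :=
  if det (dir u) (q - pp lo) != 0 then
    (if 0 < det (dir u) (q - pp lo) then 1%g
     else ((corner h true true)^-1 * corner h true false)%g)
  else ((corner h (0 < det (dir vi) (q - pp lo)) true)^-1 * h q)%g.

(** The crossing relation is what allows one and the same constant on the right of the under strand
    for both sides of the over strand. *)
Lemma mid_chart (G : groupType) (h : R * R -> G) : crossing lo hi ->
  loc_const_off_shadow D h -> crossing_relation dD h ->
  let F := mid_formula h in
  \forall q \near pp lo,
    (det (dir u) (q - pp lo) != 0 -> \forall q' \near q, F q' = F q) /\
    (det (dir vi) (q - pp lo) != 0 -> \forall q' \near q,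
        ((F q)^-1 * F q' = (h q)^-1 * h q')%g).
Proof.
move=> cr lh rh F; have [H [hH vH]] := crossing_quadrants dD cr lh.
have cE b b' : corner h b b' = H b b'.
  rewrite /corner /w /u /vi; have [_ _ e1 e2] := vH b'; move: e1 e2 => /=.
  by case: (0 < _); case: b => //= -> ->.
have rel b : ((H b true)^-1 * H b false = (H true true)^-1 * H true false)%g.
  have := rh lo hi cr; have [_ _ e1 e2] := vH true; have [_ _ e3 e4] := vH false.
  rewrite /= e1 e2 e3 e4; case: (0 < _); case: b => //= ->; done.
have sgn (v : R * R) q : det v (q - pp lo) != 0 ->
    \forall q' \near q, (0 < det v (q' - pp lo)) = (0 < det v (q - pp lo)) /\ det v (q' - pp lo) != 0.
  move=> h1.
  have := @near_det R v (pp lo) q 1; rewrite mul1r => /(_ h1) A1.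
  have := @near_det R v (pp lo) q (-1); rewrite mulN1r oppr_eq0 => /(_ h1) A2.
  apply: filterS2 A1 A2 => q'; rewrite !mul1r !mulN1r !oppr_gt0 => e1 e2; split => //.
  by rewrite neq_lt e1 e2 -neq_lt.
have key q : det (dir vi) (q - pp lo) != 0 -> (det (dir u) (q - pp lo) != 0 -> h q = H (0 < det (dir vi) (q - pp lo)) (0 < det (dir u) (q - pp lo))) ->
    F q = ((H (0 < det (dir vi) (q - pp lo)) true)^-1 * h q)%g.
  rewrite /F /mid_formula !cE; case: ifP => // n0 _ /(_ isT) ->.
  by case: ifP => _; rewrite ?mulVg ?rel.
have hH2 : \forall q \near pp lo, \forall q' \near q, det (dir vi) (q' - pp lo) != 0 -> det (dir u) (q' - pp lo) != 0 ->
    h q' = H (0 < det (dir vi) (q' - pp lo)) (0 < det (dir u) (q' - pp lo)) by exact: near_join.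
apply: filterS2 hH hH2 => q hq hq2; split=> n0.
  have := sgn _ _ n0; apply: filterS => q' [e1 e2].
  by rewrite /F /mid_formula e2 n0 e1.
have := sgn _ _ n0; apply: filterS2 hq2 => q' hq' [e1 e2].
rewrite (key q) //; last by move=> m0; apply: hq.
rewrite (key q') //; last by move=> m0; apply: hq'.
by rewrite e1 invgM invgK !mulgA mulgK.
Qed.
End MidFormula.
End Mids.

(** * Neighbourhoods of infinity *)

Section Sphere.
Variable R : realType.
Local Notation R3 := (R * R * R)%type.
Implicit Types (x y : R3) (P : S3 R -> Prop).

Lemma near_someP x P : (\forall y \near (Some x : S3 R), P y) <-> \forall y \near x, P (Some y).
Proof. by []. Qed.

Lemma norm3E x : `|x| = Num.max (Num.max `|x.1.1| `|x.1.2|) `|x.2|.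
Proof. by []. Qed.

Lemma box_compact (r : R) : compact [set x : R3 | `|x| <= r].
Proof.
have -> : [set x : R3 | `|x| <= r] = (`[- r, r] `*` `[- r, r]) `*` `[- r, r].
  apply/seteqP; split=> [x|x].
    by rewrite /= norm3E !ge_max !ler_norml !in_itv /= => /andP[/andP[-> ->] ->].
  by move=> [[]] /=; rewrite !in_itv /= norm3E !ge_max !ler_norml => -> -> ->.
by apply: compact_setX; [apply: compact_setX|]; exact: segment_compact.
Qed.

Lemma near_infty P : (\forall y \near (None : S3 R), P y) <->
  P None /\ exists2 r : R, 0 < r & forall x, r < `|x| -> P (Some x).
Proof.
split=> [[C [Cc Ccl] h]|[P0 [r r0 h]]].
  split; first by apply: h; right.
  have /pinfty_ex_gt0 [r r0 hr] := compact_bounded Cc.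
  exists r => // x xr; apply: h; left; exists x => // /hr /=.
  by rewrite leNgt xr.
exists [set x : R3 | `|x| <= r].
  split; first exact: box_compact.
  by apply: compact_closed; [exact: norm_hausdorff|exact: box_compact].
by move=> _ [[x /= nx <-]|->] //; apply: h; rewrite ltNge; apply/negP.
Qed.
End Sphere.

(** Connectedness of a union of convex pieces, each of which reaches the piece [i0] through at most
    one intermediate piece. It serves for the exterior of a square or of a cube and for the
    complement of a line. *)
Lemma loc_const_union (R : realType) (V : normedModType R) (S I : Type)
    (C : I -> set V) (f : V -> S) (i0 : I) :
  (forall i x y (t : R), C i x -> C i y -> 0 <= t <= 1 -> C i (x + t *: (y - x))) ->
  (forall i x, C i x -> \forall y \near x, f y = f x) ->
  (forall i, exists j z w, [/\ C i z, C j z, C j w & C i0 w]) ->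
  forall i j x y, C i x -> C j y -> f x = f y.
Proof.
move=> cvx fl link.
have cst i x y : C i x -> C i y -> f x = f y.
  apply: loc_const_convex; first exact: cvx.
  by move=> z /fl; apply: filterS.
have key i : exists2 w, C i0 w & forall x, C i x -> f x = f w.
  have [j [z [w [h1 h2 h3 h4]]]] := link i; exists w => // x ix.
  by rewrite (cst i x z) // (cst j z w).
move=> i j x y ix jy; have [w w0 h] := key i; have [w' w'0 h'] := key j.
by rewrite (h x ix) (h' y jy); apply: cst w0 w'0.
Qed.

Section Far.
Variables (R : realType) (D : diagram R).
Local Notation R3 := (R * R * R)%type.
Local Notation M := (gbound D).

Lemma far_not_shadow (q : R * R) : M <= `|q| -> ~ shadow D q.
Proof.
move=> + [e [k [k01 E]]]; have [h1 h2 _] := gboundP e k01; rewrite E.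
by rewrite /Num.norm /= le_max !leNgt h1 h2.
Qed.

Lemma far_sides (x : R3) : M <= `|x| -> side D 1 x \/ side D (-1) x.
Proof.
rewrite norm3E le_max => /orP[h|].
  by left; apply: not_shadow_side; exact: far_not_shadow.
rewrite lter_normr => /orP[h|h]; [right|left]; apply: far_side; rewrite ?expr1n ?sqrrN ?expr1n //.
  by rewrite mulN1r lerN2.
by rewrite mul1r; lra.
Qed.

Lemma far_side_shadow (x : R3) : M <= `|x| -> - M < x.2 -> side D 1 x -> ~ shadow D x.1.
Proof.
move=> h hz s1 [e [k [k01 E]]]; have := s1 e k k01 (esym E); rewrite mul1r subr_gt0 => lt.
have [h1 h2 h3] := gboundP e k01; move: h; rewrite norm3E E le_max => /orP[|].
  by rewrite le_max !leNgt h1 h2.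
rewrite leNgt => /negP; apply; rewrite ltr_norml hz /=; apply: lt_trans lt _.
exact: le_lt_trans (ler_norm _) h3.
Qed.

Lemma far_const (S : Type) (h : R * R -> S) : loc_const_off_shadow D h ->
  forall q, M <= `|q| -> h q = h (M, M).
Proof.
move=> lh.
pose C (i : bool * bool) : set (R * R) := [set q | M <= (if i.1 then (if i.2 then q.1 else - q.1) else (if i.2 then q.2 else - q.2))].
have CM i q : C i q -> M <= `|q|.
  rewrite /C /= => hq; apply: le_trans hq _; rewrite /Num.norm /= le_max.
  have nl (a : R) : - a <= `|a| by rewrite -normrN ler_norm.
  by case: i => -[] [] /=; rewrite ?ler_norm ?nl ?orbT.
move=> q hq; have /(_ (true, true)) key := @loc_const_union R _ S _ C h _ _ _ _.
have [i hi] : exists i, C i q.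
  move: hq; rewrite /Num.norm /= le_max !ler_normr => /orP[/orP[]|/orP[]] hh.
  - by exists (true, true).
  - by exists (true, false).
  - by exists (false, true).
  - by exists (false, false).
have M2 : - - M = M by rewrite opprK.
apply: (key _ _ _ i (true, true)) => //; last by rewrite /C /=.
- move=> j x y t; rewrite /C /= => hx hy /andP[t0 t1].
  rewrite /GRing.scale /=.
  set a := (if j.1 then _ else _) in hx; set b := (if j.1 then _ else _) in hy.
  have -> : (if j.1 then (if j.2 then x.1 + t * (y.1 - x.1) else - (x.1 + t * (y.1 - x.1))) else
      (if j.2 then x.2 + t * (y.2 - x.2) else - (x.2 + t * (y.2 - x.2)))) = (1 - t) * a + t * b.
    by rewrite /a /b; case: j.1; case: j.2; ring.
  have -> : M = (1 - t) * M + t * M by ring.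
  by apply: lerD; apply: ler_wpM2l => //; lra.
- by move=> j x /CM /far_not_shadow /lh.
- case=> -[] [].
  + by exists (true, true), (M, M), (M, M); rewrite /C /=.
  + by exists (false, true), (- M, M), (M, M); rewrite /C /= opprK.
  + by exists (false, true), (M, M), (M, M); rewrite /C /=.
  + by exists (true, true), (M, - M), (M, M); rewrite /C /= opprK.
Qed.
End Far.

Lemma near_all (T : topologicalType) (p : T) (P : T -> Prop) :
  (forall x, P x) -> \forall x \near p, P x.
Proof. by move=> h; apply: nearW. Qed.

Lemma det_both0 (R : realType) (a b v : R * R) : det b a != 0 -> det a v = 0 -> det b v = 0 ->
  v.1 = 0 /\ v.2 = 0.
Proof.
move=> d0 d1 d2; have f1 : det b a * v.1 = a.1 * det b v - b.1 * det a v by rewrite /det; ring.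
have f2 : det b a * v.2 = a.2 * det b v - b.2 * det a v by rewrite /det; ring.
move: f1 f2; rewrite d1 d2 !mulr0 subrr => /eqP + /eqP.
by rewrite !mulf_eq0 (negbTE d0) /= => /eqP -> /eqP ->.
Qed.

(** * The local system of a function on the regions *)

Section Cocycle.
Variables (R : realType) (D : diagram R).
Hypothesis dD : is_diagram D.
Local Notation R3 := (R * R * R)%type.
Local Notation M := (gbound D).
Let pp := @plane_proj R D.

Lemma crossing_at_unique lo hi lo' hi' : crossing lo hi -> crossing lo' hi' ->
  pp lo' = pp lo -> lo' = lo /\ hi' = hi.
Proof.
move=> cr cr' E; have nE : lo' = lo.
  have [//|nE] := crossing_nodes dD cr E.
  have ul : under lo' by apply/existsP; exists hi'.
  have ol : over lo' by apply/existsP; exists lo; rewrite nE.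
  by have := not_under_over dD ul; rewrite ol.
by rewrite nE in cr' *; rewrite (crossing_over_unique dD cr' cr).
Qed.

Variables (G : groupType) (h : R * R -> G).

Definition mid_fun p : R * R -> G :=
  if [pick z : node D * node D | crossing z.1 z.2 && (pp z.1 == p)] is Some z
  then mid_formula dD z.1 z.2 h else fun=> 1%g.

(** The chart at infinity. Far out in the plane [h] has the single value [h (M, M)], so the two
    branches agree there, and a threshold of height below the graph suffices to pass from the lower
    trivialization to the upper one. *)
Definition inf_fun (y : S3 R) : G := if y is Some y then
  (if - M < y.2 then ((h (M, M))^-1 * h y.1)%g else 1%g) else 1%g.

(** Two trivial local systems glued over the regions: the transport is 1 below the graph and is read
    from [h] above it, so [h] is the transition function. A point on both sides lies over a region,
    where [h] is locally constant and the two rules agree. The remaining points of the complement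
    are infinity and the segments inside the crossings. *)
Definition cocycle_of (x y : S3 R) : G :=
  match x, y with
  | Some x, Some y => if `[< side D 1 x >] then 1%g
      else if `[< side D (-1) x >] then ((h x.1)^-1 * h y.1)%g
      else ((mid_fun x.1 x.1)^-1 * mid_fun x.1 y.1)%g
  | Some _, None => 1%g
  | None, _ => inf_fun y
  end.

Hypotheses (lh : loc_const_off_shadow D h) (rh : crossing_relation dD h).

Lemma mid_funP p lo hi : crossing lo hi -> pp lo = p ->
  \forall q \near p,
    (det (dir (in_edge dD lo)) (q - p) != 0 -> \forall q' \near q, mid_fun p q' = mid_fun p q) /\
    (det (dir (in_edge dD hi)) (q - p) != 0 -> \forall q' \near q,
        ((mid_fun p q)^-1 * mid_fun p q' = (h q)^-1 * h q')%g).
Proof.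
move=> cr <-; rewrite /mid_fun; case: pickP => [[lo' hi'] /= /andP[cr' /eqP E]|/(_ (lo, hi))].
  by have [-> ->] := crossing_at_unique cr cr' E; apply: mid_chart.
by rewrite /= cr eqxx.
Qed.

Lemma cocycle_below x : side D 1 x -> \forall y \near (Some x : S3 R), cocycle_of (Some x) y = 1%g.
Proof. by move=> s; apply/near_someP; apply: near_all => y /=; rewrite asboolT. Qed.

Lemma cocycle_above x : side D (-1) x -> \forall y \near x, cocycle_of (Some x) (Some y) = ((h x.1)^-1 * h y.1)%g.
Proof.
move=> s /=; have [s1|ns1] := pselect (side D 1 x).
  have := near_fst (lh (sides_not_shadow s1 s)); apply: filterS => y ->.
  by rewrite asboolT // mulVg.
by apply: near_all => y; rewrite asboolF // asboolT.
Qed.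

Lemma sg1 : (1 : R) ^+ 2 = 1. Proof. by rewrite expr1n. Qed.

Lemma sgN1 : (-1 : R) ^+ 2 = 1. Proof. by rewrite sqrrN expr1n. Qed.

Lemma cocycle_infty : exists F : S3 R -> G, \forall x \near (None : S3 R),
  \forall y \near x, cocycle_of x y = ((F x)^-1 * F y)%g.
Proof.
have gM := gbound_gt0 D.
exists inf_fun; apply/near_infty; split.
  by apply: near_all => y /=; rewrite invg1 mul1g.
exists M => // x xM; apply/near_someP.
have near_hi : - M < x.2 -> \forall y \near x, - M < y.2.
  by move=> h2; apply: (@near_snd _ x (fun z => - M < z)); exact: (cvgr_gt x.2 cvg_id).
have [s1|ns1] := pselect (side D 1 x).
  have h0 : \forall y \near x, inf_fun (Some y) = inf_fun (Some x).
    rewrite /=; have [xl|] := ltP (- M) x.2.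
      have ns := far_side_shadow (ltW xM) xl s1.
      by apply: filterS2 (near_hi xl) (near_fst (lh ns)) => y -> ->.
    rewrite le_eqVlt => /orP[/eqP E|xl]; last first.
      have : \forall y \near x, y.2 < - M.
        by apply: (@near_snd _ x (fun z => z < - M)); exact: (cvgr_lt x.2 cvg_id).
      by apply: filterS => y yl; rewrite ltNge ltW.
    have xq : M < `|x.1|.
      by move: xM; rewrite norm3E E normrN (gtr0_norm gM) lt_max => /orP[//|]; rewrite ltxx.
    have ns := far_not_shadow (ltW xq).
    have := near_fst (lh ns); apply: filterS => y ->.
    by rewrite (far_const lh (ltW xq)) mulVg; case: ifP.
  have := cocycle_below s1 => /near_someP; apply: filterS2 h0 => y -> ->.
  by rewrite mulVg.
have s2 : side D (-1) x by have [] := far_sides (ltW xM).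
have xl : - M < x.2.
  by rewrite ltNge; apply/negP => le; apply: ns1; apply: far_side; rewrite ?sg1 // mul1r.
apply: filterS2 (near_hi xl) (cocycle_above s2) => y yl ->.
by rewrite /= xl yl invgM invgK !mulgA mulgK.
Qed.

Lemma graph_compl_some x : ~ sphere_support D (Some x) -> ~ graph_support D x.
Proof. by move=> n g; apply: n; exists x. Qed.

Lemma cocycle_of_germ : germ_cocycle (~` sphere_support D) cocycle_of.
Proof.
apply: germ_cocycle_of_charts => -[p|_]; last exact: cocycle_infty.
move=> /graph_compl_some np.
have [s1|s2|[lo [hi [cr E /andP[lt1 lt2]]]]] := side_cases dD np.
- exists (fun=> 1%g); apply/near_someP; have := side_open sg1 s1; apply: filterS => x sx.
  by have := cocycle_below sx; apply: filterS => y ->; rewrite invg1 mulg1.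
- exists (fun x => if x is Some x then h x.1 else 1%g); apply/near_someP.
  have := side_open sgN1 s2; apply: filterS => x sx.
  exact: cocycle_above.
exists (fun x => if x is Some x then mid_fun p.1 x.1 else 1%g); apply/near_someP.
have spec := near_fst (mid_funP cr E).
have sides := mid_sides dD cr E lt1 lt2.
apply: filterS2 spec sides => x [m1 m2] [e1 e2 _ _].
have [s1|ns1] := pselect (side D 1 x).
  have /e1/m1 h1 := s1; have /near_someP h2 := cocycle_below s1.
  by apply/near_someP; apply: filterS2 h2 (near_fst h1) => y -> ->; rewrite mulVg.
have [s2|ns2] := pselect (side D (-1) x).
  have /e2/m2 h1 := s2; have h2 := cocycle_above s2.
  by apply/near_someP; apply: filterS2 h2 (near_fst h1) => y -> ->.
have xE : x.1 = p.1.
  have [_ _ d0] := crossing_dirs dD cr.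
  have d1 : det (dir (in_edge dD lo)) (x.1 - p.1) = 0 by apply/eqP/negPn/negP => /e1.
  have d2 : det (dir (in_edge dD hi)) (x.1 - p.1) = 0 by apply/eqP/negPn/negP => /e2.
  have [] := det_both0 d0 d1 d2 => /= /eqP + /eqP; rewrite !subr_eq0 => /eqP f1 /eqP f2.
  by rewrite [LHS]surjective_pairing f1 f2 -surjective_pairing.
apply/near_someP; apply: near_all => y /=; rewrite asboolF // asboolF // xE //.
Qed.
End Cocycle.

(** Naturality in the group: components, multiples and linear combinations of flows are all handled
    by it, without any return to the geometry. *)
Lemma cocycle_of_morph (R : realType) (D : diagram R) (dD : is_diagram D)
    (G G' : groupType) (f : G -> G') (h : R * R -> G) :
  (forall x y, f (x * y) = f x * f y)%g -> (forall x, f x^-1 = (f x)^-1)%g ->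
  forall x y, f (cocycle_of dD h x y) = cocycle_of dD (f \o h) x y.
Proof.
move=> fM fV x y.
have f1 : f 1%g = 1%g by apply: (mulgI (f 1%g)); rewrite -fM !mulg1.
have fm p q : f (mid_fun dD h p q) = mid_fun dD (f \o h) p q.
  rewrite /mid_fun; case: pickP => // z _; rewrite /mid_formula /corner.
  by case: ifP => _; [case: ifP => _|]; rewrite ?f1 ?fM ?fV.
have fi z : f (inf_fun D h z) = inf_fun D (f \o h) z.
  by case: z => //= z; case: ifP => _; rewrite ?fM ?fV.
case: x => //= x; case: y => // y.
by case: ifP => _ //; case: ifP => _; rewrite fM fV ?fm.
Qed.

(** * Contraction of the two sides *)

Definition clamp (R : realType) (t : R) : R := Num.max 0 (Num.min 1 t).

Lemma clamp_itv (R : realType) (t : R) : 0 <= clamp t <= 1.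
Proof. by rewrite /clamp le_max lexx ge_max ler01 ge_min lexx. Qed.

Lemma clamp0 (R : realType) (t : R) : t <= 0 -> clamp t = 0.
Proof. by move=> h; rewrite /clamp max_l // ge_min h orbT. Qed.

Lemma clamp1 (R : realType) (t : R) : 1 <= t -> clamp t = 1.
Proof. by move=> h; rewrite /clamp min_l // max_r. Qed.

Lemma cont_clamp (R : realType) (T : topologicalType) (f : T -> R) (p : T) :
  continuous_at f p -> continuous_at (fun x => clamp (f x)) p.
Proof. by move=> h; rewrite /clamp; apply: cont_max; ctn. Qed.

Lemma cont_pair_ext (R : realType) (T : topologicalType) (f : T -> R * R * R) (p : T) :
  continuous_at (fun x => (f x).1.1) p -> continuous_at (fun x => (f x).1.2) p ->
  continuous_at (fun x => (f x).2) p -> continuous_at f p.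
Proof.
move=> h1 h2 h3; have -> : f = fun x => (((f x).1.1, (f x).1.2), (f x).2).
  by apply/funext => x; case: (f x) => -[].
by apply: cont_pair => //; apply: cont_pair.
Qed.

Section Contract.
Variables (R : realType) (D : diagram R) (sg : R).
Hypothesis sg1 : sg ^+ 2 = 1.
Local Notation R3 := (R * R * R)%type.
Implicit Types (x y : R3).

Definition push_down (t : R) x : R3 :=
  (x.1, x.2 - sg * (t * (`|x.2| + gbound D + 1))).

(** A vertical push beyond the graph, and then a straight motion to a fixed point of the half-space.
    Time runs through all real numbers, as in [homotopy_gauge], and the clamps stop the motion
    outside the unit interval. *)
Definition contract (t : R) x : R3 :=
  let y := push_down (clamp (2 * t)) x in
  y + clamp (2 * t - 1) *: (pushed D sg 0 - y).

Lemma contract_side t x : side D sg x -> side D sg (contract t x).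
Proof.
move=> sx; have gM := gbound_gt0 D; have nx := normr_ge0 x.2.
have [le|ge] := leP (2 * t) 1.
  rewrite /contract (@clamp0 _ (2 * t - 1)) ?scale0r ?addr0; last lra.
  apply: side_push => //; have /andP[c0 _] := clamp_itv (2 * t).
  by apply: mulr_ge0 => //; lra.
rewrite /contract (@clamp1 _ (2 * t)); last lra.
apply: far_side => //; apply: ltW; apply: half_space_cvx; last exact: clamp_itv.
- by rewrite /push_down mul1r; exact: pushed_half.
- exact: pushed_half.
Qed.

Lemma contract0 x : contract 0 x = x.
Proof.
rewrite /contract mulr0 clamp0 // (@clamp0 _ (0 - 1)); last lra.
by rewrite scale0r addr0 /push_down mul0r mulr0 subr0 -surjective_pairing.
Qed.

Lemma contract1 x : contract 1 x = pushed D sg 0.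
Proof.
have h : (1 : R) <= 2 * 1 - 1 by lra.
by rewrite /contract (clamp1 h) scale1r addrC subrK.
Qed.

Lemma contract_cont t x : continuous_at (fun z : R * R3 => contract z.1 z.2) (t, x).
Proof.
apply: cont_pair_ext; rewrite /contract /push_down /GRing.scale /= /GRing.scale /= /clamp.
all: by ctn.
Qed.

(** The contraction gauges the cocycle to its pullback by a constant map, which is 1. *)
Lemma side_trivial (G : groupType) (c : R3 -> R3 -> G) : germ_cocycle (side D sg) c ->
  exists f, trivializes (side D sg) c f.
Proof.
move=> cc; have oS : open (side D sg).
  by rewrite openE => x; exact: side_open.
have [//|t x _|f hf _] := homotopy_gauge cc oS (F := contract).
- exact: contract_side.
- exact: contract_cont.
exists (fun x => (f x)^-1)%g => x sx; have := hf x sx; apply: filterS => y.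
rewrite !contract0 !contract1.
have s0 : side D sg (pushed D sg 0).
  by rewrite -(contract1 x); apply: contract_side.
rewrite (germ_cocycle_diag cc s0) invgK => /(congr1 (fun g => f x * g * (f y)^-1))%g.
by rewrite mulg1 !mulgA mulgV mul1g mulgK.
Qed.
End Contract.

(** * Thinness of what the two sides leave out *)

Section Thin.
Variables (R : realType) (D : diagram R).
Hypothesis dD : is_diagram D.
Variable G : groupType.
Local Notation R3 := (R * R * R)%type.

(** Inside the complement of the graph it consists of infinity and of the open vertical segments
    between the two strands of the crossings. *)
Definition skeleton : set (S3 R) :=
  ~` (Some @` [set x | side D 1 x \/ side D (-1) x]).

Lemma not_skeleton (x : R3) : ~ skeleton (Some x) <-> side D 1 x \/ side D (-1) x.
Proof.
split=> [/contrapT[y sy [<-]] //|h]; first by move=> sk; apply: sk; exists x.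
Qed.

Lemma skeleton_closed : open (~` skeleton).
Proof.
rewrite /skeleton setCK; apply: one_point_compactification_open_some.
rewrite openE => x [] sx; rewrite /interior.
  by have := side_open (sg1 R) sx; apply: filterS => y; left.
by have := side_open (sgN1 R) sx; apply: filterS => y; right.
Qed.

(** Outside a large cube, infinity is the only point of the skeleton, and the exterior of a cube is
    a union of six half-spaces that can be linked. *)
Lemma thin_infty : thin G skeleton None.
Proof.
have gM := gbound_gt0 D.
have big r (x : R3) : gbound D + r < `|x| -> 0 < r -> ~ skeleton (Some x).
  by move=> h r0; apply/not_skeleton; apply: far_sides; lra.
split=> [A /near_infty[_ [r r0 h]]|kappa /near_infty[_ [r r0 h]]].
  pose x : R3 := (0, gbound D + r + 1).
  have nx : gbound D + r < `|x|.
    by rewrite norm3E lt_max /= (gtr0_norm (x := gbound D + r + 1)) ?orbT //; lra.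
  by exists (Some x); split; [apply: h; lra|exact: big nx r0].
pose b := gbound D + r.
have b0 : 0 < b by rewrite /b; lra.
pose crd (i : 'I_3) (x : R3) : R := if i == 0 :> nat then x.1.1 else if i == 1 :> nat then x.1.2 else x.2.
pose C (i : 'I_3 * bool) : set R3 := [set x | b < (if i.2 then crd i.1 x else - crd i.1 x)].
have Cn i x : C i x -> b < `|x|.
  rewrite /C /= => hx; apply: lt_le_trans hx _; rewrite norm3E !le_max.
  have nl (a : R) : - a <= `|a| by rewrite -normrN ler_norm.
  by rewrite /crd; case: i.2; case: ifP => _ /=; [|case: ifP => _| |case: ifP => _];
     rewrite ?ler_norm ?nl ?orbT.
pose f (x : R3) := kappa (Some x).
have nC x : b < `|x| -> exists i, C i x.
  rewrite norm3E !lt_max !lter_normr /C /= => /orP[/orP[/orP[]|/orP[]]|/orP[]] hx.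
  - by exists (0, true).
  - by exists (0, false).
  - by exists (1, true).
  - by exists (1, false).
  - by exists (2%:R, true).
  - by exists (2%:R, false).
pose a := b + 1.
have ab : b < a by rewrite /a; lra.
have key : forall i j x y, C i x -> C j y -> f x = f y.
  apply: (@loc_const_union R _ G _ C f (0, true)).
  - move=> i x y t; rewrite /C /= => hx hy /andP[t0 t1].
    have -> : (if i.2 then crd i.1 (x + t *: (y - x)) else - crd i.1 (x + t *: (y - x))) =
       (if i.2 then crd i.1 x else - crd i.1 x) + t * ((if i.2 then crd i.1 y else - crd i.1 y) - (if i.2 then crd i.1 x else - crd i.1 x)).
      have -> : crd i.1 (x + t *: (y - x)) = crd i.1 x + t * (crd i.1 y - crd i.1 x).
        by rewrite /crd; case: ifP => _ //; case: ifP.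
      by case: i.2; ring.
    rewrite -subr_gt0.
    have := @cvx_gt0 R ((if i.2 then crd i.1 x else - crd i.1 x) - b)
      ((if i.2 then crd i.1 y else - crd i.1 y) - b) t.
    by rewrite t0 t1 !subr_gt0 => /(_ isT hx hy); lra.
  - move=> i x /Cn xb; have : r < `|x| by rewrite /b in xb; lra.
    by move=> /h; apply; exact: big xb r0.
  - case=> -[[|[|[|//]]] i] [].
    + by exists (0, true), (a, a, a), (a, a, a); split; rewrite /C /crd /=.
    + by exists (1, true), (- a, a, a), (a, a, a); split; rewrite /C /crd /= ?opprK.
    + by exists (0, true), (a, a, a), (a, a, a); split; rewrite /C /crd /=.
    + by exists (0, true), (a, - a, a), (a, a, a); split; rewrite /C /crd /= ?opprK.
    + by exists (0, true), (a, a, a), (a, a, a); split; rewrite /C /crd /=.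
    + by exists (0, true), (a, a, - a), (a, a, a); split; rewrite /C /crd /= ?opprK.
exists (f (a, a, a)); apply/near_infty; split.
  by case; case=> x _.
exists b => // x /nC[i ix] _.
by apply: (key i (0, true) _ _ ix); rewrite /C /crd /=.
Qed.

(** Near such a point the skeleton is a vertical line, whose complement in a small cube is covered
    by four convex pieces linked in a cycle. *)
Lemma thin_mid (lo hi : node D) (p : R3) : crossing lo hi -> plane_proj lo = p.1 ->
  height lo < p.2 < height hi -> thin G skeleton (Some p).
Proof.
move=> cr E /andP[lt1 lt2].
have sides := mid_sides dD cr E lt1 lt2.
have skE : \forall y \near p, ~ skeleton (Some y) <-> y.1 <> p.1.
  apply: filterS sides => y [e1 e2 _ _]; rewrite not_skeleton e1 e2.
  have Z (v : R * R) : det v (p.1 - p.1) = 0 by rewrite det_sub; ring.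
  split=> [h yE|ne]; first by move: h; rewrite yE !Z eqxx => -[].
  apply: contrapT => h; apply: ne.
  have [_ _ d0] := crossing_dirs dD cr.
  have [] := @det_both0 R (dir (in_edge dD lo)) (dir (in_edge dD hi)) (y.1 - p.1) d0.
  - by apply/eqP/negPn/negP => h'; apply: h; left.
  - by apply/eqP/negPn/negP => h'; apply: h; right.
  move=> /= /eqP + /eqP; rewrite !subr_eq0 => /eqP f1 /eqP f2.
  by rewrite [LHS]surjective_pairing f1 f2 -surjective_pairing.
split=> [A /near_someP hA|kappa /near_someP hk].
  have /near3P[r r0 h] : \forall y \near p, A (Some y) /\ (~ skeleton (Some y) <-> y.1 <> p.1).
    by apply: filterS2 hA skE.
  pose y : R3 := ((p.1.1 + r / 2, p.1.2), p.2).
  have wy : within3 r p y.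
    have r2 : 0 < r / 2 by lra.
    by split; rewrite /y /= ?subrr ?normr0 // addrC addKr gtr0_norm //; lra.
  have [Ay sy] := h y wy; exists (Some y); split=> //; apply/sy => /(congr1 fst) /=; lra.
have /near3P[r r0 h] : \forall y \near p, (~ skeleton (Some y) ->
    \forall z \near (Some y : S3 R), kappa z = kappa (Some y)) /\ (~ skeleton (Some y) <-> y.1 <> p.1).
  by apply: filterS2 hk skE.
have {}hk y : within3 r p y -> y.1 <> p.1 -> \forall z \near y, kappa (Some z) = kappa (Some y).
  by move=> wy ne; have [h1 h2] := h y wy; exact: (h1 (h2.2 ne)).
pose C (i : bool * bool) : set R3 := [set y | within3 r p y /\
  0 < (if i.1 then (if i.2 then y.1.1 - p.1.1 else p.1.1 - y.1.1)
       else (if i.2 then y.1.2 - p.1.2 else p.1.2 - y.1.2))].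
have nC y : within3 r p y -> y.1 <> p.1 -> exists i, C i y.
  move=> wy ne; have := pair_neq_max ne; rewrite lt_max !normr_gt0 !subr_eq0 !neq_lt => /orP[]/orP[] l.
  - by exists (true, false); split=> //=; rewrite subr_gt0.
  - by exists (true, true); split=> //=; rewrite subr_gt0.
  - by exists (false, false); split=> //=; rewrite subr_gt0.
  - by exists (false, true); split=> //=; rewrite subr_gt0.
have Cn i y : C i y -> y.1 <> p.1.
  by case=> _ + yE; rewrite yE !subrr; case: i.1; case: i.2; rewrite ltxx.
pose b := r / 2; have b0 : 0 < b by rewrite /b; lra.
pose P (i j : R) : R3 := ((p.1.1 + i * b, p.1.2 + j * b), p.2).
have wP i j : `|i| <= 1 -> `|j| <= 1 -> within3 r p (P i j).
  move=> hi1 hj1; rewrite /P; split; rewrite /= ?subrr ?normr0 // addrC addKr normrM (gtr0_norm b0).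
    by apply: le_lt_trans (ler_wpM2r (ltW b0) hi1) _; rewrite mul1r /b; lra.
  by apply: le_lt_trans (ler_wpM2r (ltW b0) hj1) _; rewrite mul1r /b; lra.
have n1 : `|1 : R| <= 1 by rewrite normr1.
have nN1 : `|-1 : R| <= 1 by rewrite normrN normr1.
have key : forall i j x y, C i x -> C j y -> kappa (Some x) = kappa (Some y).
  apply: (@loc_const_union R _ G _ C (fun x => kappa (Some x)) (true, true)).
  - move=> i x y t [wx px] [wy py] t01; split; first exact: within3_cvx.
    rewrite /GRing.scale /=.
    have := cvx_gt0 t01 px py; congr (0 < _).
    by rewrite /GRing.scale /=; case: i.1; case: i.2; ring.
  - by move=> i x Cx; apply: hk; [case: Cx|exact: Cn Cx].
  - case=> -[] [].
    + by exists (true, true), (P 1 1), (P 1 1); split; split; rewrite /P /=; (try exact: wP); lra.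
    + by exists (false, true), (P (-1) 1), (P 1 1); split; split; rewrite /P /=; (try exact: wP); lra.
    + by exists (false, true), (P 1 1), (P 1 1); split; split; rewrite /P /=; (try exact: wP); lra.
    + by exists (true, true), (P 1 (-1)), (P 1 1); split; split; rewrite /P /=; (try exact: wP); lra.
exists (kappa (Some (P 1 1))); apply/near_someP; apply/near3P; exists r => // y wy.
have [_ sy] := h y wy; move=> /sy /nC[//|i iy].
apply: (key i (true, true)) => //; split; first exact: wP.
by rewrite /P /=; lra.
Qed.

Lemma skeleton_thin p : ~ sphere_support D p -> skeleton p -> thin G skeleton p.
Proof.
case: p => [p|] np sp; last exact: thin_infty.
have [s|s|[lo [hi [cr E lt]]]] := side_cases dD (graph_compl_some np).
- by have /not_skeleton : side D 1 p \/ side D (-1) p by left.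
- by have /not_skeleton : side D 1 p \/ side D (-1) p by right.
- exact: thin_mid cr E lt.
Qed.
End Thin.

Lemma trivializes_mull (T : topologicalType) (G : groupType) (U : set T) (c : T -> T -> G)
  (f : T -> G) (k : G) : trivializes U c f -> trivializes U c (fun x => k * f x)%g.
Proof.
by move=> h x Ux; have := h x Ux; apply: filterS => y ->; rewrite invgM !mulgA mulgVK.
Qed.

Lemma sphere_support_closed (R : realType) (D : diagram R) : open (~` sphere_support D).
Proof.
rewrite openE => -[x /graph_compl_some nx|_]; rewrite /interior; last first.
  apply/near_infty; split; first by case.
  exists (gbound D) => [|x xM [_ [e [k [k01 ->]]] [E]]]; first exact: gbound_gt0.
  have [h1 h2 h3] := gboundP e k01; move: xM.
  by rewrite -E norm3E !lt_max !ltNge !ltW.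
apply/near_someP; have := graph_open nx; apply: filterS => y ny [z gz [zy]].
by apply: ny; rewrite -zy.
Qed.

(** * Classification of the local systems over a given flow *)

Section Classify.
Variables (R : realType) (D : diagram R).
Hypothesis dD : is_diagram D.
Variables (A B : zmodType) (tw : twisting A B) (phi : edge D -> A).
Hypothesis phi_cons : conserved_at dD phi.
Hypothesis phi_under : forall lo hi, crossing lo hi -> phi (out_edge dD lo) = phi (in_edge dD lo).
Local Notation R3 := (R * R * R)%type.
Local Notation M := (gbound D).
Local Notation G := (semidirect tw).
Local Notation U := (~` sphere_support D).
Let pp := @plane_proj R D.
Let psi := potential phi.

Lemma psi_loc : loc_const_off_shadow D psi.
Proof. exact: potential_loc_const (conserved_planar phi_cons). Qed.

Lemma psi_jump e : psi (left_point dD (e, true)) - psi (left_point dD (e, false)) = phi e.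
Proof. exact: potential_jump (conserved_planar phi_cons). Qed.

Definition lift_pot (beta : R * R -> B) q : G := (psi q, beta q).
Definition flow_cocycle (nu : edge D -> B) := cocycle_of dD (lift_pot (potential nu)).
(** The local system with group A of the flow phi. By [cocycle_fst] it is the first component of the
    cocycle of every flow twisted by phi. *)
Definition chi x y : A := (cocycle_of dD (lift_pot (fun=> 0)) x y).1.

Lemma lift_pot_loc beta : loc_const_off_shadow D beta -> loc_const_off_shadow D (lift_pot beta).
Proof. by move=> lb q nq; apply: filterS2 (psi_loc nq) (lb q nq) => q' h1 h2; rewrite /lift_pot h1 h2. Qed.

Lemma cocycle_fst beta x y : (cocycle_of dD (lift_pot beta) x y).1 = chi x y.
Proof.
pose f (g : G) : G := (g.1, 0).
have fM g g' : f (g * g')%g = (f g * f g')%g by rewrite !sd_mulE /f /= act_0r addr0.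
have fV g : f (g^-1)%g = ((f g)^-1)%g by rewrite !sd_invE /f /= act_0r oppr0.
by have := cocycle_of_morph dD (lift_pot beta) fM fV x y => /(congr1 fst).
Qed.

Lemma flow_cocycle_germ nu : twisted_flow dD tw phi nu -> germ_cocycle U (flow_cocycle nu).
Proof.
move=> [nc nt]; have npl := conserved_planar nc.
have lp := potential_loc_const dD npl.
apply: cocycle_of_germ; first exact: lift_pot_loc.
apply/(crossing_relationE tw _ psi_loc psi_jump phi_under) => lo hi cr.
by rewrite /jump !potential_jump //; exact: nt.
Qed.

Lemma mid_not_graph lo hi (p : R3) : crossing lo hi -> pp lo = p.1 -> height lo < p.2 ->
  p.2 < height hi -> ~ graph_support D p.
Proof.
move=> cr E l1 l2 [e [k [k01 pE]]].
have E' : (edge_point e k).1 = pp lo by rewrite E pE.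
have [n [_ nE nP]] := ep_node_end dD k01 E'.
have hE : height n = p.2 by rewrite pE nP.
by have [nn|nn] := crossing_nodes dD cr nE; move: l1 l2; rewrite -hE nn ltxx.
Qed.

Lemma far_pt_not_shadow : ~ shadow D (M, M).
Proof.
apply: far_not_shadow; rewrite /Num.norm /= le_max; apply/orP; left.
exact: ler_norm.
Qed.

Lemma chi_below x : side D 1 x -> \forall y \near x, chi (Some x) (Some y) = 0.
Proof.
move=> sx; have := cocycle_below dD (lift_pot (fun=> 0)) sx.
by move=> /near_someP; apply: filterS => y; rewrite /chi => ->.
Qed.

Lemma chi_above x : side D (-1) x -> \forall y \near x, chi (Some x) (Some y) = - psi x.1 + psi y.1.
Proof.
have l0 : loc_const_off_shadow D (fun=> 0 : B) by move=> q _; exact: near_all.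
move=> sx; have := cocycle_above dD (lift_pot_loc l0) sx.
by apply: filterS => y; rewrite /chi => ->.
Qed.

Section Class.
Variables (c : S3 R -> S3 R -> G) (P : R3) (k : B).
Hypothesis c_germ : germ_cocycle U c.
Hypothesis c_fst : forall x, U x -> \forall y \near x, (c x y).1 = chi x y.
Hypothesis P_side : side D 1 P.

Let c3 (x y : R3) := c (Some x) (Some y).

Lemma side_compl sg x : side D sg x -> U (Some x).
Proof. by move=> sx [z gz [zx]]; apply: (side_not_graph sx); rewrite -zx. Qed.

Lemma c3_germ sg : germ_cocycle (side D sg) c3.
Proof. move=> p sp; exact: (c_germ (side_compl sp)). Qed.

Lemma below_triv : exists f : R3 -> G, [/\ trivializes (side D 1) c3 f,
  forall x, side D 1 x -> (f x).1 = 0 & f P = (0, k)].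
Proof.
have [g hg] := side_trivial (sg1 R) (c3_germ (sg := 1)).
have gc x y : side D 1 x -> side D 1 y -> (g x).1 = (g y).1.
  apply: (side_connected (f := fun x => (g x).1) (sg1 R)) => z sz.
  have h2 : \forall y \near z, (c3 z y).1 = chi (Some z) (Some y).
    exact: (c_fst (side_compl sz)).
  apply: filterS3 (hg z sz) h2 (chi_below sz) => z' e1 + e2.
  by rewrite e1 e2 sd_mulE sd_invE /= addrC => /eqP; rewrite subr_eq0 => /eqP.
exists (fun x => (((0, k) : G) * (g P)^-1) * g x)%g; split.
- exact: trivializes_mull.
- by move=> x sx; rewrite !sd_mulE sd_invE /= add0r (gc x P) ?addNr.
- by rewrite mulgVK.
Qed.

Lemma above_triv : exists f : R3 -> G, trivializes (side D (-1)) c3 f /\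
  forall x, side D (-1) x -> (f x).1 = psi x.1.
Proof.
have [g hg] := side_trivial (sgN1 R) (c3_germ (sg := -1)).
have gc x y : side D (-1) x -> side D (-1) y -> (g x).1 - psi x.1 = (g y).1 - psi y.1.
  apply: (side_connected (f := fun x => (g x).1 - psi x.1) (sgN1 R)) => z sz.
  have h2 : \forall y \near z, (c3 z y).1 = chi (Some z) (Some y).
    exact: (c_fst (side_compl sz)).
  apply: filterS3 (hg z sz) h2 (chi_above sz) => z' e1 + e2.
  rewrite e1 e2 sd_mulE sd_invE /= => e.
  have -> : (g z').1 = (g z).1 + (- (g z).1 + (g z').1) by rewrite addrA subrr add0r.
  by rewrite e !addrA addrK.
have [Q sQ] : exists Q : R3, side D (-1) Q.
  exists (pushed D (-1) 0); apply: far_side; [exact: sgN1|apply: ltW; exact: (pushed_half _ _ (sgN1 R))].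
exists (fun x => ((psi Q.1 - (g Q).1, 0) : G) * g x)%g; split.
  exact: trivializes_mull.
move=> x sx; rewrite sd_mulE /=; have := gc x Q sx sQ => /eqP.
by rewrite subr_eq => /eqP ->; rewrite addrA -opprB addNr add0r.
Qed.

(** A trivialization on one side and the chart at p differ by a left factor, constant on each half
    of a neighbourhood of p cut by the line of the strand; the sign of [j] selects the half. *)
Lemma half_loc (f : R3 -> G) (p : R3) (r : R) (v : R * R) (sg : R) (j : R) :
  trivializes (side D sg) c3 f ->
  (forall x, within3 r p x -> \forall y \near x, c3 x y = ((c3 p x)^-1 * c3 p y)%g) ->
  (forall x, within3 r p x -> det v (x.1 - p.1) != 0 -> side D sg x) ->
  forall x y, within3 r p x -> within3 r p y -> 0 < j * det v (x.1 - p.1) ->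
    0 < j * det v (y.1 - p.1) -> (f x * (c3 p x)^-1 = f y * (c3 p y)^-1)%g.
Proof.
move=> tf chart sd x y wx wy jx jy.
pose C : set R3 := [set x | within3 r p x /\ 0 < j * det v (x.1 - p.1)].
apply: (@loc_const_convex R R3 G C (fun x => (f x * (c3 p x)^-1)%g)) => //.
  move=> a b t [wa ja] [wb jb] t01; split; first exact: within3_cvx.
  have := cvx_gt0 t01 ja jb; rewrite /= -mulrBr mulrCA -mulrDr; congr (0 < _ * _).
  by rewrite det_cvx.
move=> z [wz jz]; have nz : det v (z.1 - p.1) != 0.
  by apply/eqP => e; move: jz; rewrite e mulr0 ltxx.
apply: filterS2 (tf z (sd z wz nz)) (chart z wz) => z' -> e _.
have -> : f z' = (f z * ((f z)^-1 * f z'))%g by rewrite mulgA mulgV mul1g.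
by rewrite e !mulgA mulgK.
Qed.

(** Over a region both trivializations are defined on the whole vertical line, so their quotient
    depends only on the projection. It is the transition function of the local system. *)
Lemma over_shadow_value (f1 f2 : R3 -> G) : trivializes (side D 1) c3 f1 ->
  trivializes (side D (-1)) c3 f2 ->
  (forall x, side D 1 x -> (f1 x).1 = 0) -> (forall x, side D (-1) x -> (f2 x).1 = psi x.1) ->
  exists2 beta, loc_const_off_shadow D beta &
    forall x, ~ shadow D x.1 -> (f2 x * (f1 x)^-1)%g = lift_pot beta x.1.
Proof.
move=> t1 t2 a1 a2; pose h (x : R3) := (f2 x * (f1 x)^-1)%g.
have hl x : ~ shadow D x.1 -> \forall y \near x, h y = h x.
  move=> nx; have s1 := not_shadow_side 1 nx; have s2 := not_shadow_side (-1) nx.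
  apply: filterS2 (t1 x s1) (t2 x s2) => y -> e.
  have -> : h y = (f2 x * ((f2 x)^-1 * f2 y) * (f1 y)^-1)%g by rewrite mulgA mulgV mul1g.
  by rewrite -e !mulgA mulgK.
have hv q z : ~ shadow D q -> h (q, z) = h (q, 0).
  move=> nq; apply: (@loc_const_convex R R G setT (fun z => h (q, z))) => // z' _.
  have zc : continuous_at (fun z : R => (q, z) : R3) z' by apply: cont_pair; ctn.
  by have := near_comp zc (hl (q, z') nq); apply: filterS.
exists (fun q => (h (q, 0)).2).
  move=> q nq; have qc : continuous_at (fun q : R * R => (q, 0) : R3) q by apply: cont_pair; ctn.
  by have := near_comp qc (hl (q, 0) nq); apply: filterS => q' e; congr (_.2); exact: e.
move=> x nx; rewrite -/(h x) [x]surjective_pairing hv //= [LHS]surjective_pairing; congr pair.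
rewrite /h sd_mulE sd_invE /=.
rewrite a2 ?a1 ?oppr0 ?addr0 //; exact: not_shadow_side.
Qed.

(** Around the segment of a crossing the cocycle has a single chart. The lower trivialization
    differs from it by [K1], constant on each side of the under strand, and the upper one by [K2],
    constant on each side of the over strand. The transition function is [K2 * K1^-1], so in its
    quotient across the under strand [K2] cancels. *)
Lemma over_shadow_relation (f1 f2 : R3 -> G) beta : trivializes (side D 1) c3 f1 ->
  trivializes (side D (-1)) c3 f2 -> loc_const_off_shadow D beta ->
  (forall x, ~ shadow D x.1 -> (f2 x * (f1 x)^-1)%g = lift_pot beta x.1) ->
  crossing_relation dD (lift_pot beta).
Proof.
move=> t1 t2 lb hE lo hi cr /=.
set u := in_edge dD lo; set w := out_edge dD lo; set vi := in_edge dD hi.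
have lt := andP cr; case: lt => _ lt.
have [p [pE l1 l2]] : exists p : R3, [/\ pp lo = p.1, height lo < p.2 & p.2 < height hi].
  by exists ((pp lo, (height lo + height hi) / 2) : R3); split=> //=; lra.
have Up : U (Some p).
  by move=> [z gz [zp]]; apply: (mid_not_graph cr pE l1 l2); rewrite -zp.
have chart0 : \forall x \near p, \forall y \near x, c3 x y = ((c3 p x)^-1 * c3 p y)%g.
  exact: (germ_cocycle_chart c_germ Up).
have sides := mid_sides dD cr pE l1 l2.
have /near3P[r r0 hr] : \forall x \near p, (\forall y \near x, c3 x y = ((c3 p x)^-1 * c3 p y)%g) /\
   ((det (dir u) (x.1 - p.1) != 0 -> side D 1 x) /\ (det (dir vi) (x.1 - p.1) != 0 -> side D (-1) x)).
  by apply: filterS2 chart0 sides => x h1 [[_ h2] [_ h3] _ _].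
have chart x : within3 r p x -> \forall y \near x, c3 x y = ((c3 p x)^-1 * c3 p y)%g.
  by move=> /hr[].
have sd1 x : within3 r p x -> det (dir u) (x.1 - p.1) != 0 -> side D 1 x by move=> /hr[_ []].
have sd2 x : within3 r p x -> det (dir vi) (x.1 - p.1) != 0 -> side D (-1) x by move=> /hr[_ []].
pose K1 (q : R * R) := (f1 (q, p.2) * (c3 p (q, p.2))^-1)%g.
pose K2 (q : R * R) := (f2 (q, p.2) * (c3 p (q, p.2))^-1)%g.
pose W : set (R * R) := [set q | within r p.1 q].
have nA : nbhs (pp lo) W.
  by rewrite pE; apply/near2P; exists r.
have wA q : W q -> within3 r p (q, p.2) by case=> a b; split; rewrite //= subrr normr0.
have hq q : W q -> det (dir u) (q - p.1) != 0 -> det (dir vi) (q - p.1) != 0 ->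
    lift_pot beta q = (K2 q * (K1 q)^-1)%g.
  move=> /wA wq n1 n2; rewrite -(hE (q, p.2)); last first.
    by apply: sides_not_shadow; [exact: sd1|exact: sd2].
  by rewrite /K1 /K2 invgM invgK !mulgA mulgVK.
have K1c q q' (j : R) : W q -> W q' -> 0 < j * det (dir u) (q - p.1) -> 0 < j * det (dir u) (q' - p.1) ->
    K1 q = K1 q'.
  by move=> /wA wq /wA wq' h1 h2; apply: (half_loc t1 chart sd1 wq wq' h1 h2).
have K2c q q' (j : R) : W q -> W q' -> 0 < j * det (dir vi) (q - p.1) -> 0 < j * det (dir vi) (q' - p.1) ->
    K2 q = K2 q'.
  by move=> /wA wq /wA wq' h1 h2; apply: (half_loc t2 chart sd2 wq wq' h1 h2).
have [[lo1 l10 dvo] [lw lw0 dw] d0] := crossing_dirs dD cr.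
rewrite -/u -/w -/vi in dvo dw d0.
pose sb (b : bool) : R := if b then 1 else -1.
have lhb := lift_pot_loc lb.
have pt d b : pp (dart_base d) = pp lo -> dart_dir (d.1, b) = sb b *: dir d.1 ->
    (exists2 l : R, 0 < l & dir d.1 = (l * (dir u).1, l * (dir u).2)) ->
    det (dir vi) (dart_dir d) != 0 ->
  exists q, [/\ W q, lift_pot beta (left_point dD (d.1, b)) = (K2 q * (K1 q)^-1)%g,
    0 < sb b * det (dir u) (q - p.1), det (dir vi) (q - p.1) != 0 &
    (0 < det (dir vi) (q - p.1)) = (0 < det (dir vi) (dart_dir d))].
  move=> bE ddE [l l0 dE] nv.
  have [q [Aq qE ql qn qs]] := crossing_side dD lhb b bE nA nv.
  move: ql qn qs; have -> : plane_proj lo = p.1 by exact: pE.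
  move=> ql qn qs; have su : 0 < sb b * det (dir u) (q - p.1).
    move: ql; rewrite ddE dE /det /GRing.scale /= /GRing.scale /= => ql.
    rewrite -(pmulr_rgt0 _ l0) /det; congr (0 < _): ql; ring.
  exists q; split => //; rewrite -qE; apply: hq => //.
  by apply/eqP => e; move: su; rewrite e mulr0 ltxx.
have ddb (e : edge D) b : dart_dir (e, b) = sb b *: dir e by case: b; rewrite /dart_dir /sb /= ?scale1r ?scaleN1r.
have pair_rel d : pp (dart_base d) = pp lo ->
    (exists2 l : R, 0 < l & dir d.1 = (l * (dir u).1, l * (dir u).2)) -> det (dir vi) (dart_dir d) != 0 ->
    exists q q', [/\ W q, W q', 0 < 1 * det (dir u) (q - p.1), 0 < -1 * det (dir u) (q' - p.1) &
      ((lift_pot beta (left_point dD (d.1, true)))^-1 * lift_pot beta (left_point dD (d.1, false)) =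
       K1 q * (K1 q')^-1)%g].
  move=> bE dE nv; have [q [Aq e1 s1 n1 z1]] := pt d true bE (ddb _ _) dE nv.
  have [q' [Aq' e2 s2 n2 z2]] := pt d false bE (ddb _ _) dE nv.
  exists q, q'; split => //.
  have -> : K1 q = (K1 q * ((K2 q)^-1 * K2 q'))%g.
    rewrite (K2c q q' (if 0 < det (dir vi) (dart_dir d) then 1 else -1)) ?mulVg ?mulg1 //.
      by move: z1; case: ifP => _ z1; rewrite ?mul1r ?z1 // mulN1r oppr_gt0 lt_neqAle n1 leNgt z1.
    by move: z2; case: ifP => _ z2; rewrite ?mul1r ?z2 // mulN1r oppr_gt0 lt_neqAle n2 leNgt z2.
  by rewrite e1 e2 invgM invgK !mulgA.
have [q1 [q2 [A1 A2 s1 s2 E1]]] : exists q q', [/\ W q, W q', 0 < 1 * det (dir u) (q - p.1),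
    0 < -1 * det (dir u) (q' - p.1) &
    ((lift_pot beta (left_point dD (w, true)))^-1 * lift_pot beta (left_point dD (w, false)) =
       K1 q * (K1 q')^-1)%g].
  apply: (pair_rel (w, true)).
  - by rewrite /dart_base /= /w out_edgeP.
  - by exists lw.
  - by rewrite -[dart_dir (w, true)]/(dir w) dw detZr mulf_eq0 negb_or d0 gt_eqF.
have [q3 [q4 [A3 A4 s3 s4 E2]]] : exists q q', [/\ W q, W q', 0 < 1 * det (dir u) (q - p.1),
    0 < -1 * det (dir u) (q' - p.1) &
    ((lift_pot beta (left_point dD (u, true)))^-1 * lift_pot beta (left_point dD (u, false)) =
       K1 q * (K1 q')^-1)%g].
  apply: (pair_rel (u, false)).
  - by rewrite /dart_base /= /u in_edgeP.
  - by exists 1; [exact: ltr01|rewrite !mul1r; exact: surjective_pairing].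
  - by rewrite -[dart_dir (u, false)]/(- dir u) detC detN opprK detC oppr_eq0.
rewrite E1 E2.
by rewrite (K1c q1 q3 1) // (K1c q2 q4 (-1)).
Qed.

(** The jumps of the transition function are the twisted flow. The transition function and the
    potential of its jumps differ by a constant, which is absorbed in the upper trivialization; the
    two trivializations then form a gauge off the skeleton. *)
Lemma classification : exists nu (f : S3 R -> G), [/\ twisted_flow dD tw phi nu,
  gauge U (flow_cocycle nu) c f, forall x, U x -> (f x).1 = 0 & f (Some P) = (0, k)].
Proof.
have [f1 [t1 a1 f1P]] := below_triv; have [f2 [t2 a2]] := above_triv.
have [beta lb hE] := over_shadow_value t1 t2 a1 a2.
have rel := over_shadow_relation t1 t2 lb hE.
pose nu := jump dD beta.
have nc : conserved_at dD nu by exact: jump_conserved.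
have nt : twisted_flow dD tw phi nu.
  by split=> //; apply/(crossing_relationE tw beta psi_loc psi_jump phi_under).
have npl := conserved_planar nc.
have lp := potential_loc_const dD npl.
pose b0 := beta (M, M) - potential nu (M, M).
have bE q : ~ shadow D q -> beta q = b0 + potential nu q.
  move=> nq; rewrite /b0.
  have -> : beta (M, M) - potential nu (M, M) = beta q - potential nu q; last by rewrite subrK.
  apply: (@zero_jump_const R D dD B (fun q => beta q - potential nu q)) => //.
  - by move=> p np; apply: filterS2 (lb p np) (lp p np) => p' -> ->.
  - move=> e; have := @potential_jump R D dD B nu e npl; rewrite /nu /jump => /esym/eqP.
    by rewrite subr_eq => /eqP ->; rewrite addrC !addrA addNr add0r addrC.
  - exact: far_pt_not_shadow.
pose hn := lift_pot (potential nu).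
pose f (z : S3 R) : G := if z is Some x then
  (if `[< side D 1 x >] then f1 x else (hn x.1)^-1 * (((0, - b0) : G) * f2 x))%g else 1%g.
have fB x : side D 1 x -> f (Some x) = f1 x by move=> s; rewrite /f asboolT.
have fA x : side D (-1) x -> f (Some x) = ((hn x.1)^-1 * (((0, - b0) : G) * f2 x))%g.
  move=> s2; rewrite /f; case: asboolP => // s1.
  have ns := sides_not_shadow s1 s2.
  have -> : f2 x = (lift_pot beta x.1 * f1 x)%g by rewrite -hE // mulgVK.
  have E : (((0, - b0) : G) * lift_pot beta x.1)%g = hn x.1.
    by rewrite sd_mulE /= act0 add0r /hn /lift_pot bE // addrA addNr add0r.
  by rewrite [X in (_ * X)%g]mulgA E mulKg.
have f_gauge : gauge (U `\` skeleton D) (flow_cocycle nu) c f.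
  case=> [x|] [Ux sk]; last by case: sk; case=> y _.
  have [s1|s2] : side D 1 x \/ side D (-1) x by apply/not_skeleton.
    have /near_someP e1 := cocycle_below dD hn s1.
    have e2 := t1 x s1; have e3 := side_open (sg1 R) s1.
    apply/near_someP; apply: filterS3 e1 e2 e3 => y h1 h2 s1'.
    by rewrite /flow_cocycle -/hn h1 !fB // mulg1; exact: h2.
  have e1 := cocycle_above dD (lift_pot_loc lp) s2; rewrite -/hn in e1.
  have e2 := t2 x s2; have e3 := side_open (sgN1 R) s2.
  apply/near_someP; apply: filterS3 e1 e2 e3 => y h1 h2 s2'.
  rewrite /flow_cocycle -/hn h1 !fA //; apply: (etrans h2).
  by rewrite !invgM !invgK !mulgA ?(mulgVK, mulgK).
have oU : open U by exact: sphere_support_closed.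
have [f' g' f'E] := gauge_extension oU (@skeleton_closed R D) (flow_cocycle_germ nt) c_germ f_gauge
   (fun p Up sp => skeleton_thin dD G Up sp).
exists nu, f'; split => //.
- have key x : U x -> ~ skeleton D x -> (f' x).1 = 0.
    case: x => [x|] Ux sk; last by case: sk; case=> y _.
    rewrite f'E //; have [s1|s2] : side D 1 x \/ side D (-1) x by apply/not_skeleton.
      by rewrite fB // a1.
    by rewrite fA // !sd_mulE sd_invE /= a2 // add0r addNr.
  (* On the skeleton, the vanishing of the first component is inherited from a nearby point off
     it. *)
  move=> x Ux; have [sx|] := pselect (skeleton D x); last exact: key.
  have hU : \forall y \near x, U y by exact: open_nbhs_nbhs.
  have e1 := c_fst Ux; have e2 := g' x Ux.
  have [y [[[h1 h2] h3] ny]] := (skeleton_thin dD G Ux sx).1 _ (filterI (filterI e1 e2) hU).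
  move: h2 => /(congr1 fst); rewrite h1 !sd_mulE sd_invE /= cocycle_fst (key y h3 ny) addr0.
  by move=> /eqP; rewrite -subr_eq subrr eq_sym oppr_eq0 => /eqP.
- rewrite f'E ?fB //; apply/not_skeleton; by left.
Qed.
End Class.
End Classify.
(** * Retraction of the complement of the graph *)

Section VectorContinuity.
Variables (R : realType) (T : topologicalType) (V : normedModType R) (p : T).

Lemma cont_addv (f g : T -> V) : continuous_at f p -> continuous_at g p ->
  continuous_at (fun x => f x + g x) p.
Proof. exact: continuousD. Qed.

Lemma cont_oppv (f : T -> V) : continuous_at f p -> continuous_at (fun x => - f x) p.
Proof. exact: continuousN. Qed.

Lemma cont_scalev (k : T -> R) (f : T -> V) : continuous_at k p -> continuous_at f p ->
  continuous_at (fun x => k x *: f x) p.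
Proof. by move=> kc fc; apply: cvgZ. Qed.

Lemma cont_sumv (I : finType) (f : I -> T -> V) : (forall i, continuous_at (f i) p) ->
  continuous_at (fun x => \sum_i f i x) p.
Proof.
move=> fc; elim: (index_enum I) => [|i r IH].
  under eq_fun do rewrite big_nil; exact: cont_cst.
under eq_fun do rewrite big_cons; exact: cont_addv.
Qed.
End VectorContinuity.

Section Push.
Variables (R : realType) (V : normedModType R).
Implicit Types (x a : V).

(** The displacement that carries x radially to the sphere of radius r around a; it vanishes outside
    the ball. *)
Definition repulse (r : R) a x : V := (Num.max 0 (r - `|x - a|) / `|x - a|) *: (x - a).

Lemma repulse_far r a x : r <= `|x - a| -> repulse r a x = 0.
Proof. by move=> h; rewrite /repulse max_l ?mul0r ?scale0r // subr_le0. Qed.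

Lemma repulse_near r a x (t : R) : x != a -> `|x - a| < r -> 0 <= t <= 1 ->
  exists2 l : R, 1 <= l & [/\ x + t *: repulse r a x = a + l *: (x - a),
    l * `|x - a| <= r & t = 1 -> l * `|x - a| = r].
Proof.
move=> xa lt /andP[t0 t1]; have n0 : 0 < `|x - a| by rewrite normr_gt0 subr_eq0.
have n0' : `|x - a| != 0 by rewrite gt_eqF.
exists (1 + t * ((r - `|x - a|) / `|x - a|)).
  by rewrite lerDl mulr_ge0 // divr_ge0 ?ltW // subr_gt0.
have E : (1 + t * ((r - `|x - a|) / `|x - a|)) * `|x - a| = `|x - a| + t * (r - `|x - a|).
  by rewrite mulrDl mul1r -mulrA divfK.
split.
- rewrite /repulse max_r ?subr_ge0 ?(ltW lt) // scalerA scalerDl scale1r addrA.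
  by rewrite (addrC a) subrK.
- rewrite E; have : t * (r - `|x - a|) <= 1 * (r - `|x - a|) by rewrite ler_wpM2r // subr_ge0 ltW.
  by lra.
- by rewrite E => ->; rewrite mul1r addrC subrK.
Qed.

Lemma repulse_cont (T : topologicalType) r (f g : T -> V) p : continuous_at f p ->
  continuous_at g p -> f p != g p -> continuous_at (fun z => repulse r (g z) (f z)) p.
Proof.
move=> fc gc ne; have dc : continuous_at (fun z => f z - g z) p by apply: cont_addv => //; apply: cont_oppv.
have nc : continuous_at (fun z => `|f z - g z|) p by apply: cont_norm.
apply: cont_scalev => //; apply: cont_mul.
  by apply: cont_max; [exact: cont_cst|apply: cont_add; [exact: cont_cst|exact: cont_opp]].
by apply: cont_inv => //; rewrite normr_eq0 subr_eq0.
Qed.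

Lemma sum_repulse_one (I : finType) r (a : I -> V) i x :
  (forall j, j != i -> r <= `|x - a j|) -> \sum_j repulse r (a j) x = repulse r (a i) x.
Proof.
by move=> h; rewrite (bigD1 i) //= big1 ?addr0 // => j /h /repulse_far.
Qed.
End Push.

Section EdgeProjection.
Variables (R : realType) (D : diagram R).
Hypothesis dD : is_diagram D.
Local Notation R3 := (R * R * R)%type.
Implicit Types (e : edge D) (x y : R3).
Let pp := @plane_proj R D.

Definition edge_vec e : R3 := pos (tgt e) - pos (src e).

Lemma edge_pointV e k : edge_point e k = pos (src e) + k *: edge_vec e.
Proof. by rewrite /edge_point /edge_vec; case: (pos (src e)) => -[]; case: (pos (tgt e)) => -[]. Qed.

(** A dilation centred on an edge does not bring points closer to that edge: undoing it moves the
    point of comparison towards the centre, and by convexity it stays on the edge. *)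
Lemma edge_point_scale e k k' (l : R) x : 0 <= k <= 1 -> 0 <= k' <= 1 -> 1 <= l ->
  exists2 k'' : R, 0 <= k'' <= 1 &
    `|edge_point e k + l *: (x - edge_point e k) - edge_point e k'| = l * `|x - edge_point e k''|.
Proof.
move=> /andP[k0 k1] /andP[k'0 k'1] l1; have l0 : 0 < l by lra.
exists (k + l^-1 * (k' - k)).
  have i0 : 0 <= l^-1 <= 1 by rewrite invr_ge0 ltW //= invf_le1.
  have -> : k + l^-1 * (k' - k) = (1 - l^-1) * k + l^-1 * k' by ring.
  move: i0 => /andP[i0 i1]; apply/andP; split.
    by rewrite addr_ge0 // mulr_ge0 // subr_ge0.
  have h1 : (1 - l^-1) * k <= (1 - l^-1) * 1 by rewrite ler_wpM2l // subr_ge0.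
  have h2 : l^-1 * k' <= l^-1 * 1 by rewrite ler_wpM2l.
  by move: h1 h2; rewrite !mulr1 => h1 h2; lra.
rewrite -{2}(gtr0_norm l0) -normrZ; congr (`|_|).
have ln : l != 0 by rewrite gt_eqF.
have -> : edge_point e (k + l^-1 * (k' - k)) =
    edge_point e k + l^-1 *: (edge_point e k' - edge_point e k).
  by rewrite !edge_pointV opprD addrACA subrr add0r -scalerBl scalerA -addrA -scalerDl.
set a := edge_point e k; set b := edge_point e k'.
rewrite [in RHS]opprD [in RHS]addrA [in RHS]scalerBr scalerA divff // scale1r opprB.
by rewrite [RHS]addrA [X in _ = X - _]addrC.
Qed.

(** The Euclidean projection of the planar coordinates, not the nearest point for the sup norm.
    Edges are never vertical, so this gives a Lipschitz retraction onto the edge; the constant K of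
    [edge_proj_lip] measures what is lost. *)
Definition edge_coord e x : R :=
  clamp (dot (x.1 - pp (src e)) (dir e) / ((dir e).1 ^+ 2 + (dir e).2 ^+ 2)).

Definition edge_proj e x : R3 := edge_point e (edge_coord e x).

Lemma edge_proj_on e x : exists2 k, 0 <= k <= 1 & edge_proj e x = edge_point e k.
Proof. by exists (edge_coord e x) => //; exact: clamp_itv. Qed.

Lemma edge_proj_id e k : 0 <= k <= 1 -> edge_proj e (edge_point e k) = edge_point e k.
Proof.
move=> /andP[k0 k1]; rewrite /edge_proj /edge_coord; congr (edge_point e _).
have -> : dot ((edge_point e k).1 - pp (src e)) (dir e) = k * ((dir e).1 ^+ 2 + (dir e).2 ^+ 2).
  by rewrite edge_pointE /dot /=; ring.
rewrite mulfK ?gt_eqF ?dir_sqr_gt0 // /clamp.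
by rewrite (min_r k1) (max_r k0).
Qed.

Lemma clamp_lip (s t : R) : `|clamp s - clamp t| <= `|s - t|.
Proof.
rewrite /clamp; have [s0|s0] := leP s 0; have [t0|t0] := leP t 0.
- by rewrite !max_l ?subrr ?normr0 // ge_min ?s0 ?t0 orbT.
- rewrite (max_l (x := 0) (y := Num.min 1 s)) ?ge_min ?s0 ?orbT // sub0r normrN.
  rewrite distrC ger0_norm ?le_max ?lexx // ger0_norm; last lra.
  by rewrite ge_max ge_min; apply/andP; split; [lra|apply/orP; right; lra].
- rewrite (max_l (x := 0) (y := Num.min 1 t)) ?ge_min ?t0 ?orbT // subr0.
  rewrite ger0_norm ?le_max ?lexx // ger0_norm; last lra.
  by rewrite ge_max ge_min; apply/andP; split; [lra|apply/orP; right; lra].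
rewrite !max_r ?le_min ?ler01 ?(ltW s0) ?(ltW t0) //.
have [s1|s1] := leP 1 s; have [t1|t1] := leP 1 t.
- by rewrite subrr normr0.
- by rewrite !ger0_norm; lra.
- by rewrite distrC (distrC s) !ger0_norm; lra.
- by [].
Qed.

(** The projection fixes the points of the edge and is Lipschitz, so the distance to the projected
    point is at most 1 plus the Lipschitz constant times the distance to any point of the edge. The
    sum over all edges makes the constant uniform. *)
Lemma edge_proj_lip : exists2 K : R, 1 <= K & forall e x (k : R), 0 <= k <= 1 ->
  `|x - edge_proj e x| <= K * `|x - edge_point e k|.
Proof.
pose n e := (dir e).1 ^+ 2 + (dir e).2 ^+ 2.
have n0 e : 0 < n e by exact: dir_sqr_gt0.
pose L e := (`|(dir e).1| + `|(dir e).2|) / n e * `|edge_vec e|.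
have L0 e : 0 <= L e.
  by apply: mulr_ge0 => //; apply: divr_ge0; [exact: addr_ge0|exact: ltW (n0 e)].
have lip e x y : `|edge_proj e x - edge_proj e y| <= L e * `|x - y|.
  rewrite /edge_proj !edge_pointV opprD addrACA subrr add0r -scalerBl normrZ.
  rewrite /L mulrAC ler_wpM2r //; apply: le_trans (clamp_lip _ _) _.
  rewrite -mulrBl normrM [X in _ * X]ger0_norm ?invr_ge0 ?(ltW (n0 e)) //.
  rewrite mulrAC ler_wpM2r ?invr_ge0 ?(ltW (n0 e)) //.
  have -> : dot (x.1 - pp (src e)) (dir e) - dot (y.1 - pp (src e)) (dir e) =
     (x.1.1 - y.1.1) * (dir e).1 + (x.1.2 - y.1.2) * (dir e).2 by rewrite /dot /=; ring.
  apply: le_trans (ler_normD _ _) _; rewrite !normrM mulrDl; apply: lerD.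
    by rewrite mulrC ler_wpM2l // norm3E !le_max lexx.
  by rewrite mulrC ler_wpM2l // norm3E !le_max lexx orbT.
exists (1 + \sum_e L e); first by rewrite lerDl sumr_ge0.
move=> e x k k01; have {1}-> : x - edge_proj e x = (x - edge_point e k) + (edge_point e k - edge_proj e x).
  by rewrite addrA subrK.
apply: le_trans (ler_normD _ _) _; rewrite mulrDl mul1r lerD2l.
rewrite -{1}(edge_proj_id e k01) distrC; apply: le_trans (lip _ _ _) _.
by rewrite ler_wpM2r // (bigD1 e) //= lerDl sumr_ge0.
Qed.

Lemma edge_proj_cont (T : topologicalType) (f : T -> R3) e p : continuous_at f p ->
  continuous_at (fun z => edge_proj e (f z)) p.
Proof.
move=> fc; rewrite /edge_proj /edge_coord /edge_point /dot /clamp /=.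
have := dir_sqr_gt0 dD e => n0.
by apply: cont_pair; [apply: cont_pair|]; ctn.
Qed.

Lemma pos_inj : injective (@pos R D).
Proof.
move=> x y E; apply: contrapT => ne; have [_ _ _ _ h] := dD.
have pE : plane_proj x = plane_proj y by rewrite /plane_proj E.
by have [_ _ hh _] := h x y ne pE; apply: hh; rewrite /height E.
Qed.

Lemma edge_meet_node e e' k k' : e <> e' -> 0 <= k <= 1 -> 0 <= k' <= 1 ->
  edge_point e k = edge_point e' k' -> exists v : node D, edge_point e k = pos v.
Proof.
move=> ne k01 k'01 E; have [ki|//] := edge_node_or_interior e k01.
by case: ne; apply: (ep_interior_unique dD ki k'01); rewrite E.
Qed.

(* [r] is the radius of the balls around the nodes, [K * eta] bounds the
   thickness of the tubes around the edges away from these balls. *)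
Lemma push_constants : exists r K eta : R, [/\ 0 < r <= 1 /\ 1 <= K, 0 < eta < r / 2,
  (forall v w : node D, v != w -> 2 * r <= `|pos v - pos w|) /\
  (forall (v : node D) e (k : R), ~ incident e v -> 0 <= k <= 1 -> 2 * r < `|pos v - edge_point e k|),
  forall e x (k : R), 0 <= k <= 1 -> `|x - edge_proj e x| <= K * `|x - edge_point e k| &
  forall e e' (k : R), e <> e' -> 0 <= k <= 1 -> (forall v : node D, r / 2 <= `|edge_point e k - pos v|) ->
    2 * K * eta < `|edge_point e k - edge_proj e' (edge_point e k)|].
Proof.
have [K K1 hK] := edge_proj_lip.
have [r1 r10 h1] := @finite_pos R _ (fun vw : node D * node D => if vw.1 != vw.2 then `|pos vw.1 - pos vw.2| else 1)
  ltac:(by case=> v w /=; case: ifP => // ne; rewrite normr_gt0 subr_eq0 (inj_eq pos_inj)).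
have pos_ve v e : exists2 r : R, 0 < r & ~ incident e v -> forall k, 0 <= k <= 1 -> r <= `|pos v - edge_point e k|.
  have [i|ni] := pselect (incident e v); first by exists 1.
  have [k|k k01|r r0 h] := @compact_pos R (fun k => `|pos v - edge_point e k|); last by exists r.
    by apply: cont_norm; apply: cont_addv; [exact: cont_cst|apply: cont_oppv; exact: edge_cont].
  rewrite normr_gt0 subr_eq0; apply/eqP => E; apply: ni.
  have E1 : (edge_point e k).1 = plane_proj v by rewrite -E.
  have [n [i _ nE]] := ep_node_end dD k01 E1.
  by have <- : n = v by apply: pos_inj; rewrite -nE E.
have /choice [r2 h2] (ve : node D * edge D) : exists r : R, 0 < r /\ (~ incident ve.2 ve.1 -> forall k, 0 <= k <= 1 -> r <= `|pos ve.1 - edge_point ve.2 k|).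
  by have [r r0 h] := pos_ve ve.1 ve.2; exists r.
have [r3 r30 h3] := finite_pos (fun ve => (h2 ve).1).
pose r := Num.min 1 (Num.min (r1 / 2) (r3 / 4)).
have r0 : 0 < r by rewrite !lt_min ltr01 !divr_gt0.
have rle1 : r <= 1 by rewrite ge_min lexx.
have rle2 : 2 * r <= r1 by have : r <= r1 / 2 by [rewrite !ge_min lexx orbT]; lra.
have rle3 : 4 * r <= r3 by have : r <= r3 / 4 by [rewrite !ge_min lexx !orbT]; lra.
have pos_ee (ee : edge D * edge D) : exists r' : R, 0 < r' /\ (ee.1 <> ee.2 -> forall k, 0 <= k <= 1 ->
    (forall v : node D, r / 2 <= `|edge_point ee.1 k - pos v|) -> r' <= `|edge_point ee.1 k - edge_proj ee.2 (edge_point ee.1 k)|).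
  case: ee => e e' /=; have [ee'|ne] := pselect (e = e'); first by exists 1.
  (* The sum is positive only within [r / 2] of a node, where two edges may meet. It makes [m]
     positive on the whole compact edge, and away from the nodes [m] is the distance to be
     bounded. *)
  pose m (k : R) : R := `|edge_point e k - edge_proj e' (edge_point e k)| + \sum_(v : node D) Num.max 0 (r / 2 - `|edge_point e k - pos v|).
  have [k|k k01|r' r'0 h] := @compact_pos R m.
  - apply: cont_add.
      apply: cont_norm; apply: cont_addv; first exact: edge_cont.
      by apply: cont_oppv; apply: edge_proj_cont; exact: edge_cont.
    apply: cont_sum => v; apply: cont_max; first exact: cont_cst.
    apply: cont_add; first exact: cont_cst.
    apply: cont_opp; apply: cont_norm; apply: cont_addv; [exact: edge_cont|exact: cont_cst].
  - have s0 : 0 <= \sum_(v : node D) Num.max 0 (r / 2 - `|edge_point e k - pos v|).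
      by apply: sumr_ge0 => v _; rewrite le_max lexx.
    have [E|ne0] := eqVneq (edge_point e k) (edge_proj e' (edge_point e k)); last first.
      by apply: ltr_wpDr => //; rewrite normr_gt0 subr_eq0.
    have [k' k'01 E'] := edge_proj_on e' (edge_point e k).
    have [v vE] := edge_meet_node ne k01 k'01 (etrans E E').
    apply: ltr_wpDl => //; rewrite (bigD1 v) //=.
    apply: ltr_pwDl; last by apply: sumr_ge0 => w _; rewrite le_max lexx.
    by rewrite vE subrr normr0 subr0 lt_max divr_gt0 ?orbT.
  exists r'; split=> // _ k k01 far; have := h k k01; rewrite /m big1 ?addr0 // => v _.
  by rewrite max_l // subr_le0.
have /choice [r4 h4] := pos_ee.
have [r5 r50 h5] := finite_pos (fun ee => (h4 ee).1).
have K0 : 0 < K by lra.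
have K20 : 0 < 4 * K by lra.
(* The bound [r / 4] makes the tubes thin compared with the balls, and [r5 / (4 * K)] keeps tubes
   around different edges apart outside the balls. *)
pose eta := Num.min (r / 4) (r5 / (4 * K)).
have eta0 : 0 < eta by rewrite lt_min !divr_gt0.
have le1 : eta <= r / 4 by rewrite ge_min lexx.
have le2 : 2 * K * eta < r5.
  have : eta * (4 * K) <= r5 by rewrite -ler_pdivlMr // ge_min lexx orbT.
  have : 0 < K * eta by rewrite mulr_gt0.
  lra.
exists r, K, eta; split => //.
- by rewrite r0.
- by apply/andP; split=> //; lra.
- split=> [v w ne|v e k ni k01].
    by have := h1 (v, w); rewrite /= ne; lra.
  by have := (h2 (v, e)).2 ni k k01; have := h3 (v, e) => /=; lra.
- move=> e e' k ne k01 far; have := (h4 (e, e')).2 ne k k01 far; have := h5 (e, e') => /=.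
  lra.
Qed.

Section Push.
Variables r K eta : R.
Hypotheses (r01 : 0 < r <= 1) (K1 : 1 <= K) (eta_itv : 0 < eta < r / 2).
Hypothesis nodes_far : forall v w : node D, v != w -> 2 * r <= `|pos v - pos w|.
Hypothesis node_edge_far : forall (v : node D) e (k : R), ~ incident e v -> 0 <= k <= 1 ->
  2 * r < `|pos v - edge_point e k|.
Hypothesis proj_le : forall e x (k : R), 0 <= k <= 1 ->
  `|x - edge_proj e x| <= K * `|x - edge_point e k|.
Hypothesis edges_far : forall e e' (k : R), e <> e' -> 0 <= k <= 1 ->
  (forall v : node D, r / 2 <= `|edge_point e k - pos v|) ->
  2 * K * eta < `|edge_point e k - edge_proj e' (edge_point e k)|.

(** Near a node the tubes of its edges overlap, so points are expelled from the balls around the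
    nodes before they are expelled from the tubes. In the second phase at most one edge acts on a
    given point. *)
Definition node_push t x : R3 := x + t *: \sum_(v : node D) repulse r (pos v) x.
Definition tube_push t x : R3 := x + t *: \sum_e repulse eta (edge_proj e x) x.
Definition push t x : R3 := tube_push (clamp (2 * t - 1)) (node_push (clamp (2 * t)) x).

Lemma node_edge_point e v : incident e v -> exists2 k : R, 0 <= k <= 1 & pos v = edge_point e k.
Proof.
case=> <-.
  exists 0; first by rewrite lexx ler01.
  by rewrite edge_pointV scale0r addr0.
exists 1; first by rewrite lexx ler01.
by rewrite edge_pointV scale1r /edge_vec addrC subrK.
Qed.

Lemma node_graph (v : node D) : graph_support D (pos v).
Proof.
have [k k01 E] : exists2 k : R, 0 <= k <= 1 & pos v = edge_point (out_edge dD v) k.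
  by apply: node_edge_point; left; exact: out_edgeP.
by exists (out_edge dD v), k.
Qed.

Lemma dist_le3 (a b c : R3) : `|a - c| <= `|a - b| + `|b - c|.
Proof. by rewrite -{1}(subrK b a) -addrA ler_normD. Qed.

Lemma node_push_cases t x : 0 <= t <= 1 -> ~ graph_support D x ->
  (node_push t x = x /\ forall v : node D, r <= `|x - pos v|) \/
  exists (v : node D) (l : R), [/\ 1 <= l, `|x - pos v| < r, node_push t x = pos v + l *: (x - pos v),
    l * `|x - pos v| <= r & t = 1 -> l * `|x - pos v| = r].
Proof.
move=> t01 nx.
have [[v lt]|no] := pselect (exists v : node D, `|x - pos v| < r); last first.
  have far (v : node D) : r <= `|x - pos v| by rewrite leNgt; apply/negP => h; apply: no; exists v.
  left; split => //; rewrite /node_push big1 ?scaler0 ?addr0 // => v _.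
  exact: repulse_far.
right; have xv : x != pos v by apply/eqP => E; apply: nx; rewrite E; exact: node_graph.
have [l l1 [h1 h2 h3]] := repulse_near xv lt t01.
exists v, l; split => //; rewrite /node_push (sum_repulse_one (i := v)) // => w wv.
have := nodes_far wv; have := dist_le3 (pos w) x (pos v); rewrite (distrC (pos w) x); lra.
Qed.

(** For an edge that ends at the node the motion is a dilation centred on the edge; any other edge
    is out of reach of the ball. *)
Lemma node_push_dist t x e (k' : R) : 0 <= t <= 1 -> ~ graph_support D x -> 0 <= k' <= 1 ->
  (exists2 k : R, 0 <= k <= 1 & `|x - edge_point e k| <= `|node_push t x - edge_point e k'|) \/
  r < `|node_push t x - edge_point e k'|.
Proof.
move=> t01 nx k'01; have [[-> _]|[v [l [l1 lt -> lr _]]]] := node_push_cases t01 nx.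
  by left; exists k'.
have [i|ni] := pselect (incident e v); [left|right].
  have [k k01 ->] := node_edge_point i.
  have [k2 k201 ->] := edge_point_scale e x k01 k'01 l1.
  by exists k2 => //; rewrite ler_peMl.
have := node_edge_far ni k'01; have := dist_le3 (pos v) (pos v + l *: (x - pos v)) (edge_point e k').
have -> : `|pos v - (pos v + l *: (x - pos v))| = l * `|x - pos v|.
  by rewrite opprD addrA subrr add0r normrN normrZ ger0_norm //; lra.
lra.
Qed.

Lemma node_push1 x (v : node D) : ~ graph_support D x -> r <= `|node_push 1 x - pos v|.
Proof.
have one : 0 <= (1 : R) <= 1 by rewrite ler01 lexx.
move=> nx; have [[-> //]|[w [l [l1 lt -> _ /(_ erefl) lr]]]] := node_push_cases one nx.
have E : `|pos w + l *: (x - pos w) - pos w| = r.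
  by rewrite addrC addrA addNr add0r normrZ ger0_norm //; lra.
have [->|vw] := eqVneq v w; first by rewrite E.
have := nodes_far vw; have := dist_le3 (pos v) (pos w + l *: (x - pos w)) (pos w).
by rewrite E (distrC (pos v) (pos w + l *: (x - pos w))); lra.
Qed.

Lemma tube_push_cases t x : 0 <= t <= 1 -> ~ graph_support D x ->
  (forall v : node D, r <= `|x - pos v|) ->
  (tube_push t x = x /\ forall e, eta <= `|x - edge_proj e x|) \/
  exists e (l : R), [/\ 1 <= l, tube_push t x = edge_proj e x + l *: (x - edge_proj e x),
    l * `|x - edge_proj e x| <= eta, t = 1 -> l * `|x - edge_proj e x| = eta &
    forall e' (k : R), e <> e' -> 0 <= k <= 1 -> 2 * eta < `|edge_proj e x - edge_point e' k|].
Proof.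
move=> t01 nx far; have /andP[eta0 eta_r] := eta_itv.
have [[e lt]|no] := pselect (exists e, `|x - edge_proj e x| < eta); last first.
  have fare e : eta <= `|x - edge_proj e x| by rewrite leNgt; apply/negP => h; apply: no; exists e.
  left; split => //; rewrite /tube_push big1 ?scaler0 ?addr0 // => e _.
  exact: repulse_far.
right; have [k k01 pE] := edge_proj_on e x.
have xe : x != edge_proj e x by apply/eqP => E; apply: nx; rewrite E pE; exists e, k.
have [l l1 [h1 h2 h3]] := repulse_near xe lt t01.
have pfar (v : node D) : r / 2 <= `|edge_point e k - pos v|.
  have := far v; have := dist_le3 x (edge_proj e x) (pos v); rewrite -pE; lra.
have pe e' (k' : R) : e <> e' -> 0 <= k' <= 1 -> 2 * eta < `|edge_proj e x - edge_point e' k'|.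
  move=> ne k'01; have := edges_far ne k01 pfar; have := proj_le e' (edge_point e k) k'01.
  rewrite -pE => i1 i2; have K0 : 0 < K := lt_le_trans ltr01 K1.
  by rewrite -(ltr_pM2l K0); apply: lt_le_trans i1; rewrite mulrCA mulrA.
exists e, l; split => //; rewrite /tube_push (sum_repulse_one (i := e)) // => e' e'e.
rewrite leNgt; apply/negP => lt'.
have [k2 k201 pE2] := edge_proj_on e' x.
have ne : e <> e' by move=> E; move: e'e; rewrite E eqxx.
have := pe e' k2 ne k201; rewrite -pE2; have := dist_le3 (edge_proj e x) x (edge_proj e' x).
rewrite (distrC (edge_proj e x) x); lra.
Qed.

Lemma tube_push_other (l : R) x e e' (k : R) : 1 <= l -> l * `|x - edge_proj e x| <= eta ->
  2 * eta < `|edge_proj e x - edge_point e' k| ->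
  eta < `|edge_proj e x + l *: (x - edge_proj e x) - edge_point e' k|.
Proof.
move=> l1 h1 h2; have := dist_le3 (edge_proj e x) (edge_proj e x + l *: (x - edge_proj e x)) (edge_point e' k).
have -> : `|edge_proj e x - (edge_proj e x + l *: (x - edge_proj e x))| = l * `|x - edge_proj e x|.
  by rewrite opprD addrA subrr add0r normrN normrZ ger0_norm //; lra.
lra.
Qed.

Lemma tube_push_dist t x e (k' : R) : 0 <= t <= 1 -> ~ graph_support D x ->
  (forall v : node D, r <= `|x - pos v|) -> 0 <= k' <= 1 ->
  (exists2 k : R, 0 <= k <= 1 & `|x - edge_point e k| <= `|tube_push t x - edge_point e k'|) \/
  eta < `|tube_push t x - edge_point e k'|.
Proof.
move=> t01 nx far k'01; have [[-> _]|[e0 [l [l1 -> le _ ne]]]] := tube_push_cases t01 nx far.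
  by left; exists k'.
have [E|ee] := pselect (e0 = e); [left|right].
  have [k k01 ->] := edge_proj_on e0 x; rewrite E.
  have [k2 k201 ->] := edge_point_scale e x k01 k'01 l1.
  by exists k2 => //; rewrite ler_peMl.
by apply: tube_push_other => //; exact: ne.
Qed.

Lemma tube_push1 x e (k' : R) : ~ graph_support D x -> (forall v : node D, r <= `|x - pos v|) ->
  0 <= k' <= 1 -> eta / K <= `|tube_push 1 x - edge_point e k'|.
Proof.
have one : 0 <= (1 : R) <= 1 by rewrite ler01 lexx.
have K0 : 0 < K := lt_le_trans ltr01 K1.
have /andP[eta0 _] := eta_itv.
move=> nx far k'01; rewrite ler_pdivrMr // mulrC.
have [[-> h]|[e0 [l [l1 -> le /(_ erefl) lE ne]]]] := tube_push_cases one nx far.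
  by apply: le_trans (h e) _; exact: proj_le.
have [E|ee] := pselect (e0 = e).
  have [k k01 pE] := edge_proj_on e0 x; rewrite pE E.
  have [k2 k201 ->] := edge_point_scale e x k01 k'01 l1.
  rewrite -lE mulrCA ler_wpM2l //; first by lra.
  by rewrite E; exact: proj_le.
have := tube_push_other l1 le (ne e k' ee k'01).
by move=> h; apply: le_trans (ltW h) _; rewrite ler_peMl.
Qed.

Lemma not_graph_dist x : ~ graph_support D x <-> forall e (k : R), 0 <= k <= 1 -> 0 < `|x - edge_point e k|.
Proof.
split=> [nx e k k01|h [e [k [k01 E]]]]; last by have := h e k k01; rewrite E subrr normr0 ltxx.
by rewrite normr_gt0 subr_eq0; apply/eqP => E; apply: nx; exists e, k.
Qed.

Lemma node_push_graph t x : 0 <= t <= 1 -> ~ graph_support D x -> ~ graph_support D (node_push t x).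
Proof.
move=> t01 nx; apply/not_graph_dist => e k k01; have /andP[r0 _] := r01.
have [[k' k'01 le]|] := node_push_dist e t01 nx k01; last exact: lt_trans.
by apply: lt_le_trans le; move/not_graph_dist: nx; apply.
Qed.

(** This alternative makes the complement of every sufficiently thin neighbourhood of the graph
    invariant under the whole homotopy. *)
Lemma push_dist t x e (k' : R) : ~ graph_support D x -> 0 <= k' <= 1 ->
  (exists2 k : R, 0 <= k <= 1 & `|x - edge_point e k| <= `|push t x - edge_point e k'|) \/
  eta < `|push t x - edge_point e k'|.
Proof.
move=> nx k'01; have /andP[r0 _] := r01; have /andP[eta0 eta_r] := eta_itv; rewrite /push.
set s := clamp (2 * t); set s' := clamp (2 * t - 1).
have s01 : 0 <= s <= 1 := clamp_itv _; have s'01 : 0 <= s' <= 1 := clamp_itv _.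
have ny := node_push_graph s01 nx.
have [k [k01 le]] : exists k : R, 0 <= k <= 1 /\
    (`|node_push s x - edge_point e k| <= `|tube_push s' (node_push s x) - edge_point e k'| \/
     eta < `|tube_push s' (node_push s x) - edge_point e k'|).
  have [le|gt] := leP (2 * t) 1.
    exists k'; split => //; left; rewrite /s' clamp0; last by rewrite subr_le0.
    by rewrite /tube_push scale0r addr0.
  have E : s = 1 by rewrite /s clamp1 // ltW.
  have far (v : node D) : r <= `|node_push s x - pos v| by rewrite E; exact: node_push1.
  by have [[k k01 le]|h] := tube_push_dist e s'01 ny far k'01; [exists k|exists k']; split=> //; [left|right].
case: le => [le|]; last by right.
have [[k2 k201 le2]|lt] := node_push_dist e s01 nx k01.
  by left; exists k2 => //; apply: le_trans le.
by right; apply: lt_le_trans le; apply: lt_trans lt; lra.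
Qed.

Lemma push1 x e (k' : R) : ~ graph_support D x -> 0 <= k' <= 1 ->
  eta / K <= `|push 1 x - edge_point e k'|.
Proof.
move=> nx k'01; rewrite /push.
have -> : clamp (2 * 1 : R) = 1 by rewrite clamp1 //; lra.
have -> : clamp (2 * 1 - 1 : R) = 1 by rewrite clamp1 //; lra.
have one : 0 <= (1 : R) <= 1 by rewrite ler01 lexx.
by apply: tube_push1 => //; [exact: node_push_graph|move=> v; exact: node_push1].
Qed.

Lemma push0 x : push 0 x = x.
Proof.
rewrite /push clamp0; last lra.
by rewrite /tube_push scale0r addr0 /node_push clamp0 ?mulr0 // scale0r addr0.
Qed.

Lemma push_far t x : gbound D + 1 < `|x| -> push t x = x.
Proof.
have /andP[r0 r1] := r01; have /andP[eta0 eta_r] := eta_itv.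
move=> xM; have far e (k : R) : 0 <= k <= 1 -> 1 <= `|x - edge_point e k|.
  move=> k01; have [h1 h2 h3] := gboundP e k01.
  have : `|edge_point e k| < gbound D by rewrite norm3E !gt_max h1 h2 h3.
  by have := dist_le3 x (edge_point e k) 0; rewrite !subr0; lra.
have E1 s : node_push s x = x.
  rewrite /node_push big1 ?scaler0 ?addr0 // => v _; apply: repulse_far.
  have [k k01 ->] : exists2 k : R, 0 <= k <= 1 & pos v = edge_point (out_edge dD v) k.
    by apply: node_edge_point; left; exact: out_edgeP.
  exact: le_trans (far _ _ k01).
rewrite /push E1 /tube_push big1 ?scaler0 ?addr0 // => e _; apply: repulse_far.
have [k k01 ->] := edge_proj_on e x; apply: le_trans (far _ _ k01); lra.
Qed.

Lemma push_cont t x : ~ graph_support D x -> continuous_at (fun z : R * R3 => push z.1 z.2) (t, x).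
Proof.
move=> nx.
have c1 : continuous_at (fun z : R * R3 => clamp (2 * z.1)) (t, x) by apply: cont_clamp; ctn.
have c2 : continuous_at (fun z : R * R3 => clamp (2 * z.1 - 1)) (t, x) by apply: cont_clamp; ctn.
have cs : continuous_at (fun z : R * R3 => z.2) (t, x) by ctn.
have c3 : continuous_at (fun z : R * R3 => node_push (clamp (2 * z.1)) z.2) (t, x).
  apply: cont_addv; first exact: cs.
  apply: cont_scalev => //; apply: cont_sumv => v.
  apply: repulse_cont; [exact: cs|exact: cont_cst|].
  by apply/eqP => /= E; apply: nx; rewrite E; exact: node_graph.
rewrite /push; apply: cont_addv => //; apply: cont_scalev => //; apply: cont_sumv => e.
apply: repulse_cont => //; first exact: edge_proj_cont.
apply/eqP => /= E; have [k k01 E'] := edge_proj_on e (node_push (clamp (2 * t)) x).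
have := node_push_graph (clamp_itv (2 * t)) nx; apply; rewrite E E'.
by exists e, k.
Qed.
End Push.

Lemma eps_neighborhoodP eps x : (~` eps_neighborhood D eps) (Some x) <->
  forall e (k : R), 0 <= k <= 1 -> eps < `|x - edge_point e k|.
Proof.
split=> [h e k k01|h [z [_ [e [k [k01 ->]]] le] [zx]]].
  by rewrite ltNge; apply/negP => le; apply: h; exists x => //; exists (edge_point e k) => //; exists e, k.
by have := h e k k01; rewrite -zx ltNge le.
Qed.

(** The bound [eta / K] is the distance from the graph that every point has reached at time 1.
    Infinity is fixed, and continuity there holds because far points do not move. *)
Lemma push_homotopy : exists2 eps0 : R, 0 < eps0 & exists F : R -> S3 R -> S3 R, [/\
  forall t z, ~ sphere_support D z -> ~ sphere_support D (F t z),
  forall t z, ~ sphere_support D z -> continuous_at (fun y : R * S3 R => F y.1 y.2) (t, z),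
  forall z, F 0 z = z,
  forall t x, gbound D + 1 < `|x| -> F t (Some x) = Some x &
  forall eps, 0 < eps < eps0 ->
    (forall t z, (~` eps_neighborhood D eps) z -> (~` eps_neighborhood D eps) (F t z)) /\
    (forall z, ~ sphere_support D z -> (~` eps_neighborhood D eps) (F 1 z))].
Proof.
have [r [K [eta [[r01 K1] eta_itv [nn ne] pl ee]]]] := push_constants.
have /andP[eta0 eta_r] := eta_itv.
have K0 : 0 < K := lt_le_trans ltr01 K1.
exists (eta / K); first by rewrite divr_gt0.
have gsE x : ~ sphere_support D (Some x) <-> ~ graph_support D x.
  by split=> [|h [z gz [zx]]]; [exact: graph_compl_some|apply: h; rewrite -zx].
have pd := push_dist r01 K1 eta_itv nn ne pl ee.
exists (fun t z => if z is Some x then Some (push r eta t x) else None); split.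
- move=> t [x|] // /gsE nx; apply/gsE/not_graph_dist => e k k01.
  have [[k' k'01 le]|] := pd t x e k nx k01; last exact: lt_trans.
  by apply: lt_le_trans le; move/not_graph_dist: nx; apply.
- move=> t [x|].
    move=> /gsE nx; have c : continuous_at (fun z : R * R3 => push r eta z.1 z.2) (t, x).
      exact: push_cont.
    move=> A /= hA; have := c (fun y => A (Some y)) hA; case=> -[P Q] /= [hP hQ] sub.
    exists (P, Some @` Q); first by split=> //; exact: one_point_compactification_some_nbhs.
    by case=> t' z [/= Pt [y Qy <-]]; exact: (sub (t', y)).
  move=> _ A /= hA; exists (setT, A `&` [set z | if z is Some x then gbound D + 1 < `|x| else True]).
    split; [exact: filterT|apply: filterI => //].
    apply/near_infty; split=> //; exists (gbound D + 1) => //.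
    by have := gbound_gt0 D; lra.
  by case=> t' [x|] [/= _ [Az xM]] //; rewrite /= push_far.
- by case=> // x; rewrite push0.
- by move=> t x xM; rewrite push_far.
- move=> eps /andP[e0 e1]; have eK : eta / K <= eta by rewrite ler_pdivrMr // ler_peMr // ltW.
  split=> [t [x|]|[x|]]; try by move=> _ [].
    move=> h; have nx : ~ graph_support D x.
      by apply/not_graph_dist => e k k01; move/eps_neighborhoodP: h => /(_ e k k01); exact: lt_trans.
    apply/eps_neighborhoodP => e k k01; have [[k' k'01 le]|] := pd t x e k nx k01; last by lra.
    by apply: lt_le_trans le; move/eps_neighborhoodP: h; apply.
  move=> /gsE nx; apply/eps_neighborhoodP => e k k01; apply: lt_le_trans e1 _.
  exact: push1.
Qed.
End EdgeProjection.

Lemma gauge_swap (G : groupType) (a b c d : G) : (a = b^-1 * c * d -> c = b * a * d^-1)%g.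
Proof. by move=> ->; rewrite !mulgA mulgV mul1g mulgK. Qed.

Lemma transport_cancel (G : groupType) (a b c d e : G) :
  (a * b * ((c^-1 * (d^-1 * a) * b)^-1 * e^-1) = d * c * e^-1)%g.
Proof. by rewrite !invgM !invgK !mulgA mulgK mulgV mul1g. Qed.

(** * Restriction to a deformation retract *)

Section Pushable.
Variables (R : realType) (D : diagram R).
Hypothesis dD : is_diagram D.
Local Notation R3 := (R * R * R)%type.
Local Notation U := (~` sphere_support D).

(* [V] is a deformation retract of the complement of the graph, up to
   homotopy. *)
Definition pushable (V : set (S3 R)) (F : R -> S3 R -> S3 R) :=
  [/\ open V, V `<=` U,
    (forall t z, U z -> U (F t z)) /\ (forall t z, V z -> V (F t z)),
    (forall t z, U z -> continuous_at (fun y : R * S3 R => F y.1 y.2) (t, z)) /\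
    (forall z, F 0 z = z) &
    (forall z, U z -> V (F 1 z)) /\
    (forall t x, gbound D + 1 < `|x| -> F t (Some x) = Some x)].

Variables (V : set (S3 R)) (F : R -> S3 R -> S3 R).
Hypothesis pF : pushable V F.

Lemma push_path_cont t z : U z -> continuous_at (F^~ z) t.
Proof.
move=> Uz; have [_ _ _ [Fc _] _] := pF.
have h : continuous_at (fun s : R => (s, z)) t by apply: cont_pair; [exact: cont_id|exact: cont_cst].
exact: (cvg_comp _ _ h (Fc t z Uz)).
Qed.

Lemma push_end_cont t z : U z -> continuous_at (F t) z.
Proof.
move=> Uz; have [_ _ _ [Fc _] _] := pF.
have h : continuous_at (fun y : S3 R => (t, y)) z by apply: cont_pair; [exact: cont_cst|exact: cont_id].
exact: (cvg_comp _ _ h (Fc t z Uz)).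
Qed.

Section Cocycles.
Variable G : groupType.

Lemma push_gauge (Y : set (S3 R)) (c : S3 R -> S3 R -> G) : open Y -> Y `<=` U ->
  (forall t z, Y z -> Y (F t z)) -> germ_cocycle Y c ->
  exists2 g, gauge Y c (fun x y => c (F 1 x) (F 1 y)) g &
    forall z, Y z -> exists l : R -> G, [/\ l 0 = 1%g, l 1 = g z &
      trivializes [set t : R | 0 <= t <= 1] (fun t t' => c (F t z) (F t' z)) l].
Proof.
move=> oY YU FY cY; have [_ _ _ [Fc F0] _] := pF.
have [g hg hl] := homotopy_gauge cY oY FY (fun t y Yy => Fc t y (YU y Yy)).
by exists g => // x Yx; have := hg x Yx; apply: filterS => y; rewrite !F0.
Qed.

Lemma lift_const (c : S3 R -> S3 R -> G) (Y : set (S3 R)) z (l : R -> G) : germ_cocycle Y c -> Y z ->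
  (forall t, F t z = z) -> l 0 = 1%g ->
  trivializes [set t : R | 0 <= t <= 1] (fun t t' => c (F t z) (F t' z)) l -> l 1 = 1%g.
Proof.
move=> cY Yz Fz l0 tl; rewrite -l0; apply/esym.
apply: (@loc_const_segment R G l 0 1) => // t t01; have := tl t t01.
apply: filterS => t'; rewrite !Fz (germ_cocycle_diag cY Yz) => E _.
by apply/esym; rewrite -[l t]mulg1 E mulgA mulgV mul1g.
Qed.
End Cocycles.

(** The first component is a homomorphism, so the first component of a lift is determined by that of
    the cocycle. *)
Lemma lift_fst (A B : zmodType) (tw : twisting A B) (c c' : S3 R -> S3 R -> semidirect tw)
    (Y : set (S3 R)) z l l' : Y `<=` U -> (forall t, Y (F t z)) -> U z ->
  (forall x, Y x -> \forall y \near x, (c x y).1 = (c' x y).1) ->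
  l 0 = 1%g -> l' 0 = 1%g ->
  trivializes [set t : R | 0 <= t <= 1] (fun t t' => c (F t z) (F t' z)) l ->
  trivializes [set t : R | 0 <= t <= 1] (fun t t' => c' (F t z) (F t' z)) l' ->
  (l 1).1 = (l' 1).1.
Proof.
move=> YU FY Uz cc l0 l'0 tl tl'; apply/eqP; rewrite -subr_eq0; apply/eqP.
have -> : 0 = (l 0).1 - (l' 0).1 by rewrite l0 l'0 subrr.
apply/esym; apply: (@loc_const_segment R _ (fun t => (l t).1 - (l' t).1) 0 1) => // t t01.
have h := near_comp (@push_path_cont t z Uz) (cc _ (FY t)).
apply: filterS3 (tl t t01) (tl' t t01) h => t' e e' + _.
rewrite e e' !sd_mulE !sd_invE /= => E.
have -> : (l t').1 = (l t).1 + (- (l t).1 + (l t').1) by rewrite addrA subrr add0r.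
by rewrite E !addrA addrK.
Qed.

(** * Transfer between equivalent complements *)

Section Rigid.
Variables (A B : zmodType) (tw : twisting A B) (phi : edge D -> A).
Hypothesis phi_cons : conserved_at dD phi.
Hypothesis phi_under : forall lo hi, crossing lo hi -> phi (out_edge dD lo) = phi (in_edge dD lo).
Local Notation G := (semidirect tw).
Variable P : R3.
Hypotheses (P_far : gbound D + 1 < `|P|) (P_side : side D 1 P).

(** The retraction extends the gauge from V to U. Below the graph both cocycles are trivial, so the
    gauge is constant there, with the value 1 that it has at P. Above the graph it then forces the
    two potentials to differ by a constant, and their jumps are equal. *)
Lemma flow_rigid nu1 nu2 (f : S3 R -> G) :
  twisted_flow dD tw phi nu1 -> twisted_flow dD tw phi nu2 ->
  gauge V (flow_cocycle dD tw phi nu1) (flow_cocycle dD tw phi nu2) f ->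
  f (Some P) = 1%g -> forall e, nu1 e = nu2 e.
Proof.
move=> n1 n2 fg fP.
have [oV VU [FU FV] [Fc F0] [F1 Ffar]] := pF.
have oU : open U by exact: sphere_support_closed.
have c1 := flow_cocycle_germ phi_cons phi_under n1.
have c2 := flow_cocycle_germ phi_cons phi_under n2.
have [g1 hg1 hl1] := push_gauge oU (@subset_refl _ _) FU c1.
have [g2 hg2 hl2] := push_gauge oU (@subset_refl _ _) FU c2.
have UP : U (Some P) by exact: side_compl P_side.
(* P is so far away that the retraction does not move it, hence the transport along its path is
   trivial. *)
have g1P : g1 (Some P) = 1%g.
  have [l [l0 <- tl]] := hl1 _ UP; apply: (lift_const c1 UP) tl => // t; exact: Ffar.
have g2P : g2 (Some P) = 1%g.
  have [l [l0 <- tl]] := hl2 _ UP; apply: (lift_const c2 UP) tl => // t; exact: Ffar.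
pose k x := (g1 x * f (F 1 x) * (g2 x)^-1)%g.
have kg : gauge U (flow_cocycle dD tw phi nu1) (flow_cocycle dD tw phi nu2) k.
  move=> x Ux; have h := near_comp (@push_end_cont 1 x Ux) (fg _ (F1 _ Ux)).
  apply: filterS3 (hg1 x Ux) (hg2 x Ux) h => y e1 e2; rewrite e1 e2.
  move=> /(congr1 (fun z => g2 x * z * (g2 y)^-1))%g.
  by rewrite /k !invgM !invgK !mulgA mulgV mul1g mulgK.
have kP : k (Some P) = 1%g by rewrite /k g1P g2P Ffar // fP invg1 !mul1g.
have kS x : side D 1 x -> k (Some x) = 1%g.
  move=> sx; rewrite -kP.
  suff kl z : side D 1 z -> \forall y \near z, k (Some y) = k (Some z).
    exact: (side_connected (f := fun x => k (Some x)) (sg1 R) kl sx P_side).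
  move=> sz; have /near_someP e1 := cocycle_below dD (lift_pot tw phi (potential nu1)) sz.
  have /near_someP e2 := cocycle_below dD (lift_pot tw phi (potential nu2)) sz.
  have /near_someP := kg _ (side_compl sz); rewrite /flow_cocycle => e3.
  apply: filterS3 e1 e2 e3 => y -> ->; rewrite mulg1 => e.
  by rewrite -[k (Some z)]mulg1 e mulgA mulgV mul1g.
have lp1 := potential_loc_const dD (conserved_planar n1.1).
have lp2 := potential_loc_const dD (conserved_planar n2.1).
have psl := psi_loc phi_cons.
pose h1 := lift_pot tw phi (potential nu1); pose h2 := lift_pot tw phi (potential nu2).
have kA : forall x y, side D (-1) x -> side D (-1) y ->
    (h1 x.1 * k (Some x) * (h2 x.1)^-1 = h1 y.1 * k (Some y) * (h2 y.1)^-1)%g.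
  pose kf (x : R3) := (h1 x.1 * k (Some x) * (h2 x.1)^-1)%g.
  suff kl z : side D (-1) z -> \forall y \near z, kf y = kf z.
    by move=> x y sx sy; exact: (side_connected (f := kf) (sgN1 R) kl sx sy).
  move=> sz; rewrite /kf.
  have e1 := cocycle_above dD (lift_pot_loc tw phi_cons lp1) sz.
  have e2 := cocycle_above dD (lift_pot_loc tw phi_cons lp2) sz.
  have /near_someP := kg _ (side_compl sz); rewrite /flow_cocycle => e3.
  apply: filterS3 e1 e2 e3 => y -> ->; rewrite -/h1 -/h2 => e.
  have -> : ((h2 y.1)^-1 = ((k (Some z))^-1 * ((h1 z.1)^-1 * h1 y.1) * k (Some y))^-1 * (h2 z.1)^-1)%g.
    by rewrite -e invgM invgK mulgK.
  exact: transport_cancel.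
pose q0 : R * R := (gbound D, gbound D).
pose beta q := potential nu1 q - potential nu2 q.
have bE q : ~ shadow D q -> beta q = beta q0.
  move=> nq; have nq0 : ~ shadow D q0 := @far_pt_not_shadow R D.
  have sd (p : R * R) : ~ shadow D p -> side D (-1) (p, 0) /\ side D 1 (p, 0).
    by move=> np; split; apply: not_shadow_side.
  have := kA (q, 0) (q0, 0) (sd _ nq).1 (sd _ nq0).1.
  rewrite (kS _ (sd _ nq).2) (kS _ (sd _ nq0).2) !mulg1 /h1 /h2 /lift_pot !sd_mulE !sd_invE /=.
  by move=> /(congr1 snd) /=; rewrite !act_N !actVK.
move=> e; have bl : loc_const_off_shadow D beta.
  by move=> p np; apply: filterS2 (lp1 p np) (lp2 p np) => p'; rewrite /beta => -> ->.
have bd b : beta (left_point dD (e, b)) = beta q0.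
  apply: left_pointE => // t t01; have := left_not_shadow dD (e, b) t01.
  by apply: filterS => q hq /hq /bE.
rewrite -(@potential_jump R D dD B nu1 e (conserved_planar n1.1)).
rewrite -(@potential_jump R D dD B nu2 e (conserved_planar n2.1)).
have := bd true; rewrite -(bd false) /beta => /eqP; rewrite subr_eq => /eqP ->.
by rewrite addrC !addrA addNr add0r addrC.
Qed.
End Rigid.
End Pushable.

Section Transfer.
Variables (R : realType) (D D' : diagram R).
Hypotheses (dD : is_diagram D) (dD' : is_diagram D').
Local Notation R3 := (R * R * R)%type.
Local Notation U := (~` sphere_support D).
Local Notation U' := (~` sphere_support D').
Variables (V V' : set (S3 R)) (F F' : R -> S3 R -> S3 R) (h h' : S3 R -> S3 R).
Hypotheses (pF : pushable D V F) (pF' : pushable D' V' F').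
Hypotheses (hc : continuous h) (hc' : continuous h') (hK : cancel h h') (h'K : cancel h' h).
Hypothesis VV' : forall z, V z <-> V' (h z).
Variables (A B : zmodType) (tw : twisting A B) (phi : edge D -> A) (phi' : edge D' -> A).
Hypotheses (phi_cons : conserved_at dD phi) (phi_cons' : conserved_at dD' phi').
Hypothesis phi_under : forall lo hi, crossing lo hi -> phi (out_edge dD lo) = phi (in_edge dD lo).
Hypothesis phi_under' : forall lo hi, crossing lo hi -> phi' (out_edge dD' lo) = phi' (in_edge dD' lo).
Local Notation G := (semidirect tw).
Variable w : S3 R -> A.
Hypothesis chi_eq : forall x, V x -> \forall y \near x,
  chi dD' tw phi' (h x) (h y) = - w x + chi dD tw phi x y + w y.
Variables P P' : R3.
Hypotheses (VP : V (Some P)) (hP : h (Some P) = Some P') (P'_side : side D' 1 P').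

(** The value at P normalizes the gauge. With it the relation between [nu] and [nu'] is linear by
    [linked_lin], and [flow_rigid] makes it injective. *)
Definition linked_flows nu nu' (f : S3 R -> G) :=
  [/\ gauge V (flow_cocycle dD tw phi nu) (fun x y => flow_cocycle dD' tw phi' nu' (h x) (h y)) f,
      forall x, V x -> (f x).1 = w x & f (Some P) = (w (Some P), 0)].

(** The cocycle of [nu] is carried to V' by h and extended to U' by pulling it back along the
    retraction. Its first component is adjusted on the way to be exactly that of [phi'], so that
    [classification] applies. *)
Lemma flow_transfer nu : twisted_flow dD tw phi nu -> exists nu' f,
  twisted_flow dD' tw phi' nu' /\ linked_flows nu nu' f.
Proof.
move=> nf; have [oV VU _ _ _] := pF.
have [oV' V'U' [FU' FV'] [Fc' F0'] [F1' _]] := pF'.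
have oU' : open U' by exact: sphere_support_closed.
have cnu := flow_cocycle_germ phi_cons phi_under nf.
have cnuV : germ_cocycle V (flow_cocycle dD tw phi nu) by move=> x /VU; exact: cnu.
pose fw (x : S3 R) : G := (w x, 0).
pose d (x y : S3 R) := ((fw x)^-1 * flow_cocycle dD tw phi nu x y * fw y)%g.
have dV : germ_cocycle V d by apply: (gauge_germ_cocycle oV cnuV (f := fw)) => x _; exact: near_all.
pose c0 x y := d (h' x) (h' y).
have hV x : V' x -> V (h' x) by move=> vx; apply/VV'; rewrite h'K.
have c0V : germ_cocycle V' c0 by apply: (germ_cocycle_pullback oV' hV _ dV) => x _; exact: hc'.
have c0fst x : V' x -> \forall y \near x, (c0 x y).1 = chi dD' tw phi' x y.
  move=> vx; have e := near_comp (@hc' x) (chi_eq (hV x vx)).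
  apply: filterS e => y; rewrite !h'K => ->.
  by rewrite /c0 /d !sd_mulE !sd_invE /= cocycle_fst.
pose c1 x y := c0 (F' 1 x) (F' 1 y).
have c1U : germ_cocycle U' c1.
  by apply: (germ_cocycle_pullback oU' F1' _ c0V) => x Ux; exact: (push_end_cont pF').
(* The retraction changes the first component by a gauge. The zero flow provides a cocycle whose
   first component is that of [phi'], and its gauge [g] gives the correction [ga]. *)
have zf : twisted_flow dD' tw phi' (fun=> 0).
  split; [split=> [x _ _|lo hi _]; rewrite ?addr0 //|by move=> lo hi _; rewrite act_0r].
  by rewrite !big1.
have cz := flow_cocycle_germ phi_cons' phi_under' zf.
have [g hg lg] := push_gauge pF' oU' (@subset_refl _ _) FU' cz.
pose ga (x : S3 R) : G := (- (g x).1, 0).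
pose c2 x y := ((ga x)^-1 * c1 x y * ga y)%g.
have c2U : germ_cocycle U' c2 by apply: (gauge_germ_cocycle oU' c1U (f := ga)) => x _; exact: near_all.
have c2fst x : U' x -> \forall y \near x, (c2 x y).1 = chi dD' tw phi' x y.
  move=> Ux; have e := near_comp (@push_end_cont _ _ _ _ pF' 1 x Ux) (c0fst _ (F1' _ Ux)).
  apply: filterS2 e (hg x Ux) => y e1 /(congr1 fst) e2.
  rewrite !sd_mulE !sd_invE /= !cocycle_fst in e2.
  have -> : (c2 x y).1 = - - (g x).1 + (c0 (F' 1 x) (F' 1 y)).1 - (g y).1 by [].
  rewrite e1 e2 opprK.
  by rewrite !addrA addrN add0r addrK.
have UP' : U' (Some P') := side_compl P'_side.
have VP' : V' (Some P') by rewrite -hP; apply/VV'.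
have [g0 hg0 lg0] := push_gauge pF' oV' V'U' FV' c0V.
(* The retraction of D' may move P'. Prescribing this value at P' makes the total gauge [k] equal to
   1 there. *)
pose kk : B := (g0 (Some P') * ga (Some P'))%g.2.
have [nu' [f' [nf' fg' f'fst f'P]]] := classification phi_cons' phi_under' kk c2U c2fst P'_side.
have gfst x : V' x -> (g0 x).1 = (g x).1.
  move=> vx; have [l [l0 <- tl]] := lg _ (V'U' _ vx); have [l' [l'0 <- tl']] := lg0 _ vx.
  apply: (lift_fst pF' V'U' _ _ _ l'0 l0 tl' tl); [by move=> t; exact: FV'|exact: V'U'|].
  by move=> y vy; apply: filterS (c0fst y vy) => z ->; rewrite cocycle_fst.
pose k x := (f' x * (ga x)^-1 * (g0 x)^-1)%g.
have kE x : V' x -> \forall y \near x, c0 x y = ((k x)^-1 * flow_cocycle dD' tw phi' nu' x y * k y)%g.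
  move=> vx; apply: filterS2 (hg0 x vx) (fg' x (V'U' x vx)) => y e1 e2.
  rewrite -/(c1 x y) in e1.
  have -> : c0 x y = (g0 x * c1 x y * (g0 y)^-1)%g by rewrite e1 !mulgA mulgV mul1g mulgK.
  have -> : c1 x y = (ga x * c2 x y * (ga y)^-1)%g by rewrite /c2 !mulgA mulgV mul1g mulgK.
  by rewrite e2 /k !invgM !invgK !mulgA.
exists nu', (fun x => fw x * (k (h x))^-1)%g; split=> //; split.
- move=> x vx; have e := near_comp (@hc x) (kE _ ((VV' x).1 vx)).
  apply: filterS e => y; rewrite /c0 !hK /d => e.
  have -> : flow_cocycle dD' tw phi' nu' (h x) (h y) =
     (k (h x) * ((fw x)^-1 * flow_cocycle dD tw phi nu x y * fw y) * (k (h y))^-1)%g.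
    exact: gauge_swap e.
  by rewrite !invgM !invgK !mulgA.
- move=> x vx; have vx' := (VV' x).1 vx.
  rewrite /k !sd_mulE !sd_invE /= f'fst ?gfst //; last exact: V'U'.
  by rewrite add0r opprK subrr oppr0 addr0.
- rewrite hP; suff -> : k (Some P') = 1%g by rewrite invg1 mulg1.
  have E : (g0 (Some P') * ga (Some P'))%g = f' (Some P').
    rewrite f'P [LHS]surjective_pairing /kk; congr pair.
    by rewrite sd_mulE /= gfst // subrr.
  by rewrite /k -E mulgK mulgV.
Qed.
End Transfer.
(** * Dimensions of spaces of colorings *)

Section Dimension.
Variable X : fieldType.

Definition has_indep (W : lmodType X) (P : W -> Prop) (n : nat) :=
  exists b : 'I_n -> W, (forall i, P (b i)) /\
    forall c : 'I_n -> X, \sum_i c i *: b i = 0 -> forall i, c i = 0.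

(** Defined through independent families, so that solution sets given by predicates on functions can
    be compared without being turned into subspaces. *)
Definition dimension (W : lmodType X) (P : W -> Prop) (n : nat) :=
  forall k, has_indep P k <-> (k <= n)%N.

Lemma has_indep_le (W : lmodType X) (P : W -> Prop) k n : (k <= n)%N -> has_indep P n -> has_indep P k.
Proof.
elim: n => [|n IH]; first by rewrite leqn0 => /eqP ->.
rewrite leq_eqVlt ltnS => /predU1P[-> //|kn] [b [Pb ib]]; apply: IH kn _.
exists (fun i => b (lift ord_max i)); split=> // c c0 i.
pose c' j := if unlift ord_max j is Some i then c i else 0.
have <- : c' (lift ord_max i) = c i by rewrite /c' liftK.
apply: ib; rewrite -[RHS]c0 (bigD1_ord ord_max) //= {1}/c' unlift_none scale0r add0r.
by apply: eq_bigr => j _; rewrite /c' liftK.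
Qed.

Lemma dimension_vspace (W : vectType X) (U : {vspace W}) : dimension (fun v => v \in U) (\dim U).
Proof.
move=> k; split=> [[b [Ub ib]]|kn].
  have fb : free [tuple b i | i < k].
    apply/freeP => c; under eq_bigr do rewrite nth_mktuple; exact: ib.
  have := dimvS (_ : <<[tuple b i | i < k]>> <= U)%VS.
  rewrite (eqP fb) size_tuple; apply; apply/span_subvP => v /mapP[i _ ->]; exact: Ub.
apply: (has_indep_le kn); exists (fun i => (vbasis U)`_i); split=> [i|].
  by apply: vbasis_mem; apply: mem_nth; rewrite size_tuple.
by apply/freeP; exact: basis_free (vbasisP U).
Qed.

Lemma dimension_ker n p (A : 'M[X]_(n, p)) : dimension (fun v : 'rV_n => v *m A = 0) (n - \rank A).
Proof.
move=> k; rewrite -mxrank_ker; split=> [[b [Ub ib]]|kn].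
  pose W := \matrix_i b i.
  have fW : row_free W.
    rewrite -kermx_eq0; apply/rowV0P => v /sub_kermxP; rewrite mulmx_sum_row => e.
    apply/rowP => i; rewrite mxE; apply: ib; rewrite -[RHS]e.
    by apply: eq_bigr => j _; rewrite rowK.
  rewrite -(eqP fW); apply: mxrankS; apply/row_subP => i; rewrite rowK.
  by apply/sub_kermxP; exact: Ub.
apply: (has_indep_le kn); exists (fun i => row i (row_base (kermx A))); split=> [i|c].
  by apply/sub_kermxP; apply: submx_trans (row_sub _ _) _; rewrite eq_row_base.
move=> e i; have := row_base_free (kermx A); rewrite -kermx_eq0 => /rowV0P /(_ (\row_j c j)).
have -> : (\row_j c j <= kermx (row_base (kermx A)))%MS.
  by apply/sub_kermxP; rewrite mulmx_sum_row -[RHS]e; apply: eq_bigr => j _; rewrite mxE.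
by move=> /(_ isT) /rowP /(_ i); rewrite !mxE.
Qed.

(** A linear relation takes the place of a map: flows of two diagrams correspond through the
    existence of a gauge, and partners are chosen only for the members of an independent family. *)
Lemma dimension_le (W W' : lmodType X) (P : W -> Prop) (P' : W' -> Prop)
    (L : W -> W' -> Prop) n n' : dimension P n -> dimension P' n' ->
  (forall v, P v -> exists2 v', P' v' & L v v') ->
  L 0 0 -> (forall k v1 v2 w1 w2, L v1 w1 -> L v2 w2 -> L (k *: v1 + v2) (k *: w1 + w2)) ->
  (forall v, L v 0 -> v = 0) -> (n <= n')%N.
Proof.
move=> dP dP' tot L0 lin inj; apply/dP'; have [b [Pb ib]] : has_indep P n by apply/dP.
have /choice [b' hb'] i : exists w, P' w /\ L (b i) w by have [w] := tot _ (Pb i); exists w.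
exists b'; split=> [i|c]; first by have [] := hb' i.
move=> e; apply: ib; apply: inj; rewrite -e.
elim: (index_enum _) => [|i r IH]; first by rewrite !big_nil.
by rewrite !big_cons; apply: lin => //; have [] := hb' i.
Qed.

(** One step of Gaussian elimination with pivot [i0]; if [l] vanishes on the whole family, one
    vector is dropped instead. *)
Lemma dimension_cut (W : vectType X) (P P' : W -> Prop) (l : W -> X) n n' :
  dimension P n -> dimension P' n' -> P 0 ->
  (forall k v w, P v -> P w -> P (k *: v + w)) ->
  (forall k v w, l (k *: v + w) = k * l v + l w) ->
  (forall v, P v -> l v = 0 -> P' v) -> (n <= n'.+1)%N.
Proof.
move=> dP dP' P0 Plin llin PP'; case: n dP => // n dP; rewrite ltnS; apply/dP'.
have [b [Pb ib]] : has_indep P n.+1 by apply/dP.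
have fb : free [tuple b i | i < n.+1].
  by apply/freeP => c; under eq_bigr do rewrite nth_mktuple; exact: ib.
have l0 : l 0 = 0 by have := llin (-1) 0 0; rewrite scaler0 addr0 mulN1r addNr.
have [i0 [h0|h0]] : exists i0 : 'I_n.+1, (forall i, l (b i) = 0) \/ l (b i0) != 0.
  have [/forallP h|/forallPn[i h]] := boolP [forall i, l (b i) == 0].
    by exists ord0; left=> i; apply/eqP.
  by exists i; right.
  apply: (has_indep_le (leqnSn n)); exists b; split=> // i; exact: PP'.
exists (fun i => - (l (b (lift i0 i)) / l (b i0)) *: b i0 + b (lift i0 i)); split=> [i|c].
  by apply: PP'; [exact: Plin|rewrite llin mulNr divfK // addNr].
pose c' j := if unlift i0 j is Some i then c i else - \sum_i c i * (l (b (lift i0 i)) / l (b i0)).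
move=> e i; have /(_ (lift i0 i)) : forall j, c' j = 0; last by rewrite /c' liftK.
apply: ib; rewrite -[RHS]e (bigD1_ord i0) //= /c' unlift_none.
under [in LHS]eq_bigr do rewrite liftK.
rewrite scaleNr scaler_suml -sumrN -big_split /=; apply: eq_bigr => j _.
by rewrite scalerDr scalerA mulrN scaleNr.
Qed.
End Dimension.

(** * Powers with residues as exponents *)

Section Residues.
Variables (m : nat) (X : fieldType).
Implicit Types (k l : 'I_m.+1) (x : X).

Lemma zpowD x k l : x ^+ m.+1 = 1 -> x ^+ (k + l)%R = x ^+ k * x ^+ l.
Proof. by move=> x1; rewrite -exprD /= expr_mod. Qed.

Lemma zpow_neq0 x k : x ^+ m.+1 = 1 -> x ^+ k != 0.
Proof.
move=> x1; rewrite expf_neq0 //; apply/eqP => x0.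
by move: x1; rewrite x0 expr0n /= => /eqP; rewrite eq_sym oner_eq0.
Qed.

Lemma zpowN x k : x ^+ m.+1 = 1 -> x ^+ (- k)%R = (x ^+ k)^-1.
Proof.
move=> x1; apply: (mulfI (zpow_neq0 k x1)); rewrite -zpowD // subrr expr0.
by rewrite divff ?zpow_neq0.
Qed.

Definition power_act x (k : 'I_m.+1) (b : X^o) : X^o := x ^+ k * b.

Definition power_twisting x (x1 : x ^+ m.+1 = 1) : twisting 'I_m.+1 X^o.
Proof.
exists (power_act x) => [b|k l b|k b b']; rewrite /power_act.
- by rewrite expr0 mul1r.
- by rewrite zpowD // mulrA.
- by rewrite mulrBr.
Defined.
End Residues.

(** * Colorings as functions on the nodes *)

Section Colorings.
Variables (R : realType) (D : diagram R).
Hypothesis dD : is_diagram D.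
Variables (m : nat) (X : fieldType) (s t : X).
Hypotheses (s1 : s ^+ m.+1 = 1) (t1 : t ^+ m.+1 = 1).
Implicit Types (e a b c u v w : edge D) (x lo hi : node D).
Let T := t / s.

Lemma T1 : T ^+ m.+1 = 1. Proof. by rewrite expr_div_n s1 t1 divr1. Qed.

Variable phi : {ffun edge D -> 'I_m.+1}.

Definition straight lo hi : bool := 0 < det (dir (in_edge dD hi)) (dir (in_edge dD lo)).

Lemma crossing_atP u w v v' : crossing_at u w v v' -> exists lo hi, crossing lo hi /\
  if straight lo hi then [/\ u = in_edge dD lo, w = out_edge dD lo, v = out_edge dD hi & v' = in_edge dD hi]
  else [/\ u = out_edge dD lo, w = in_edge dD lo, v = in_edge dD hi & v' = out_edge dD hi].
Proof.
rewrite /crossing_at; case: ifP => sg /and3P[/eqP E1 /eqP E2 cr].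
  have [bl bh] := crossing_bivalent dD cr.
  have [[l l0 dvo] _ _] := crossing_dirs dD cr.
  have uE := bivalent_in dD bl erefl; have v'E := bivalent_in dD bh erefl.
  have wE := bivalent_out dD bl (esym E1); have vE := bivalent_out dD bh (esym E2).
  exists (tgt u), (tgt v'); split=> //; rewrite ifT //.
  by move: sg; rewrite {1}vE dvo detZ pmulr_rgt0 // {1}uE.
have [bl bh] := crossing_bivalent dD cr.
have [_ [l l0 dw] d0] := crossing_dirs dD cr.
have wE := bivalent_in dD bl erefl; have vE := bivalent_in dD bh erefl.
have uE := bivalent_out dD bl (esym E1); have v'E := bivalent_out dD bh (esym E2).
exists (tgt w), (tgt v); split=> //; rewrite ifF //.
by move: sg; rewrite {1}uE dw detZr pmulr_rgt0 // {1}vE.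
Qed.

Lemma crossing_at_straight lo hi : crossing lo hi ->
  if straight lo hi
  then crossing_at (in_edge dD lo) (out_edge dD lo) (out_edge dD hi) (in_edge dD hi)
  else crossing_at (out_edge dD lo) (in_edge dD lo) (in_edge dD hi) (out_edge dD hi).
Proof.
move=> cr; have [[l l0 dvo] [l' l'0 dw] d0] := crossing_dirs dD cr.
rewrite /crossing_at; case: ifP; rewrite /straight => sg.
  by rewrite dvo detZ pmulr_rgt0 // sg !in_edgeP !out_edgeP !eqxx.
by rewrite dw detZr pmulr_rgt0 // sg !in_edgeP !out_edgeP !eqxx.
Qed.

Definition is_flow := conserved_at dD phi /\
  forall lo hi, crossing lo hi -> phi (out_edge dD lo) = phi (in_edge dD lo).

Lemma modn_ordE (i j k : 'I_m.+1) : (i == j + k %[mod m.+1])%N = (i == (j + k)%R).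
Proof. by rewrite modn_small // -val_eqE. Qed.

(** The arc condition on the over strand of a crossing is not part of [is_flow]: it follows from
    conservation at the crossing and from constancy along the under strand. *)
Lemma flowP : flow phi <-> is_flow.
Proof.
split.
  case/and3P=> /forallP h1 /forallP h2 /forallP h3.
  have arc x : bivalent x -> ~~ under x -> phi (out_edge dD x) = phi (in_edge dD x).
    move=> bx nu; have /forallP/(_ (out_edge dD x))/implyP h := h1 (in_edge dD x).
    apply/esym/eqP/h; rewrite /same_arc /consecutive in_edgeP out_edgeP eqxx bx /=.
    exact: nu.
  have und lo hi : crossing lo hi -> phi (out_edge dD lo) = phi (in_edge dD lo).
    move=> cr; have := crossing_at_straight cr; case: ifP => _ cra.
      by have /forallP/(_ (out_edge dD lo))/forallP/(_ (out_edge dD hi))/forallP/(_ (in_edge dD hi))/implyP/(_ cra)/eqP := h2 (in_edge dD lo).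
    by have /forallP/(_ (in_edge dD lo))/forallP/(_ (in_edge dD hi))/forallP/(_ (out_edge dD hi))/implyP/(_ cra)/eqP := h2 (out_edge dD lo).
  split=> //; split=> [x nu no|lo hi cr]; last first.
    rewrite (und _ _ cr) arc //; first by have [] := crossing_bivalent dD cr.
    apply/negP => uh; have := not_under_over dD uh; move/negP; apply.
    by apply/existsP; exists lo.
  have [bx|nbx] := boolP (bivalent x).
    by rewrite (sum_src_bivalent dD) // (sum_tgt_bivalent dD) // arc.
  have [a [b [c [va cs]]]] := trivalent_vertex dD nbx.
  have /forallP/(_ b)/forallP/(_ c)/implyP/(_ va) := h3 a; rewrite modn_ordE => /eqP E.
  have ab : a != b by move: va; rewrite /vertex_at => /andP[].
  case: cs => -[E1 E2 E3].
    have [f1 f2] := vertex_in_sums dD phi ab (etrans E1 (esym E3)) (etrans E2 (esym E3)).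
    by rewrite -E3 f1 f2.
  have [f1 f2] := vertex_out_sums dD phi ab (etrans E3 (esym E1)) (etrans E3 (esym E2)).
  by rewrite -E3 f1 f2.
move=> [cons und]; apply/and3P; split.
- apply/forallP => e; apply/forallP => e'; apply/implyP.
  rewrite /same_arc /consecutive => /andP[/andP[/eqP E bx] nu].
  have eE := bivalent_in dD bx erefl; have e'E := bivalent_out dD bx (esym E).
  rewrite {1}eE e'E; apply/eqP/esym.
  have [/existsP[lo cr]|no] := boolP (over (tgt e)).
    exact: (crossing_over_flow cons cr (und _ _ cr)).
  by have := cons.1 _ nu no; rewrite (sum_src_bivalent dD) // (sum_tgt_bivalent dD).
- apply/forallP => u; apply/forallP => w; apply/forallP => v; apply/forallP => v'; apply/implyP.
  move=> /crossing_atP[lo [hi [cr]]]; case: ifP => _ [-> -> _ _]; first by rewrite (und _ _ cr).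
  by rewrite (und _ _ cr).
- apply/forallP => a; apply/forallP => b; apply/forallP => c; apply/implyP => va.
  rewrite modn_ordE; move: va; rewrite /vertex_at => /andP[ab /orP[]] /and3P[/eqP E1 /eqP E2 _].
    have [_ _ nb] := vertex_in_edges dD ab E1 E2; have [nu no] := nonbivalent_lone dD nb.
    have [f1 f2] := vertex_in_sums dD phi ab E1 E2.
    by rewrite -f1 -f2 cons.1.
  have [_ _ nb] := vertex_out_edges dD ab E1 E2; have [nu no] := nonbivalent_lone dD nb.
  have [f1 f2] := vertex_out_sums dD phi ab E1 E2.
  by rewrite -f1 -f2 cons.1.
Qed.

(** At an under crossing, an iterate of the Alexander quandle operation with parameter t / s, or of
    its inverse if the over strand runs the other way; the sign is contained in [over_shift]. *)
Definition edge_value (y : node D -> X) e : X :=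
  if under (src e) then
    let k := over_shift dD phi (src e) (over_node (src e)) in
    T ^+ k * y (src e) + (1 - T ^+ k) * y (over_node (src e))
  else y (src e).

Definition node_coloring (y : node D -> X) := forall e, y (tgt e) = edge_value y e.

Hypothesis fphi : is_flow.
Let psi := potential (phi : edge D -> 'I_m.+1).
Let psiR e := psi (left_point dD (e, false)).

(** The power of s, indexed by the region on the right of e, absorbs the over operation: in this
    gauge a strand keeps its value when it passes over another one, and all edges at a vertex have
    the same value. *)
Definition represents_coloring (C : {ffun edge D -> X^o}) (y : node D -> X) :=
  forall e, C e = s ^+ psiR e * y (tgt e).

Lemma psi_off : loc_const_off_shadow D psi.
Proof. exact: (potential_loc_const dD (conserved_planar fphi.1)). Qed.

Lemma psi_left e : psi (left_point dD (e, true)) = psiR e + phi e.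
Proof.
have := @potential_jump R D dD _ phi e (conserved_planar fphi.1) => /eqP.
by rewrite subr_eq addrC => /eqP.
Qed.

Lemma crossing_psi lo hi : crossing lo hi ->
  if straight lo hi
  then [/\ psiR (in_edge dD lo) = psiR (out_edge dD hi),
    psiR (out_edge dD lo) = psiR (in_edge dD lo) + phi (out_edge dD hi) &
    psiR (in_edge dD hi) = psiR (out_edge dD hi) + phi (in_edge dD lo)]
  else [/\ psiR (out_edge dD lo) = psiR (in_edge dD hi),
    psiR (in_edge dD lo) = psiR (out_edge dD lo) + phi (in_edge dD hi) &
    psiR (out_edge dD hi) = psiR (in_edge dD hi) + phi (out_edge dD lo)].
Proof.
move=> cr; have [H [_ vH]] := crossing_quadrants dD cr psi_off.
have [a1 a2 a3 a4] := vH false; have [b1 b2 b3 b4] := vH true.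
rewrite !psi_left in b1 b2 b3 b4; rewrite /straight.
move: a1 a2 a3 a4 b1 b2 b3 b4; rewrite -/(psiR _) -/(psiR _) -/(psiR _) -/(psiR _) /=.
case: ifP => sg /=.
  move=> a1 a2 a3 a4 b1 b2 b3 b4; have uv := etrans a4 (esym a1).
  by split=> //; [rewrite uv; exact: etrans a3 (esym b1)|
                  rewrite -uv; exact: etrans a2 (esym b4)].
move=> a1 a2 a3 a4 b1 b2 b3 b4; have wv := etrans a3 (esym a2).
by split=> //; [rewrite wv; exact: etrans a4 (esym b2)|
                rewrite -wv; exact: etrans a1 (esym b3)].
Qed.

Lemma zpow_T (k : 'I_m.+1) : T ^+ k = t ^+ k / s ^+ k.
Proof. by rewrite expr_div_n. Qed.

Lemma crossing_eq1 (a b p yw ylo yhi : X) : a != 0 -> p != 0 ->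
  a * p * yw = b * (p * ylo) + (a - b) * (p * yhi) <->
  yw = b / a * ylo + (1 - b / a) * yhi.
Proof.
move=> a0 p0; split=> [h|->]; last by field.
by apply: (mulfI (mulf_neq0 a0 p0)); rewrite h; field.
Qed.

Lemma crossing_eq2 (a b p yu ylo yhi : X) : a != 0 -> b != 0 -> p != 0 ->
  a * p * ylo = b * (p * yu) + (a - b) * (p * yhi) <->
  yu = (b / a)^-1 * ylo + (1 - (b / a)^-1) * yhi.
Proof.
move=> a0 b0 p0; split=> [h|->]; last by field; rewrite a0 b0.
apply: (mulfI (mulf_neq0 b0 p0)).
have -> : b * p * yu = a * p * ylo - (a - b) * (p * yhi) by rewrite h; ring.
by field; rewrite a0 b0.
Qed.

Definition crossing_rule (C : edge D -> X) u w v v' :=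
  C w = under_op s t (phi v) (C u) (C v) /\ C v' = over_op s (phi u) (C v) (C u).

Lemma over_value y lo hi e : crossing lo hi -> src e = hi -> edge_value y e = y hi.
Proof.
move=> cr E; rewrite /edge_value E ifF //; apply/negbTE/negP => uh.
by have := not_under_over dD uh; move/negP; apply; apply/existsP; exists lo.
Qed.

Lemma crossing_coloring C y lo hi : represents_coloring C y -> crossing lo hi ->
  (if straight lo hi
   then crossing_rule C (in_edge dD lo) (out_edge dD lo) (out_edge dD hi) (in_edge dD hi)
   else crossing_rule C (out_edge dD lo) (in_edge dD lo) (in_edge dD hi) (out_edge dD hi)) <->
  y (tgt (out_edge dD lo)) = edge_value y (out_edge dD lo) /\
  y (tgt (out_edge dD hi)) = edge_value y (out_edge dD hi).
Proof.
move=> rep cr; have := crossing_psi cr; have oE := over_nodeE dD cr.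
have ul : under lo by apply/existsP; exists hi.
have ov := crossing_over_flow fphi.1 cr (fphi.2 _ _ cr).
rewrite (over_value y cr (out_edgeP dD hi)) /edge_value out_edgeP ul oE /over_shift.
rewrite -/(straight lo hi) /crossing_rule /under_op /over_op -!exprnP !rep.
have a0 (k : 'I_m.+1) : s ^+ k != 0 := zpow_neq0 k s1.
have b0 (k : 'I_m.+1) : t ^+ k != 0 := zpow_neq0 k t1.
case: ifP => sg [e1 e2 e3].
  rewrite e2 e3 e1 !in_edgeP !(zpowD _ _ s1) zpow_T -ov.
  rewrite [s ^+ psiR _ * s ^+ phi (out_edge dD hi)]mulrC.
  have over_eq : s ^+ psiR (out_edge dD hi) * s ^+ phi (in_edge dD lo) * y hi =
     s ^+ phi (in_edge dD lo) * (s ^+ psiR (out_edge dD hi) * y (tgt (out_edge dD hi))) <->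
     y (tgt (out_edge dD hi)) = y hi.
    by rewrite [_ * s ^+ phi _]mulrC -mulrA; split=> [/(mulfI (a0 _))/(mulfI (a0 _))|->].
  rewrite over_eq; split=> -[h1 h2]; split=> //.
    by rewrite h2 in h1; exact: ((crossing_eq1 _ _ _ _ (a0 _) (a0 _)).1 h1).
  by rewrite h2; exact: ((crossing_eq1 _ _ _ _ (a0 _) (a0 _)).2 h1).
rewrite e2 e3 e1 !in_edgeP !(zpowD _ _ s1) zpowN ?T1 // zpow_T.
rewrite [s ^+ psiR _ * s ^+ phi (in_edge dD hi)]mulrC.
have over_eq : s ^+ psiR (in_edge dD hi) * s ^+ phi (out_edge dD lo) * y (tgt (out_edge dD hi)) =
   s ^+ phi (out_edge dD lo) * (s ^+ psiR (in_edge dD hi) * y hi) <->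
   y (tgt (out_edge dD hi)) = y hi.
  by rewrite [_ * s ^+ phi _]mulrC -mulrA; split=> [/(mulfI (a0 _))/(mulfI (a0 _))|->].
rewrite over_eq; split=> -[h1 h2]; split=> //.
  exact: ((crossing_eq2 _ _ _ (a0 _) (b0 _) (a0 _)).1 h1).
exact: ((crossing_eq2 _ _ _ (a0 _) (b0 _) (a0 _)).2 h1).
Qed.

Lemma vertex_psi a b c : vertex_at a b c -> psiR a = psiR c /\ psiR b = psiR c + phi a.
Proof.
move=> va; have [e1 e2 _] := vertex_values dD psi_off va.
by rewrite /psiR e1 e2 psi_left; split=> //; congr (_ + _); exact: e1.
Qed.

Lemma plain_value y e : ~~ under (src e) -> edge_value y e = y (src e).
Proof. by rewrite /edge_value => /negbTE ->. Qed.

Lemma coloring_nodes C y : represents_coloring C y -> coloring s t phi C <-> node_coloring y.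
Proof.
move=> rep; have a0 (k : 'I_m.+1) : s ^+ k != 0 := zpow_neq0 k s1.
split=> [[h1 h2 h3] e|ny].
  have crs lo hi : crossing lo hi -> y (tgt (out_edge dD lo)) = edge_value y (out_edge dD lo) /\
      y (tgt (out_edge dD hi)) = edge_value y (out_edge dD hi).
    move=> cr; apply/(crossing_coloring rep cr); have := crossing_at_straight cr.
    by case: ifP => _; exact: h2.
  have [/existsP[hi cr]|nu] := boolP (under (src e)).
    have [b _] := crossing_bivalent dD cr.
    by rewrite (bivalent_out dD b erefl); exact: (crs _ _ cr).1.
  have [/existsP[lo cr]|no] := boolP (over (src e)).
    have [_ b] := crossing_bivalent dD cr.
    by rewrite (bivalent_out dD b erefl); exact: (crs _ _ cr).2.
  rewrite plain_value //; have [bx|nbx] := boolP (bivalent (src e)).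
    have sa : same_semiarc (in_edge dD (src e)) e.
      by rewrite /same_semiarc /same_arc /consecutive in_edgeP eqxx bx /=; apply/andP.
    have := h1 _ _ sa; rewrite !rep in_edgeP (bivalent_out dD bx erefl) out_edgeP.
    rewrite /psiR (bivalent_values dD psi_off false bx nu no).
    by move/(mulfI (a0 _)).
  have [a [b [c [va cs]]]] := trivalent_vertex dD nbx; have [p1 p2] := vertex_psi va.
  have [c1 c2] := h3 _ _ _ va; rewrite /over_op -exprnP !rep p2 p1 zpowD // in c1 c2.
  have {}c1 : y (tgt a) = y (tgt c) by exact: (mulfI (a0 _) c1).
  have {}c2 : y (tgt b) = y (tgt c).
    by apply: (mulfI (mulf_neq0 (a0 (psiR c)) (a0 (phi a)))); rewrite c2 mulrA [_ * s ^+ psiR _]mulrC.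
  move: va; rewrite /vertex_at => /andP[ab _].
  case: cs => -[E1 E2 E3].
    have [_ ec _] := vertex_in_edges dD ab (etrans E1 (esym E3)) (etrans E2 (esym E3)).
    by rewrite (ec e (esym E3)) -c1 E1 E3.
  have [ee _ _] := vertex_out_edges dD ab (etrans E3 (esym E1)) (etrans E3 (esym E2)).
  by have [E|E] := ee e (esym E3); rewrite E ?c1 ?c2 E3 ?E1 ?E2.
split.
- move=> e e'; rewrite /same_semiarc /same_arc /consecutive => /andP[/andP[/andP[/eqP E bx] nu] no].
  rewrite !rep (ny e') plain_value -?E //.
  have -> : psiR e' = psiR e; last by [].
  have eE := bivalent_in dD bx erefl; have e'E := bivalent_out dD bx (esym E).
  by have := bivalent_values dD psi_off false bx nu no; rewrite -eE -e'E.
- move=> u w v v' /crossing_atP[lo [hi [cr]]].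
  have := (crossing_coloring rep cr).2 (conj (ny _) (ny _)).
  by case: ifP => _ h [-> -> -> ->].
- move=> a b c va; have [p1 p2] := vertex_psi va.
  suff [-> ->] : C a = s ^+ psiR c * y (tgt c) /\ C b = s ^+ phi a * (s ^+ psiR c * y (tgt c)).
    by rewrite /over_op -exprnP rep.
  rewrite !rep p1 p2 zpowD //; move: va; rewrite /vertex_at => /andP[ab /orP[]] /and3P[/eqP E1 /eqP E2 _].
    have [_ _ nb] := vertex_in_edges dD ab E1 E2; have [nu no] := nonbivalent_lone dD nb.
    by rewrite (ny c) plain_value // E1 E2 mulrA [_ * s ^+ psiR _]mulrC.
  have [_ _ nb] := vertex_out_edges dD ab E1 E2; have [nu no] := nonbivalent_lone dD nb.
  by rewrite (ny a) (ny b) !plain_value -?E1 -?E2 // mulrA [s ^+ phi _ * _]mulrC.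
Qed.

(** Two edges that end at the same vertex give the same value to it, because the vertex rule
    multiplies by the very power of s by which the regions on their right differ. *)
Lemma coloring_represented C : coloring s t phi C -> exists y, represents_coloring C y.
Proof.
have a0 (k : 'I_m.+1) : s ^+ k != 0 := zpow_neq0 k s1.
move=> [h1 h2 h3]; exists (fun x => (s ^+ psiR (in_edge dD x))^-1 * C (in_edge dD x)) => e.
suff [E|E] : e = in_edge dD (tgt e) \/ exists a b c, [/\ vertex_at a b c, tgt a = tgt e, tgt b = tgt e &
    (e = a \/ e = b) /\ (in_edge dD (tgt e) = a \/ in_edge dD (tgt e) = b)].
- by rewrite -E mulrA divff ?mul1r.
- have [a [b [c [va E1 E2 [ee ie]]]]] := E; have [p1 p2] := vertex_psi va.
  have [c1 c2] := h3 _ _ _ va; rewrite /over_op -exprnP in c2.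
  have key e' : e' = a \/ e' = b -> (s ^+ psiR e')^-1 * C e' = (s ^+ psiR c)^-1 * C c.
    by case=> ->; rewrite ?p1 ?c1 // p2 c2 zpowD // invfM mulrA divfK.
  by rewrite key // -(key e ee) mulrA divff ?mul1r.
have [bx|nbx] := boolP (bivalent (tgt e)); first by left; exact: bivalent_in.
have [a [b [c [va [[E1 E2 E3]|[E1 E2 E3]]]]]] := trivalent_vertex dD nbx.
  right; exists a, b, c; split=> //; have /andP[ab _] := va.
  have [ee _ _] := vertex_in_edges dD ab (etrans E1 (esym E3)) (etrans E2 (esym E3)).
  by split; apply: ee; rewrite ?in_edgeP E3.
left; have /andP[ab _] := va.
have [_ ec _] := vertex_out_edges dD ab (etrans E3 (esym E1)) (etrans E3 (esym E2)).
by rewrite (ec e (esym E3)) -(ec (in_edge dD (tgt e))) ?in_edgeP ?E3.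
Qed.
End Colorings.

Section DimensionMap.
Variables (X : fieldType) (W W' : lmodType X).

Lemma linear_zero (g : W -> W') : (forall k v w, g (k *: v + w) = k *: g v + g w) -> g 0 = 0.
Proof. by move=> gl; have := gl (-1) 0 0; rewrite scaler0 addr0 scaleN1r addNr. Qed.

Lemma has_indep_map (g : W -> W') (P : W -> Prop) (P' : W' -> Prop) k :
  (forall k v w, g (k *: v + w) = k *: g v + g w) -> (forall v, g v = 0 -> v = 0) ->
  (forall v, P v -> P' (g v)) -> has_indep P k -> has_indep P' k.
Proof.
move=> gl gi PP' [b [Pb ib]]; exists (fun i => g (b i)); split=> [i|c e]; first exact: PP'.
apply: ib; apply: gi; rewrite -[RHS]e.
elim: (index_enum _) => [|i r IH]; first by rewrite !big_nil linear_zero.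
by rewrite !big_cons gl IH.
Qed.

End DimensionMap.

Lemma dimension_map (X : fieldType) (W W' : lmodType X) (g : W -> W') (g' : W' -> W) (P : W -> Prop) (P' : W' -> Prop) n :
  (forall k v w, g (k *: v + w) = k *: g v + g w) -> cancel g g' -> cancel g' g ->
  (forall v, P v <-> P' (g v)) -> dimension P n -> dimension P' n.
Proof.
move=> gl gK g'K PP' dP k.
have g'l c v w : g' (c *: v + w) = c *: g' v + g' w by rewrite -{1}(g'K v) -{1}(g'K w) -gl gK.
have gi v : g v = 0 -> v = 0.
  by move=> e; apply: (can_inj gK); rewrite e (linear_zero gl).
have g'i v : g' v = 0 -> v = 0.
  by move=> e; rewrite -(g'K v) e (linear_zero gl).
have P'P v : P' v -> P (g' v) by rewrite PP' g'K.
split=> [h|/dP h]; last exact: (has_indep_map gl gi (fun v => (PP' v).1) h).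
exact: ((dP k).1 (has_indep_map g'l g'i P'P h)).
Qed.

Lemma dimension_ffun (X : fieldType) (I : finType) (P : {ffun I -> X^o} -> Prop) d :
  dimension (fun v : 'rV[X]_#|I| => P [ffun i => v 0 (enum_rank i)]) d -> dimension P d.
Proof.
apply: (@dimension_map X _ _ (fun v : 'rV[X]_#|I| => [ffun i => v 0 (enum_rank i)] : {ffun I -> X^o})
  (fun f : {ffun I -> X^o} => \row_i f (enum_val i))) => //.
- by move=> k v w; apply/ffunP => i; rewrite !ffunE !mxE.
- by move=> v; apply/rowP => i; rewrite mxE ffunE enum_valK.
- by move=> f; apply/ffunP => i; rewrite ffunE mxE enum_rankK.
Qed.

(** * Duality between colorings and twisted flows *)

Section Duality.
Variables (R : realType) (D : diagram R).
Hypothesis dD : is_diagram D.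
Variables (m : nat) (X : fieldType) (s t : X).
Hypotheses (s1 : s ^+ m.+1 = 1) (t1 : t ^+ m.+1 = 1).
Implicit Types (e : edge D) (x lo hi : node D).
Let T := t / s.

Lemma TV1 : (T^-1) ^+ m.+1 = 1. Proof. by rewrite exprVn T1 // invr1. Qed.

(** Transposition reverses the direction of the rule: the equation of an under node gives the
    incoming flow as a power of T times the outgoing one, hence the inverse of T. *)
Definition col_twisting := power_twisting TV1.

Variable phi : {ffun edge D -> 'I_m.+1}.

Definition delta x (z : node D) : X := (z == x)%:R.

Lemma sum_delta (y : node D -> X) z : \sum_x y x * delta x z = y z.
Proof.
rewrite (bigD1 z) //= /delta eqxx mulr1 big1 ?addr0 // => x xz.
by rewrite eq_sym (negbTE xz) mulr0.
Qed.

Lemma edge_value_sum y e : edge_value dD s t phi y e = \sum_x y x * edge_value dD s t phi (delta x) e.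
Proof.
rewrite /edge_value; case: ifP => _; last by rewrite sum_delta.
under [RHS]eq_bigr do rewrite mulrDr !(mulrCA (y _)).
by rewrite big_split /= -!mulr_sumr !sum_delta.
Qed.

Definition incidence x e : X := edge_value dD s t phi (delta x) e - delta x (tgt e).

Lemma incidence_sum (nu : edge D -> X^o) x :
  \sum_e nu e * incidence x e = \sum_e nu e * edge_value dD s t phi (delta x) e - \sum_(e | tgt e == x) nu e.
Proof.
rewrite /incidence; under eq_bigr do rewrite mulrBr.
rewrite sumrB; congr (_ - _); rewrite [RHS]big_mkcond; apply: eq_bigr => e _.
by rewrite /delta; case: ifP => _; rewrite ?mulr1 ?mulr0.
Qed.

Lemma sum_src_delta (nu : edge D -> X^o) x (k : X) :
  \sum_e nu e * (k * delta x (src e)) = k * \sum_(e | src e == x) nu e.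
Proof.
rewrite [in RHS]big_mkcond mulr_sumr; apply: eq_bigr => e _.
by rewrite /delta; case: ifP => _; rewrite ?mulr1 ?mulr0 // mulrC.
Qed.

(** The equation of an under node is the twisting rule. That of the corresponding over node has the
    extra term [(1 - k lo hi) * nu (out_edge dD lo)], and the sum of the two is conservation at the
    crossing. *)
Lemma incidence_flow (nu : edge D -> X^o) :
  (forall x, \sum_e nu e * incidence x e = 0) <-> twisted_flow dD col_twisting phi nu.
Proof.
have Tk0 (k : 'I_m.+1) : T ^+ k != 0 by apply: zpow_neq0; exact: T1.
pose k lo hi := T ^+ over_shift dD phi lo hi.
have d0 x z : z != x -> delta x z = 0 by rewrite /delta => /negbTE ->.
have plain x : ~~ under x -> ~~ over x -> \sum_e nu e * incidence x e =
    \sum_(e | src e == x) nu e - \sum_(e | tgt e == x) nu e.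
  move=> nu_ no; rewrite incidence_sum -[X in _ = X - _]mul1r -sum_src_delta; congr (_ - _).
  apply: eq_bigr => e _; rewrite mul1r; congr (_ * _); rewrite /edge_value; case: ifP => // ue.
  have [E1|E1] := eqVneq (src e) x; first by rewrite -E1 ue in nu_.
  have ox : over_node (src e) != x.
    apply: contraNneq no => <-; apply/existsP; exists (src e); exact: over_nodeP.
  by rewrite (d0 _ _ E1) (d0 _ _ ox) !mulr0 addr0.
have low lo hi : crossing lo hi -> \sum_e nu e * incidence lo e =
    k lo hi * nu (out_edge dD lo) - nu (in_edge dD lo).
  move=> cr; have [bl bh] := crossing_bivalent dD cr; rewrite incidence_sum (sum_tgt_bivalent dD) //.
  rewrite -(sum_src_bivalent dD nu bl) -sum_src_delta; congr (_ - _).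
  have ul : under lo by apply/existsP; exists hi.
  apply: eq_bigr => e _; congr (_ * _); rewrite /edge_value; case: ifP => ue.
    have ol : over_node (src e) != lo.
      apply: contraTneq ul => <-; apply/negP => uo; have := not_under_over dD uo; move/negP; apply.
      apply/existsP; exists (src e); exact: over_nodeP.
    rewrite (d0 _ _ ol) mulr0 addr0; have [E|E] := eqVneq (src e) lo.
      by rewrite E (over_nodeE dD cr).
    by rewrite (d0 _ _ E) !mulr0.
  have E : src e != lo by apply: contraFneq ue => ->.
  by rewrite (d0 _ _ E) mulr0.
have high lo hi : crossing lo hi -> \sum_e nu e * incidence hi e =
    nu (out_edge dD hi) + (1 - k lo hi) * nu (out_edge dD lo) - nu (in_edge dD hi).
  move=> cr; have [bl bh] := crossing_bivalent dD cr; rewrite incidence_sum (sum_tgt_bivalent dD) //.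
  rewrite -(sum_src_bivalent dD nu bl) -(sum_src_bivalent dD nu bh) -sum_src_delta.
  rewrite -[X in _ = X + _ - _]mul1r -sum_src_delta -big_split /=; congr (_ - _).
  have ul : under lo by apply/existsP; exists hi.
  have oh : over hi by apply/existsP; exists lo.
  apply: eq_bigr => e _; rewrite -mulrDr; congr (_ * _); rewrite /edge_value; case: ifP => ue.
    have [E|E] := eqVneq (src e) lo.
      rewrite E (over_nodeE dD cr) /delta !eqxx (_ : (lo == hi) = false) ?mulr0 //.
      by apply/eqP; exact: crossing_neq cr.
    have sh : src e != hi.
      apply: contraTneq oh => <-; exact: not_under_over ue.
    have ol : over_node (src e) != hi.
      apply: contraNneq E => oE; apply/eqP; apply: (crossing_under_unique dD _ cr).
      by rewrite -oE; exact: over_nodeP.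
    by rewrite (d0 _ _ E) (d0 _ _ sh) (d0 _ _ ol) !mulr0 addr0.
  have sl : src e != lo by apply: contraFneq ue => ->.
  by rewrite (d0 _ _ sl) mulr0 addr0 mul1r.
have actE lo hi (b : X^o) : col_twisting (over_shift dD phi lo hi) b = (k lo hi)^-1 * b.
  by rewrite /= /power_act exprVn.
split=> [h|[[h1 h2] h3] x].
  have h3 lo hi : crossing lo hi -> nu (out_edge dD lo) =
      col_twisting (over_shift dD phi lo hi) (nu (in_edge dD lo)).
    move=> cr; rewrite actE; have := h lo; rewrite (low _ _ cr) => /eqP; rewrite subr_eq0 => /eqP <-.
    by rewrite mulrA mulVf ?mul1r ?Tk0.
  split=> //; split=> [x nu_ no|lo hi cr].
    by have := h x; rewrite plain // => /eqP; rewrite subr_eq0 => /eqP.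
  have := h hi; rewrite (high _ _ cr) => /eqP; rewrite subr_eq0 => /eqP <-.
  have := h lo; rewrite (low _ _ cr) => /eqP; rewrite subr_eq0 => /eqP <-.
  by ring.
have [/existsP[hi cr]|nu_] := boolP (under x).
  by rewrite (low _ _ cr) (h3 _ _ cr) actE mulrA divff ?mul1r ?subrr ?Tk0.
have [/existsP[lo cr]|no] := boolP (over x); last by rewrite plain // h1 // subrr.
rewrite (high _ _ cr); have := h2 _ _ cr => E.
have -> : nu (in_edge dD x) = nu (out_edge dD lo) + nu (out_edge dD x) - nu (in_edge dD lo).
  by rewrite E addrAC subrr add0r.
have -> : nu (in_edge dD lo) = k lo x * nu (out_edge dD lo).
  by rewrite (h3 _ _ cr) actE mulrA divff ?mul1r ?Tk0.
by ring.
Qed.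

Lemma flow_dimensions : exists r, [/\ (r <= #|node D|)%N, (r <= #|edge D|)%N,
  dimension (fun y : {ffun node D -> X^o} => node_coloring dD s t phi y) (#|node D| - r) &
  dimension (fun nu : {ffun edge D -> X^o} => twisted_flow dD col_twisting phi nu) (#|edge D| - r)].
Proof.
pose A : 'M[X]_(#|node D|, #|edge D|) := \matrix_(i, j) incidence (enum_val i) (enum_val j).
exists (\rank A); split; [exact: rank_leq_row|exact: rank_leq_col| |].
  apply: dimension_ffun => k; rewrite -(dimension_ker A k).
  suff E (v : 'rV_#|node D|) : node_coloring dD s t phi [ffun x => v 0 (enum_rank x) : X^o] <-> v *m A = 0.
    by split=> -[b [Pb ib]]; exists b; split=> // i; apply/E.
  have AE e : (v *m A) 0 (enum_rank e) = edge_value dD s t phi [ffun x => v 0 (enum_rank x) : X^o] e - v 0 (enum_rank (tgt e)).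
    rewrite mxE edge_value_sum -[X in _ - X](sum_delta (fun x => v 0 (enum_rank x))) -sumrB.
    rewrite (reindex_onto enum_rank enum_val) => [|i _]; last exact: enum_valK.
    rewrite big_mkcond; apply: eq_bigr => x _; rewrite enum_rankK eqxx.
    by rewrite !mxE !enum_rankK /incidence ffunE mulrBr.
  split=> [h|h e].
    apply/rowP => j; have := AE (enum_val j); rewrite enum_valK => ->.
    by rewrite -h ffunE subrr mxE.
  have := AE e; rewrite h mxE => /esym/eqP; rewrite subr_eq0 => /eqP ->.
  by rewrite ffunE.
apply: dimension_ffun => k; rewrite -(mxrank_tr A) -(dimension_ker A^T k).
suff E (v : 'rV_#|edge D|) : twisted_flow dD col_twisting phi [ffun e => v 0 (enum_rank e) : X^o] <-> v *m A^T = 0.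
  by split=> -[b [Pb ib]]; exists b; split=> // i; apply/E.
rewrite -incidence_flow.
have AE x : (v *m A^T) 0 (enum_rank x) = \sum_e [ffun e => v 0 (enum_rank e) : X^o] e * incidence x e.
  rewrite mxE (reindex_onto enum_rank enum_val) => [|i _]; last exact: enum_valK.
  rewrite big_mkcond; apply: eq_bigr => e _; rewrite enum_rankK eqxx.
  by rewrite !mxE !enum_rankK ffunE.
split=> [h|h x]; last by rewrite -AE h mxE.
by apply/rowP => j; have := AE (enum_val j); rewrite enum_valK => ->; rewrite h mxE.
Qed.

Lemma dim_col_nodes n : is_flow dD phi ->
  dimension (fun y : {ffun node D -> X^o} => node_coloring dD s t phi y) n ->
  \dim (col_space s t phi) = n.
Proof.
move=> fphi dn; have dc := dimension_vspace (col_space s t phi).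
have s0 (k : 'I_m.+1) : s ^+ k != 0 := zpow_neq0 k s1.
apply/eqP; rewrite eqn_leq; apply/andP; split.
- apply: (dimension_le (L := fun C (y : {ffun node D -> X^o}) => represents_coloring dD s phi C y) dc dn).
  + move=> C /mem_col_space hC; have [y ry] := coloring_represented s1 fphi hC.
    have ry' : represents_coloring dD s phi C [ffun x => y x : X^o] by move=> e; rewrite ry ffunE.
    exists [ffun x => y x]; last exact: ry'.
    exact: (coloring_nodes s1 t1 fphi ry').1.
  + by move=> e; rewrite !ffunE mulr0.
  + move=> c C1 C2 y1 y2 r1 r2 e; rewrite !ffunE r1 r2 mulrDr; congr (_ + _).
    by rewrite /GRing.scale /= mulrCA.
  + by move=> C rC; apply/ffunP => e; rewrite rC !ffunE mulr0.
- apply: (dimension_le (L := fun (y : {ffun node D -> X^o}) C => represents_coloring dD s phi C y) dn dc).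
  + move=> y ny; pose C : {ffun edge D -> X^o} := [ffun e => s ^+ potential phi (left_point dD (e, false)) * y (tgt e)].
    have rC : represents_coloring dD s phi C y by move=> e; rewrite ffunE.
    exists C => //; apply/mem_col_space; exact: (coloring_nodes s1 t1 fphi rC).2.
  + by move=> e; rewrite !ffunE mulr0.
  + move=> c y1 y2 C1 C2 r1 r2 e; rewrite !ffunE r1 r2 mulrDr; congr (_ + _).
    by rewrite /GRing.scale /= mulrCA.
  + move=> y rC; apply/ffunP => x; rewrite ffunE -(in_edgeP dD x).
    have := rC (in_edge dD x); rewrite ffunE => /eqP; rewrite eq_sym mulf_eq0 (negbTE (s0 _)) /=.
    by move/eqP.
Qed.
End Duality.

(** * Crossing changes *)

Section Switch.
Variables (R : realType) (node edge : finType) (src tgt : edge -> node) (p1 p2 : node -> R * R * R).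
Let D1 := Diagram src tgt p1.
Let D2 := Diagram src tgt p2.
Hypotheses (dD1 : is_diagram D1) (dD2 : is_diagram D2).
Variables lo hi : node.
Hypotheses (cr1 : @crossing R D1 lo hi) (cr2 : @crossing R D2 hi lo).
Hypothesis same_proj : forall x, (p1 x).1 = (p2 x).1.
Hypothesis same_pos : forall x, x != lo -> x != hi -> p1 x = p2 x.

Lemma switch_crossings x y : @crossing R D1 x y -> (x = lo /\ y = hi) \/ @crossing R D2 x y.
Proof.
move=> cr; have [xl|xl] := eqVneq x lo.
  by left; split=> //; apply: (crossing_over_unique dD1 _ cr1); rewrite -xl.
have [yh|yh] := eqVneq y hi.
  by case/eqP: xl; apply: (crossing_under_unique dD1 _ cr1); rewrite -yh.
have xh : x != hi.
  apply/eqP => xh; have uh : @under R D1 hi by apply/existsP; exists y; rewrite -xh.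
  by have := not_under_over dD1 uh; move/negP; apply; apply/existsP; exists lo.
have yl : y != lo.
  apply/eqP => yl; have ul : @under R D1 lo by apply/existsP; exists hi.
  by have := not_under_over dD1 ul; move/negP; apply; apply/existsP; exists x; rewrite -yl.
by right; move: cr; rewrite /crossing /plane_proj /height /= !same_pos.
Qed.

Lemma switch_unmarked x : ~~ @under R D2 x -> ~~ @over R D2 x -> ~~ @under R D1 x /\ ~~ @over R D1 x.
Proof.
move=> nu no; split; apply/existsP => -[y /switch_crossings[[E1 E2]|cr]].
- by case/negP: no; apply/existsP; exists hi; rewrite E1.
- by case/negP: nu; apply/existsP; exists y.
- by case/negP: nu; apply/existsP; exists lo; rewrite E2.
- by case/negP: no; apply/existsP; exists y.
Qed.

Lemma switch_in x : @bivalent R D1 x -> in_edge dD2 x = in_edge dD1 x :> edge.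
Proof. by move=> bx; apply: (bivalent_in dD1 bx); exact: (in_edgeP dD2 x). Qed.

Lemma switch_out x : @bivalent R D1 x -> out_edge dD2 x = out_edge dD1 x :> edge.
Proof. by move=> bx; apply: (bivalent_out dD1 bx); exact: (out_edgeP dD2 x). Qed.

Lemma switch_dir (e : edge) : @dir R D2 e = @dir R D1 e.
Proof. by rewrite /dir /plane_proj /= !same_proj. Qed.

Section Values.
Variables (A B : zmodType) (tw : twisting A B).

Lemma switch_conserved (C : zmodType) (nu : edge -> C) : 
  (forall x y, @crossing R D2 x y -> (x = hi /\ y = lo) \/ @crossing R D1 x y) ->
  conserved_at dD1 nu -> conserved_at dD2 nu.
Proof.
move=> sw [h1 h2]; split=> [x nux nox|x y cr].
  by have [nu1 no1] := switch_unmarked nux nox; have := h1 x nu1 no1.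
have [bx by_] := crossing_bivalent dD2 cr.
rewrite !switch_in // !switch_out //; have [[-> ->]|cr'] := sw _ _ cr; last exact: h2.
by rewrite addrC (h2 _ _ cr1) addrC.
Qed.

Lemma switch_over_shift (phi : edge -> A) x y : @bivalent R D1 x -> @bivalent R D1 y ->
  over_shift dD2 phi x y = over_shift dD1 phi x y.
Proof. by move=> bx by_; rewrite /over_shift !switch_in // !switch_dir. Qed.

(** Conservation is symmetric in the two strands of a crossing, so only the twisting rule of the
    switched crossing changes: it now concerns the strand that has become the lower one. *)
Lemma switch_twisted (phi : edge -> A) (nu : edge -> B) :
  (forall x y, @crossing R D2 x y -> (x = hi /\ y = lo) \/ @crossing R D1 x y) ->
  twisted_flow dD1 tw phi nu ->
  nu (out_edge dD2 hi) = tw (over_shift dD2 phi hi lo) (nu (in_edge dD2 hi)) ->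
  twisted_flow dD2 tw phi nu.
Proof.
move=> sw [h1 h2] h; split=> [|x y cr]; first exact: switch_conserved.
have [bx by_] := crossing_bivalent dD2 cr.
have [[-> ->] //|cr'] := sw _ _ cr.
by rewrite switch_over_shift // switch_in // switch_out //; exact: h2.
Qed.
End Values.

Lemma switch_is_flow (m : nat) (phi : {ffun edge -> 'I_m.+1}) :
  (forall x y, @crossing R D2 x y -> (x = hi /\ y = lo) \/ @crossing R D1 x y) ->
  @is_flow R D1 dD1 m phi -> @is_flow R D2 dD2 m phi.
Proof.
move=> sw [h1 h2]; split=> [|x y cr]; first exact: switch_conserved.
have [bx by_] := crossing_bivalent dD2 cr.
rewrite switch_in // switch_out //; have [[-> _]|cr'] := sw _ _ cr; last exact: h2 cr'.
exact: (crossing_over_flow h1 cr1 (h2 _ _ cr1)).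
Qed.

Lemma switch_dim (m : nat) (X : fieldType) (s t : X) (s1 : s ^+ m.+1 = 1) (t1 : t ^+ m.+1 = 1)
    (phi : {ffun edge -> 'I_m.+1}) n1 n2 :
  (forall x y, @crossing R D2 x y -> (x = hi /\ y = lo) \/ @crossing R D1 x y) ->
  dimension (fun nu : {ffun edge -> X^o} => @twisted_flow R D1 dD1 _ _ (col_twisting s1 t1) phi nu) n1 ->
  dimension (fun nu : {ffun edge -> X^o} => @twisted_flow R D2 dD2 _ _ (col_twisting s1 t1) phi nu) n2 ->
  (n1 <= n2.+1)%N.
Proof.
move=> sw d1 d2; set tw := col_twisting s1 t1.
have twl a c (b b' : X^o) : tw a (c * b + b') = c * tw a b + tw a b'.
  by rewrite /= /power_act mulrDr mulrCA.
pose a := over_shift dD2 phi hi lo.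
apply: (dimension_cut (l := fun nu : {ffun edge -> X^o} => nu (out_edge dD2 hi) - tw a (nu (in_edge dD2 hi))) d1 d2).
- split; first split=> [x _ _|x y _].
  + by rewrite !big1 // => e _; rewrite ffunE.
  + by rewrite !ffunE.
  + by move=> x y _; rewrite !ffunE act_0r.
- move=> c v w [[v1 v2] v3] [[w1 w2] w3]; split; first split=> [x nu no|x y cr].
  + under eq_bigr do rewrite !ffunE. under [RHS]eq_bigr do rewrite !ffunE.
    by rewrite !big_split /= -!scaler_sumr v1 // w1.
  + rewrite !ffunE addrACA -scalerDr v2 // scalerDr.
    by rewrite [RHS]addrACA -(w2 _ _ cr).
  + by move=> x y cr; rewrite !ffunE (v3 _ _ cr) (w3 _ _ cr) -[LHS]twl.
- move=> c v w; rewrite !ffunE (twl _ c) mulrBr opprD; exact: addrACA.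
- by move=> v tv /eqP; rewrite subr_eq0 => /eqP; exact: switch_twisted.
Qed.
End Switch.

Section CrossingChange.
Variables (R : realType) (D : diagram R) (lo hi : node D).
Let D2 := switch_crossing lo hi.
Hypotheses (dD : is_diagram D) (dD2 : is_diagram D2) (cr : crossing lo hi).
Variables (m : nat) (X : fieldType) (s t : X).
Hypotheses (s1 : s ^+ m.+1 = 1) (t1 : t ^+ m.+1 = 1).
Variable phi : {ffun edge D -> 'I_m.+1}.

Lemma crossing_change_dim : @is_flow R D dD m phi -> @is_flow R D2 dD2 m phi /\
  (\dim (@col_space R D X s t m.+1 phi) <= (\dim (@col_space R D2 X s t m.+1 phi)).+1)%N /\
  (\dim (@col_space R D2 X s t m.+1 phi) <= (\dim (@col_space R D X s t m.+1 phi)).+1)%N.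
Proof.
have := crossing_neq cr; move: dD dD2 cr phi; rewrite /D2 /switch_crossing.
case: D lo hi => nd ed sr tg ps /= l h; set ps2 := fun x => _ => d1 d2 c1 f ne fl.
have lh : l != h by apply/eqP.
have hl : (h == l) = false by rewrite eq_sym; exact: negbTE.
have sp x : (ps x).1 = (ps2 x).1.
  by rewrite /ps2; case: eqVneq => [->//|_]; case: eqVneq => [->|].
have spos x : x != l -> x != h -> ps x = ps2 x.
  by rewrite /ps2 => /negbTE -> /negbTE ->.
have c2 : @crossing R (Diagram sr tg ps2) h l.
  move: c1 => /andP[/eqP E lt]; apply/andP; split.
    by rewrite /plane_proj /= -!sp -/(@plane_proj R (Diagram sr tg ps) h); apply/eqP; exact: esym.
  by rewrite /height /= /ps2 hl !eqxx /=; exact: lt.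
have sw1 := switch_crossings d1 (p2 := ps2) c1 spos.
have spos' x : x != h -> x != l -> ps2 x = ps x by move=> a b; rewrite spos.
have sp' x : (ps2 x).1 = (ps x).1 by [].
have sw2 := switch_crossings d2 (p2 := ps) c2 spos'.
have fl2 := switch_is_flow d2 c1 c2 spos sw2 fl.
split=> //.
have [r [r1 r2 a1 a2]] := flow_dimensions d1 s1 t1 f.
have [r' [r1' r2' a1' a2']] := flow_dimensions d2 s1 t1 f.
rewrite (dim_col_nodes s1 t1 fl a1) (dim_col_nodes s1 t1 fl2 a1').
have := switch_dim c1 c2 sp spos sw2 a2 a2'.
have := switch_dim c2 c1 sp' spos' sw1 a2' a2.
move: r1 r2 r1' r2' => /=; lia.
Qed.
End CrossingChange.

Lemma off_shadow_dense (R : realType) (D : diagram R) (dD : is_diagram D) (q : R * R) (W : set (R * R)) :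
  nbhs q W -> exists2 q', W q' & ~ shadow D q'.
Proof.
move=> /near2P[r r0 h].
have [c /andP[c1 c2] cs] := @avoid_seq R [seq (plane_proj x).1 | x <- enum (node D)] q.1 (q.1 + r) ltac:(lra).
have np (x : node D) : plane_proj x != (c, q.2).
  by apply: contraNneq cs => E; apply/mapP; exists x; rewrite ?mem_enum // E.
(* A constant function has no jumps, so the density statement of [off_shadow_value] holds at every
   planar point that is not the projection of a node. *)
have [_ hd] := @off_shadow_value R D dD unit (fun=> tt) (fun _ _ => near_all _ (fun _ => erefl)) (fun=> erefl) (c, q.2) np.
have /hd[q' Wq' nq'] : nbhs (c, q.2) W; last by exists q'.
apply/near2P; exists (Num.min (c - q.1) (r - (c - q.1))); first by rewrite lt_min; apply/andP; split; lra.
move=> q' /=; rewrite !lt_min => /andP[/ltr_normlP[a1 a2] /ltr_normlP[a3 a4]] /andP[a5 a6].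
by apply: h; [apply/ltr_normlP; split; lra|apply: lt_trans a6 _; lra].
Qed.

Definition linked (R : realType) (D D' : diagram R) V V' F F' (h h' : S3 R -> S3 R) :=
  [/\ pushable D V F, pushable D' V' F', continuous h, continuous h' &
      [/\ cancel h h', cancel h' h & forall z, V z <-> V' (h z)]].

Lemma linked_sym (R : realType) (D D' : diagram R) V V' F F' h h' :
  linked D D' V V' F F' h h' -> linked D' D V' V F' F h' h.
Proof. by case=> a b c d [e f g]; split=> //; split=> // z; rewrite g f. Qed.

Lemma morph_inv (G G' : groupType) (f : G -> G') :
  (forall x y, f (x * y) = f x * f y)%g -> (forall x, f x^-1 = (f x)^-1)%g.
Proof.
move=> fM x; have f1 : f 1%g = 1%g by apply: (mulgI (f 1%g)); rewrite -fM !mulg1.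
by apply: (mulgI (f x)); rewrite -fM !mulgV.
Qed.

Section Chi.
Variables (R : realType) (D : diagram R).
Hypothesis dD : is_diagram D.
Variables (A B B' : zmodType) (tw : twisting A B) (tw' : twisting A B').

Lemma chi_mulrn (phi : edge D -> A) n x y : chi dD tw (fun e => phi e *+ n) x y = chi dD tw phi x y *+ n.
Proof.
pose f (g : semidirect tw) : semidirect tw := (g.1 *+ n, 0).
have fM g g' : f (g * g')%g = (f g * f g')%g by rewrite !sd_mulE /f /= act_0r addr0 mulrnDl.
have := cocycle_of_morph dD (lift_pot tw phi (fun=> 0)) fM (morph_inv fM) x y => /(congr1 fst) /= ->.
have -> // : f \o lift_pot tw phi (fun=> 0) = lift_pot tw (fun e => phi e *+ n) (fun=> 0).
apply/funext => q; rewrite /lift_pot /=; congr pair; rewrite /potential -sumrMnl.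
by apply: eq_bigr => e _; rewrite !pmulrn mulrzAC.
Qed.

Lemma chi_zero x y : chi dD tw (fun=> 0) x y = 0.
Proof. by have := chi_mulrn (fun _ : edge D => 0) 0 x y; rewrite mulr0n. Qed.

(** The class of phi reappears as the second component of an untwisted flow cocycle, which opens it
    to the results on twisted flows. *)
Lemma chi_flow (phi : edge D -> A) x y :
  (flow_cocycle dD (trivial_twisting A A) (fun=> 0) phi x y).2 = chi dD tw phi x y.
Proof.
pose f (g : semidirect (trivial_twisting A A)) : semidirect tw := (g.2, 0).
have fM g g' : f (g * g')%g = (f g * f g')%g by rewrite !sd_mulE /f /= act_0r addr0.
have := cocycle_of_morph dD (lift_pot (trivial_twisting A A) (fun _ : edge D => 0) (potential phi)) fM (morph_inv fM) x y.
by move=> /(congr1 fst).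
Qed.
End Chi.

(** * Invariance under equivalence *)

Section Linked.
Variables (R : realType) (D D' : diagram R).
Hypotheses (dD : is_diagram D) (dD' : is_diagram D').
Variables (V V' : set (S3 R)) (F F' : R -> S3 R -> S3 R) (h h' : S3 R -> S3 R).
Hypothesis lk : linked D D' V V' F F' h h'.

(** The common origin for gauges on both sides: below D and so far out that the retraction fixes it,
    and mapped to a point over a region of D'. An open set of candidates has an open image, which
    contains points off the shadow of D'. *)
Lemma base_point : exists P P' : R * R * R, [/\ gbound D + 1 < `|P|, side D 1 P, V (Some P),
  h (Some P) = Some P' & side D' 1 P'].
Proof.
have [pF pF' hc hc' [hK h'K VV']] := lk.
have gM := gbound_gt0 D.
pose W : set (R * R * R) := [set x | x.2 < - (gbound D + 1)].
have Wn x : W x -> \forall y \near x, W y.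
  by move=> wx; apply: (@near_snd R x (fun z => z < - (gbound D + 1))); exact: (cvgr_lt x.2 cvg_id).
have Wside x : W x -> side D 1 x.
  by rewrite /W /= => wx; apply: far_side; rewrite ?sg1 // mul1r; lra.
have Wfar x : W x -> gbound D + 1 < `|x|.
  rewrite /W /= norm3E lt_max => wx; apply/orP; right; apply: lt_le_trans (_ : - x.2 <= _); first lra.
  by rewrite -normrN ler_norm.
have [x0 [wx0 [y0 hy0]]] : exists x, W x /\ exists y, h (Some x) = Some y.
  (* One point may be sent to infinity by h, but not two. *)
  pose a (c : R) : R * R * R := ((c, 0), - (gbound D + 2)).
  have wa c : W (a c) by rewrite /W /a /=; lra.
  case E0: (h (Some (a 0))) => [y|]; first by exists (a 0); split=> //; exists y.
  case E1: (h (Some (a 1))) => [y|]; first by exists (a 1); split=> //; exists y.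
  have := can_inj hK (etrans E0 (esym E1)) => -[] /eqP; rewrite eq_sym oner_eq0 //.
have nW : \forall y \near y0, exists2 x, W x & h' (Some y) = Some x.
  have hn : \forall z \near h' (Some y0), exists2 x, W x & z = Some x.
    rewrite -hy0 hK; apply/near_someP; have := Wn x0 wx0; apply: filterS => x wx; by exists x.
  exact: (hc' (Some y0) _ hn).
have /near3P[r r0 hr] := nW.
have nq : nbhs y0.1 [set q | within3 r y0 (q, y0.2)].
  by apply/near2P; exists r => // q a b; split; rewrite //= subrr normr0.
have [q wq nsq] := off_shadow_dense dD' nq.
have [x wx E] := hr _ wq.
have hx : h (Some x) = Some (q, y0.2) by rewrite -E h'K.
exists x, (q, y0.2); split=> //; [exact: Wfar|exact: Wside| |exact: not_shadow_side].
have [_ _ _ _ [F1 Ffar]] := pF.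
rewrite -(Ffar 1 x (Wfar x wx)); apply: F1; exact: side_compl (Wside x wx).
Qed.

(** On V, the class of phi and the pullback by h of the class of [phi'] are cohomologous, and [w] is
    the 0-cochain between them. *)
Definition shift_related (A B : zmodType) (tw : twisting A B) phi phi' (w : S3 R -> A) :=
  forall x, V x -> \forall y \near x,
    chi dD' tw phi' (h x) (h y) = - w x + chi dD tw phi x y + w y.

Section LevelOne.
Variables (A B : zmodType) (tw : twisting A B).
Local Notation tw0 := (trivial_twisting A A).

Lemma flow_shift (phi : edge D -> A) :
  conserved_at dD phi -> (forall lo hi, crossing lo hi -> phi (out_edge dD lo) = phi (in_edge dD lo)) ->
  exists (phi' : edge D' -> A) w, [/\ conserved_at dD' phi',
    forall lo hi, crossing lo hi -> phi' (out_edge dD' lo) = phi' (in_edge dD' lo) &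
    shift_related tw phi phi' w].
Proof.
move=> pc pu; have [P [P' [_ _ VP hP sP']]] := base_point.
have [pF pF' hc hc' [hK h'K VV']] := lk.
have z0 (E : diagram R) (dE : is_diagram E) : conserved_at dE (fun=> 0 : A).
  by split=> [x _ _|lo hi _]; rewrite ?addr0 // !big1.
have ce x : V x -> \forall y \near x, chi dD' tw0 (fun=> 0) (h x) (h y) =
    - (fun=> 0) x + chi dD tw0 (fun=> 0) x y + (fun=> 0 : A) y.
  by move=> _; apply: near_all => y; rewrite !chi_zero oppr0 !addr0.
have tf : twisted_flow dD tw0 (fun=> 0) phi by split.
have [phi' [f [[c' u'] [fg f1 _]]]] := flow_transfer pF pF' hc hc' hK h'K VV' (z0 D dD) (z0 D' dD')
  (fun _ _ _ => erefl) (fun _ _ _ => erefl) ce VP hP sP' tf.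
exists phi', (fun x => (f x).2); split=> // x vx.
have := fg x vx; apply: filterS => y /(congr1 snd).
rewrite (chi_flow dD' tw) !sd_mulE !sd_invE /= => ->.
by rewrite (chi_flow dD tw).
Qed.

(** If n annihilates [phi'], then n times the class of phi is a coboundary on V, and rigidity makes
    the flow itself vanish, not only its class. *)
Lemma shift_torsion (phi : edge D -> A) phi' w n :
  conserved_at dD phi -> (forall lo hi, crossing lo hi -> phi (out_edge dD lo) = phi (in_edge dD lo)) ->
  shift_related tw phi phi' w -> (forall e, phi' e *+ n = 0) -> forall e, phi e *+ n = 0.
Proof.
move=> pc pu sr n0; have [P [P' [farP sP VP hP sP']]] := base_point.
have [pF _ _ _ _] := lk.
have z0 : conserved_at dD (fun=> 0 : A) by split=> [x _ _|lo hi _]; rewrite ?addr0 // !big1.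
have tf1 : twisted_flow dD tw0 (fun=> 0) (fun e => phi e *+ n).
  split=> [|lo hi cr]; last by rewrite /= (pu _ _ cr).
  split=> [x nu no|lo hi cr]; first by rewrite !sumrMnl pc.1.
  by rewrite -!mulrnDl pc.2.
have tf2 : twisted_flow dD tw0 (fun=> 0) (fun=> 0 : A) by split.
pose f (x : S3 R) : semidirect tw0 := (0, w x *+ n - w (Some P) *+ n).
apply: (flow_rigid pF z0 (fun _ _ _ => erefl) farP sP (f := f) tf1 tf2); last by rewrite /f subrr.
move=> x vx; have := sr x vx; apply: filterS => y E.
rewrite [LHS]surjective_pairing [RHS]surjective_pairing !sd_mulE !sd_invE /=.
rewrite !cocycle_fst !(chi_flow dD tw) !chi_zero !chi_mulrn oppr0 !addr0; congr pair.
have -> : chi dD tw phi x y = w x + chi dD' tw phi' (h x) (h y) - w y.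
  by rewrite E !addrA subrr add0r addrK.
have c0 : chi dD' tw phi' (h x) (h y) *+ n = 0.
  rewrite -chi_mulrn; have -> : (fun e => phi' e *+ n) = (fun=> 0) by apply/funext.
  exact: chi_zero.
rewrite mulrnBl mulrnDl c0.
by rewrite addr0 opprB !addrA !subrK subrr.
Qed.
End LevelOne.
End Linked.

Lemma shift_related_sym (R : realType) (D D' : diagram R) (dD : is_diagram D) (dD' : is_diagram D')
    V V' F F' h h' (A B : zmodType) (tw : twisting A B) phi phi' w :
  linked D D' V V' F F' h h' -> shift_related dD dD' V h tw phi phi' w ->
  shift_related dD' dD V' h' tw phi' phi (fun x => - w (h' x)).
Proof.
move=> [pF pF' hc hc' [hK h'K VV']] sr x vx.
have vx' : V (h' x) by apply/VV'; rewrite h'K.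
have := near_comp (@hc' x) (sr _ vx'); apply: filterS => y; rewrite !h'K => ->.
by rewrite opprK !addrA subrr add0r addrK.
Qed.

Lemma flow_gcd_dvd (R : realType) (D : diagram R) (m n : nat) (phi : {ffun edge D -> 'I_m}) :
  (m %| flow_gcd phi * n)%N <-> forall e, (m %| phi e * n)%N.
Proof.
rewrite /flow_gcd; split=> [h e|h].
  apply: dvdn_trans h _; apply: dvdn_mul => //; rewrite (bigD1 e) //=; exact: dvdn_gcdl.
by elim/big_ind: _ => [|a b ha hb|e _]; [exact: dvdn_mulr|rewrite muln_gcdl dvdn_gcd ha hb|exact: h].
Qed.

(** The gcd divides the modulus, so it can be recovered from the integers that annihilate the flow:
    the test value is the modulus divided by the gcd. *)
Lemma flow_gcd_eq (R : realType) (D D' : diagram R) (m : nat) (phi : {ffun edge D -> 'I_m.+1})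
    (phi' : {ffun edge D' -> 'I_m.+1}) :
  (forall n, (forall e, phi e *+ n = 0) <-> (forall e, phi' e *+ n = 0)) -> flow_gcd phi = flow_gcd phi'.
Proof.
have zE (k : 'I_m.+1) n : k *+ n = 0 <-> (m.+1 %| k * n)%N.
  have -> : (m.+1 %| k * n)%N = (k *+ n == 0).
    by rewrite -val_eqE Zp_mulrn /= /dvdn.
  by split=> /eqP.
move=> h; have {}h n : (m.+1 %| flow_gcd phi * n)%N <-> (m.+1 %| flow_gcd phi' * n)%N.
  rewrite !flow_gcd_dvd; have [h1 h2] := h n.
  by split=> a e; apply/zE; [apply: h1|apply: h2] => e'; apply/zE.
have dm (E : diagram R) (f : {ffun edge E -> 'I_m.+1}) : (flow_gcd f %| m.+1)%N.
  by rewrite /flow_gcd; elim: (index_enum _) => [|e r IH]; rewrite ?big_nil // big_cons; apply: dvdn_trans (dvdn_gcdr _ _) IH.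
have half (E E' : diagram R) (f : {ffun edge E -> 'I_m.+1}) (f' : {ffun edge E' -> 'I_m.+1}) :
    (forall n, (m.+1 %| flow_gcd f * n)%N -> (m.+1 %| flow_gcd f' * n)%N) -> (flow_gcd f %| flow_gcd f')%N.
  move=> hh; have /dvdnP[k kE] := dm _ f; have k0 : (0 < k)%N by case: k kE => // /eqP.
  have := hh k; rewrite {1}kE mulnC dvdnn => /(_ isT).
  by move=> hd; rewrite -(dvdn_pmul2l k0) -kE [X in (_ %| X)%N]mulnC.
by apply/eqP; rewrite eqn_dvd; apply/andP; split; apply: half => n /h.
Qed.

Section ColFlows.
Variables (R : realType) (D : diagram R).
Hypothesis dD : is_diagram D.
Variables (A : zmodType) (X : fieldType) (tw : twisting A X^o).
Hypothesis twl : forall a (c : X) b b', tw a (c *: b + b') = c *: tw a b + tw a b'.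

Definition pair_twisting : twisting A (X^o * X^o)%type.
Proof.
exists (fun a b => (tw a b.1, tw a b.2)) => [[b b']|a a' [b b']|a [b b'] [c c']] /=.
- by rewrite !act0.
- by rewrite !actD.
- by rewrite !actB.
Defined.

(** Both flows and their combination are images of one cocycle with second component in X x X under
    homomorphisms of semidirect products, so linearity is a case of naturality. *)
Lemma flow_cocycle_lin phi c (nu1 nu2 : edge D -> X^o) x y :
  (flow_cocycle dD tw phi (fun e => c *: nu1 e + nu2 e) x y).2 =
  c *: (flow_cocycle dD tw phi nu1 x y).2 + (flow_cocycle dD tw phi nu2 x y).2.
Proof.
pose h2 q : semidirect pair_twisting := (potential phi q, (potential nu1 q, potential nu2 q)).
pose p1 (g : semidirect pair_twisting) : semidirect tw := (g.1, g.2.1).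
pose p2 (g : semidirect pair_twisting) : semidirect tw := (g.1, g.2.2).
pose f (g : semidirect pair_twisting) : semidirect tw := (g.1, c *: g.2.1 + g.2.2).
have p1M g g' : p1 (g * g')%g = (p1 g * p1 g')%g by [].
have p2M g g' : p2 (g * g')%g = (p2 g * p2 g')%g by [].
have fM g g' : f (g * g')%g = (f g * f g')%g.
  by rewrite !sd_mulE /f /= twl scalerDr addrACA.
have e1 := cocycle_of_morph dD h2 p1M (morph_inv p1M) x y.
have e2 := cocycle_of_morph dD h2 p2M (morph_inv p2M) x y.
have e3 := cocycle_of_morph dD h2 fM (morph_inv fM) x y.
have E1 : flow_cocycle dD tw phi nu1 x y = p1 (cocycle_of dD h2 x y) by rewrite e1.
have E2 : flow_cocycle dD tw phi nu2 x y = p2 (cocycle_of dD h2 x y) by rewrite e2.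
have E3 : flow_cocycle dD tw phi (fun e => c *: nu1 e + nu2 e) x y = f (cocycle_of dD h2 x y).
  rewrite e3; congr (cocycle_of dD _ x y); apply/funext => q; rewrite /lift_pot /f /h2 /=; congr pair.
  rewrite /potential scaler_sumr -big_split /=; apply: eq_bigr => e _.
  by rewrite mulrzDl scalerMzr.
by rewrite E1 E2 E3.
Qed.
End ColFlows.

Section LevelTwo.
Variables (R : realType) (D D' : diagram R).
Hypotheses (dD : is_diagram D) (dD' : is_diagram D').
Variables (V V' : set (S3 R)) (F F' : R -> S3 R -> S3 R) (h h' : S3 R -> S3 R).
Hypothesis lk : linked D D' V V' F F' h h'.
Variables (A : zmodType) (X : fieldType) (tw : twisting A X^o).
Hypothesis twl : forall a (c : X) b b', tw a (c *: b + b') = c *: tw a b + tw a b'.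
Variables (phi : edge D -> A) (phi' : edge D' -> A) (w : S3 R -> A).
Hypotheses (pc : conserved_at dD phi) (pc' : conserved_at dD' phi').
Hypothesis pu : forall lo hi, crossing lo hi -> phi (out_edge dD lo) = phi (in_edge dD lo).
Hypothesis pu' : forall lo hi, crossing lo hi -> phi' (out_edge dD' lo) = phi' (in_edge dD' lo).
Hypothesis sr : shift_related dD dD' V h tw phi phi' w.

Lemma act_lin3 a a' c (u1 u2 b1 b2 v1 v2 : X^o) :
  c *: (- tw a u1 + tw a b1 + tw a' v1) + (- tw a u2 + tw a b2 + tw a' v2) =
  - tw a (c *: u1 + u2) + tw a (c *: b1 + b2) + tw a' (c *: v1 + v2).
Proof.
have aux (x x' y y' z z' : X) : c * (- x + y + z) + (- x' + y' + z') =
    - (c * x + x') + (c * y + y') + (c * z + z') by ring.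
rewrite (twl a c u1) (twl a c b1) (twl a' c v1); exact: aux.
Qed.

Lemma linked_lin P c nu1 nu2 nu1' nu2' (f1 f2 : S3 R -> semidirect tw) :
  linked_flows dD dD' V h phi phi' w P nu1 nu1' f1 ->
  linked_flows dD dD' V h phi phi' w P nu2 nu2' f2 ->
  exists f : S3 R -> semidirect tw, linked_flows dD dD' V h phi phi' w P (fun e => c *: nu1 e + nu2 e)
    (fun e => c *: nu1' e + nu2' e) f.
Proof.
move=> [g1 a1 b1] [g2 a2 b2]; have [[oV _ _ _ _] _ _ _ _] := lk.
exists (fun x => (w x, c *: (f1 x).2 + (f2 x).2) : semidirect tw); split=> //.
  move=> x vx; have hV : \forall y \near x, V y by exact: open_nbhs_nbhs.
  apply: filterS3 (g1 x vx) (g2 x vx) hV => y e1 e2 vy.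
  rewrite [LHS]surjective_pairing [RHS]surjective_pairing.
  move: e1 => /[dup] /(congr1 fst) e11 /(congr1 snd) e12; move: e2 => /(congr1 snd) e22.
  rewrite !sd_mulE !sd_invE /= !cocycle_fst ?a1 ?a2 // in e11 e12 e22 *.
  congr pair; first exact: e11.
  rewrite (flow_cocycle_lin dD' twl phi' c nu1' nu2') (flow_cocycle_lin dD twl phi c nu1 nu2) e12 e22.
  exact: act_lin3.
by rewrite b1 b2 /= scaler0 addr0.
Qed.

Lemma twisted_flow_dim n n' :
  dimension (fun nu : {ffun edge D -> X^o} => twisted_flow dD tw phi nu) n ->
  dimension (fun nu : {ffun edge D' -> X^o} => twisted_flow dD' tw phi' nu) n' -> (n <= n')%N.
Proof.
move=> dn dn'; have [P [P' [farP sP VP hP sP']]] := base_point dD' lk.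
have [pF pF' hc hc' [hK h'K VV']] := lk.
pose L (nu : {ffun edge D -> X^o}) (nu' : {ffun edge D' -> X^o}) :=
  twisted_flow dD tw phi nu /\ exists f : S3 R -> semidirect tw, linked_flows dD dD' V h phi phi' w P nu nu' f.
have tot (nu : {ffun edge D -> X^o}) : twisted_flow dD tw phi nu -> exists2 nu' : {ffun edge D' -> X^o}, twisted_flow dD' tw phi' nu' & L nu nu'.
  move=> tf; have [nu' [f [tf' lf]]] := flow_transfer pF pF' hc hc' hK h'K VV' pc pc' pu pu' sr VP hP sP' tf.
  pose g : {ffun edge D' -> X^o} := [ffun e => nu' e].
  have gE : (g : edge D' -> X^o) = nu' by apply/funext => e; rewrite ffunE.
  by exists g; rewrite /L gE //; split=> //; exists f.
have tfl c (v v' : {ffun edge D -> X^o}) :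
    twisted_flow dD tw phi v -> twisted_flow dD tw phi v' -> twisted_flow dD tw phi (c *: v + v').
  move=> [[v1 v2] v3] [[w1 w2] w3]; split; first split=> [x nu no|x y cr].
  - under eq_bigr do rewrite !ffunE. under [RHS]eq_bigr do rewrite !ffunE.
    by rewrite !big_split /= -!scaler_sumr v1 // w1.
  - by rewrite !ffunE addrACA -scalerDr v2 // scalerDr [RHS]addrACA -(w2 _ _ cr).
  - by move=> x y cr; rewrite !ffunE (v3 _ _ cr) (w3 _ _ cr) -twl.
have lin c v1 v2 w1 w2 : L v1 w1 -> L v2 w2 -> L (c *: v1 + v2) (c *: w1 + w2).
  move=> [t1 [f1 l1]] [t2 [f2 l2]]; split; first exact: tfl.
  have [f lf] := linked_lin c l1 l2; exists f.
  have E1 : ((c *: v1 + v2 : {ffun edge D -> X^o}) : edge D -> X^o) = fun e => c *: v1 e + v2 e.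
    by apply/funext => e; rewrite !ffunE.
  have E2 : ((c *: w1 + w2 : {ffun edge D' -> X^o}) : edge D' -> X^o) = fun e => c *: w1 e + w2 e.
    by apply/funext => e; rewrite !ffunE.
  by rewrite E1 E2.
have L0 : L 0 0.
  have t0 : twisted_flow dD tw phi (0 : {ffun edge D -> X^o}).
    split; first split=> [x _ _|x y _].
    - by rewrite !big1 // => e _; rewrite ffunE.
    - by rewrite !ffunE.
    - by move=> x y _; rewrite !ffunE act_0r.
  (* Zero is linked to some flow, and the difference of this link with itself links zero to zero. *)
  have [v' _ l] := tot _ t0; have := lin (-1) _ _ _ _ l l.
  by rewrite !scaleN1r !addNr.
apply: (dimension_le dn dn' tot L0 lin) => v [tv [f [fg f1 fP]]].
have [t0 [g [gg g1 gP]]] := L0.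
apply/ffunP => e; rewrite -[RHS]/((0 : {ffun edge D -> X^o}) e).
(* The links of [v] and of 0 to the same zero flow compose to a gauge between their cocycles which
   is 1 at P. *)
apply: (flow_rigid pF pc pu farP sP (f := fun x => (f x * (g x)^-1)%g) tv t0); last by rewrite fP gP mulgV.
move=> x vx; apply: filterS2 (fg x vx) (gg x vx) => y e1 e2.
rewrite e1 in e2; have -> := gauge_swap (esym (esym e2)).
by rewrite !invgM !invgK !mulgA.
Qed.
End LevelTwo.

(** * Functions constant on the components *)

Section EdgeGap.
Variables (R : realType) (D : diagram R).
Hypothesis dD : is_diagram D.
Implicit Types (e : edge D) (v : node D).

Lemma edge_point_incident e (k : R) v : 0 <= k <= 1 -> edge_point e k = pos v -> incident e v.
Proof.
move=> k01 E; have E1 : (edge_point e k).1 = plane_proj v by rewrite E.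
have [n [i _ nE]] := ep_node_end dD k01 E1.
by have <- : n = v by apply: (pos_inj dD); rewrite -nE E.
Qed.

(** Edges without a common node are disjoint compact sets, hence at a positive distance, and there
    are finitely many pairs. *)
Lemma edge_gap : exists2 c0 : R, 0 < c0 & forall e e' (k k' : R), 0 <= k <= 1 -> 0 <= k' <= 1 ->
  `|edge_point e k - edge_point e' k'| < c0 -> exists v, incident e v /\ incident e' v.
Proof.
have [K K1 hK] := edge_proj_lip dD; have K0 : 0 < K := lt_le_trans ltr01 K1.
have gap (ee : edge D * edge D) : exists r : R, 0 < r /\ (~ (exists v, incident ee.1 v /\ incident ee.2 v) ->
    forall k, 0 <= k <= 1 -> r <= `|edge_point ee.1 k - edge_proj ee.2 (edge_point ee.1 k)|).
  case: ee => e e' /=; have [sh|ns] := pselect (exists v, incident e v /\ incident e' v); first by exists 1.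
  have [k|k k01|r r0 hr] := @compact_pos R (fun k => `|edge_point e k - edge_proj e' (edge_point e k)|); last by exists r.
    apply: cont_norm; apply: cont_addv; first exact: edge_cont.
    by apply: cont_oppv; apply: (edge_proj_cont dD); exact: edge_cont.
  rewrite normr_gt0 subr_eq0; apply/eqP => E; apply: ns.
  have [k' k'01 E'] := edge_proj_on e' (edge_point e k).
  have EE : edge_point e k = edge_point e' k' by rewrite E E'.
  have [ee'|ne] := pselect (e = e'); first by exists (src e); split; left; rewrite ?ee'.
  have [v vE] := edge_meet_node dD ne k01 k'01 EE.
  by exists v; split; [exact: edge_point_incident vE|apply: (edge_point_incident k'01); rewrite -EE].
have /choice [r hr] := gap; have [r0 r00 h0] := finite_pos (fun ee => (hr ee).1).
exists (r0 / K) => [|e e' k k' k01 k'01]; first by rewrite divr_gt0.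
rewrite ltr_pdivlMr // => lt; apply: contrapT => ns.
have := (hr (e, e')).2 ns k k01 => /= le1; have := hK e' (edge_point e k) k' k'01.
by have := h0 (e, e'); rewrite mulrC in lt; lra.
Qed.

Definition constant_on_edges (X : Type) (y : node D -> X) := forall e, y (tgt e) = y (src e).

Lemma incident_value (X : Type) (y : node D -> X) e v : constant_on_edges y -> incident e v -> y v = y (src e).
Proof. by move=> cy [<-//|<-]. Qed.

Lemma node_coloring0 (m : nat) (X : fieldType) (s t : X) (y : node D -> X) :
  node_coloring dD s t ([ffun=> 0] : {ffun edge D -> 'I_m.+1}) y <-> constant_on_edges y.
Proof.
have E e : edge_value dD s t ([ffun=> 0] : {ffun edge D -> 'I_m.+1}) y e = y (src e).
  rewrite /edge_value; case: ifP => // _; rewrite /over_shift !ffunE oppr0.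
  by case: ifP => _; rewrite !expr0 mul1r subrr mul0r addr0.
by split=> h e; have := h e; rewrite E.
Qed.

Lemma eps_neighborhood_some (eps : R) (x : R * R * R) : eps_neighborhood D eps (Some x) <->
  exists e k, 0 <= k <= 1 /\ `|x - edge_point e k| <= eps.
Proof.
split=> [[z [_ [e [k [k01 ->]]] le] [<-]]|[e [k [k01 le]]]]; first by exists e, k.
by exists x => //; exists (edge_point e k) => //; exists e, k.
Qed.

(** The edge at which a point is evaluated is chosen from the point alone, so the evaluation is
    linear in y. *)
Lemma component_values (X : zmodType) (eps : R) : exists q : S3 R -> (node D -> X) -> X, forall x,
  eps_neighborhood D eps (Some x) -> exists e k, [/\ 0 <= k <= 1, `|x - edge_point e k| <= eps &
    forall y, q (Some x) y = y (src e)].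
Proof.
have /choice [q hq] (z : S3 R) : exists g : (node D -> X) -> X, forall x, z = Some x ->
    eps_neighborhood D eps (Some x) -> exists e k, [/\ 0 <= k <= 1, `|x - edge_point e k| <= eps &
    forall y, g y = y (src e)].
  have [[x [zx /eps_neighborhood_some[e [k [k01 le]]]]]|no] := pselect (exists x, z = Some x /\ eps_neighborhood D eps (Some x)).
    by exists (fun y => y (src e)) => x'; rewrite zx => -[<-] _; exists e, k.
  by exists (fun=> 0) => x zx nx; case: no; exists x.
by exists q => x; exact: hq.
Qed.
End EdgeGap.

Lemma near_norm (R : realType) (x : R * R * R) (r : R) : 0 < r -> \forall y \near x, `|x - y| < r.
Proof.
move=> r0; apply/near3P; exists r => // y [h1 h2 h3].
by rewrite norm3E !gt_max !(distrC _ y.1.1) !(distrC _ y.1.2) !(distrC _ y.2) h1 h2 h3.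
Qed.

Lemma triple_lt (R : realFieldType) (a c : R) : 0 < a -> 3 * a < c -> a + (a + a) < c /\ a < c.
Proof. by move=> a0 ac; split; lra. Qed.

Section ConstantTransfer.
Variables (R : realType) (D D' : diagram R).
Hypotheses (dD : is_diagram D) (dD' : is_diagram D').
Variables (eps eps' c0 : R) (h h' : S3 R -> S3 R).
Hypotheses (e0 : 0 < eps) (e0' : 0 < eps') (small : 3 * eps < c0).
Hypothesis gap : forall (e e' : edge D) (k k' : R), 0 <= k <= 1 -> 0 <= k' <= 1 ->
  `|edge_point e k - edge_point e' k'| < c0 -> exists v, incident e v /\ incident e' v.
Hypotheses (hc' : continuous h') (hK : cancel h h') (h'K : cancel h' h).
Hypothesis NN' : forall z, eps_neighborhood D eps z <-> eps_neighborhood D' eps' (h z).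
Local Notation R3 := (R * R * R)%type.

(** Evaluation of y is constant along paths inside the neighbourhood, and [h'] carries the edges of
    D' to such paths. A function constant on the edges of D thus gives one on the nodes of D'. *)
Lemma constant_dim (X : fieldType) n n' :
  dimension (fun y : {ffun node D -> X^o} => constant_on_edges y) n ->
  dimension (fun y : {ffun node D' -> X^o} => constant_on_edges y) n' -> (n <= n')%N.
Proof.
move=> dn dn'; have [q hq] := component_values D X eps.
have N'N z : eps_neighborhood D' eps' z -> eps_neighborhood D eps (h' z).
  by move=> nz; apply/NN'; rewrite h'K.
have qz z : eps_neighborhood D eps z -> exists e, forall y, q z y = y (src e).
  by case: z => [x|] nx; [have [e [k [_ _ hy]]] := hq x nx; exists e|case: nx => x _].
(* Each point is within eps of its edge and the two points are within eps of each other; this is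
   where [3 * eps < c0] comes from. *)
have qloc y x x1 : constant_on_edges y -> eps_neighborhood D eps (Some x) ->
    eps_neighborhood D eps (Some x1) -> `|x - x1| < eps -> q (Some x) y = q (Some x1) y.
  move=> cy nx nx1 lt; have [e [k [k01 le ->]]] := hq x nx; have [e1 [k1 [k101 le1 ->]]] := hq x1 nx1.
  have [v [i1 i2]] : exists v, incident e v /\ incident e1 v.
    apply: (gap k01 k101); apply: le_lt_trans (dist_le3 _ x _) _.
    have b := le_trans (dist_le3 x x1 (edge_point e1 k1)) (lerD (ltW lt) le1).
    have s3 : eps + (eps + eps) < c0 by have [] := triple_lt e0 small.
    by rewrite distrC in le; exact: le_lt_trans (lerD le b) s3.
  by rewrite -(incident_value cy i1) (incident_value cy i2).
have path y (p : R -> R3) : constant_on_edges y -> (forall t, continuous_at p t) ->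
    (forall t, 0 <= t <= 1 -> eps_neighborhood D' eps' (Some (p t))) ->
    q (h' (Some (p 0))) y = q (h' (Some (p 1))) y.
  move=> cy pc pN; apply: (@loc_const_segment R X (fun t => q (h' (Some (p t))) y) 0 1) => // t t01.
  have N1 := N'N _ (pN t t01).
  have [x xE] : exists x : R3, h' (Some (p t)) = Some x by case: (h' _) N1 => [x|[x _ //]]; exists x.
  pose S (z : S3 R) := exists2 x1 : R3, z = Some x1 & `|x - x1| < eps.
  have hn : \forall z \near h' (Some (p t)), S z.
    rewrite xE; apply/near_someP; have : \forall y0 \near x, `|x - y0| < eps by exact: near_norm.
    by apply: filterS => x1 lt; exists x1.
  have hn1 : \forall y0 \near p t, S (h' (Some y0)).
    have hn0 : \forall z \near (Some (p t) : S3 R), S (h' z) := @hc' (Some (p t)) S hn.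
    exact: hn0.
  have := near_comp (pc t) hn1; apply: filterS => t' [x1 x1E lt] t'01.
  have N2 := N'N _ (pN t' t'01); rewrite xE in N1 *; rewrite x1E in N2 *.
  exact/esym/qloc.
have nodeN (v' : node D') : eps_neighborhood D' eps' (Some (pos v')).
  apply/eps_neighborhood_some; have [e [k [k01 E]]] := node_graph dD' v'.
  by exists e, k; split=> //; rewrite E subrr normr0 ltW.
have edgeN (e' : edge D') (k : R) : 0 <= k <= 1 -> eps_neighborhood D' eps' (Some (edge_point e' k)).
  by move=> k01; apply/eps_neighborhood_some; exists e', k; split=> //; rewrite subrr normr0 ltW.
have srcE (e' : edge D') : edge_point e' 0 = pos (src e') :> R3 by rewrite edge_pointV scale0r addr0.
have tgtE (e' : edge D') : edge_point e' 1 = pos (tgt e') :> R3 by rewrite edge_pointV scale1r /edge_vec addrC subrK.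
pose L (y : {ffun node D -> X^o}) (y' : {ffun node D' -> X^o}) :=
  constant_on_edges y /\ forall v', y' v' = q (h' (Some (pos v'))) y.
apply: (dimension_le (L := L) dn dn').
- move=> y cy; exists [ffun v' => q (h' (Some (pos v'))) y : X^o]; last by split=> // v'; rewrite ffunE.
  move=> e'; rewrite !ffunE -srcE -tgtE; apply/esym; apply: (path y (edge_point e')) => //.
    by move=> t; exact: edge_cont.
  by move=> t t01; exact: edgeN.
- split=> [e|v']; first by rewrite !ffunE.
  by have [e ->] := qz _ (N'N _ (nodeN v')); rewrite !ffunE.
- move=> c y1 y2 w1 w2 [c1 h1] [c2 h2]; split=> [e|v']; first by rewrite !ffunE c1 c2.
  by rewrite !ffunE h1 h2; have [e E] := qz _ (N'N _ (nodeN v')); rewrite !E !ffunE.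
- move=> y [cy y0]; apply/ffunP => v; rewrite ffunE.
  have nv : eps_neighborhood D eps (Some (pos v)).
    apply/eps_neighborhood_some; have [e [k [k01 E]]] := node_graph dD v.
    by exists e, k; split=> //; rewrite E subrr normr0 ltW.
  have -> : y v = q (Some (pos v)) y.
    have [e [k [k01 le ->]]] := hq _ nv.
    have [k1 k101 E] : exists2 k1 : R, 0 <= k1 <= 1 & pos v = edge_point (in_edge dD v) k1.
      by apply: node_edge_point; right; exact: in_edgeP.
    have [u [i1 i2]] : exists u, incident (in_edge dD v) u /\ incident e u.
      by apply: (gap k101 k01); rewrite -E; apply: le_lt_trans le _; by have [] := triple_lt e0 small.
    have iv : incident (in_edge dD v) v by right; exact: in_edgeP.
    by rewrite (incident_value cy iv) -(incident_value cy i1) (incident_value cy i2).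
  have := (NN' _).1 nv; rewrite -{2}[Some (pos v)]hK.
  case: (h (Some (pos v))) => [x'|[? _ //]] /[dup] nx' /eps_neighborhood_some[e' [k' [k'01 le']]].
  (* The image of a node of D is joined to a node of D' inside the neighbourhood: straight to a
     close point of an edge by [p1], then along the edge to its source by [p2]. *)
  pose p1 (t : R) : R3 := x' + t *: (edge_point e' k' - x').
  have E1 : q (h' (Some (p1 0))) y = q (h' (Some (p1 1))) y.
    apply: path => // t; first by rewrite /p1; apply: cont_addv; [exact: cont_cst|apply: cont_scalev; [exact: cont_id|exact: cont_cst]].
    move=> /andP[t0 t1]; apply/eps_neighborhood_some; exists e', k'; split=> //.
    have -> : p1 t - edge_point e' k' = (1 - t) *: (x' - edge_point e' k').
      by rewrite /p1 scalerBl scale1r -[edge_point e' k' - x']opprB scalerN addrAC.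
    rewrite normrZ ger0_norm ?subr_ge0 //; apply: le_trans le'.
    by rewrite ler_piMl // lerBlDr lerDl.
  rewrite /p1 scale0r addr0 scale1r addrC subrK in E1; rewrite E1.
  pose p2 (t : R) : R3 := edge_point e' ((1 - t) * k').
  have E2 : q (h' (Some (p2 0))) y = q (h' (Some (p2 1))) y.
    apply: path => // t.
      by rewrite /p2 /edge_point; apply: cont_pair; [apply: cont_pair|]; ctn.
    move=> /andP[t0 t1]; apply: edgeN; have /andP[k0 k1] := k'01.
    rewrite mulr_ge0 ?subr_ge0 //=; apply: le_trans k1; rewrite ler_piMl // lerBlDr lerDl //.
  rewrite /p2 subr0 mul1r subrr mul0r srcE in E2.
  by rewrite E2 -y0 ffunE.
Qed.
End ConstantTransfer.

Lemma eps_complement_open (R : realType) (D : diagram R) (eps : R) : 0 < eps ->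
  open (~` eps_neighborhood D eps).
Proof.
move=> e0; rewrite openE => -[x|] nx; rewrite /interior.
  have [e k|e k k01|r r0 hr] := @edge_pos R D (fun e k => `|x - edge_point e k| - eps).
  - apply: cont_add; last exact: cont_cst.
    by apply: cont_norm; apply: cont_addv; [exact: cont_cst|apply: cont_oppv; exact: edge_cont].
  - by rewrite subr_gt0; move/eps_neighborhoodP: nx; apply.
  apply/near_someP; have : \forall y \near x, `|x - y| < r by exact: near_norm.
  apply: filterS => y lt; apply/eps_neighborhoodP => e k k01.
  by have := hr e k k01; have := dist_le3 x y (edge_point e k); lra.
apply/near_infty; split=> //; exists (gbound D + eps); first by have := gbound_gt0 D; lra.
move=> x xM; apply/eps_neighborhoodP => e k k01; have [h1 h2 h3] := gboundP e k01.
have : `|edge_point e k| < gbound D by rewrite norm3E !gt_max h1 h2 h3.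
by have := dist_le3 x (edge_point e k) 0; rewrite !subr0; lra.
Qed.

Lemma image_cancel (T : Type) (f g : T -> T) (W : set T) z : cancel f g -> (f @` W) (f z) <-> W z.
Proof. by move=> fK; split=> [[y Wy /(can_inj fK) <-]|Wz] //; exists z. Qed.

Lemma good_neighborhood (R : realType) (D : diagram R) (dD : is_diagram D) g (H : handlebody_knot R g) :
  represents D H -> exists (eps c0 : R) F (f f' : S3 R -> S3 R),
  [/\ 0 < eps /\ 3 * eps < c0, forall (e e' : edge D) (k k' : R), 0 <= k <= 1 -> 0 <= k' <= 1 ->
      `|edge_point e k - edge_point e' k'| < c0 -> exists v, incident e v /\ incident e' v,
    pushable D (~` eps_neighborhood D eps) F, continuous f /\ continuous f' &
    [/\ cancel f f', cancel f' f & f @` eps_neighborhood D eps = hk_set H]].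
Proof.
move=> [rn _]; have [c0 c00 gap] := edge_gap dD.
have [eps0 eps00 [F [FU Fc F0 Ffar Feps]]] := push_homotopy dD.
have lt1 : \forall eps \near 0^'+, eps < eps0 by exact: nbhs_right_lt.
have lt2 : \forall eps \near 0^'+, eps < c0 / 3 by apply: nbhs_right_lt; lra.
have gt0 : \forall eps \near (0 : R)^'+, 0 < eps by exact: nbhs_right_gt.
have [eps [[[e1 e2] e3] [f [[fc [f' [f'c fK f'K]]] _ _ fE]]]] :=
  filter_ex (filterI (filterI (filterI lt1 lt2) gt0) rn).
have e01 : 0 < eps < eps0 by rewrite e3 e1.
have [FV F1] := Feps eps e01.
exists eps, c0, F, f, f'; split=> //; first by split=> //; move: e2 => /=; lra.
split=> //; first exact: eps_complement_open.
move=> [x|] nx [y [e [k [k01 yE]]] yx]; last by [].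
case: yx => yx; apply: nx; apply/eps_neighborhood_some.
by exists e, k; split=> //; rewrite -yx yE subrr normr0 ltW.
Qed.

(** * Invariance and the bound on the Gordian distance *)

Section Invariance.
Variables (R : realType) (m : nat) (X : fieldType) (s t : X).
Hypotheses (s1 : s ^+ m.+1 = 1) (t1 : t ^+ m.+1 = 1).
Local Notation tw := (col_twisting s1 t1).
Local Notation dim_col D phi := (\dim (@col_space R D X s t m.+1 phi)).

Lemma col_twisting_lin a (c : X) b b' : tw a (c *: b + b') = c *: tw a b + tw a b'.
Proof. by rewrite /= /power_act mulrDr mulrCA. Qed.

Lemma zero_is_flow (D : diagram R) (dD : is_diagram D) : is_flow dD ([ffun=> 0] : {ffun edge D -> 'I_m.+1}).
Proof.
split=> [|lo hi _]; last by rewrite !ffunE.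
split=> [x _ _|lo hi _]; last by rewrite !ffunE.
by rewrite !big1 // => e _; rewrite ffunE.
Qed.

Lemma flow_dim_eq (D D' : diagram R) (dD : is_diagram D) (dD' : is_diagram D') V V' F F' h h'
    (phi : {ffun edge D -> 'I_m.+1}) (phi' : {ffun edge D' -> 'I_m.+1}) w n n' :
  linked D D' V V' F F' h h' -> is_flow dD phi -> is_flow dD' phi' ->
  shift_related dD dD' V h tw phi phi' w ->
  dimension (fun nu : {ffun edge D -> X^o} => twisted_flow dD tw phi nu) n ->
  dimension (fun nu : {ffun edge D' -> X^o} => twisted_flow dD' tw phi' nu) n' -> n = n'.
Proof.
move=> lk [c1 u1] [c2 u2] sr d d'; apply/eqP; rewrite eqn_leq; apply/andP; split.
  exact: (twisted_flow_dim lk col_twisting_lin c1 c2 u1 u2 sr d d').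
have sr' := shift_related_sym lk sr.
exact: (twisted_flow_dim (linked_sym lk) col_twisting_lin c2 c1 u2 u1 sr' d' d).
Qed.

Lemma equivalent_dims g (H H' : handlebody_knot R g) (D D' : diagram R) :
  diagram_of D H -> diagram_of D' H' -> hk_equiv H H' ->
  forall phi : {ffun edge D -> 'I_m.+1}, flow phi ->
  exists phi' : {ffun edge D' -> 'I_m.+1}, [/\ flow phi', flow_gcd phi = flow_gcd phi' &
    dim_col D phi = dim_col D' phi'].
Proof.
move=> [dD rD] [dD' rD'] [hq [[hqc [hq' [hqc' hqK hqK']]] _ hqE _]] phi /(flowP dD) fphi.
have [eps [c0 [F [f [f' [[e0 small] gap pF [fc f'c] [fK f'K fE]]]]]]] := good_neighborhood dD rD.
have [eps' [c0' [F' [k [k' [[e0' small'] gap' pF' [kc k'c] [kK k'K kE]]]]]]] := good_neighborhood dD' rD'.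
(* The maps f and k take polygonal neighbourhoods to the handlebodies, so this composite matches the
   two neighbourhoods. The graphs themselves need not correspond. *)
pose h x := k' (hq (f x)); pose h' x := f' (hq' (k x)).
have hc : continuous h.
  by move=> x; apply: (cvg_comp (hq \o f) k' _ (k'c _)); apply: (cvg_comp f hq (fc _) (hqc _)).
have hc' : continuous h'.
  by move=> x; apply: (cvg_comp (hq' \o k) f' _ (f'c _)); apply: (cvg_comp k hq' (kc _) (hqc' _)).
have hK : cancel h h' by move=> x; rewrite /h /h' k'K hqK fK.
have h'K : cancel h' h by move=> x; rewrite /h /h' f'K hqK' kK.
have NN' z : eps_neighborhood D eps z <-> eps_neighborhood D' eps' (h z).
  rewrite -(image_cancel _ z fK) fE -(image_cancel _ (f z) hqK) hqE -kE.
  by rewrite -{1}(k'K (hq (f z))) (image_cancel _ _ kK).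
have lk : linked D D' (~` eps_neighborhood D eps) (~` eps_neighborhood D' eps') F F' h h'.
  by split=> //; split=> // z; rewrite /= NN'.
have [phi1 [w [c1 u1 sr]]] := flow_shift dD' lk tw fphi.1 fphi.2.
pose phi' : {ffun edge D' -> 'I_m.+1} := [ffun e => phi1 e].
have pE : (phi' : edge D' -> 'I_m.+1) = phi1 by apply/funext => e; rewrite ffunE.
have fphi' : is_flow dD' phi' by rewrite /is_flow pE.
rewrite -pE in sr; have sr' := shift_related_sym lk sr.
exists phi'; split; first exact/flowP.
  apply: flow_gcd_eq => n; split.
    exact: (shift_torsion (linked_sym lk) fphi'.1 fphi'.2 sr').
  exact: (shift_torsion lk fphi.1 fphi.2 sr).
have [r [r1 r2 a1 a2]] := flow_dimensions dD s1 t1 phi.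
have [r' [r1' r2' a1' a2']] := flow_dimensions dD' s1 t1 phi'.
have [q [q1 q2 b1 b2]] := flow_dimensions dD s1 t1 [ffun=> 0].
have [q' [q1' q2' b1' b2']] := flow_dimensions dD' s1 t1 [ffun=> 0].
rewrite (dim_col_nodes s1 t1 fphi a1) (dim_col_nodes s1 t1 fphi' a1').
have E1 := flow_dim_eq lk fphi fphi' sr a2 a2'.
have sr0 : shift_related dD dD' (~` eps_neighborhood D eps) h tw
    ([ffun=> 0] : {ffun edge D -> 'I_m.+1}) ([ffun=> 0] : {ffun edge D' -> 'I_m.+1}) (fun=> 0).
  move=> x _; apply: near_all => y.
  have zE (E : diagram R) : (([ffun=> 0] : {ffun edge E -> 'I_m.+1}) : edge E -> 'I_m.+1) = fun=> 0.
    by apply/funext => e; rewrite ffunE.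
  by rewrite !zE !chi_zero oppr0 !addr0.
have E2 := flow_dim_eq lk (zero_is_flow dD) (zero_is_flow dD') sr0 b2 b2'.
have cst (E : diagram R) (dE : is_diagram E) n :
    dimension (fun y : {ffun node E -> X^o} => node_coloring dE s t ([ffun=> 0] : {ffun edge E -> 'I_m.+1}) y) n ->
    dimension (fun y : {ffun node E -> X^o} => constant_on_edges y) n.
  move=> d j; rewrite -(d j).
  by split=> -[b [Pb ib]]; exists b; split=> // i;
    [apply: (@node_coloring0 R E dE m X s t (b i)).2|apply: (@node_coloring0 R E dE m X s t (b i)).1]; apply: Pb.
have E3 : (#|node D| - q = #|node D'| - q')%N.
  apply/eqP; rewrite eqn_leq; apply/andP; split.
    exact: (constant_dim dD dD' e0 e0' small gap hc' hK h'K NN' (cst _ _ _ b1) (cst _ _ _ b1')).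
  have N'N z : eps_neighborhood D' eps' z <-> eps_neighborhood D eps (h' z) by rewrite NN' h'K.
  exact: (constant_dim dD' dD e0' e0 small' gap' hc h'K hK N'N (cst _ _ _ b1') (cst _ _ _ b1)).
lia.
Qed.

Lemma deformable_dims g n (H H' : handlebody_knot R g) (D D' : diagram R) :
  diagram_of D H -> diagram_of D' H' -> deformable n H H' ->
  forall phi : {ffun edge D -> 'I_m.+1}, flow phi ->
  exists phi' : {ffun edge D' -> 'I_m.+1}, [/\ flow phi', flow_gcd phi = flow_gcd phi' &
    (dim_col D phi <= dim_col D' phi' + n)%N /\ (dim_col D' phi' <= dim_col D phi + n)%N].
Proof.
elim: n H D => [|n IH] H D dH dH' /=.
  move=> hq phi fl; have [phi' [f1 f2 ->]] := equivalent_dims dH dH' hq fl.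
  by exists phi'; rewrite addn0.
move=> [K [K' [hq [D0 [lo [hi [dK cr dK']]]] df]]] phi fl.
have [phi0 [f1 f2 f3]] := equivalent_dims dH dK hq fl.
have [[kd _] [kd' _]] := (dK, dK').
have [fl2 [le1 le2]] := crossing_change_dim kd' cr s1 t1 ((flowP kd phi0).1 f1).
have fl3 : @flow R (switch_crossing lo hi) m.+1 phi0 by apply/(flowP kd').
have [phi' [g1 g2 [g3 g4]]] := IH _ _ dK' dH' df phi0 fl3.
exists phi'; split=> //; first by rewrite f2 -g2.
by rewrite f3; lia.
Qed.
End Invariance.

Theorem theorem6p1 (R : realType) (p : nat) (p_prime : prime p)
  (f s : laurent 'F_p) (f_irr : ring_irreducible f)
  (X : fieldType) (cls : {rmorphism laurent 'F_p -> X})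
  (X_quotient : is_quotient_by f cls)
  (s_unit : cls s \is a GRing.unit)
  (m : nat) (m_type : is_type (cls s) (cls (laurentX 'F_p)) m)
  (g : nat) (g_ge1 : (1 <= g)%N)
  (H1 H2 : handlebody_knot R g) (D1 D2 : diagram R)
  (D1_H1 : diagram_of D1 H1) (D2_H2 : diagram_of D2 H2) :
  let dim_col (D : diagram R) (phi : {ffun edge D -> 'I_m}) : R :=
    (\dim (col_space (cls s) (cls (laurentX 'F_p)) phi))%:R in
  (\big[maxe/-oo]_(phi1 : {ffun edge D1 -> 'I_m} | flow phi1)
     \big[mine/+oo]_(phi2 : {ffun edge D2 -> 'I_m}
         | flow phi2 && (flow_gcd phi1 == flow_gcd phi2))
        `|dim_col D1 phi1 - dim_col D2 phi2|%:E
   <= gordian H1 H2)%E.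
Proof.
case: m m_type => [|m] [m0 triv _] //= .
have [tt1 ss1] : cls (laurentX 'F_p) ^+ m.+1 = 1 /\ cls s ^+ m.+1 = 1.
  (* The pairs (1, 0) and (1, 1) isolate the power of t and the power of s. *)
  have [e1 _] := triv 1 0; have [_ e2] := triv 1 1.
  move: e1 e2; rewrite /under_op /over_op -!exprnP !mulr1 mulr0 addr0 => e1 e2; by split.
apply: bigmax_le; first exact: leNye.
(* Each length n of a deformation is a separate bound, so [phi2] may depend on n. *)
move=> phi1 fl1; apply: le_ereal_inf_tmp => _ [n df <-].
have [phi2 [fl2 gE [le1 le2]]] := deformable_dims ss1 tt1 D1_H1 D2_H2 df fl1.
have P2 : flow phi2 && (flow_gcd phi1 == flow_gcd phi2) by rewrite fl2 gE eqxx.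
apply: (@le_trans _ (\bar R)); first exact: (@bigmin_le_cond _ (\bar R) _ _ phi2).
have l1 : ((\dim (col_space (cls s) (cls (laurentX 'F_p)) phi1))%:R : R) <=
    (\dim (col_space (cls s) (cls (laurentX 'F_p)) phi2))%:R + n%:R by rewrite -natrD ler_nat.
have l2 : ((\dim (col_space (cls s) (cls (laurentX 'F_p)) phi2))%:R : R) <=
    (\dim (col_space (cls s) (cls (laurentX 'F_p)) phi1))%:R + n%:R by rewrite -natrD ler_nat.
by rewrite lee_fin ler_norml lerBlDl l1 andbT lerNl opprB lerBlDl l2.
Qed.
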